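(* Let $\Omega\subset\mathbb{R}^N$, $N\geq 3$, be a bounded open set with smooth boundary, let $p\in\left(1,\frac{N}{N-2}\right)$, and let $(\alpha_n,\lambda_n,v_n)$, $n\in\mathbb{N}$, be such that $\alpha_n\in\mathbb{R}$, $\lambda_n>0$, $v_n\in C^{2,\beta}(\overline\Omega)$ for some $\beta\in(0,1)$, and \[ \begin{cases} -\Delta v_n=\mu_n[v_n-1]_+^p & \text{in } \Omega,\\ v_n=0 & \text{on } \partial\Omega,\\ \mu_n:=\lambda_n|\alpha_n|^{p-1}\to+\infty & \text{as } n\to+\infty,\\ \int_\Omega |\alpha_n|^p[v_n-1]_+^p\,dx=1. \end{cases} \] Assume that there is $C_0>0$ such that $\mu_n^{N/2}\int_\Omega[v_n-1]_+^p\,dx\leq C_0$ for all $n$, and assume moreover that either $\Omega$ is convex, or there is $C_1>0$ such that $\mu_n^{N/2}\int_\Omega[v_n-1]_+^{p+1}\,dx\leq C_1$ for all $n$. Then, after passing to a subsequence, $(v_n)$ is a spike sequence (relative to its spike set $\Sigma$), and every spike point $z_j\in\Sigma\cap\Omega$ is simple, i.e. its multiplicity $m_j$ equals $1$.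
   Context: Notation: $[t]_+=\max\{t,0\}$, $\epsilon_n^2:=\mu_n^{-1}$, $B_r(x)$ is the open ball of radius $r$ centered at $x$. Model profile. Let $u$ be the unique positive (radial) solution of $-\Delta u=u^p$ in $B_1(0)$, $u=0$ on $\partial B_1(0)$, regarded as a function of $|x|$, and set $R_0:=\left(\frac{-u'(1)}{N-2}\right)^{\frac{p-1}{2}}$. Define $w_0(x)=1+R_0^{\frac{2}{1-p}}u(R_0^{-1}|x|)$ for $|x|\le R_0$ and $w_0(x)=(R_0/|x|)^{N-2}$ for $|x|\ge R_0$; $w_0$ is the unique solution of $-\Delta w=[w-1]_+^p$ in $\mathbb{R}^N$, $w>0$, $w\to0$ at infinity, $w(0)=\max w>1$, $\int[w-1]_+^p<\infty$. Set $M_{p,0}:=\int_{\mathbb{R}^N}[w_0-1]_+^p=\int_{B_{R_0}(0)}[w_0-1]_+^p$. Spike set. The spike set of $(v_n)$ is the largest set $\Sigma\subset\overline\Omega$ such that for every $z\in\Sigma$ there exist $x_n\to z$, $\sigma_z>0$, $M_z>0$ with: $v_n(x_n)\geq1+\sigma_z$ for all $n$; $\epsilon_n=o(\mathrm{dist}(x_n,\partial\Omega))$ as $n\to\infty$; and $\mu_n^{N/2}\int_{B_r(z)\cap\Omega}[v_n-1]_+^p\le M_z$ for all $r>0$. Its elements are called spike points. Spike sequence. $(v_n)$ with nonempty spike set $\Sigma=\{z_1,\dots,z_l\}$ is a spike sequence if: there exist positive integers $m_1,\dots,m_l$ and sequences $(z_{i,n})_n$, $i=1,\dots,Z:=\sum_k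 m_k$, with exactly $m_j$ of them converging to $z_j$ for each $j$; and there exist $R_n\to+\infty$, $\bar n\in\mathbb{N}$, $\tilde C>0$, $\sigma>0$ such that (i) $\epsilon_nR_n\to0$; (ii) $B_{4R_n}(0)\Subset\Omega_{i,n}:=(\Omega-z_{i,n})/\epsilon_n$ for all $i$; (iii) if $Z\ge2$, the balls $B_{2\epsilon_nR_n}(z_{i,n})$ are pairwise disjoint, and $v_n(z_{i,n})=\max_{\overline\Omega\setminus\bigcup_{j\ne i}B_{2\epsilon_nR_n}(z_{j,n})}v_n\ge1+\sigma$ for all $i$; (iv) $w_{i,n}(y):=v_n(\epsilon_ny+z_{i,n})$, $y\in\Omega_{i,n}$, satisfy $\|w_{i,n}-w_0\|_{C^2(B_{2R_n}(0))}\to0$, and $\{x\in\Omega: v_n>1\}\Subset\bigcup_{i=1}^ZB_{2\epsilon_nR_0}(z_{i,n})$ for $n\ge\bar n$; (v) for each $r>0$ there is $C_r>0$ with $0\le\max_{\overline\Omega\setminus\bigcup_jB_r(z_j)}v_n\le C_r\epsilon_n^{N-2}$ and $0\le\max_{\overline\Omega\setminus\bigcup_iB_{2\epsilon_nR_n}(z_{i,n})}v_n\le\tilde C R_n^{2-N}$ for $n\ge\bar n$; (vi) $\lim_n\mu_n^{N/2}\int_{B_{\epsilon_nR_n}(z_{i,n})}[v_n-1]_+^p=M_{p,0}$ for each $i$, and $\lim_n\int_\Omega\mu_n^{N/2}[v_n-1]_+^p\varphi=M_{p,0}\sum_jm_j\varphi(z_j)$ for every $\varphi\in C^0(\overline\Omega)$.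 The integer $m_j$ is the multiplicity of the spike point $z_j$; $z_j$ is simple if $m_j=1$. *)

(* Defs.v *)
From HB Require Import structures.
From mathcomp Require Import all_boot all_order all_algebra.
From mathcomp Require Import all_classical all_reals all_analysis.
Set Implicit Arguments. Unset Strict Implicit. Unset Printing Implicit Defensive.
Import Order.TTheory GRing.Theory Num.Theory.
Import numFieldNormedType.Exports.
Local Open Scope classical_set_scope.
Local Open Scope ring_scope.

Definition muN2 {R : realType} (N : nat) (mu : nat -> R) (n : nat) : R :=
  Num.sqrt (mu n) ^+ N.

Section Defs.
Context {R : realType} {N : nat}.
Notation V := 'rV[R]_N.

Definition enorm (x : V) : R := Num.sqrt (\sum_(i < N) x ord0 i ^+ 2).
Definition eball (c : V) (r : R) : set V := [set x | enorm (x - c) < r].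

Definition edist (x : V) (A : set V) : R := inf [set enorm (x - y) | y in A].

Definition bdry (A : set V) : set V := closure A `\` interior A.

Definition ev (i : 'I_N) : V := delta_mx ord0 i.
Definition pd (i : 'I_N) (f : V -> R) : V -> R := fun x => derive f x (ev i).
Definition iterpd (l : seq 'I_N) (f : V -> R) : V -> R := foldr pd f l.
Definition lap (f : V -> R) : V -> R := fun x => \sum_(i < N) pd i (pd i f) x.

Definition smoothRN (f : V -> R) : Prop :=
  forall l : seq 'I_N, continuous (iterpd l f) /\
    forall (i : 'I_N) (x : V), derivable (iterpd l f) x (ev i).

Definition smooth_bounded_domain (Om : set V) : Prop :=
  open Om /\ (exists M : R, forall x, Om x -> enorm x <= M) /\
  exists rho : V -> R, smoothRN rho /\ Om = [set x | rho x < 0] /\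
    forall x, rho x = 0 -> exists i, pd i rho x != 0.

Definition convex_domain (Om : set V) : Prop :=
  forall x y t, Om x -> Om y -> 0 <= t <= 1 -> Om ((1 - t) *: x + t *: y).

Definition holder_bdd (A : set V) (beta : R) (g : V -> R) : Prop :=
  exists C : R, forall x y, A x -> A y ->
    `|g x| <= C /\ `|g x - g y| <= C * powR (enorm (x - y)) beta.

(** v in C^{2,beta}(closure Om): continuous on the closure, twice partially
    differentiable in Om, all derivatives of order <= 2 bounded and
    uniformly beta-Hoelder in Om (hence extending continuously to closure). *)
Definition C2beta (Om : set V) (beta : R) (v : V -> R) : Prop :=
  {within closure Om, continuous v} /\
  (forall i x, Om x -> derivable v x (ev i)) /\
  (forall i j x, Om x -> derivable (pd i v) x (ev j)) /\
  (forall l : seq 'I_N, (size l <= 2)%N -> holder_bdd Om beta (iterpd l v)).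

Definition C2RN (w : V -> R) : Prop :=
  (forall i x, derivable w x (ev i)) /\ (forall i j x, derivable (pd i w) x (ev j)) /\
  (forall l : seq 'I_N, (size l <= 2)%N -> continuous (iterpd l w)).

(** Lebesgue integral over R^N, as the iterated one-dimensional Lebesgue integral
    (Fubini). Coordinate k of x is replaced by t. *)
Definition upd (x : V) (k : nat) (t : R) : V :=
  \row_(j < N) (if nat_of_ord j == k then t else x ord0 j).

Fixpoint iint (k : nat) (f : V -> R) (x : V) : R :=
  match k with
  | 0%N => f x
  | k'.+1 => Rintegral (@lebesgue_measure R) setT (fun t => iint k' f (upd x k' t))
  end.
Definition intRN (f : V -> R) : R := iint N f 0.
Definition intRN_on (D : set V) (f : V -> R) : R := intRN (patch (fun=> 0) D f).

(** extended-real (nonnegative) iterated integral, used for finiteness *)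
Fixpoint eiint (k : nat) (f : V -> R) (x : V) : \bar R :=
  match k with
  | 0%N => (f x)%:E
  | k'.+1 => (\int[@lebesgue_measure R]_(t in setT) eiint k' f (upd x k' t))%E
  end.
Definition eintRN (f : V -> R) : \bar R := eiint N f 0.

Definition pp (p t : R) : R := powR (Num.max t 0) p.

Definition epsn (mu : nat -> R) (n : nat) : R := (Num.sqrt (mu n))^-1.

(** The spike set: the largest set of points with the stated property,
    i.e. the set of all points z of closure Om having it. *)
Definition spike_set (Om : set V) (p : R) (mu : nat -> R) (v : nat -> V -> R)
  : set V :=
  [set z | closure Om z /\
    exists x : nat -> V, (x @ \oo --> z) /\ (forall n, closure Om (x n)) /\
    exists sigma Mz : R, 0 < sigma /\ 0 < Mz /\
      (forall n, 1 + sigma <= v n (x n)) /\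
      (forall e : R, 0 < e -> \forall n \near \oo, epsn mu n <= e * edist (x n) (bdry Om)) /\
      (forall r : R, 0 < r -> forall n,
          muN2 N mu n * intRN_on (eball z r `&` Om) (fun y => pp p (v n y - 1)) <= Mz)].

(** (v_n) is a spike sequence with spike points z_0..z_{l-1} (pairwise distinct,
    forming the spike set) of multiplicities m_0..m_{l-1}. The profile w0 and
    radius R0 and M_{p,0} = M0 are passed as parameters. *)
Definition spike_sequence_data (Om : set V) (p : R) (mu : nat -> R)
  (v : nat -> V -> R) (w0 : V -> R) (R0 M0 : R)
  (l : nat) (z : 'I_l -> V) (m : 'I_l -> nat) : Prop :=
  (0 < l)%N /\ injective z /\ spike_set Om p mu v = range z /\
  (forall j, (0 < m j)%N) /\
  let Z := (\sum_(j < l) m j)%N in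
  exists (zz : 'I_Z -> nat -> V) (c : 'I_Z -> 'I_l),
    (forall i, zz i @ \oo --> z (c i)) /\
    (forall j, #|[set i | c i == j]| = m j) /\
  exists (Rn : nat -> R) (nbar : nat) (Ct sigma : R),
    (Rn @ \oo --> +oo) /\ 0 < Ct /\ 0 < sigma /\
    ((fun n => epsn mu n * Rn n) @ \oo --> 0) /\
    (forall n i y, closure (eball 0 (4 * Rn n)) y -> Om (epsn mu n *: y + zz i n)) /\
    ((1 < Z)%N ->
      (forall n i j, i != j ->
         eball (zz i n) (2 * epsn mu n * Rn n) `&` eball (zz j n) (2 * epsn mu n * Rn n)
           = set0) /\
      (forall n i,
         let S := closure Om `\` \bigcup_(j in [set j | j != i]) eball (zz j n) (2 * epsn mu n * Rn n) in
         S (zz i n) /\ (forall x, S x -> v n x <= v n (zz i n)) /\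
         1 + sigma <= v n (zz i n))) /\
    (forall i, forall e : R, 0 < e -> \forall n \near \oo,
       let d := fun y => v n (epsn mu n *: y + zz i n) - w0 y in
       forall y, eball 0 (2 * Rn n) y ->
         `|d y| <= e /\ (forall a, `|pd a d y| <= e) /\
         (forall a b, `|pd b (pd a d) y| <= e)) /\
    (forall n, (nbar <= n)%N ->
       closure [set x | Om x /\ 1 < v n x] `<=`
         \bigcup_(i in [set: 'I_Z]) eball (zz i n) (2 * epsn mu n * R0)) /\
    (forall r : R, 0 < r -> exists Cr : R, 0 < Cr /\
       forall n, (nbar <= n)%N -> forall x, closure Om x ->
         (forall j, ~ eball (z j) r x) -> 0 <= v n x <= Cr * epsn mu n ^+ (N - 2)) /\
    (forall n, (nbar <= n)%N -> forall x, closure Om x ->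
       (forall i, ~ eball (zz i n) (2 * epsn mu n * Rn n) x) ->
       0 <= v n x <= Ct * (Rn n ^+ (N - 2))^-1) /\
    (forall i, (fun n => muN2 N mu n *
        intRN_on (eball (zz i n) (epsn mu n * Rn n)) (fun y => pp p (v n y - 1)))
        @ \oo --> M0) /\
    (forall phi : V -> R, {within closure Om, continuous phi} ->
       (fun n => intRN_on Om (fun y => muN2 N mu n * pp p (v n y - 1) * phi y))
         @ \oo --> M0 * \sum_(j < l) (m j)%:R * phi (z j)).

End Defs.

(* Main.v *)
Require Import Defs.
From HB Require Import structures.
From mathcomp Require Import all_boot all_order all_algebra.
From mathcomp Require Import all_classical all_reals all_analysis.
From mathcomp Require Import ring lra zify.
(** Blow up at the scale eps_n = mu_n^(-1/2). The mass bound and p < N/(N-2) bound v_n uniformly, so the rescaled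
    functions v_n(eps_n y + x_n) are equicontinuous and, along an ultrafilter, converge to entire or half-space
    solutions of -lap W = [W-1]_+^p. Moving planes exclude the half-space and make the entire ones radial, hence
    translates of w0. Each spike thus carries a fixed amount of mass, so there are finitely many, and off the
    spikes v_n is trapped between multiples of sums of Newtonian kernels centred at them.

    If several spikes had a common interior limit, rescale by their largest mutual distance d_n, small against the
    distance to the boundary: v_n, divided by its amplitude, tends to a sum of kernels |y - zeta_i|^(2-N) with
    distinct poles. Near a pole which is extremal in some direction all other poles pull to one side, and planes
    moved towards it in a small ball pass the pole without ever stopping, although they cannot: v_n has its
    maximum there.

    The boundary value problem enters only through second differences and comparison functions, so that limits
    need not be differentiable: [wsol] is stable under uniform convergence. *)

Set Implicit Arguments. Unset Strict Implicit. Unset Printing Implicit Defensive.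
Import Order.TTheory GRing.Theory Num.Theory.
Import numFieldNormedType.Exports.
Local Open Scope classical_set_scope.
Local Open Scope ring_scope.

(* [lra] is slow in a large context, so only the goal and the facts moved into it are kept; a forgotten fact
   leaves a placeholder because [lra] fails when section variables are cleared. *)
Ltac forget := repeat match goal with h : ?P |- _ => lazymatch type of P with Prop => clear h; assert (h := Datatypes.tt) end end.
Ltac glra := forget; lra.
Ltac gnra := forget; nra.

(** The mass hypothesis only sees the set where v_n > 1, whereas moving planes on a blow-up limit
    need decay to 0 at infinity. The bridge is [peak]: within O(eps_n) of a point with v_n >= theta
    > 0 there is a point with v_n >= 1 + sigma. Otherwise the source would be tiny on a large ball,
    v_n would stay above theta/2 on it, and testing the equation at scale K eps_n against the
    superharmonic function (1+|y|^2)^(-1/2) gives a contradiction: the mass contributes only K^2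
    K^(-N) C_0, which tends to 0 because N >= 3. Every peak costs a fixed mass, so the points with
    v_n >= theta lie in boundedly many balls of radius O(eps_n) ([few]); this is the decay. The
    ultrafilter makes all limits exist at once. A genuine subsequence is chosen only at the end,
    each term from a set of indices that belongs to the ultrafilter. The pointwise estimates rest on
    the maximum principle and explicit barriers: quadratic functions for gradients, exponentials for
    the boundary and for strict positivity, Newtonian kernels for the far field. *)

Section Ct.
Context {R : realType} {T : topologicalType}.
Implicit Types (f g : T -> R) (x : T).
Lemma ctD f g x : {for x, continuous f} -> {for x, continuous g} -> {for x, continuous (fun y => f y + g y)}.
Proof. by move=> a b; apply: cvgD. Qed.
Lemma ctM f g x : {for x, continuous f} -> {for x, continuous g} -> {for x, continuous (fun y => f y * g y)}.
Proof. by move=> a b; apply: cvgM. Qed.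
Lemma ctC (c : R) x : {for x, continuous (fun _ : T => c)}.
Proof. exact: cvg_cst. Qed.
Lemma ctN f x : {for x, continuous f} -> {for x, continuous (fun y => - f y)}.
Proof. by move=> a; apply: cvgN. Qed.
Lemma ctB f g x : {for x, continuous f} -> {for x, continuous g} -> {for x, continuous (fun y => f y - g y)}.
Proof. by move=> a b; apply: cvgB. Qed.
Lemma ctV f x : f x != 0 -> {for x, continuous f} -> {for x, continuous (fun y => (f y)^-1)}.
Proof. by move=> a b; apply: cvgV. Qed.
Lemma ct_comp f (g : R -> R) x : {for x, continuous f} -> {for f x, continuous g} -> {for x, continuous (fun y => g (f y))}.
Proof. by move=> a b; apply: (@continuous_comp _ _ _ f g x a b). Qed.
Lemma ct_max f g x : {for x, continuous f} -> {for x, continuous g} -> {for x, continuous (fun y => Num.max (f y) (g y))}.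
Proof.
move=> a b; rewrite (_ : (fun y => Num.max (f y) (g y)) = fun y => (f y + g y + `|f y - g y|) / 2).
  apply: ctM; last exact: ctC.
  apply: ctD; first exact: ctD.
  by apply: cvg_norm; exact: ctB.
by apply/funext => y; rewrite maxr_absE.
Qed.
End Ct.

(** * Euclidean inner product, norm and topology on row vectors *)

Section Euclid.
Context {R : realType} {N : nat}.
Notation V := 'rV[R]_N.
Implicit Types x y z : V.

Definition dot x y : R := \sum_(i < N) x ord0 i * y ord0 i.
Definition sqn x : R := dot x x.

Lemma dotC x y : dot x y = dot y x.
Proof. by apply: eq_bigr => i _; rewrite mulrC. Qed.
Lemma dotDl x y z : dot (x + y) z = dot x z + dot y z.
Proof. by rewrite -big_split; apply: eq_bigr => i _; rewrite mxE mulrDl. Qed.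
Lemma dotZl a x y : dot (a *: x) y = a * dot x y.
Proof. by rewrite mulr_sumr; apply: eq_bigr => i _; rewrite mxE mulrA. Qed.
Lemma dotNl x y : dot (- x) y = - dot x y.
Proof. by rewrite -scaleN1r dotZl mulN1r. Qed.
Lemma dotBl x y z : dot (x - y) z = dot x z - dot y z.
Proof. by rewrite dotDl dotNl. Qed.
Lemma dotDr x y z : dot x (y + z) = dot x y + dot x z.
Proof. by rewrite dotC dotDl !(dotC _ x). Qed.
Lemma dotZr a x y : dot x (a *: y) = a * dot x y.
Proof. by rewrite dotC dotZl dotC. Qed.
Lemma dotNr x y : dot x (- y) = - dot x y.
Proof. by rewrite dotC dotNl dotC. Qed.
Lemma dotBr x y z : dot x (y - z) = dot x y - dot x z.
Proof. by rewrite dotDr dotNr. Qed.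
Lemma dot0l x : dot 0 x = 0.
Proof. by rewrite -(scale0r (0:V)) dotZl mul0r. Qed.
Lemma dot0r x : dot x 0 = 0.
Proof. by rewrite dotC dot0l. Qed.
Definition dotE := (dotDl, dotDr, dotBl, dotBr, dotNl, dotNr, dotZl, dotZr, dot0l, dot0r).
Lemma sqn_ge0 x : 0 <= sqn x.
Proof. by apply: sumr_ge0 => i _; rewrite -expr2 sqr_ge0. Qed.
Lemma sqn_eq0 x : sqn x = 0 -> x = 0.
Proof.
move=> h; apply/rowP => i; rewrite mxE; apply/eqP; rewrite -(@sqrf_eq0 R).
move: h => /eqP; rewrite psumr_eq0; last by move=> j _; rewrite -expr2 sqr_ge0.
by move=> /allP /(_ i); rewrite mem_index_enum => /(_ isT); rewrite expr2.
Qed.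
Lemma enormE x : enorm x = Num.sqrt (sqn x).
Proof. by congr Num.sqrt; apply: eq_bigr => i _; rewrite expr2. Qed.
Lemma enorm_ge0 x : 0 <= enorm x.
Proof. exact: sqrtr_ge0. Qed.
Lemma enorm2 x : enorm x ^+ 2 = sqn x.
Proof. by rewrite enormE sqr_sqrtr // sqn_ge0. Qed.
Lemma enorm_eq0 x : enorm x = 0 -> x = 0.
Proof. by move=> h; apply: sqn_eq0; rewrite -enorm2 h expr0n. Qed.
Lemma enorm0 : enorm (0 : V) = 0.
Proof. by rewrite enormE /sqn dot0l sqrtr0. Qed.
Lemma enormZ a x : enorm (a *: x) = `|a| * enorm x.
Proof. by rewrite !enormE /sqn dotZl dotZr mulrA -expr2 sqrtrM ?sqr_ge0 // sqrtr_sqr. Qed.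
Lemma enormN x : enorm (- x) = enorm x.
Proof. by rewrite -scaleN1r enormZ normrN1 mul1r. Qed.
Lemma enormB x y : enorm (x - y) = enorm (y - x).
Proof. by rewrite -opprB enormN. Qed.
Lemma CS2 x y : dot x y ^+ 2 <= sqn x * sqn y.
Proof.
have [h|h] := eqVneq (sqn y) 0.
  by rewrite (sqn_eq0 h) dot0r expr0n mulr_ge0 ?sqn_ge0.
have h0 : 0 < sqn y by rewrite lt_neqAle eq_sym h sqn_ge0.
have := sqn_ge0 (sqn y *: x - dot x y *: y).
rewrite /sqn !dotE -/(sqn x) -/(sqn y) (dotC y x) => k.
have : 0 <= sqn y * (sqn x * sqn y - dot x y ^+ 2) by lra.
by rewrite pmulr_rge0 // subr_ge0.
Qed.
Lemma CS x y : `|dot x y| <= enorm x * enorm y.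
Proof.
rewrite -(@ler_pXn2r _ 2) ?nnegrE ?mulr_ge0 ?enorm_ge0 //.
by rewrite exprMn !enorm2 real_normK ?num_real // CS2.
Qed.
Lemma CS1 x y : dot x y <= enorm x * enorm y.
Proof. exact: le_trans (ler_norm _) (CS _ _). Qed.
Lemma sqnD x y : sqn (x + y) = sqn x + 2 * dot x y + sqn y.
Proof. by rewrite /sqn !dotE (dotC y x); ring. Qed.
Lemma sqnB x y : sqn (x - y) = sqn x - 2 * dot x y + sqn y.
Proof. by rewrite /sqn !dotE (dotC y x); ring. Qed.
Lemma enormD x y : enorm (x + y) <= enorm x + enorm y.
Proof.
rewrite -(@ler_pXn2r _ 2) ?nnegrE ?addr_ge0 ?enorm_ge0 //.
rewrite sqrrD !enorm2 sqnD lerD2r lerD2l mulr2n.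
by have := CS1 x y; lra.
Qed.
Lemma enormBD x y z : enorm (x - z) <= enorm (x - y) + enorm (y - z).
Proof. by apply: le_trans (enormD _ _); rewrite addrA subrK. Qed.
Lemma enorm_sub x y : `|enorm x - enorm y| <= enorm (x - y).
Proof.
rewrite ler_norml; have := enormD (x - y) y; have := enormD (y - x) x.
by rewrite !subrK (enormB y x); lra.
Qed.
Lemma enorm_gt0 x : x != 0 -> 0 < enorm x.
Proof.
move=> h; rewrite lt_neqAle enorm_ge0 andbT eq_sym; apply/eqP => /enorm_eq0.
by move/eqP: h.
Qed.
Lemma coord_le x i : `|x ord0 i| <= enorm x.
Proof.
rewrite enormE -sqrtr_sqr ler_sqrt ?sqn_ge0 // /sqn /dot (bigD1 i) //= expr2.
by rewrite lerDl sumr_ge0 // => j _; rewrite -expr2 sqr_ge0.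
Qed.
Lemma norm_le_enorm x : `|x| <= enorm x.
Proof.
rewrite -[leLHS]/(mx_norm x) mx_normrE; apply: bigmax_le => [|[i j] _ /=]; first exact: enorm_ge0.
by rewrite (ord1 i) coord_le.
Qed.
Lemma coord_norm x i : `|x ord0 i| <= `|x|.
Proof.
rewrite -[leRHS]/(mx_norm x) mx_normrE.
exact: (le_bigmax _ (fun ij : 'I_1 * 'I_N => `|x ij.1 ij.2|) (ord0, i)).
Qed.
Lemma enorm_le_norm x : enorm x <= N%:R * `|x|.
Proof.
have nx : 0 <= N%:R * `|x| by rewrite mulr_ge0.
rewrite enormE -(ger0_norm nx) -sqrtr_sqr ler_sqrt ?sqr_ge0 //.
apply: (@le_trans _ _ (\sum_(i < N) `|x| ^+ 2)).
  apply: ler_sum => i _; rewrite -expr2 -(real_normK (num_real (x ord0 i))).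
  by rewrite ler_pXn2r ?nnegrE ?normr_ge0 // coord_norm.
rewrite big_const_ord iter_addr addr0 -[_ *+ N]mulr_natl exprMn.
have h : (N%:R : R) <= N%:R ^+ 2.
  by rewrite -natrX ler_nat; case: N => [//|m]; rewrite expnS leq_pmulr // expn_gt0.
by have := sqr_ge0 `|x|; nra.
Qed.

Definition cball (c : V) (r : R) : set V := [set x | enorm (x - c) <= r].

(** The topology of row vectors comes from the maximum norm; the two norms are equivalent, so
    Euclidean balls form a basis of neighbourhoods as well. *)
Lemma nbhs_eballP x (A : set V) :
  nbhs x A <-> exists2 r, 0 < r & forall y, enorm (y - x) < r -> A y.
Proof.
split.
  move=> /nbhs_normP [r /= r0 h]; exists r => // y yr; apply: h => /=.
  by rewrite distrC; exact: le_lt_trans (norm_le_enorm _) yr.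
(* Dividing by [N.+1] instead of [N] keeps the radius meaningful in dimension 0. *)
move=> [r r0 h]; rewrite nbhs_nearE; apply/nbhs_normP; exists (r / (N.+1)%:R) => /=.
  by rewrite divr_gt0.
move=> y /=; rewrite distrC ltr_pdivlMr // => hy; apply: h.
apply: le_lt_trans (enorm_le_norm _) _; apply: le_lt_trans hy.
by rewrite mulrC ler_wpM2l // ler_nat.
Qed.

Lemma openP (A : set V) :
  open A <-> forall x, A x -> exists2 r, 0 < r & forall y, enorm (y - x) < r -> A y.
Proof.
rewrite openE; split => h x Ax; first by apply/nbhs_eballP; exact: h.
by apply/nbhs_eballP; exact: h.
Qed.

Lemma contP (f : V -> R) x : {for x, continuous f} <->
  forall e, 0 < e -> exists2 r, 0 < r & forall y, enorm (y - x) < r -> `|f y - f x| < e.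
Proof.
split.
  move=> /cvgrPdist_lt h e e0; have /nbhs_eballP [r r0 H] := h e e0.
  by exists r => // y yr; rewrite distrC; exact: H.
move=> h; apply/(@cvgrPdist_lt _ _ _ _ (nbhs_filter x)) => e e0; have [r r0 H] := h e e0.
by apply/nbhs_eballP; exists r => // y yr; rewrite distrC; exact: H.
Qed.

Lemma cont_enorm : continuous (@enorm R N).
Proof.
move=> x; apply/contP => e e0; exists e => // y yr.
exact: le_lt_trans (enorm_sub _ _) yr.
Qed.
Lemma cont_sqn : continuous sqn.
Proof.
rewrite (_ : sqn = (fun x => enorm x * enorm x)); last by apply/funext => x; rewrite -expr2 enorm2.
exact: (fun x => ctM (@cont_enorm x) (@cont_enorm x)).
Qed.
Lemma dot_lip e x y : `|dot x e - dot y e| <= enorm (x - y) * enorm e.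
Proof. by rewrite -dotBl CS. Qed.
Lemma cont_dot e : continuous (fun x => dot x e).
Proof.
move=> x; apply/contP => d d0; exists (d / (1 + enorm e)).
  by rewrite divr_gt0 // ltr_wpDr ?enorm_ge0.
move=> y; rewrite ltr_pdivlMr; last by rewrite ltr_wpDr ?enorm_ge0.
move=> h; apply: le_lt_trans (dot_lip _ _ _) _; apply: le_lt_trans h.
by have := enorm_ge0 (y - x); have := enorm_ge0 e; nra.
Qed.
Lemma ct_lip (f : V -> R) (A : V -> V) (C : R) x : (forall y, enorm (A y - A x) <= C * enorm (y - x)) ->
  {for A x, continuous f} -> {for x, continuous (fun y => f (A y))}.
Proof.
move=> hA /contP hf; apply/contP => e e0; have [r r0 h] := hf e e0.
exists (r / (1 + `|C|)); first by rewrite divr_gt0 // ltr_wpDr.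
move=> y; rewrite ltr_pdivlMr; last by rewrite ltr_wpDr.
move=> hy; apply: h; apply: le_lt_trans (hA y) _; apply: le_lt_trans hy.
by have := enorm_ge0 (y - x); have := ler_norm C; nra.
Qed.

Lemma closed_cball c r : closed (cball c r).
Proof.
rewrite -openC; apply/openP => x /negP; rewrite -ltNge => h.
exists (enorm (x - c) - r); first by rewrite subr_gt0.
move=> y hy; apply/negP; rewrite -ltNge.
by have := enormBD x y c; rewrite (enormB x y); lra.
Qed.
Lemma closed_bounded_compact (K : set V) : closed K ->
  (exists M, forall x, K x -> enorm x <= M) -> compact K.
Proof.
move=> cK [M hM]; apply: bounded_closed_compact => //.
exists M; split; first exact: num_real.
by move=> M' MM' x Kx /=; apply: le_trans (norm_le_enorm _) (le_trans (hM _ Kx) (ltW MM')).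
Qed.
Lemma cball_sub c r x : cball c r x -> enorm x <= enorm c + r.
Proof. by rewrite /cball /= => h; have := enormD (x - c) c; rewrite subrK; lra. Qed.

Lemma compact_min (f : V -> R) (K : set V) : K !=set0 -> compact K ->
  (forall x, K x -> {for x, continuous f}) -> exists2 c, K c & forall x, K x -> f c <= f x.
Proof.
move=> K0 cK cf; have [c /set_mem Kc h] := compact_EVT_min K0 cK (continuous_in_subspaceT (fun x xK => cf x (set_mem xK))).
by exists c => // x Kx; apply: h; rewrite inE.
Qed.
Lemma compact_max (f : V -> R) (K : set V) : K !=set0 -> compact K ->
  (forall x, K x -> {for x, continuous f}) -> exists2 c, K c & forall x, K x -> f x <= f c.
Proof.
move=> K0 cK cf; have [c /set_mem Kc h] := compact_EVT_max K0 cK (continuous_in_subspaceT (fun x xK => cf x (set_mem xK))).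
by exists c => // x Kx; apply: h; rewrite inE.
Qed.
Lemma cball_center c r : 0 <= r -> cball c r c.
Proof. by rewrite /cball /= subrr enorm0. Qed.
Lemma compact_cball c r : compact (cball c r).
Proof.
apply: closed_bounded_compact; first exact: closed_cball.
by exists (enorm c + r) => x; exact: cball_sub.
Qed.
End Euclid.

(** * One-variable derivatives as quantitative expansions *)

Section OneDim.
Context {R : realType}.
Implicit Types (f df : R -> R) (x y t a b c e : R).

(** Differentiability in Peano form, equivalent to [is_derive] by [hd_is] and [is_hd]. The explicit
    remainder is what the second-difference estimates consume. *)
Definition hd f x d := forall e, 0 < e -> exists2 r : R, 0 < r &
  forall t, `|t| < r -> `|f (x + t) - f x - d * t| <= e * `|t|.

Lemma hd_is f x d : hd f x d -> is_derive x 1 f d.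
Proof.
move=> h.
have H : (fun t => t^-1 *: ((f \o shift x) (t *: 1) - f x)) @ 0^' --> d.
  apply/cvgrPdist_le => e e0; have [r r0 hr] := h e e0.
  near=> t.
  have t0 : t != 0 by near: t; exact: nbhs_dnbhs_neq.
  have tr : `|t| < r.
    near: t; apply/nbhs_ballP; exists r => //= y /=.
    by rewrite /ball /= sub0r normrN.
  have := hr _ tr; rewrite /= /shift /= [t%:A]mulr1 [t + x]addrC => k.
  rewrite distrC -(ler_pM2r (_ : 0 < `|t|)) ?normr_gt0 // -normrM; apply: le_trans k.
  by rewrite mulrBl /GRing.scale /= mulrAC mulVf // mul1r.
by split; [apply/cvg_ex; exists d|apply: cvg_lim].
Unshelve. all: by end_near. Qed.

Lemma is_hd f x d : is_derive x 1 f d -> hd f x d.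
Proof.
move=> [h hd]; move: h => /cvg_ex [l hl].
have ll : l = d by rewrite -hd; apply/esym; apply: cvg_lim.
rewrite ll in hl => {ll l}.
move=> e e0; move/cvgrPdist_le: hl => /(_ _ e0).
rewrite /dnbhs /within /= -nbhs_nearE => /nbhs_ballP [r r0 hr].
exists r => // t tr; have [->|t0] := eqVneq t 0; first by rewrite addr0 subrr mulr0 subrr normr0 mulr0.
have := hr t; rewrite /ball /= sub0r normrN => /(_ tr t0).
rewrite /= /shift /= [t%:A]mulr1 [t + x]addrC distrC -(ler_pM2r (_ : 0 < `|t|)) ?normr_gt0 // -normrM.
by rewrite mulrBl /GRing.scale /= mulrAC mulVf // mul1r.
Qed.

Lemma hd_ct f x d : hd f x d -> {for x, continuous f}.
Proof. by move=> /hd_is [h _]; apply: differentiable_continuous; apply/derivable1_diffP. Qed.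

(** The mean value theorem after subtraction of the slope [c]: with [c = 0] it bounds increments,
    with [c] a reference derivative it bounds a Taylor remainder. The endpoints are unordered so
    that negative increments need no separate treatment. *)
Lemma mvt1 f df a b c e :
  (forall x, Num.min a b <= x <= Num.max a b -> hd f x (df x) /\ `|df x - c| <= e) ->
  `|f b - f a - c * (b - a)| <= e * `|b - a|.
Proof.
wlog ab : a b / a <= b.
  move=> H; have /orP [ab|ba] := le_total a b; first exact: H.
  move=> h; rewrite (_ : _ - _ = - (f a - f b - c * (a - b))); last by ring.
  by rewrite normrN (distrC b a); apply: H => // x; rewrite minC maxC; exact: h.
move=> h.
have h1 x : a <= x <= b -> hd f x (df x) /\ `|df x - c| <= e.
  by move=> xab; apply: h; rewrite (min_idPl ab) (max_idPr ab).
have [|| z /[!in_itv] /= zab ->] := @MVT_segment _ f df a b ab.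
- by move=> x /[!in_itv] /= /andP [ax xb]; apply: hd_is; apply: (h1 x _).1; rewrite !ltW.
- apply: continuous_in_subspaceT => x /set_mem /=; rewrite in_itv /= => xab.
  exact: hd_ct (h1 x xab).1.
by rewrite -mulrBl normrM ler_wpM2r // (h1 _ zab).2.
Qed.

Lemma hdC c x : hd (fun=> c) x 0.
Proof. by move=> e e0; exists 1 => // t _; rewrite subrr mul0r subrr normr0 mulr_ge0 // ltW. Qed.
Lemma hd_id x : hd id x 1.
Proof.
move=> e e0; exists 1 => // t _.
by rewrite (_ : x + t - x - 1 * t = 0); [rewrite normr0 mulr_ge0 // ltW|ring].
Qed.
Lemma hdD f g x a b : hd f x a -> hd g x b -> hd (fun t => f t + g t) x (a + b).
Proof. by move=> /hd_is h1 /hd_is h2; apply: is_hd; exact: is_deriveD. Qed.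
Lemma hdN f x a : hd f x a -> hd (fun t => - f t) x (- a).
Proof. by move=> /hd_is h1; apply: is_hd; exact: is_deriveN. Qed.
Lemma hdB f g x a b : hd f x a -> hd g x b -> hd (fun t => f t - g t) x (a - b).
Proof. by move=> h1 h2; apply: hdD h1 (hdN h2). Qed.
Lemma hdM f g x a b : hd f x a -> hd g x b -> hd (fun t => f t * g t) x (a * g x + f x * b).
Proof.
move=> /hd_is h1 /hd_is h2; apply: is_hd; have h := is_deriveM h1 h2; apply: is_derive_eq h _.
by rewrite /GRing.scale /=; ring.
Qed.
Lemma hdZ f k x a : hd f x a -> hd (fun t => k * f t) x (k * a).
Proof. by move=> h; have := hdM (hdC k x) h; rewrite mul0r add0r. Qed.
Lemma hd_eq f x a b : hd f x a -> a = b -> hd f x b.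
Proof. by move=> h <-. Qed.
Lemma hd_ext f g x a : (exists2 r : R, 0 < r & forall y, `|y - x| < r -> f y = g y) -> hd f x a -> hd g x a.
Proof.
move=> [r r0 h] H e e0; have [r' r'0 h'] := H e e0.
exists (Num.min r r'); first by rewrite lt_min r0.
move=> t; rewrite lt_min => /andP [tr tr']; have := h' _ tr'.
rewrite !h ?subrr ?normr0 //; by rewrite addrAC subrr add0r.
Qed.
Lemma hd_comp f (g : R -> R) x a b : hd f x a -> hd g (f x) b -> hd (fun t => g (f t)) x (b * a).
Proof. by move=> /hd_is h1 /hd_is h2; apply: is_hd; have := is_derive1_comp h2 h1. Qed.
Lemma hd_aff f x k m a : hd f (k * x + m) a -> hd (fun t => f (k * t + m)) x (k * a).
Proof.
move=> h; rewrite mulrC; apply: (@hd_comp (fun t => k * t + m) f) h.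
apply: hd_eq; first exact: hdD (hdZ k (hd_id x)) (hdC m x).
by rewrite mulr1 addr0.
Qed.
Lemma hd_expR x : hd expR x (expR x).
Proof. apply: is_hd; exact: is_derive_expR. Qed.
Lemma hd_powR q x : 0 < x -> hd (fun t => powR t q) x (q * powR x (q - 1)).
Proof. by move=> x0; apply: is_hd; have := @is_derive1_powR _ q x x0. Qed.

Lemma hd_sum (I : Type) (r : seq I) (F : I -> R -> R) (a : I -> R) x : (forall i, hd (F i) x (a i)) ->
  hd (fun t => \sum_(i <- r) F i t) x (\sum_(i <- r) a i).
Proof.
move=> h; elim: r => [|i r IH].
  by rewrite big_nil (_ : (fun _ => _) = fun=> 0); [exact: hdC|apply/funext => t; rewrite big_nil].
rewrite big_cons (_ : (fun _ => _) = fun t => F i t + \sum_(i <- r) F i t); first exact: hdD (h i) IH.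
by apply/funext => t; rewrite big_cons.
Qed.

(** A second-order Taylor expansion at the single point [x], exactly what is needed to compute
    [hlap] of a composition with [f]. *)
Definition peano (f : R -> R) x b1 b2 := forall e, 0 < e -> exists2 r : R, 0 < r &
  forall t, `|t| < r -> `|f (x + t) - f x - b1 * t - b2 / 2 * t ^+ 2| <= e * t ^+ 2.

(** The second-order remainder has as derivative the first-order remainder of [f1], which is at most
    e|s|; [mvt1] integrates this once. *)
Lemma peano_hd f f1 x b2 : (exists2 r : R, 0 < r & forall y, `|y - x| < r -> hd f y (f1 y)) ->
  hd f1 x b2 -> peano f x (f1 x) b2.
Proof.
move=> [r r0 h] h1 e e0; have [r' r'0 h'] := h1 e e0.
exists (Num.min r r'); first by rewrite lt_min r0.
move=> t; rewrite lt_min => /andP [tr tr'].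
set K := fun s => f (1 * s + x) - f1 x * s - b2 / 2 * s ^+ 2.
have M := @mvt1 K (fun s => 1 * f1 (1 * s + x) - f1 x * 1 - b2 / 2 * (1 * s + s * 1)) 0 t 0 (e * `|t|).
have -> : f (x + t) - f x - f1 x * t - b2 / 2 * t ^+ 2 = K t - K 0 - 0 * (t - 0).
  by rewrite /K !mul1r add0r (addrC t x); ring.
have -> : e * t ^+ 2 = e * `|t| * `|t - 0| by rewrite subr0 -mulrA -expr2 real_normK ?num_real.
apply: M => s hs.
have st : `|s| <= `|t|.
  by have /orP [t0|t0] := le_total 0 t; move: hs; [rewrite (min_idPl t0) (max_idPr t0)|rewrite (min_idPr t0) (max_idPl t0)] => /andP [ha hb]; [rewrite !ger0_norm|rewrite !ler0_norm]; move: (hb) (ha); glra.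
split.
  apply: hdB; first apply: hdB.
  - apply: hd_aff; rewrite mul1r; apply: h; rewrite addrK; exact: le_lt_trans st tr.
  - apply: hdZ; exact: hd_id.
  - apply: hdZ; rewrite (_ : (fun s => s ^+ 2) = fun s => s * s); last by apply/funext => z; rewrite expr2.
    exact: hdM (hd_id s) (hd_id s).
rewrite subr0 !mul1r !mulr1 (_ : _ - _ = f1 (x + s) - f1 x - b2 * s); last by rewrite (addrC s x); field.
apply: le_trans (h' s (le_lt_trans st tr')) _.
by rewrite ler_pM2l.
Qed.

Lemma peano_id x : peano id x 1 0.
Proof.
move=> e e0; exists 1 => // t _; rewrite (_ : _ - _ = 0); last by rewrite /= ?expr2; lra.
by rewrite normr0 mulr_ge0 ?(ltW e0) ?sqr_ge0.
Qed.
Lemma peano_exp k m x : peano (fun t => expR (k * t + m)) x (k * expR (k * x + m)) (k ^+ 2 * expR (k * x + m)).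
Proof.
apply: (@peano_hd _ (fun t => k * expR (k * t + m))).
  exists 1 => // y _; apply: hd_aff; exact: hd_expR.
rewrite expr2 -mulrA; apply: hdZ; apply: hd_aff; exact: hd_expR.
Qed.
Lemma peano_pow q m x : 0 < x + m ->
  peano (fun t => powR (t + m) q) x (q * powR (x + m) (q - 1)) (q * (q - 1) * powR (x + m) (q - 1 - 1)).
Proof.
move=> xm.
have aux k y : 0 < y + m -> hd (fun t => powR (t + m) k) y (k * powR (y + m) (k - 1)).
  move=> ym; rewrite -[X in hd _ _ X]mul1r.
  apply: (@hd_ext (fun t => powR (1 * t + m) k)); first by exists 1 => // z _; rewrite mul1r.
  by apply: (@hd_aff (fun t => powR t k)); rewrite mul1r; exact: hd_powR.
apply: (@peano_hd _ (fun t => q * powR (t + m) (q - 1))).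
  exists (x + m) => // y yx; apply: aux.
  by move: yx; rewrite ltr_norml; lra.
rewrite -mulrA; apply: hdZ; exact: aux.
Qed.

Lemma fin_r n (P : 'I_n -> R -> Prop) : (forall i r r', 0 < r' <= r -> P i r -> P i r') ->
  (forall i, exists2 r : R, 0 < r & P i r) -> exists2 r : R, 0 < r & forall i, P i r.
Proof.
move=> mono h; have [f hf] := choice (fun i => let: ex_intro2 r a b := h i in ex_intro (fun r => 0 < r /\ P i r) r (conj a b)).
have f0 : 0 < \big[Num.min/1]_i f i 
  by apply: (big_ind (fun z => 0 < z)) => // [a b a0 b0|i _]; [rewrite lt_min a0|exact: (hf i).1].
exists (\big[Num.min/1]_i f i) => // i; apply: mono (hf i).2.
by rewrite f0 bigmin_le_cond.
Qed.

End OneDim.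

(** * The Laplacian through second differences *)

Section Hlap.
Context {R : realType} {N : nat}.
Notation V := 'rV[R]_N.
Implicit Types (u w : V -> R) (x y q : V) (e t a b c k : R).

Definition ortho (Q : 'M[R]_N) := Q *m Q^T = 1%:M.
Definition sd u x h : R := u (x + h) + u (x - h) - 2 * u x.
(* Second differences summed over every orthonormal frame: this makes the Laplacian
   manifestly invariant under isometries and avoids the multivariate chain rule. *)
Definition hlap u x (L : R) := forall Q, ortho Q -> forall e, 0 < e -> exists2 r : R, 0 < r &
  forall t, 0 < t < r -> `|\sum_(i < N) sd u x (t *: row i Q) - L * t ^+ 2| <= e * t ^+ 2.

Lemma xhx x q : x + q - x = q.
Proof. by rewrite addrC addKr. Qed.
Lemma hlapD u w x a b : hlap u x a -> hlap w x b -> hlap (fun y => u y + w y) x (a + b).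
Proof.
move=> h1 h2 Q oQ e e0; have e2 : 0 < e / 2 by lra.
have [r r0 hr] := h1 Q oQ _ e2; have [s s0 hs] := h2 Q oQ _ e2.
exists (Num.min r s); first by rewrite lt_min r0.
move=> t; rewrite lt_min => /and3P [t0 tr ts].
have := hr t; have := hs t; rewrite t0 tr ts => /(_ isT) k1 /(_ isT) k2.
set S1 := \sum_(i < N) sd u _ _ in k2; set S2 := \sum_(i < N) sd w _ _ in k1.
rewrite (_ : _ - _ = (S1 - a * t ^+ 2) + (S2 - b * t ^+ 2)).
  by apply: le_trans (ler_normD _ _) _; move: (k2) (k1); glra.
rewrite (_ : \sum_(i < N) _ = S1 + S2); first by ring.
by rewrite -big_split; apply: eq_bigr => i _; rewrite /sd /=; ring.
Qed.
Lemma hlapZ k u x a : hlap u x a -> hlap (fun y => k * u y) x (k * a).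
Proof.
move=> h Q oQ e e0; have k0 : 0 < `|k| + 1 by rewrite ltr_wpDl.
have [r r0 hr] := h Q oQ _ (divr_gt0 e0 k0); exists r => // t tr.
rewrite (_ : \sum_(i < N) _ = k * \sum_(i < N) sd u x (t *: row i Q)).
  rewrite -mulrA -mulrBr normrM; apply: le_trans (ler_wpM2l (normr_ge0 _) (hr t tr)) _.
  rewrite mulrA ler_wpM2r ?sqr_ge0 // mulrCA ler_piMr ?(ltW e0) // ler_pdivrMr // mul1r.
  by rewrite lerDl.
by rewrite mulr_sumr; apply: eq_bigr => i _; rewrite /sd /=; ring.
Qed.
Lemma hlapN u x a : hlap u x a -> hlap (fun y => - u y) x (- a).
Proof.
move=> h; rewrite -mulN1r (_ : (fun y => - u y) = fun y => -1 * u y); last by apply/funext => y; rewrite mulN1r.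
exact: hlapZ.
Qed.
Lemma hlapB u w x a b : hlap u x a -> hlap w x b -> hlap (fun y => u y - w y) x (a - b).
Proof. by move=> h1 h2; apply: hlapD h1 (hlapN h2). Qed.
Lemma hlapC c x : hlap (fun=> c) x 0.
Proof.
move=> Q _ e e0; exists 1 => // t _; rewrite big1; last by move=> i _; rewrite /sd; ring.
by rewrite mul0r subrr normr0 mulr_ge0 ?(ltW e0) ?sqr_ge0.
Qed.
Lemma row_norm Q i : ortho Q -> enorm (row i Q : V) = 1.
Proof.
move=> oQ; rewrite enormE (_ : sqn _ = 1) ?sqrtr1 //.
have : (Q *m Q^T) i i = (1%:M : 'M[R]_N) i i by rewrite oQ.
rewrite !mxE eqxx mulr1n => <-.
by apply: eq_bigr => j _; rewrite !mxE.
Qed.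
Lemma hlap_loc u w x a : (exists2 r : R, 0 < r & forall y, enorm (y - x) < r -> u y = w y) ->
  hlap u x a -> hlap w x a.
Proof.
move=> [r r0 uw] h Q oQ e e0; have [s s0 hs] := h Q oQ _ e0.
exists (Num.min r s); first by rewrite lt_min r0.
move=> t; rewrite lt_min => /and3P [t0 tr ts].
have := hs t; rewrite t0 ts => /(_ isT); congr (`|_ - _| <= _).
apply: eq_bigr => i _; rewrite /sd.
have ht : enorm (t *: row i Q) < r by rewrite enormZ row_norm // mulr1 gtr0_norm.
by rewrite !uw ?xhx ?enormN ?subrr ?enorm0.
Qed.
(** The frame [Q] for the composed function is the frame [Q *m A] for [u]; this is what the
    quantification over all orthonormal frames is for. *)
Lemma hlap_isom A (b : V) u x a : ortho A -> hlap u (x *m A + b) a -> hlap (fun y => u (y *m A + b)) x a.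
Proof.
move=> oA h Q oQ e e0; have [|s s0 hs] := h (Q *m A) _ _ e0.
  by rewrite /ortho trmx_mul mulmxA -(mulmxA Q) oA mulmx1.
exists s => // t ts; have := hs t ts; congr (`|_ - _| <= _).
apply: eq_bigr => i _; rewrite /sd row_mul !mulmxDl mulNmx -!scalemxAl.
by rewrite -!addrA !(addrC b).
Qed.
Lemma hlap_dil k (b : V) u x a : 0 < k -> hlap u (k *: x + b) a -> hlap (fun y => u (k *: y + b)) x (k ^+ 2 * a).
Proof.
move=> k0 h Q oQ e e0; have [|s s0 hs] := h Q oQ (e / k ^+ 2) _; first by rewrite divr_gt0 // exprn_gt0.
exists (s / k); first by rewrite divr_gt0.
move=> t /andP [t0 ts]; have := hs (k * t).
rewrite mulr_gt0 //= mulrC -ltr_pdivlMr // => /(_ ts).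
rewrite exprMn (_ : e / _ * _ = e * t ^+ 2); last by field; rewrite gt_eqF.
rewrite (_ : a * _ = k ^+ 2 * a * t ^+ 2); last by ring.
congr (`|_ - _| <= _); apply: eq_bigr => i _; rewrite /sd !scalerDr scalerN scalerA (mulrC t k).
by rewrite -!addrA !(addrC b).
Qed.
Lemma hlap_min u x a : (exists2 r : R, 0 < r & forall y, enorm (y - x) < r -> u x <= u y) ->
  hlap u x a -> 0 <= a.
Proof.
move=> [r r0 mn] h; rewrite leNgt; apply/negP => a0.
have o1 : ortho 1%:M by rewrite /ortho trmx1 mulmx1.
have [|s s0 hs] := h 1%:M o1 (- a / 2) _; first lra.
have [t /andP [t0 tm]] : exists t, 0 < t < Num.min r s.
  by exists (Num.min r s / 2); have : 0 < Num.min r s by [rewrite lt_min r0]; lra.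
move: tm; rewrite lt_min => /andP [tr ts]; have := hs t; rewrite t0 ts => /(_ isT).
have : 0 <= \sum_(i < N) sd u x (t *: row i 1%:M).
  apply: sumr_ge0 => i _; rewrite /sd.
  have ht : enorm (t *: row i 1%:M : V) < r by rewrite enormZ row_norm // mulr1 gtr0_norm.
  have := mn (x + t *: row i 1%:M); have := mn (x - t *: row i 1%:M).
  rewrite !xhx enormN => /(_ ht) k1 /(_ ht) k2.
  by lra.
have t2 : 0 < t ^+ 2 by rewrite exprn_gt0.
by rewrite ler_norml => k /andP [_]; nra.
Qed.

Lemma parseval Q x : ortho Q -> \sum_(i < N) dot x (row i Q) ^+ 2 = sqn x.
Proof.
move=> oQ; have e : sqn (x *m Q^T) = sqn x.
  have sq (z : V) : sqn z = (z *m z^T) ord0 ord0 by rewrite mxE; apply: eq_bigr => i _; rewrite mxE.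
  by rewrite !sq trmx_mul trmxK -mulmxA (mulmxA Q^T) (mulmx1C oQ) mul1mx.
rewrite -e; apply: eq_bigr => i _; rewrite expr2; congr (_ * _);
by rewrite mxE; apply: eq_bigr => j _; rewrite !mxE.
Qed.

(** The symmetric second difference of [f] along a parabola g + t l + t^2 m: the terms linear in t
    cancel, and b1 t^2 m and b2/2 (t l)^2 each occur twice. *)
Lemma peano_quad (f : R -> R) (g b1 b2 l m e : R) : peano f g b1 b2 -> 0 < e -> exists2 r : R, 0 < r &
  forall t, 0 < t < r -> `|f (g + t * l + t ^+ 2 * m) + f (g + - t * l + (- t) ^+ 2 * m) - 2 * f g
     - (2 * b1 * m + b2 * l ^+ 2) * t ^+ 2| <= e * t ^+ 2.
Proof.
move=> pf e0; pose D : R := `|l| + `|m| + 1.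
have D1 : 1 <= D by rewrite /D lerDr addr_ge0.
have D0 : 0 < D by lra.
have [|r r0 hr] := pf (e / (4 * D ^+ 2)); first by rewrite divr_gt0 // mulr_gt0 // exprn_gt0.
(* [B] bounds the coefficient of the surviving term b2 m^2 t^4, which is absorbed by taking t^2 <= t
   < e / (2 B). *)
pose B : R := `|b2| * m ^+ 2 + 1.
have B0 : 0 < B by rewrite /B ltr_wpDl // mulr_ge0 ?sqr_ge0.
exists (Num.min 1 (Num.min (r / D) (e / (2 * B)))).
  by rewrite !lt_min ltr01 /= !divr_gt0 // mulr_gt0.
move=> t; rewrite !lt_min => /and4P [t0 t1 tr te].
move: tr te; rewrite !ltr_pdivlMr // ?mulr_gt0 // => tr te.
have t2 : 0 < t ^+ 2 by rewrite exprn_gt0.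
have dl s : `|s| = t -> `|s * l + s ^+ 2 * m| <= t * D.
  move=> st; apply: le_trans (ler_normD _ _) _; rewrite !normrM st /D.
  have l0 := normr_ge0 l; have m0 := normr_ge0 m.
  have h1 : t * `|m| <= `|m| by rewrite ler_piMl // ltW.
  have := ler_wpM2l (ltW t0) h1; have := mulr_ge0 (ltW t0) l0; move: (t0); glra.
have ds s : `|s| = t -> `|f (g + (s * l + s ^+ 2 * m)) - f g - b1 * (s * l + s ^+ 2 * m) - b2 / 2 * (s * l + s ^+ 2 * m) ^+ 2| <= e / 4 * t ^+ 2.
  move=> st; apply: le_trans (hr _ (le_lt_trans (dl s st) tr)) _.
  have h : (s * l + s ^+ 2 * m) ^+ 2 <= (t * D) ^+ 2.
    by have := dl s st; rewrite ler_norml => /andP [k1 k2]; have : 0 <= (t * D - (s * l + s ^+ 2 * m)) * (t * D + (s * l + s ^+ 2 * m)); [apply: mulr_ge0; move: (k2) (k1); glra|rewrite !expr2; glra].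
  apply: le_trans (ler_wpM2l _ h) _; first by rewrite divr_ge0 ?ltW // mulr_gt0 // exprn_gt0.
  by rewrite exprMn le_eqVlt; apply/orP; left; apply/eqP; field; rewrite gt_eqF.
have k1 := ds t (gtr0_norm t0).
have k2 := ds (- t) ltac:(by rewrite normrN gtr0_norm).
rewrite !addrA in k1 k2.
set A1 := _ - _ - _ - _ in k1; set A2 := _ - _ - _ - _ in k2.
have -> : f (g + t * l + t ^+ 2 * m) + f (g + - t * l + (- t) ^+ 2 * m) - 2 * f g
     - (2 * b1 * m + b2 * l ^+ 2) * t ^+ 2 = A1 + A2 + b2 * m ^+ 2 * t ^+ 2 * t ^+ 2.
  by rewrite /A1 /A2; field.
have k3 : `|b2 * m ^+ 2 * t ^+ 2 * t ^+ 2| <= e / 2 * t ^+ 2.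
  have p0 : 0 <= m ^+ 2 * t ^+ 2 * t ^+ 2 by exact: mulr_ge0 (mulr_ge0 (sqr_ge0 m) (sqr_ge0 t)) (sqr_ge0 t).
  rewrite -(mulrA b2) -(mulrA b2) normrM (ger0_norm p0).
  rewrite (_ : _ * _ = (`|b2| * m ^+ 2 * t ^+ 2) * t ^+ 2); last by ring.
  rewrite ler_pM2r //.
  have q1 : `|b2| * m ^+ 2 <= B by rewrite /B lerDl.
  have q2 : t ^+ 2 <= t by rewrite expr2 ler_piMl // ltW.
  have q3 := ler_pM (mulr_ge0 (normr_ge0 b2) (sqr_ge0 m)) (ltW t2) q1 q2.
  by clear -q3 te; lra.
apply: le_trans (ler_normD _ _) _; have := ler_normD A1 A2; move: (k1) (k2) (k3); glra.
Qed.

(** Functions [g] that are quadratic on every line include |y - a|^2 and y.e, so this one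
    computation serves both the radial and the ridge barriers. *)
Lemma hlap_comp_quad (f : R -> R) (g : V -> R) x b1 b2 (l m : V -> R) lsum : peano f (g x) b1 b2 ->
  (forall q t, g (x + t *: q) = g x + t * l q + t ^+ 2 * m q) ->
  (forall Q, ortho Q -> \sum_(i < N) (2 * b1 * m (row i Q) + b2 * l (row i Q) ^+ 2) = lsum) ->
  hlap (fun y => f (g y)) x lsum.
Proof.
move=> pf hg hs Q oQ e e0.
have e1 : 0 < e / (N%:R + 1) by rewrite divr_gt0 // ltr_wpDl.
have [r r0 hr] : exists2 r : R, 0 < r & forall i, forall t, 0 < t < r ->
   `|sd (fun y => f (g y)) x (t *: row i Q) - (2 * b1 * m (row i Q) + b2 * l (row i Q) ^+ 2) * t ^+ 2| <= e / (N%:R + 1) * t ^+ 2.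
  apply: fin_r => [i r r' /andP [_ rr] h t /andP [t0 tr]|i].
    by apply: h; rewrite t0 (lt_le_trans tr).
  have [r r0 hr] := peano_quad (l (row i Q)) (m (row i Q)) pf e1.
  by exists r => // t tr; rewrite /sd -scaleNr !hg; exact: hr.
exists r => // t tr; rewrite -(hs Q oQ) mulr_suml -sumrB.
apply: le_trans (ler_norm_sum _ _ _) _.
apply: le_trans (ler_sum _ (fun i _ => hr i t tr)) _.
rewrite big_const_ord iter_addr addr0 -[_ *+ N]mulr_natl mulrA ler_wpM2r ?sqr_ge0 //.
rewrite mulrCA ler_piMr ?(ltW e0) // ler_pdivrMr ?ltr_wpDl // mul1r lerDl //.
Qed.

Lemma hlap_radial (f : R -> R) (a x : V) b1 b2 : peano f (sqn (x - a)) b1 b2 ->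
  hlap (fun y => f (sqn (y - a))) x (2 * N%:R * b1 + 4 * b2 * sqn (x - a)).
Proof.
move=> pf; apply: (@hlap_comp_quad f (fun y => sqn (y - a)) x b1 b2 (fun q => 2 * dot (x - a) q) sqn _ pf).
  by move=> q t; rewrite addrAC (sqnD (x - a)) /sqn !dotZl !dotZr; ring.
move=> Q oQ; rewrite big_split /=; congr (_ + _).
  rewrite (eq_bigr (fun=> 2 * b1)); last by move=> i _; rewrite -enorm2 row_norm // expr1n mulr1.
  by rewrite big_const_ord iter_addr addr0 -[_ *+ N]mulr_natl; ring.
rewrite -(parseval (x - a) oQ) mulr_sumr; apply: eq_bigr => i _; ring.
Qed.

Lemma hlap_ridge (f : R -> R) (e x : V) b1 b2 : peano f (dot x e) b1 b2 ->
  hlap (fun y => f (dot y e)) x (b2 * sqn e).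
Proof.
move=> pf; apply: (@hlap_comp_quad f (fun y => dot y e) x b1 b2 (fun q => dot q e) (fun=> 0) _ pf).
  by move=> q t; rewrite !dotE; ring.
move=> Q oQ; rewrite -(parseval e oQ) mulr_sumr; apply: eq_bigr => i _; rewrite dotC; ring.
Qed.

Lemma hlap_sqn (a x : V) : hlap (fun y => sqn (y - a)) x (2 * N%:R).
Proof. by have := hlap_radial (peano_id (sqn (x - a))); rewrite mulr1 mulr0 mul0r addr0. Qed.

(** The increment is split into legs parallel to the axes, and [mvt1] is applied on each leg with
    slope [c0 ord0 k]. *)
Lemma c1_expand u x r (c0 : V) e : (forall y, enorm (y - x) < r -> forall i, derivable u y (ev i) /\ `|pd i u y - c0 ord0 i| <= e) ->
  forall h : V, enorm h < r -> `|u (x + h) - u x - dot c0 h| <= e * \sum_(i < N) `|h ord0 i|.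
Proof.
move=> H h hr.
(* [stp k] keeps the first k coordinates of [h]; every point of a leg is coordinatewise no larger
   than [h], hence stays in the ball. *)
pose stp (k : nat) : V := \row_j (if (j < k)%N then h ord0 j else 0).
have nstp (g : V) : (forall j, `|g ord0 j| <= `|h ord0 j|) -> enorm g < r.
  move=> gh; apply: le_lt_trans hr; rewrite !enormE ler_sqrt ?sqn_ge0 //.
  apply: ler_sum => j _; rewrite -!expr2 -(real_normK (num_real (g _ _))) -(real_normK (num_real (h _ _))).
  by rewrite ler_pXn2r ?nnegrE ?normr_ge0.
have st (k : 'I_N) : `|u (x + stp k.+1) - u (x + stp k) - c0 ord0 k * h ord0 k| <= e * `|h ord0 k|.
  have e1 : stp k.+1 = stp k + h ord0 k *: ev k.
    apply/rowP => j; rewrite !mxE eqxx /= ltnS leq_eqVlt.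
    have [->|jk] := eqVneq j k; first by rewrite eqxx ltnn mulr1 add0r.
    by rewrite eqE /= in jk; rewrite (negPf jk) /= mulr0 addr0.
  have := @mvt1 R (fun s => u (x + stp k + s *: ev k)) (fun s => pd k u (x + stp k + s *: ev k)) 0 (h ord0 k) (c0 ord0 k) e.
  rewrite scale0r addr0 subr0 -[x + stp k + h ord0 k *: ev k]addrA -e1; apply=> s hs.
  have sh : `|s| <= `|h ord0 k|.
    by have /orP [t0|t0] := le_total 0 (h ord0 k); move: hs; [rewrite (min_idPl t0) (max_idPr t0)|rewrite (min_idPr t0) (max_idPl t0)] => /andP [ha hb]; [rewrite !ger0_norm|rewrite !ler0_norm]; move: (hb) (ha); glra.
  have [|dk bk] := H (x + stp k + s *: ev k) _ k.
    rewrite -[x + stp k + _]addrA xhx; apply: nstp => j; rewrite !mxE eqxx /=.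
    have [->|jk] := eqVneq j k; first by rewrite ltnn add0r mulr1.
    by rewrite mulr0 addr0; case: ifP => // _; rewrite normr0.
  split=> //; apply: is_hd.
  have E : (fun t => t^-1 *: (((fun s => u (x + stp k + s *: ev k)) \o shift s) (t *: 1) - u (x + stp k + s *: ev k)))
     = (fun t => t^-1 *: ((u \o shift (x + stp k + s *: ev k)) (t *: ev k) - u (x + stp k + s *: ev k))).
    apply/funext => t; rewrite /shift /= [t%:A]mulr1; congr (_ *: (u _ - _)).
    by rewrite scalerDl addrCA.
  by split; [rewrite /derivable E|rewrite /derive E].
have -> : u (x + h) - u x - dot c0 h = \sum_(k < N) (u (x + stp k.+1) - u (x + stp k) - c0 ord0 k * h ord0 k).
  rewrite sumrB -/(dot c0 h); congr (_ - _).
  rewrite -(big_mkord xpredT (fun k : nat => u (x + stp k.+1) - u (x + stp k))) telescope_sumr //.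
  congr (u (x + _) - u _); first by apply/rowP => j; rewrite mxE ltn_ord.
  by rewrite (_ : stp 0%N = 0) ?addr0 //; apply/rowP => j; rewrite !mxE.
by apply: le_trans (ler_norm_sum _ _ _) _; rewrite mulr_sumr; apply: ler_sum.
Qed.

Definition grad u x : V := \row_i pd i u x.

Lemma l1_le (h : V) : \sum_(i < N) `|h ord0 i| <= N%:R * enorm h.
Proof.
apply: le_trans (ler_sum _ (fun i _ => coord_le h i)) _.
by rewrite big_const_ord iter_addr addr0 -[_ *+ N]mulr_natl.
Qed.

Lemma c1_diff u x : (exists2 r : R, 0 < r & forall y, enorm (y - x) < r -> forall i, derivable u y (ev i)) ->
  (forall i, {for x, continuous (pd i u)}) -> forall e, 0 < e -> exists2 r : R, 0 < r &
  forall h : V, enorm h < r -> `|u (x + h) - u x - dot (grad u x) h| <= e * enorm h.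
Proof.
move=> [r0 r00 d0] cp e e0.
have e1 : 0 < e / (N%:R + 1) by rewrite divr_gt0 // ltr_wpDl.
have [r1 r10 h1] : exists2 r : R, 0 < r & forall i, forall y, enorm (y - x) < r -> `|pd i u y - pd i u x| <= e / (N%:R + 1).
  apply: fin_r => [i r r' /andP [_ rr] h y yr|i].
    by apply: h; apply: lt_le_trans rr.
  by have /contP /(_ _ e1) [r r0' hr] := cp i; exists r => // y yr; rewrite ltW // hr.
exists (Num.min r0 r1); first by rewrite lt_min r00.
move=> h hr; apply: le_trans (@c1_expand u x (Num.min r0 r1) (grad u x) (e / (N%:R + 1)) _ h hr) _.
  by move=> y; rewrite lt_min => /andP [y0 y1] i; split; [exact: d0|rewrite mxE; exact: h1].
apply: le_trans (ler_wpM2l (ltW e1) (l1_le h)) _.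
rewrite mulrA ler_wpM2r ?enorm_ge0 // -mulrA ler_piMr ?(ltW e0) //.
by rewrite mulrC ler_pdivrMr ?ltr_wpDl // mul1r lerDl.
Qed.

Lemma c1_line u x q : (exists2 r : R, 0 < r & forall y, enorm (y - x) < r -> forall i, derivable u y (ev i)) ->
  (forall i, {for x, continuous (pd i u)}) -> hd (fun s => u (x + s *: q)) 0 (dot (grad u x) q).
Proof.
move=> d0 cp e e0; have q1 : 0 < enorm q + 1 by rewrite ltr_wpDl ?enorm_ge0.
have [r r0 hr] := c1_diff d0 cp (divr_gt0 e0 q1).
exists (r / (enorm q + 1)); first by rewrite divr_gt0.
move=> t; rewrite ltr_pdivlMr // => tr; rewrite add0r scale0r addr0 mulrC -dotZr.
have tq : enorm (t *: q) <= `|t| * (enorm q + 1) by rewrite enormZ ler_wpM2l // lerDl.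
apply: le_trans (hr _ (le_lt_trans tq tr)) _.
rewrite mulrAC ler_pdivrMr //; apply: le_trans (ler_wpM2l (ltW e0) tq) _; by rewrite mulrA.
Qed.

Definition C2at u x := exists2 r : R, 0 < r &
  (forall y, enorm (y - x) < r -> (forall i, derivable u y (ev i)) /\ (forall i, {for y, continuous (pd i u)}) /\
     (forall i j, derivable (pd i u) y (ev j))) /\ (forall i j, {for x, continuous (pd j (pd i u))}).

(** This is where classical derivatives are converted to second differences. Along a unit vector q
    the second difference is t^2 times the Hessian form at q, up to o(t^2), and the sum of this form
    over an orthonormal frame is the trace. *)
Lemma C2_hlap u x : C2at u x -> hlap u x (lap u x).
Proof.
move=> [r0 r00 [hy hx]] Q oQ e e0.
have nb y s : enorm (y - x) < s -> exists2 r : R, 0 < r & forall z, enorm (z - y) < r -> enorm (z - x) < s.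
  move=> ys; exists (s - enorm (y - x)); first by rewrite subr_gt0.
  by move=> z zr; have := enormBD z y x; lra.
(* The Hessian quadratic form. Summed over the rows of [Q], the orthonormality of the columns leaves
   only the pure second derivatives. *)
pose G q := \sum_(i < N) q ord0 i * dot (grad (pd i u) x) q.
have sG : \sum_(k < N) G (row k Q) = lap u x.
  rewrite /G exchange_big /=; apply: eq_bigr => i _.
  rewrite (eq_bigr (fun k : 'I_N => \sum_(j < N) Q k i * Q k j * pd j (pd i u) x)); last first.
    by move=> k _; rewrite mulr_sumr; apply: eq_bigr => j _; rewrite !mxE; ring.
  rewrite exchange_big /= (bigD1 i) //= [X in _ + X]big1 ?addr0; last first.
    move=> j ji; rewrite -mulr_suml; have : (Q^T *m Q) i j = (1%:M : 'M[R]_N) i j by rewrite (mulmx1C oQ).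
    rewrite !mxE eq_sym (negPf ji) /= => E; rewrite (eq_bigr (fun k : 'I_N => Q^T i k * Q k j)) ?E ?mul0r //.
    by move=> k _; rewrite mxE.
  rewrite -mulr_suml; have : (Q^T *m Q) i i = (1%:M : 'M[R]_N) i i by rewrite (mulmx1C oQ).
  rewrite !mxE eqxx => E; rewrite (eq_bigr (fun k : 'I_N => Q^T i k * Q k i)) ?E ?mul1r //.
  by move=> k _; rewrite mxE.
have e1 : 0 < e / (N%:R + 1) by rewrite divr_gt0 // ltr_wpDl.
have [r rp hr] : exists2 r : R, 0 < r & forall i, forall t, 0 < t < r ->
   `|sd u x (t *: row i Q) - G (row i Q) * t ^+ 2| <= e / (N%:R + 1) * t ^+ 2.
  apply: fin_r => [i r r' /andP [_ rr] h t /andP [t0 tr]|k].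
    by apply: h; rewrite t0 (lt_le_trans tr).
  set q := row k Q; have nq : enorm q = 1 by exact: row_norm.
  pose g1 s := dot (grad u (x + s *: q)) q.
  have hg s : `|s| < r0 -> hd (fun t => u (x + t *: q)) s (g1 s).
    move=> sr.
    have sx : enorm (x + s *: q - x) < r0 by rewrite xhx enormZ nq mulr1.
    have [s' s'0 hs'] := nb _ _ sx.
    have := @c1_line u (x + s *: q) q.
    have d1 : exists2 r : R, 0 < r & forall y, enorm (y - (x + s *: q)) < r -> forall i, derivable u y (ev i).
      by exists s' => // y ys; exact: (hy y (hs' y ys)).1.
    move=> /(_ d1 (hy _ sx).2.1) L e' e'0; have [r r1 hr] := L e' e'0; exists r => // t tr.
    by have := hr t tr; rewrite add0r scale0r addr0 scalerDl !addrA.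
  have hg1 : hd g1 0 (G q).
    rewrite /g1 /G (_ : (fun s => _) = (fun s => \sum_(i < N) q ord0 i * pd i u (x + s *: q))); last first.
      by apply/funext => s; apply: eq_bigr => i _; rewrite mxE mulrC.
    have L i : hd (fun s => pd i u (x + s *: q)) 0 (dot (grad (pd i u) x) q).
      apply: c1_line; last by move=> j; exact: hx.
      by exists r0 => // y yr j; exact: (hy y yr).2.2.
    by apply: hd_sum => i; apply: hdZ; exact: L.
  have e2 : 0 < e / (N%:R + 1) / 2 by rewrite divr_gt0.
  have [r1 r10 hr1] := hg1 _ e2.
  exists (Num.min r0 r1); first by rewrite lt_min r00.
  move=> t; rewrite lt_min => /and3P [t0 tr tr1].
  pose K s := u (x + s *: q) + u (x + (-1 * s + 0) *: q) - G q * s ^+ 2.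
  have M := @mvt1 R K (fun s => g1 s + -1 * g1 (-1 * s + 0) - G q * (1 * s + s * 1)) 0 t 0 (e / (N%:R + 1) * t).
  have -> : sd u x (t *: q) - G q * t ^+ 2 = K t - K 0 - 0 * (t - 0).
    by rewrite /K /sd mulN1r mulr0 !addr0 !scale0r !addr0 scaleNr expr0n /=; ring.
  have -> : e / (N%:R + 1) * t ^+ 2 = e / (N%:R + 1) * t * `|t - 0|.
    by rewrite subr0 gtr0_norm // expr2 mulrA.
  apply: M => s; rewrite (min_idPl (ltW t0)) (max_idPr (ltW t0)) => /andP [s0 st].
  have sn : `|s| = s by rewrite ger0_norm.
  have ms : -1 * s + 0 = - s by rewrite mulN1r addr0.
  split.
    apply: hdB; first apply: hdD.
    - by apply: hg; rewrite sn; move: (tr) (st); glra.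
    - by apply: (@hd_aff _ (fun s => u (x + s *: q))); apply: hg; rewrite ms normrN sn; move: (tr) (st); glra.
    - apply: hdZ; rewrite (_ : (fun s => s ^+ 2) = fun s => s * s); last by apply/funext => z; rewrite expr2.
      exact: hdM (hd_id s) (hd_id s).
  have := hr1 s; rewrite sn => /(_ (le_lt_trans st tr1)).
  have := hr1 (- s); rewrite normrN sn => /(_ (le_lt_trans st tr1)).
  rewrite !add0r ms subr0 !ler_norml => /andP [k1 k2] /andP [k3 k4].
  have k5 : e / (N%:R + 1) * s <= e / (N%:R + 1) * t by rewrite ler_pM2l.
  move: k1 k2 k3 k4 k5; move: (e / (N%:R + 1)) (g1 s) (g1 (- s)) (g1 0) (G q) => E a1 a2 a3 a4.
  by clear => k1 k2 k3 k4 k5; apply/andP; split; lra.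
exists r => // t tr; rewrite -sG mulr_suml -sumrB.
apply: le_trans (ler_norm_sum _ _ _) _.
apply: le_trans (ler_sum _ (fun i _ => hr i t tr)) _.
rewrite big_const_ord iter_addr addr0 -[_ *+ N]mulr_natl mulrA ler_wpM2r ?sqr_ge0 //.
rewrite mulrCA ler_piMr ?(ltW e0) // ler_pdivrMr ?ltr_wpDl // mul1r lerDl //.
Qed.
End Hlap.

(** * Approximate solutions: maximum principles, gradient and boundary estimates *)

Section Weak.
Context {R : realType} {N : nat}.
Notation V := 'rV[R]_N.
Implicit Types (u w W F D : V -> R) (x y a z : V) (e t r d k c : R) (G K : set V).

(* [- lap W = F] on [G] in the sense of locally uniform approximation: the class is stable
   under uniform limits and linear combinations, and still obeys the second derivative test. *)
Definition wsol G W F := forall a r, 0 < r -> cball a r `<=` G -> forall e, 0 < e ->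
  exists u : V -> R, (forall y, cball a r y -> {for y, continuous u} /\ `|u y - W y| <= e) /\
    forall y, enorm (y - a) < r -> exists L, hlap u y L /\ `|L + F y| <= e.

Lemma wsol_hlap G u F : (forall y, G y -> {for y, continuous u} /\ hlap u y (- F y)) -> wsol G u F.
Proof.
move=> h a r r0 aG e e0; exists u; split.
  by move=> y /aG /h [cu _]; split => //; rewrite subrr normr0 ltW.
move=> y yr; exists (- F y); split; first by apply: (h y _).2; apply: aG; rewrite /cball /= ltW.
by rewrite addNr normr0 ltW.
Qed.
Lemma wsol_sub G G' W F : G' `<=` G -> wsol G W F -> wsol G' W F.
Proof. by move=> s h a r r0 aG; apply: h => // y /aG /s. Qed.
Lemma wsol_ext G W F W' F' : (forall y, G y -> W y = W' y) -> (forall y, G y -> F y = F' y) ->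
  wsol G W F -> wsol G W' F'.
Proof.
move=> hW hF h a r r0 aG e e0; have [u [h1 h2]] := h a r r0 aG e e0; exists u; split.
  by move=> y yb; have [] := h1 y yb; rewrite hW //; exact: aG.
by move=> y yb; have := h2 y yb; rewrite hF //; apply: aG; rewrite /cball /= ltW.
Qed.
Lemma wsolD G W F W' F' : wsol G W F -> wsol G W' F' -> wsol G (fun y => W y + W' y) (fun y => F y + F' y).
Proof.
move=> h h' a r r0 aG e e0; have e2 : 0 < e / 2 by rewrite divr_gt0.
have [u [h1 h2]] := h a r r0 aG _ e2; have [u' [h1' h2']] := h' a r r0 aG _ e2.
exists (fun y => u y + u' y); split => y yb.
  have [c1 b1] := h1 y yb; have [c2 b2] := h1' y yb; split; first exact: ctD.
  rewrite (_ : _ - _ = (u y - W y) + (u' y - W' y)); last by ring.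
  by apply: le_trans (ler_normD _ _) _; lra.
have [L [c1 b1]] := h2 y yb; have [L' [c2 b2]] := h2' y yb; exists (L + L'); split; first exact: hlapD.
rewrite (_ : _ + _ = (L + F y) + (L' + F' y)); last by ring.
by apply: le_trans (ler_normD _ _) _; lra.
Qed.
Lemma wsolZ k G W F : wsol G W F -> wsol G (fun y => k * W y) (fun y => k * F y).
Proof.
move=> h a r r0 aG e e0; have k0 : 0 < `|k| + 1 by rewrite ltr_wpDl.
have [u [h1 h2]] := h a r r0 aG _ (divr_gt0 e0 k0).
have kk (z : R) : `|z| <= e / (`|k| + 1) -> `|k * z| <= e.
  move=> hz; rewrite normrM; apply: le_trans (ler_wpM2l (normr_ge0 k) hz) _.
  by rewrite mulrCA ler_piMr ?(ltW e0) // ler_pdivrMr // mul1r lerDl.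
exists (fun y => k * u y); split => y yb.
  have [c1 b1] := h1 y yb; split; first by apply: ctM => //; exact: ctC.
  by rewrite -mulrBr kk.
have [L [c1 b1]] := h2 y yb; exists (k * L); split; first exact: hlapZ.
by rewrite -mulrDr kk.
Qed.
Lemma wsolN G W F : wsol G W F -> wsol G (fun y => - W y) (fun y => - F y).
Proof.
by move=> h; apply: wsol_ext (wsolZ (-1) h) => y _; rewrite mulN1r.
Qed.
Lemma wsolB G W F W' F' : wsol G W F -> wsol G W' F' -> wsol G (fun y => W y - W' y) (fun y => F y - F' y).
Proof. by move=> h h'; apply: wsolD h (wsolN h'). Qed.

Lemma ortho_norm (A : 'M[R]_N) x : ortho A -> enorm (x *m A) = enorm x.
Proof.
move=> oA; rewrite !enormE; congr Num.sqrt.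
have sq (z : V) : sqn z = (z *m z^T) ord0 ord0 by rewrite mxE; apply: eq_bigr => i _; rewrite mxE.
by rewrite !sq trmx_mul -mulmxA (mulmxA A) oA mul1mx.
Qed.
Lemma wsol_isom (A : 'M[R]_N) (b : V) G W F : ortho A -> wsol G W F ->
  wsol [set y | G (y *m A + b)] (fun y => W (y *m A + b)) (fun y => F (y *m A + b)).
Proof.
move=> oA h a r r0 aG e e0.
have dd y z : enorm (y *m A + b - (z *m A + b)) = enorm (y - z).
  by rewrite opprD addrACA subrr addr0 -mulmxBl ortho_norm.
have sub : cball (a *m A + b) r `<=` G.
  move=> z hz; have := aG ((z - b) *m A^T).
  rewrite /= -mulmxA (mulmx1C oA) mulmx1 subrK; apply.
  by rewrite /cball /= -dd -mulmxA (mulmx1C oA) mulmx1 subrK.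
have [u [h1 h2]] := h _ r r0 sub e e0; exists (fun y => u (y *m A + b)); split => y yb.
  have [c1 b1] := h1 (y *m A + b) ltac:(by rewrite /cball /= dd); split => //.
  by apply: (@ct_lip _ _ _ (fun y => y *m A + b) 1) => // z; rewrite dd mul1r.
have [L [c1 b1]] := h2 (y *m A + b) ltac:(by rewrite dd).
by exists L; split => //; exact: hlap_isom.
Qed.
Lemma wsol_dil k (b : V) G W F : 0 < k -> wsol G W F ->
  wsol [set y | G (k *: y + b)] (fun y => W (k *: y + b)) (fun y => k ^+ 2 * F (k *: y + b)).
Proof.
move=> k0 h a r r0 aG e e0.
have kn : k != 0 by rewrite gt_eqF.
have dd y z : enorm (k *: y + b - (k *: z + b)) = k * enorm (y - z).
  by rewrite opprD addrACA subrr addr0 -scalerBr enormZ gtr0_norm.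
have sub : cball (k *: a + b) (k * r) `<=` G.
  move=> z hz; have := aG (k^-1 *: (z - b)).
  rewrite /= scalerA divff // scale1r subrK; apply.
  by rewrite /cball /= -(ler_pM2l k0) -dd scalerA divff // scale1r subrK.
have e1 : 0 < Num.min e (e / k ^+ 2) by rewrite lt_min e0 divr_gt0 // exprn_gt0.
have [u [h1 h2]] := h _ (k * r) (mulr_gt0 k0 r0) sub _ e1; exists (fun y => u (k *: y + b)); split => y yb.
  have [c1] := h1 (k *: y + b) ltac:(by rewrite /cball /= dd ler_pM2l).
  rewrite le_min => /andP [b1 _]; split => //.
  by apply: (@ct_lip _ _ _ (fun y => k *: y + b) k) => // z; rewrite dd.
have [L [c1]] := h2 (k *: y + b) ltac:(by rewrite dd ltr_pM2l).
rewrite le_min => /andP [_ b1].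
exists (k ^+ 2 * L); split => //; first exact: hlap_dil.
have k2 : 0 < k ^+ 2 by rewrite exprn_gt0.
by rewrite -mulrDr normrM (gtr0_norm k2) mulrC -ler_pdivlMr.
Qed.

(** If F x > 0, an approximant plus a small multiple of |y - x|^2 has an interior minimum on a small
    ball, and there its Laplacian would be negative, against [hlap_min]. *)
Lemma locmin G W F x : open G -> wsol G W F -> G x -> {for x, continuous F} ->
  (exists2 r, 0 < r & forall y, enorm (y - x) < r -> W x <= W y) -> F x <= 0.
Proof.
move=> /openP oG h Gx /contP cF [r0 r00 mn]; rewrite leNgt; apply/negP => Fx.
have [r1 r10 hG] := oG x Gx.
have F4 : 0 < F x / 4 by rewrite divr_gt0.
have [r2 r20 hF] := cF _ F4.
pose r := Num.min r0 (Num.min r1 r2) / 2.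
have r_0 : 0 < r by rewrite divr_gt0 // !lt_min r00 r10.
have rr : r < r0 /\ r < r1 /\ r < r2.
  have : r < Num.min r0 (Num.min r1 r2) by rewrite ltr_pdivrMr //; move: r_0; rewrite /r; lra.
  by rewrite !lt_min => /and3P [].
case: rr => [rr0 [rr1 rr2]].
(* The quadratic term has Laplacian 2Nn, at most half of F x, so the sum still has negative
   Laplacian. *)
pose n := F x / (4 * (N%:R + 1)).
have N1 : 0 < N%:R + 1 :> R by rewrite ltr_wpDl.
have n0 : 0 < n by rewrite divr_gt0 // mulr_gt0.
have nN : n * (2 * N%:R) <= F x / 2.
  rewrite /n mulrAC ler_pdivrMr ?mulr_gt0 //; move: (F4); gnra.
(* The second bound makes 2e smaller than n r^2, so the minimum cannot lie on the sphere; the first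
   keeps the error in the Laplacian small against F x. *)
pose e := Num.min (F x / 8) (n * r ^+ 2 / 4).
have e0 : 0 < e by rewrite lt_min !divr_gt0 // mulr_gt0 // exprn_gt0.
have [|u [h1 h2]] := h x r r_0 _ e e0.
  by move=> y hy; apply: hG; exact: le_lt_trans hy rr1.
pose g y := u y + n * sqn (y - x).
have cq y : {for y, continuous (fun y => sqn (y - x))}.
  by apply: (@ct_lip _ _ _ (fun y => y - x) 1); [move=> z; rewrite mul1r opprB addrA subrK|exact: cont_sqn].
have [m mK mmin] : exists2 c, cball x r c & forall y, cball x r y -> g c <= g y.
  apply: compact_min; [by exists x; exact: cball_center (ltW r_0)|exact: compact_cball|].
  move=> y /h1 [cu _]; apply: ctD => //; apply: ctM; [exact: ctC|exact: cq].
have [ee1 ee2] : e <= F x / 8 /\ e <= n * r ^+ 2 / 4 by split; rewrite ge_min lexx ?orbT.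
have mr : enorm (m - x) < r.
  rewrite lt_neqAle mK andbT; apply/eqP => E.
  have := mmin x (cball_center x (ltW r_0)); rewrite /g subrr /sqn dot0l mulr0 addr0 -/(sqn _) -enorm2 E.
  have [_ b1] := h1 m mK; have [_ b2] := h1 x (cball_center x (ltW r_0)).
  have := mn m; rewrite E => /(_ rr0).
  move: b1 b2; rewrite !ler_norml => /andP [b1 _] /andP [_ b2] b3 b4.
  have : 0 < n * r ^+ 2 by rewrite mulr_gt0 // exprn_gt0.
  by clear -ee2 b1 b2 b3 b4; lra.
have [L [hL bL]] := h2 m mr.
have : 0 <= L + n * (2 * N%:R).
  apply: (@hlap_min _ _ g m); last by apply: hlapD => //; apply: hlapZ; exact: hlap_sqn.
  exists (r - enorm (m - x)); first by rewrite subr_gt0.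
  by move=> y hy; apply: mmin; rewrite /cball /=; have := enormBD y m x; move: (hy); glra.
have := hF m (lt_trans mr rr2).
move: bL; rewrite ler_norml ltr_norml => /andP [_ k1] /andP [k2 _] k3.
by clear -k1 k2 k3 nN ee1 Fx; lra.
Qed.

(** Boundary conditions are encoded by asking that a point of [K] where W < 0 be interior to [K] and
    to [G]; at a negative minimum over [K] this contradicts [locmin]. *)
Lemma minpr G K W F : open G -> wsol G W F -> compact K -> (forall y, K y -> {for y, continuous W}) ->
  (forall x, K x -> W x < 0 -> G x /\ (exists2 r, 0 < r & forall y, enorm (y - x) < r -> K y) /\
     {for x, continuous F} /\ 0 < F x) -> forall x, K x -> 0 <= W x.
Proof.
move=> oG h cK cW H x Kx; rewrite leNgt; apply/negP => Wx.
have [m Km mm] := compact_min (ex_intro _ x Kx) cK cW.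
have Wm : W m < 0 by apply: le_lt_trans (mm x Kx) Wx.
have [Gm [[r r0 hr] [cF]]] := H m Km Wm; rewrite ltNge => /negP; apply.
by apply: (locmin oG h Gm cF); exists r => // y /hr; exact: mm.
Qed.

(** A nonnegative source is made strictly positive by adding n (C - |y|^2), which is nonnegative on
    [K]. Wherever the sum is negative, W is negative too, so the hypotheses carry over to the
    sum. *)
Lemma minpr0 G K W F : (0 < N)%N -> open G -> wsol G W F -> compact K -> (forall y, K y -> {for y, continuous W}) ->
  (forall x, K x -> W x < 0 -> G x /\ (exists2 r, 0 < r & forall y, enorm (y - x) < r -> K y) /\
     {for x, continuous F} /\ 0 <= F x) -> forall x, K x -> 0 <= W x.
Proof.
move=> N0 oG h cK cW H x Kx; rewrite leNgt; apply/negP => Wx.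
have cS : forall y, K y -> {for y, continuous (@sqn R N)} by move=> y _; exact: cont_sqn.
have [m Km mm] := compact_max (ex_intro _ x Kx) cK cS.
have C0 := sqn_ge0 m; pose C := sqn m + 1.
have Cp : 0 < C by rewrite /C ltr_wpDl.
(* Chosen so that n C = - W x / 2: the perturbation cannot lift the negative value W x up to 0. *)
pose n := - W x / (2 * C).
have n0 : 0 < n by rewrite divr_gt0 ?oppr_gt0 // mulr_gt0.
have nC : n * C = - W x / 2 by rewrite /n; field; rewrite gt_eqF.
have cg y : {for y, continuous (fun y => n * (C - sqn (y - 0)))}.
  apply: ctM; first exact: ctC.
  apply: ctB; first exact: ctC.
  by rewrite (_ : (fun y => sqn (y - 0)) = @sqn R N); [exact: cont_sqn|apply/funext => z; rewrite subr0].
have wg : wsol G (fun y => n * (C - sqn (y - 0))) (fun=> n * (2 * N%:R)).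
  apply: wsol_hlap => y _; split; first exact: cg.
  rewrite (_ : - _ = n * (0 - 2 * N%:R)); last by ring.
  by apply: hlapZ; apply: hlapB; [exact: hlapC|exact: hlap_sqn].
have P := @minpr G K _ _ oG (wsolD h wg) cK _ _ x Kx.
have sK y : K y -> 0 <= n * (C - sqn (y - 0)).
  by move=> Ky; rewrite subr0 mulr_ge0 ?(ltW n0) // /C; have := mm y Ky; glra.
have H0 : 0 <= W x + n * (C - sqn (x - 0)) -> False.
  rewrite subr0 mulrBr nC; have := mulr_ge0 (ltW n0) (sqn_ge0 x); clear -Wx; lra.
apply/H0/P => [y Ky|y Ky hy]; first by apply: ctD; [exact: cW|exact: cg].
have [|Gy [hr [cF F0]]] := H y Ky; first by have := sK y Ky; move: (hy); glra.
split=> //; split=> //; split; first by apply: ctD => //; exact: ctC.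
by rewrite ltr_wpDl // mulr_gt0 // mulr_gt0 // ltr0n.
Qed.

Definition refl a (n : V) y : V := y - (2 * dot (y - a) n) *: n.
Definition reflM (n : V) : 'M[R]_N := 1%:M - 2 *: (n^T *m n).
Lemma mul_outer y (n : V) : y *m (n^T *m n) = dot y n *: n.
Proof.
rewrite mulmxA; have -> : y *m n^T = (dot y n)%:M :> 'M[R]_1.
  apply/matrixP => i j; rewrite !ord1 !mxE eqxx mulr1n; by apply: eq_bigr => k _; rewrite mxE.
by rewrite mul_scalar_mx.
Qed.
Lemma reflE a n y : refl a n y = y *m reflM n + (2 * dot a n) *: n.
Proof.
rewrite /refl /reflM mulmxBr mulmx1 -scalemxAr mul_outer dotBl mulrBr scalerBl opprB addrA.
by rewrite scalerA addrAC.
Qed.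
Lemma ortho_refl n : sqn n = 1 -> ortho (reflM n).
Proof.
move=> n1; rewrite /ortho /reflM; set M := n^T *m n.
have MT : M^T = M by rewrite /M trmx_mul trmxK.
have MM : M *m M = M.
  rewrite {2}/M mulmxA /M -(mulmxA n^T); have -> : n *m n^T = 1%:M :> 'M[R]_1.
    apply/matrixP => i j; rewrite !ord1 !mxE eqxx mulr1n -n1; by apply: eq_bigr => k _; rewrite mxE.
  by rewrite mulmx1.
clearbody M; have -> : (1%:M - 2 *: M)^T = 1%:M - 2 *: M.
  apply/matrixP => i j; rewrite !mxE eq_sym; congr (_ - _ * _).
  by have := congr1 (fun X : 'M[R]_N => X i j) MT; rewrite mxE.
rewrite mulmxBr mulmx1 mulmxBl mul1mx -scalemxAl -scalemxAr MM.
rewrite scalerA (_ : 2 * 2 = 2 + 2 :> R); last by ring.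
by apply/matrixP => i j; rewrite !mxE; ring.
Qed.
Lemma wsol_refl a n G W F : sqn n = 1 -> wsol G W F ->
  wsol [set y | G (refl a n y)] (fun y => W (refl a n y)) (fun y => F (refl a n y)).
Proof.
move=> n1 h; have := @wsol_isom (reflM n) ((2 * dot a n) *: n) G W F (ortho_refl n1) h.
have -> : refl a n = (fun y => y *m reflM n + (2 * dot a n) *: n) by apply/funext => y; rewrite reflE.
by [].
Qed.
Lemma refl_dist a n y z : sqn n = 1 -> enorm (refl a n y - refl a n z) = enorm (y - z).
Proof.
move=> n1; rewrite !reflE opprD addrACA subrr addr0 -mulmxBl ortho_norm //; exact: ortho_refl.
Qed.
Lemma refl_a a n : refl a n a = a.
Proof. by rewrite /refl subrr dot0l mulr0 scale0r subr0. Qed.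
Lemma refl_dot a n y : sqn n = 1 -> dot (refl a n y - a) n = - dot (y - a) n.
Proof. by rewrite /refl /sqn => n1; rewrite (addrAC y) (dotBl (y - a)) dotZl n1; ring. Qed.
Lemma reflK a n y : sqn n = 1 -> refl a n (refl a n y) = y.
Proof.
move=> n1; rewrite {1}/refl refl_dot // /refl mulrN scaleNr opprK subrK //.
Qed.
Lemma refl_fix a n y : dot (y - a) n = 0 -> refl a n y = y.
Proof. by rewrite /refl => ->; rewrite mulr0 scale0r subr0. Qed.
Lemma ct_refl a n W x : sqn n = 1 -> {for refl a n x, continuous W} -> {for x, continuous (fun y => W (refl a n y))}.
Proof. by move=> n1; apply: (@ct_lip _ _ _ _ 1) => y; rewrite refl_dist // mul1r. Qed.


(* Gradient bound: the odd part of [W] in a half ball lies below [A |y-a|^2 + B s - C s^2]. *)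
Lemma grad_half a n G W F M B d : (0 < N)%N -> open G -> wsol G W F -> sqn n = 1 -> 0 < d ->
  cball a d `<=` G -> (forall y, G y -> {for y, continuous W} /\ {for y, continuous F}) ->
  (forall y, cball a d y -> `|W y| <= M /\ `|F y| <= B) -> forall t, 0 <= t <= d ->
  W (a + t *: n) - W (a - t *: n) <= 2 * t * (N%:R * M / d + B * d / 2).
Proof.
move=> N0 oG h n1 d0 aG cWF bd t /andP [t0 td].
pose G' := G `&` [set y | G (refl a n y)].
have oG' : open G'.
  apply: openI => //; apply/openP => y Gy; have /openP /(_ _ Gy) [r r0 hr] := oG.
  by exists r => // z zr; apply: hr; rewrite refl_dist.
have M0 : 0 <= M by have [+ _] := bd a (cball_center a (ltW d0)); apply: le_trans.
have B0 : 0 <= B by have [_] := bd a (cball_center a (ltW d0)); apply: le_trans.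
have d2 : 0 < d ^+ 2 by rewrite exprn_gt0.
(* [A] makes psi >= M on the sphere |y - a| = d, and [C] gives - lap psi = - 2NA + 2C = B. Hence 2
   psi dominates the odd part, which is at most 2M, vanishes on the plane and has source at most
   2B. *)
pose A := M / d ^+ 2; pose C := N%:R * A + B / 2.
have A0 : 0 <= A by rewrite divr_ge0 // ltW.
have N1 : 1 <= N%:R :> R by rewrite ler1n.
have AC : A <= C by rewrite /C; have := ler_wpM2r A0 N1; rewrite mul1r; move: (B0); glra.
have C0 : 0 <= C by (move: (A0) (AC); glra).
pose s y := dot y n - dot a n.
have sE y : s y = dot (y - a) n by rewrite dotBl.
pose psi y := A * sqn (y - a) + (C * d * (dot y n - dot a n) - C * (dot y n - dot a n) ^+ 2).
have cs y : {for y, continuous s} by apply: ctB; [exact: cont_dot|exact: ctC].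
have cq y : {for y, continuous (fun y => sqn (y - a))}.
  by apply: (@ct_lip _ _ _ (fun y => y - a) 1); [move=> z; rewrite mul1r opprB addrA subrK|exact: cont_sqn].
have cpsi y : {for y, continuous psi}.
  apply: ctD; first by apply: ctM; [exact: ctC|exact: cq].
  apply: ctB; first by apply: ctM; [exact: ctC|exact: cs].
  by apply: ctM; [exact: ctC|exact: (ctM (cs y) (cs y))].
have wpsi : wsol G' psi (fun=> B).
  apply: wsol_hlap => y _; split => //.
  have -> : - B = A * (2 * N%:R) + (- 2 * C) * sqn n by rewrite n1 /C; field.
  apply: hlapD; first by apply: hlapZ; exact: hlap_sqn.
  apply: (@hlap_ridge R N (fun t => C * d * (t - dot a n) - C * (t - dot a n) ^+ 2) n y (C * d - 2 * C * (dot y n - dot a n))).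
  move=> e e0; exists 1 => // z _; rewrite (_ : _ - _ = 0); last by field.
  by rewrite normr0 mulr_ge0 ?(ltW e0) ?sqr_ge0.
have wphi : wsol G' (fun y => W y - W (refl a n y)) (fun y => F y - F (refl a n y)).
  apply: wsolB; first by apply: wsol_sub h => y [].
  by apply: wsol_sub (wsol_refl (a := a) n1 h) => y [].
have rb y : cball a d y -> cball a d (refl a n y) by move=> yb; rewrite /cball /= -[X in _ - X](refl_a a n) refl_dist.
have cR W' y : cball a d y -> (forall y, G y -> {for y, continuous W'}) -> {for y, continuous (fun y => W' y - W' (refl a n y))}.
  move=> yb cW'; apply: ctB; first exact/cW'/aG.
  by apply: ct_refl => //; exact/cW'/aG/rb.
pose K := cball a d `&` [set y | 0 <= s y].
have cK : compact K.
  apply: compact_closedI; first exact: compact_cball.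
  by apply: (@preimage_closed _ _ s [set x | 0 <= x]); [move=> y _; exact: cs|exact: closed_ge].
have sd y : cball a d y -> s y <= d.
  move=> yb; rewrite sE; apply: le_trans (CS1 _ _) _.
  by rewrite (_ : enorm n = 1) ?mulr1 // enormE n1 sqrtr1.
have P := @minpr0 G' K _ _ N0 oG' (wsolB (wsolZ 2 wpsi) wphi) cK _ _.
have Zt : 0 <= 2 * psi (a + t *: n) - (W (a + t *: n) - W (refl a n (a + t *: n))).
  apply: P => [y [yb _]|y [yb ys] Zy|].
  - by apply: ctB; [apply: ctM; [exact: ctC|exact: cpsi]|apply: cR => // z /cWF []].
  - have rby := rb y yb.
    have [Wy Fy] := bd y yb; have [Wr Fr] := bd _ rby.
    have q0 := mulr_ge0 A0 (sqn_ge0 (y - a)).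
    have q1 : C * d * s y - C * (s y) ^+ 2 = C * (s y * (d - s y)) by ring.
    have q2 : 0 <= C * (s y * (d - s y)).
      by rewrite mulr_ge0 // mulr_ge0 // subr_ge0 sd.
    have ys0 : 0 < s y.
      rewrite lt_neqAle ys andbT; apply/eqP => ys0; move: Zy.
      rewrite refl_fix -?sE // subrr subr0 /psi -/(s y) q1; move: (q0) (q2); glra.
    have yd : enorm (y - a) < d.
      rewrite lt_neqAle; apply/andP; split=> //; apply/eqP => yd; move: Zy.
      have : A * sqn (y - a) = M by rewrite -enorm2 yd /A divfK // gt_eqF.
      move: Wy Wr; rewrite !ler_norml /psi -/(s y) q1 => /andP [a1 a2] /andP [a3 a4] a5.
      clear -a1 a2 a3 a4 a5 q2; lra.
    split; first by split; [exact: aG|exact: aG].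
    split.
      have /contP /(_ _ ys0) [r r0 hr] := cs y.
      exists (Num.min r (d - enorm (y - a))); first by rewrite lt_min r0 subr_gt0.
      move=> z; rewrite lt_min => /andP [zr zd]; split.
        by rewrite /cball /=; have := enormBD z y a; move: (zd); glra.
      by have := hr z zr; rewrite /= ltr_norml; glra.
    split; first by apply: ctB; [exact: ctC|apply: cR => // z /cWF []].
    by move: Fy Fr; rewrite !ler_norml; glra.
  - have e1 : a + t *: n - a = t *: n by rewrite xhx.
    have nn : enorm n = 1 by rewrite enormE n1 sqrtr1.
    split; first by rewrite /cball /= e1 enormZ nn mulr1 ger0_norm.
    by rewrite /= sE e1 dotZl -/(sqn n) n1 mulr1.
move: Zt; rewrite /psi -/(s _) sE xhx dotZl -/(sqn n) n1 mulr1 /refl xhx dotZl -/(sqn n) n1 mulr1.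
rewrite (_ : a + t *: n - (2 * t) *: n = a - t *: n); last by apply/rowP => i; rewrite !mxE; ring.
rewrite /sqn dotZl dotZr -/(sqn n) n1 mulr1 => Zt.
have E : N%:R * M / d + B * d / 2 = C * d by rewrite /C /A; field; rewrite gt_eqF.
have := mulr_ge0 (mulr_ge0 t0 t0) (_ : 0 <= C - A).
rewrite E subr_ge0 => /(_ AC); move: (Zt); glra.
Qed.

Lemma grad_est a n G W F M B d : (0 < N)%N -> open G -> wsol G W F -> sqn n = 1 -> 0 < d ->
  cball a d `<=` G -> (forall y, G y -> {for y, continuous W} /\ {for y, continuous F}) ->
  (forall y, cball a d y -> `|W y| <= M /\ `|F y| <= B) -> forall t, 0 <= t <= d ->
  `|W (a + t *: n) - W (a - t *: n)| <= 2 * t * (N%:R * M / d + B * d / 2).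
Proof.
move=> N0 oG h n1 d0 aG cWF bd t td; rewrite ler_norml; apply/andP; split.
  rewrite lerNl opprB.
  have := grad_half N0 oG h (_ : sqn (- n) = 1) d0 aG cWF bd td.
  by rewrite scalerN opprK; apply; rewrite /sqn dotNl dotNr opprK.
exact: grad_half N0 oG h n1 d0 aG cWF bd t td.
Qed.

(** [grad_est] centred at the midpoint, in the direction of x - y, with t = |x - y| / 2. *)
Lemma lip_est x y G W F M B d : (0 < N)%N -> open G -> wsol G W F -> 0 < d ->
  cball (2^-1 *: (x + y)) d `<=` G -> (forall y, G y -> {for y, continuous W} /\ {for y, continuous F}) ->
  (forall z, cball (2^-1 *: (x + y)) d z -> `|W z| <= M /\ `|F z| <= B) -> enorm (x - y) <= 2 * d ->
  `|W x - W y| <= enorm (x - y) * (N%:R * M / d + B * d / 2).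
Proof.
move=> N0 oG h d0 aG cWF bd xy.
have [->|ne] := eqVneq x y; first by rewrite !subrr normr0 enorm0 mul0r.
have p : 0 < enorm (x - y) by rewrite enorm_gt0 // subr_eq0.
pose n := (enorm (x - y))^-1 *: (x - y).
have n1 : sqn n = 1 by rewrite -enorm2 enormZ gtr0_norm ?invr_gt0 // mulVf ?expr1n // gt_eqF.
have tn : (enorm (x - y) / 2) *: n = 2^-1 *: (x - y).
  by rewrite /n scalerA; congr (_ *: _); field; rewrite gt_eqF.
have h2 : (2^-1 + 2^-1 : R) = 1 by field.
have := grad_est N0 oG h n1 d0 aG cWF bd (t := enorm (x - y) / 2).
rewrite tn -scalerDr -scalerBr (_ : x + y + (x - y) = x + x); last by rewrite addrACA subrr addr0.
rewrite (_ : x + y - (x - y) = y + y); last by rewrite opprB addrC addrA subrK addrC.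
rewrite !scalerDr -!scalerDl h2 !scale1r (_ : 2 * (enorm (x - y) / 2) = enorm (x - y)); last by field.
by apply; apply/andP; split; move: (p) (xy); glra.
Qed.


Lemma hlap_exp k m a x : hlap (fun y => expR (k * sqn (y - a) + m)) x
  ((2 * N%:R * k + 4 * k ^+ 2 * sqn (x - a)) * expR (k * sqn (x - a) + m)).
Proof.
have := hlap_radial (peano_exp k m (sqn (x - a))).
by rewrite (_ : _ + _ = (2 * N%:R * k + 4 * k ^+ 2 * sqn (x - a)) * expR (k * sqn (x - a) + m)); [|ring].
Qed.
Lemma ct_sqnB a x : {for x, continuous (fun y => sqn (y - a))}.
Proof. by apply: (@ct_lip _ _ _ (fun y => y - a) 1); [move=> z; rewrite mul1r opprB addrA subrK|exact: cont_sqn]. Qed.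
Lemma ct_enB a x : {for x, continuous (fun y => enorm (y - a))}.
Proof. by apply: (@ct_lip _ _ _ (fun y => y - a) 1); [move=> z; rewrite mul1r opprB addrA subrK|exact: cont_enorm]. Qed.
Lemma ct_exp k m a x : {for x, continuous (fun y => expR (k * sqn (y - a) + m))}.
Proof.
apply: ct_comp; last exact: continuous_expR.
apply: ctD; last exact: ctC.
by apply: ctM; [exact: ctC|exact: ct_sqnB].
Qed.

(** Near y the function is at least D y / 2. In the remaining annulus it is compared with a multiple
    of exp(-al |z-y|^2) - exp(-al r^2), which vanishes on the outer sphere and is positive before
    it. *)
Lemma smp_ball y r G D F : (0 < N)%N -> open G -> wsol G D F -> cball y r `<=` G ->
  (forall z, G z -> {for z, continuous D} /\ {for z, continuous F}) ->
  (forall z, cball y r z -> 0 <= D z /\ 0 <= F z) -> 0 < D y -> forall x, enorm (x - y) < r -> 0 < D x.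
Proof.
move=> N0 oG h yG cDF pos Dy x xr.
have r0 : 0 < r by apply: le_lt_trans xr; exact: enorm_ge0.
have Gy : G y by apply: yG; exact: cball_center (ltW r0).
have [/contP cDy _] := cDF y Gy.
have D2 : 0 < D y / 2 by rewrite divr_gt0.
have [q0 q00 hq] := cDy _ D2.
pose q := Num.min q0 r / 2.
have q_0 : 0 < q by rewrite divr_gt0 // lt_min q00.
have [qq qr] : q < q0 /\ q < r.
  have : q < Num.min q0 r by rewrite ltr_pdivrMr //; move: q_0; rewrite /q; glra.
  by rewrite lt_min => /andP.
have Dq z : enorm (z - y) <= q -> D y / 2 <= D z.
  move=> zq; have := hq z (le_lt_trans zq qq); rewrite ltr_norml; glra.
have [xq|xq] := leP (enorm (x - y)) q; first by apply: lt_le_trans (Dq x xq).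
have nR : 0 < N%:R :> R by rewrite ltr0n.
have q2 : 0 < q ^+ 2 by rewrite exprn_gt0.
(* With this [al] the exponential is subharmonic for |z - y| >= q, since 4 al^2 |z-y|^2 >= 4 N al
   exceeds 2 N al. *)
pose al := N%:R / q ^+ 2; have al0 : 0 < al by rewrite divr_gt0.
pose E z := expR (- al * sqn (z - y) + 0).
pose h0 := expR (- al * r ^+ 2).
have E1 z : E z <= 1 by rewrite /E addr0 -expR0 ler_expR mulNr oppr_le0 mulr_ge0 ?sqn_ge0 // ltW.
pose c := D y / 2.
pose Z z := D z - c * (E z - h0).
have wZ : wsol G Z (fun z => F z - c * - ((2 * N%:R * - al + 4 * (- al) ^+ 2 * sqn (z - y)) * E z)).
  apply: wsolB => //; apply: wsolZ.
  apply: wsol_hlap => z _; split; first by apply: ctB; [exact: ct_exp|exact: ctC].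
  by rewrite opprK -[X in hlap _ _ X]subr0; apply: hlapB; [exact: hlap_exp|exact: hlapC].
pose K := cball y r `&` [set z | q <= enorm (z - y)].
have cK : compact K.
  apply: compact_closedI; first exact: compact_cball.
  by apply: (@preimage_closed _ _ (fun z => enorm (z - y)) [set x | q <= x]); [move=> z _; exact: ct_enB|exact: closed_ge].
have cE z : {for z, continuous E} by exact: ct_exp.
have Zx : 0 <= Z x.
  apply: (@minpr0 G K Z _ N0 oG wZ cK) => [z [/yG zG _]|z [zr zq] Zz|]; last by split; [exact: ltW|exact: ltW].
    apply: ctB; first exact: (cDF z zG).1.
    apply: ctM; first exact: ctC.
    by apply: ctB; [exact: cE|exact: ctC].
  have zG := yG z zr; have [Dz Fz] := pos z zr.
  have zq' : q < enorm (z - y).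
    rewrite lt_neqAle zq andbT; apply/eqP => qz; move: Zz.
    have := Dq z; rewrite -qz => /(_ (lexx _)).
    have : 0 < h0 by exact: expR_gt0.
    have := E1 z; rewrite /Z -/c => e1 e2 e3; have : 0 <= c * (1 - (E z - h0)) by rewrite mulr_ge0 ?(ltW D2) //; move: (e1) (e2); glra.
    by move: (e3); glra.
  have zr' : enorm (z - y) < r.
    rewrite lt_neqAle; apply/andP; split=> //; apply/eqP => rz; move: Zz.
    by rewrite /Z /E /h0 -enorm2 rz addr0 subrr mulr0 subr0; move: (Dz); glra.
  split=> //; split.
    exists (Num.min (enorm (z - y) - q) (r - enorm (z - y))); first by rewrite lt_min !subr_gt0 zq'.
    move=> w; rewrite lt_min => /andP [w1 w2]; split.
      by rewrite /cball /=; have := enormBD w z y; move: (w2); glra.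
    by rewrite /=; have := enormBD z w y; rewrite (enormB z w); move: (w1); glra.
  split.
    apply: ctB; first exact: (cDF z zG).2.
    apply: ctM; first exact: ctC.
    apply: ctN; apply: ctM; last exact: cE.
    apply: ctD; first exact: ctC.
    by apply: ctM; [exact: ctC|exact: ct_sqnB].
  have zs : q ^+ 2 <= sqn (z - y) by rewrite -enorm2 ler_pXn2r ?nnegrE ?enorm_ge0 // ltW.
  have : 0 <= 2 * N%:R * - al + 4 * (- al) ^+ 2 * sqn (z - y).
    have e1 : al * q ^+ 2 = N%:R by rewrite /al divfK // gt_eqF.
    have e2 : N%:R <= al * sqn (z - y) by rewrite -e1 ler_pM2l.
    rewrite sqrrN (_ : _ + _ = al * (4 * (al * sqn (z - y)) - 2 * N%:R)); last by ring.
    by rewrite mulr_ge0 ?(ltW al0) //; move: (nR) (e2); glra.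
  have : 0 <= E z by exact: expR_ge0.
  move=> e1 e2; rewrite mulrN opprK addr_ge0 // mulr_ge0 ?(ltW D2) // mulr_ge0 //.
move: Zx; rewrite /Z subr_ge0; apply: lt_le_trans; rewrite mulr_gt0 // subr_gt0 /E /h0 addr0 ltr_expR.
rewrite !mulNr ltrN2 ltr_pM2l // -enorm2 ltr_pXn2r ?nnegrE ?enorm_ge0 //; exact: ltW.
Qed.

Definition convexs G := forall x y t, G x -> G y -> 0 <= t <= 1 -> G ((1 - t) *: x + t *: y).

(** Positivity is carried from y to x by a chain of overlapping balls centred on the segment, all of
    the same radius. *)
Lemma smp G D F : (0 < N)%N -> open G -> convexs G -> wsol G D F ->
  (forall z, G z -> {for z, continuous D} /\ {for z, continuous F}) ->
  (forall z, G z -> 0 <= D z /\ 0 <= F z) -> forall y x, G y -> G x -> 0 < D y -> 0 < D x.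
Proof.
move=> N0 oG cvG h cDF pos y x Gy Gx Dy.
have [r1 r10 h1] := (openP G).1 oG y Gy; have [r2 r20 h2] := (openP G).1 oG x Gx.
pose r := Num.min r1 r2 / 2.
have r_0 : 0 < r by rewrite divr_gt0 // lt_min r10.
have [rr1 rr2] : r < r1 /\ r < r2.
  have : r < Num.min r1 r2 by rewrite ltr_pdivrMr //; move: r_0; rewrite /r; lra.
  by rewrite lt_min => /andP.
pose p t := (1 - t) *: y + t *: x.
(* By convexity, a ball around a point of the segment is a convex combination of equal balls around
   the two ends. *)
have pG t : 0 <= t <= 1 -> cball (p t) r `<=` G.
  move=> t01 z zr; have -> : z = (1 - t) *: (y + (z - p t)) + t *: (x + (z - p t)).
    by rewrite /p; apply/rowP => i; rewrite !mxE; ring.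
  by apply: cvG => //; [apply: h1|apply: h2]; rewrite xhx; exact: le_lt_trans zr _.
have [n hn] : exists n : nat, enorm (x - y) < r * n.+1%:R.
  exists (Num.truncn (enorm (x - y) / r)); rewrite mulrC -ltr_pdivrMr //.
  by apply: Num.Theory.truncnS_gt.
have n0 : 0 < n.+1%:R :> R by rewrite ltr0n.
have H (k : nat) : (k <= n.+1)%N -> 0 < D (p (k%:R / n.+1%:R)).
  elim: k => [|k IH] kn; first by rewrite mul0r /p subr0 scale1r scale0r addr0.
  have k01 : 0 <= (k%:R / n.+1%:R : R) <= 1.
    by rewrite divr_ge0 //= ler_pdivrMr // mul1r ler_nat ltnW.
  have s := pG _ k01.
  apply: (smp_ball N0 oG h s cDF (fun z zr => pos z (s z zr)) (IH (ltnW kn))).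
  rewrite (_ : p _ - p _ = n.+1%:R^-1 *: (x - y)); last first.
    by rewrite /p -[k.+1]addn1 natrD; apply/rowP => i; rewrite !mxE; ring.
  by rewrite enormZ gtr0_norm ?invr_gt0 // mulrC ltr_pdivrMr.
by have := H n.+1 (leqnn _); rewrite divff ?gt_eqF // /p subrr scale0r add0r scale1r.
Qed.

(** Comparison with A (1 - exp(N (1 - |z-a|^2/s^2))), which vanishes on the exterior ball of radius
    s, exceeds M at distance 2s, and has a source at least B in between. The bound is linear in t
    with a constant that is invariant under scaling, so smallness can be obtained at any scale. *)
Lemma barrier a s G W F M B : (0 < N)%N -> open G -> wsol G W F -> 0 < s -> 0 <= M -> 0 <= B ->
  (forall z, G z -> {for z, continuous F}) -> (forall z, {for z, continuous W}) ->
  (forall z, cball a (2 * s) z -> G z -> W z <= M /\ F z <= B) -> (forall z, ~ G z -> W z <= 0) ->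
  (forall z, enorm (z - a) < s -> ~ G z) ->
  forall y t, 0 <= t <= 1 -> enorm (y - a) <= s * (1 + t) -> W y <= 3 * N%:R * (2 * M + B * s ^+ 2 * expR (3 * N%:R)) * t.
Proof.
move=> N0 oG h s0 M0 B0 cF cW bd W0 ext y t /andP [t0 t1] yt.
have nR : 1 <= N%:R :> R by rewrite ler1n.
(* For |z - a| <= 2s the exponential is at least e^(-3N), whence the factor in front of B s^2; at |z
   - a| = 2s it is at most 1/2, whence 2M. *)
pose A := 2 * M + B * s ^+ 2 * expR (3 * N%:R).
have s2 : 0 < s ^+ 2 by rewrite exprn_gt0.
have e30 : 0 < expR (3 * N%:R : R) by exact: expR_gt0.
have Bs : 0 <= B * s ^+ 2 * expR (3 * N%:R) by rewrite !mulr_ge0 // ltW.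
have A0 : 0 <= A by rewrite /A; lra.
have AM : 2 * M <= A by rewrite /A; lra.
rewrite -/A.
have RHS0 : 0 <= 3 * N%:R * A * t by rewrite !mulr_ge0.
have [Gy|/W0 Gy] := pselect (G y); last exact: le_trans Gy RHS0.
pose k := - N%:R / s ^+ 2.
pose E z := expR (k * sqn (z - a) + N%:R).
pose H z := A * (1 - E z).
have ks z : k * sqn (z - a) + N%:R = - N%:R * (sqn (z - a) / s ^+ 2 - 1).
  by rewrite /k; field; rewrite gt_eqF.
have wZ : wsol G (fun z => H z - W z) (fun z => A * ((2 * N%:R * k + 4 * k ^+ 2 * sqn (z - a)) * E z) - F z).
  apply: wsolB => //; apply: wsolZ; apply: wsol_hlap => z _; split.
    by apply: ctB; [exact: ctC|exact: ct_exp].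
  by rewrite -[X in hlap _ _ X]sub0r; apply: hlapB; [exact: hlapC|exact: hlap_exp].
pose K := cball a (2 * s) `&` [set z | s <= enorm (z - a)].
have cK : compact K.
  apply: compact_closedI; first exact: compact_cball.
  by apply: (@preimage_closed _ _ (fun z => enorm (z - a)) [set x | s <= x]); [move=> z _; exact: ct_enB|exact: closed_ge].
have H0 z : s <= enorm (z - a) -> 0 <= H z.
  move=> zs; rewrite mulr_ge0 // subr_ge0 /E -[X in _ <= X]expR0 ler_expR ks mulNr oppr_le0 mulr_ge0 ?ler0n //.
  by rewrite subr_ge0 ler_pdivlMr // mul1r -enorm2 ler_pXn2r ?nnegrE ?enorm_ge0 // ltW.
have cH z : {for z, continuous H}.
  by apply: ctM; [exact: ctC|apply: ctB; [exact: ctC|exact: ct_exp]].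
(* A point of the open set G at distance exactly s could be moved slightly towards a without leaving
   G, into the excluded ball. *)
have Gs z : G z -> s < enorm (z - a).
  move=> Gz; rewrite ltNge; apply/negP => zs.
  have [r r0 hr] := (openP G).1 oG z Gz.
  have za : 0 < enorm (z - a).
    rewrite lt_neqAle enorm_ge0 andbT eq_sym; apply/eqP => za.
    by have := ext z; rewrite za => /(_ s0).
  pose e := Num.min (r / (2 * enorm (z - a))) (1 / 2).
  have e0 : 0 < e by rewrite lt_min !divr_gt0 // mulr_gt0.
  have [e1 e2] : e <= r / (2 * enorm (z - a)) /\ e <= 1 / 2 by split; rewrite ge_min lexx ?orbT.
  apply: (ext (z - e *: (z - a))).
    rewrite (_ : _ - _ = (1 - e) *: (z - a)); last by apply/rowP => i; rewrite !mxE; ring.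
    rewrite enormZ ger0_norm; last (move: (e2); glra).
    by apply: lt_le_trans zs; rewrite gtr_pMl //; move: (e0); glra.
  apply: hr; rewrite xhx enormN enormZ gtr0_norm //.
  move: e1; rewrite ler_pdivlMr ?mulr_gt0 //; have := mulr_gt0 e0 za; glra.
have Zp z : K z -> 0 <= H z - W z.
  apply: (@minpr0 G K _ _ N0 oG wZ cK) => [w _|w [wr ws] Zw]; first by apply: ctB.
  have Gw : G w.
    by apply: contrapT => /W0 Ww; have := H0 w ws; move: (Zw) (Ww); glra.
  have [WM FB] := bd w wr Gw.
  have ws' := Gs w Gw.
  have wq : sqn (w - a) <= 4 * s ^+ 2.
    rewrite (_ : 4 * s ^+ 2 = (2 * s) ^+ 2); last by ring.
    by rewrite -enorm2 ler_pXn2r ?nnegrE ?enorm_ge0 ?mulr_ge0 // ltW.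
  have wr' : enorm (w - a) < 2 * s.
    rewrite lt_neqAle; apply/andP; split=> //; apply/eqP => wE; move: Zw.
    have : E w <= 1 / 2.
      rewrite /E ks -enorm2 wE exprMn mulfK ?gt_eqF // mulNr expRN.
      rewrite div1r lef_pV2 ?posrE ?expR_gt0 //; have := expR_ge1Dx (N%:R * (2 ^+ 2 - 1) : R).
      by apply: le_trans; rewrite expr2; move: (nR); glra.
    move=> Ew; have : 0 <= A * (1 / 2 - E w) by rewrite mulr_ge0 // subr_ge0.
    by rewrite /H !mulrBr mulr1; clear -AM WM; lra.
  split=> //; split.
    exists (Num.min (enorm (w - a) - s) (2 * s - enorm (w - a))); first by rewrite lt_min !subr_gt0 ws'.
    move=> z'; rewrite lt_min => /andP [w1 w2]; split.
      by rewrite /cball /=; have := enormBD z' w a; move: (w2); glra.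
    by rewrite /=; have := enormBD w z' a; rewrite (enormB w z'); move: (w1); glra.
  split.
    apply: ctB; last exact: cF.
    apply: ctM; first exact: ctC.
    apply: ctM; last exact: ct_exp.
    apply: ctD; first exact: ctC.
    by apply: ctM; [exact: ctC|exact: ct_sqnB].
  rewrite subr_ge0; apply: le_trans FB _.
  have sq1 : s ^+ 2 <= sqn (w - a) by rewrite -enorm2 ler_pXn2r ?nnegrE ?enorm_ge0 // ltW.
  pose rho := sqn (w - a) / s ^+ 2.
  have r1 : 1 <= rho by rewrite ler_pdivlMr // mul1r.
  have r4 : rho <= 4 by rewrite ler_pdivrMr.
  have -> : 2 * N%:R * k + 4 * k ^+ 2 * sqn (w - a) = N%:R * (4 * (N%:R * rho) - 2 * N%:R) / s ^+ 2.
    by rewrite /k /rho; field; rewrite gt_eqF.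
  have p1 : 1 <= N%:R * (4 * (N%:R * rho) - 2 * N%:R).
    have : N%:R <= N%:R * rho by rewrite ler_peMr ?ler0n.
    move=> q1; have : 1 * 1 <= N%:R * (4 * (N%:R * rho) - 2 * N%:R); last by rewrite mulr1.
    by apply: ler_pM => //; move: (nR) (q1); glra.
  have p2 : expR (- (3 * N%:R)) <= E w.
    rewrite /E ks ler_expR mulNr lerN2 -/rho mulrC ler_wpM2r ?ler0n //; move: (r4); glra.
  have p3 : B * s ^+ 2 <= A * E w.
    apply: le_trans (ler_wpM2l A0 p2); rewrite expRN ler_pdivlMr // /A; move: (M0); glra.
  rewrite mulrCA -(ler_pM2r s2) mulrAC divfK ?gt_eqF //.
  apply: le_trans p3 _; by rewrite ler_peMl // mulr_ge0 // expR_ge0.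
have yK : K y.
  split; last exact: ltW (Gs y Gy).
  by apply: le_trans yt _; rewrite mulrC ler_pM2r //; move: (t1); glra.
have := Zp y yK; rewrite subr_ge0 => /le_trans; apply; rewrite /H.
rewrite (_ : 3 * N%:R * A * t = A * (N%:R * (3 * t))); last by ring.
rewrite ler_wpM2l // /E ks; have := expR_ge1Dx (- N%:R * (sqn (y - a) / s ^+ 2 - 1) : R).
have : sqn (y - a) / s ^+ 2 <= (1 + t) ^+ 2.
  rewrite ler_pdivrMr // -enorm2 -exprMn mulrC ler_pXn2r ?nnegrE ?enorm_ge0 // mulr_ge0 //; move: (s0) (t0); glra.
move=> q1 q2.
have q3 : sqn (y - a) / s ^+ 2 - 1 <= 3 * t by apply: le_trans (lerB q1 (lexx 1)) _; move: (t0) (t1); gnra.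
have : N%:R * (sqn (y - a) / s ^+ 2 - 1) <= N%:R * (3 * t) by rewrite ler_wpM2l.
move: (q2); glra.
Qed.
End Weak.

(** * The nonlinearity [t]_+^p and its abstract properties *)

Section Pp.
Context {R : realType}.
Implicit Types (p q s t : R).

Lemma pp_ge0 p t : 0 <= pp p t.
Proof. exact: powR_ge0. Qed.
Lemma pp_neg p t : p != 0 -> t <= 0 -> pp p t = 0.
Proof. by move=> p0 t0; rewrite /pp (max_idPr t0) powR0. Qed.
Lemma pp_pos p t : 0 <= t -> pp p t = powR t p.
Proof. by move=> t0; rewrite /pp (max_idPl t0). Qed.
Lemma pp_gt0 p t : 0 < t -> 0 < pp p t.
Proof. by move=> t0; rewrite pp_pos ?ltW // powR_gt0. Qed.
Lemma pp_mono p s t : 0 <= p -> s <= t -> pp p s <= pp p t.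
Proof.
move=> p0 st; have h : Num.max s 0 <= Num.max t 0 by rewrite ge_max !le_max st lexx !orbT.
by apply: ge0_ler_powR => //; rewrite nnegrE le_max lexx orbT.
Qed.
Lemma pp_small p e : 0 < p -> 0 < e -> exists2 r : R, 0 < r & forall t, t <= r -> pp p t <= e.
Proof.
move=> p0 e0; exists (powR e p^-1); first exact: powR_gt0.
move=> t tr; apply: le_trans (pp_mono (ltW p0) tr) _.
by rewrite pp_pos ?powR_ge0 // -powRrM mulVf ?gt_eqF // powRr1 // ltW.
Qed.
Lemma pp_split p t : 1 < p -> pp p t = Num.max t 0 * pp (p - 1) t.
Proof.
move=> p1; have [t0|t0] := leP t 0.
  by rewrite !pp_neg ?mul0r //; rewrite ?subr_eq0; [rewrite gt_eqF|rewrite gt_eqF //; lra].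
rewrite !pp_pos ?ltW // -[X in X * _]powRr1 ?ltW // -powRD; last by rewrite (gt_eqF t0) /= implybT.
by congr powR; ring.
Qed.
Lemma hd_pp p t : 1 < p -> hd (pp p) t (p * pp (p - 1) t).
Proof.
move=> p1; have [t0|t0|->] := ltgtP t 0.
- rewrite pp_neg ?mulr0; last by [rewrite ltW]; last by lra.
  apply: (@hd_ext _ (fun=> 0)); last exact: hdC.
  exists (- t); first by rewrite oppr_gt0.
  move=> y; rewrite ltr_norml => /andP [_ h]; rewrite pp_neg //; lra.
- rewrite pp_pos ?(ltW t0) //; apply: (@hd_ext _ (fun t => powR t p)); last exact: hd_powR.
  exists t => // y; rewrite ltr_norml => /andP [h _]; rewrite pp_pos //; lra.
- rewrite (@pp_neg (p - 1)) ?mulr0 //; last by lra.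
  move=> e e0; have [|r r0 hr] := @pp_small (p - 1) e _ e0; first lra.
  exists r => // h hr'; rewrite add0r mul0r subr0 (@pp_neg p 0) // ?subr0; last by lra.
  rewrite ger0_norm ?pp_ge0 // pp_split // mulrC.
  have hh : h <= `|h| by exact: ler_norm.
  apply: ler_pM; rewrite ?pp_ge0 ?le_max ?lexx ?orbT //.
    by apply: hr; lra.
  by rewrite ge_max hh normr_ge0.
Qed.
Lemma ct_pp p t : 1 < p -> {for t, continuous (pp p)}.
Proof. by move=> p1; exact: hd_ct (hd_pp t p1). Qed.
Lemma pp_lip p s t M : 1 < p -> s <= t <= M -> 0 <= M -> pp p t - pp p s <= p * powR M (p - 1) * (t - s).
Proof.
move=> p1 /andP [st tM] M0.
have := @mvt1 _ (pp p) (fun x => p * pp (p - 1) x) s t 0 (p * powR M (p - 1)).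
rewrite mul0r subr0 (ger0_norm (_ : 0 <= t - s)); last by rewrite subr_ge0.
move=> h; apply: le_trans (ler_norm _) (h _) => x.
rewrite (min_idPl st) (max_idPr st) => /andP [sx xt]; split; first exact: hd_pp.
have p0 : 0 <= p by lra.
rewrite subr0 ger0_norm ?mulr_ge0 ?pp_ge0 // ler_wpM2l // -(pp_pos (p - 1) M0) pp_mono //; move: (p1) (tM) (xt); glra.
Qed.

(** What moving planes and uniqueness ask of the nonlinearity. It is kept abstract because blow-up
    at a scale other than eps_n multiplies [fp p] by a constant. *)
Definition goodf (f : R -> R) := [/\ forall s t, s <= t -> f s <= f t, forall t, t <= 1 -> f t = 0,
  forall M, exists2 L, 0 < L & forall s t, s <= t <= M -> f t - f s <= L * (t - s) & continuous f].
Definition fp p (t : R) := pp p (t - 1).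
Lemma goodf_fp p : 1 < p -> goodf (fp p).
Proof.
move=> p1; split.
- by move=> s t st; apply: pp_mono; lra.
- by move=> t t1; apply: pp_neg; lra.
- move=> M; pose M' := `|M| + 1.
  have M'0 : 0 < M' by rewrite /M' ltr_wpDl.
  exists (p * powR M' (p - 1)); first by rewrite mulr_gt0 ?powR_gt0 //; lra.
  move=> s t /andP [st tM]; have := @pp_lip p (s - 1) (t - 1) M' p1.
  rewrite (_ : t - 1 - (s - 1) = t - s); last by ring.
  by apply; rewrite ?(ltW M'0) // lerD2r st /=; have := ler_norm M; rewrite /M'; lra.
- move=> t; apply: (@ct_comp _ _ (fun t => t - 1) (pp p) t); last exact: ct_pp.
  by apply: ctB; [exact: (fun x => x)|exact: ctC].
Qed.
Lemma goodf_ge0 f t : goodf f -> 0 <= f t.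
Proof.
move=> [mf zf _ _]; have [t1|t1] := leP t 1; first by rewrite zf.
by rewrite -(zf 1) // mf // ltW.
Qed.
End Pp.

Section Cover.
Context {R : realType} {N : nat}.
Notation V := 'rV[R]_N.

Implicit Types (x y z : V).

(** Upgrades a locally uniform eventual property to one that is uniform on a compact set, for an
    arbitrary filter: it serves both [\oo] and ultrafilters. *)
Lemma compact_near (K : set V) (I : Type) (F : set_system I) (P : I -> V -> Prop) : Filter F -> compact K ->
  (forall x, K x -> exists2 r : R, 0 < r & F [set i | forall y, enorm (y - x) < r -> P i y]) ->
  F [set i | forall x, K x -> P i x].
Proof.
move=> FF /compact_near_coveringP cK h.
apply: (cK I F P FF) => x Kx; have [r r0 Fr] := h x Kx.
exists ([set y | enorm (y - x) < r], [set i | forall y, enorm (y - x) < r -> P i y]) => /=.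
  by split => //; apply/nbhs_eballP; exists r.
by move=> [y i] /= [yr hi]; exact: hi.
Qed.

Lemma unif_cont (W : V -> R) K e : compact K -> (forall x, K x -> {for x, continuous W}) -> 0 < e ->
  exists2 d : R, 0 < d & forall x y, K x -> enorm (y - x) < d -> `|W y - W x| < e.
Proof.
move=> cK cW e0.
have [//|k _ hk] := @compact_near K nat \oo
  (fun k x => forall y, enorm (y - x) < (k.+1%:R)^-1 -> `|W y - W x| < e) _ cK _.
  move=> x Kx; have e2 : 0 < e / 2 by rewrite divr_gt0.
  have /contP /(_ _ e2) [r r0 hr] := cW x Kx.
  exists (r / 2); first by rewrite divr_gt0.
  have r2 : 0 < r / 2 by rewrite divr_gt0.
  have [k _ hk] := near_infty_natSinv_lt (PosNum r2).
  exists k => // j kj y yx z zy.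
  have /= hj := hk j kj.
  have h1 := hr y ltac:(lra).
  have h3 := lt_trans zy hj; have h2 := hr z ltac:(have := enormBD z y x; move: (yx) (h3); glra).
  rewrite (_ : _ - _ = (W z - W x) - (W y - W x)); last by ring.
  by apply: le_lt_trans (ler_normB _ _) _; move: (h1) (h2); glra.
exists (k.+1%:R)^-1; first by rewrite invr_gt0 ltr0n.
by move=> x y Kx; apply: (hk k (leqnn k) x Kx).
Qed.
End Cover.

(** * Moving planes in an abstract setting *)

Section MovingPlanes.
Context {R : realType} {N : nat}.
Notation V := 'rV[R]_N.
Variables (f : R -> R) (W : V -> R) (G Gc Q : set V) (n : V) (ls lu M : R).
Implicit Types (y z x : V) (l : R).
Let rf l y := refl (l *: n) n y.
Let D l y := W (rf l y) - W y.
Hypotheses (N0 : (0 < N)%N) (gf : goodf f) (n1 : sqn n = 1) (cW : continuous W) (oG : open G)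
  (wW : wsol G W (f \o W)) (oGc : open Gc) (cvGc : convexs Gc) (GcG : Gc `<=` G) (cQ : closed Q) (GcQ : Gc `<=` Q)
  (W0 : forall y, 0 <= W y) (WM : forall y, W y <= M)
  (dec : forall e, 0 < e -> exists r : R, forall y, Q y -> r < enorm y -> W y < e)
  (rfG : forall l y, ls < l -> l <= lu -> Gc y -> l < dot y n -> G (rf l y))
  (bdD : forall l y, ls < l -> l <= lu -> Q y -> ~ Gc y -> l < dot y n -> 0 < D l y).

(** The comparison is claimed on the closed set [Q]; the equation is exploited on the open convex
    part [Gc], and on the rest of [Q] strict positivity is supplied by [bdD]. Three instances occur:
    the whole space, a half-space [Gc] inside [Q = setT], and a small open ball inside its
    closure. *)
Definition mp_good l := forall y, Q y -> l <= dot y n -> 0 <= D l y.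

Let dln l y : dot (y - l *: n) n = dot y n - l.
Proof. by rewrite dotBl dotZl -/(sqn n) n1 mulr1. Qed.
Let rf_fix l y : dot y n = l -> rf l y = y.
Proof. by move=> h; apply: refl_fix; rewrite dln h subrr. Qed.
Let rf_diff l l' y : rf l y - rf l' y = (2 * (l - l')) *: n.
Proof. by rewrite /rf /refl !dln; apply/rowP => i; rewrite !mxE; ring. Qed.
Let en1 : enorm n = 1.
Proof. by rewrite enormE n1 sqrtr1. Qed.
Let cD l y : {for y, continuous (D l)}.
Proof. by apply: ctB; [apply: ct_refl => //|]; exact: cW. Qed.
Let cf x : {for x, continuous (f \o W)}.
Proof. by apply: (@ct_comp _ _ W f); [exact: cW|case: gf => _ _ _ h; exact: h]. Qed.

Let cap l := Gc `&` [set y | l < dot y n].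
Let ocap l : open (cap l).
Proof.
apply: openI => //; apply: (@open_comp _ _ (fun y => dot y n) [set t | l < t]); last exact: open_gt.
by move=> y _; exact: cont_dot.
Qed.
Let wD l : ls < l -> l <= lu -> wsol (cap l) (D l) (fun y => f (W (rf l y)) - f (W y)).
Proof.
move=> ll lv; apply: wsolB; last by apply: wsol_sub wW => y [/GcG].
by refine (@wsol_sub _ _ _ (cap l) _ _ _ (@wsol_refl R N (l *: n) n G W _ n1 wW)) => y [Gy ly]; exact: rfG.
Qed.

(** For a plane slightly lower than [l0], consider a negative minimum of D/psi with psi = 2 - exp(-a
    s), s the distance to the plane. Near the plane the source a^2 exp(-a s) of psi beats the
    Lipschitz constant of f, far out f vanishes because W < 1, and on the compact remainder D stays
    positive by uniform continuity. *)
Lemma mp_step l0 : l0 <= lu -> (forall y, Q y -> l0 < dot y n -> 0 < D l0 y) ->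
  exists2 eta, 0 < eta & forall l, ls < l -> l0 - eta <= l <= l0 -> mp_good l.
Proof.
move=> l0u Dpos; have [fm fz fL fc] := gf; have [L L0 hL] := fL M.
(* Then a^2 exp(-a s) > 2L in the strip s < 1/a, where psi < 2. *)
pose a := 2 * L * expR 1 + 1.
have e1 : 0 < expR 1 :> R by exact: expR_gt0.
have a1 : 1 < a by rewrite /a ltrDr !mulr_gt0.
have a0 : 0 < a by lra.
have aL (z : R) : z < a^-1 -> 2 * L < a ^+ 2 * expR (- a * z).
  move=> za; have h : expR (- 1) < expR (- a * z).
    by rewrite ltr_expR mulNr ltrN2 mulrC -ltr_pdivlMr // div1r.
  have h2 : a * expR (-1) < a ^+ 2 * expR (- a * z).
    rewrite expr2 -mulrA ltr_pM2l //; apply: lt_le_trans h _; rewrite ler_peMl ?expR_ge0 //; exact: ltW.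
  apply: lt_trans h2; rewrite expRN ltr_pdivlMr //.
  by rewrite /a ltrDl.
pose h := a^-1 / 2; have h0 : 0 < h by rewrite divr_gt0 // invr_gt0.
have [rho hrho] := dec (ltr01 : 0 < 1 :> R).
pose K := (cball 0 rho `&` Q) `&` [set y | l0 + h <= dot y n].
have cK : compact K.
  apply: compact_closedI; first by apply: compact_closedI => //; exact: compact_cball.
  by apply: (@preimage_closed _ _ (fun y => dot y n) [set t | l0 + h <= t]); [move=> y _; exact: cont_dot|exact: closed_ge].
have [eta eta0 hK] : exists2 eta, 0 < eta & forall l y, l0 - eta <= l <= l0 -> K y -> 0 < D l y.
  have [[y0 Ky0]|K0] := pselect (K !=set0); last first.
    by exists 1 => // l y _ Ky; exfalso; apply: K0; exists y.
  have [m Km hm] := compact_min (ex_intro _ y0 Ky0) cK (fun y _ => @cD l0 y).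
  have Dm : 0 < D l0 m by case: Km => [[_ Qm] dm]; apply: Dpos => //; apply: lt_le_trans dm; rewrite ltrDl.
  have [d d0 hd] := unif_cont (@compact_cball R N 0 (rho + 2 * (rho + `|l0|))) (fun y _ => @cW y) Dm.
  exists (d / 4); first by rewrite divr_gt0.
  move=> l y /andP [l1 l2] Ky; have [[yr Qy] dy] := Ky.
  have yrho : enorm y <= rho by move: yr; rewrite /cball /= subr0.
  have := hd (rf l0 y) (rf l y); rewrite rf_diff enormZ en1 mulr1.
  have -> : `|2 * (l - l0)| = 2 * (l0 - l).
    by rewrite normrM (ger0_norm (_ : 0 <= 2 :> R)) // distrC ger0_norm // subr_ge0.
  have q1 : cball 0 (rho + 2 * (rho + `|l0|)) (rf l0 y).
    rewrite /cball /= subr0 /rf /refl dln; apply: le_trans (enormD _ _) _.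
    rewrite enormN enormZ en1 mulr1; apply: lerD => //.
    rewrite normrM (ger0_norm (_ : 0 <= 2 :> R)) // ler_pM2l //.
    apply: le_trans (ler_normB _ _) _; apply: lerD => //.
    by have := CS y n; rewrite en1 mulr1 => /le_trans; apply.
  move=> /(_ q1); have -> : 2 * (l0 - l) < d by (move: (d0) (l1); glra).
  move=> /(_ isT); rewrite ltr_norml => /andP [q2 _].
  by have := hm y Ky; rewrite /D in q2 *; move: (q2); glra.
exists (Num.min eta h); first by rewrite lt_min eta0.
move=> l ll /andP [l1 l2] y0 Qy0 ly0; rewrite leNgt; apply/negP => Dy0.
have llu : l <= lu by exact: le_trans l2 l0u.
have [et1 et2] : Num.min eta h <= eta /\ Num.min eta h <= h by split; rewrite ge_min lexx ?orbT.
pose E y := expR (- a * (dot y n - l)).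
pose psi y := 2 - E y.
have E01 y : l <= dot y n -> 0 < E y <= 1.
  move=> ly; rewrite expR_gt0 /= /E -[X in _ <= X]expR0 ler_expR mulNr oppr_le0 mulr_ge0 ?(ltW a0) //.
  by rewrite subr_ge0.
have cE y : {for y, continuous E}.
  apply: (ct_comp (f := fun y => - a * (dot y n - l))); last exact: continuous_expR.
  apply: ctM; first exact: ctC.
  by apply: ctB; [exact: cont_dot|exact: ctC].
have cpsi y : {for y, continuous psi} by apply: ctB; [exact: ctC|exact: cE].
(* As psi < 2, the ratio D/psi at [y0] is at most - e. Outside a large ball W < e, so D >= - e and
   the minimum over the compact part is a global one. *)
pose e := - D l y0 / 2; have e0 : 0 < e by rewrite divr_gt0 // oppr_gt0.
have [r hr] := dec e0.
pose K' := (cball 0 (Num.max r (enorm y0)) `&` Q) `&` [set y | l <= dot y n].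
have cK' : compact K'.
  apply: compact_closedI; first by apply: compact_closedI => //; exact: compact_cball.
  by apply: (@preimage_closed _ _ (fun y => dot y n) [set t | l <= t]); [move=> y _; exact: cont_dot|exact: closed_ge].
have K'y0 : K' y0 by split => //; split=> //; rewrite /cball /= subr0 le_max lexx orbT.
have psi1 y : l <= dot y n -> 1 <= psi y < 2 by move=> /E01 /andP [? ?]; rewrite /psi; apply/andP; split; lra.
have crat y : K' y -> {for y, continuous (fun y => D l y * (psi y)^-1)}.
  move=> [_ /psi1 /andP [p1 _]]; apply: ctM; first exact: cD.
  by apply: ctV; [rewrite gt_eqF //; move: (p1); glra|exact: cpsi].
have [x [[xr Qx] lx] xm] := compact_min (ex_intro _ y0 K'y0) cK' crat.
(* D + T psi is nonnegative on the closed half-space and touches 0 at [x], where [locmin] will be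
   contradicted. *)
pose T := - (D l x / psi x).
have /andP [px1 px2] := psi1 x lx.
have /andP [py1 py2] := psi1 y0 ly0.
have eT : e <= T.
  have := xm y0 K'y0; rewrite /T => q; have : e <= - (D l y0 / psi y0); last by (move: (q); glra).
  have P2 : 2^-1 <= (psi y0)^-1 by rewrite lef_pV2 ?posrE ?(ltW py2) //; move: (py1); glra.
  have := ler_wpM2l (_ : 0 <= - D l y0) P2; rewrite oppr_ge0 (ltW Dy0) /e => /(_ isT); glra.
have T0 : 0 < T by (move: (e0) (eT); glra).
have Tp : 0 < T * psi x by rewrite mulr_gt0 // (lt_le_trans ltr01 px1).
have DxT : D l x = - T * psi x by rewrite /T opprK divfK // gt_eqF //; move: (px1); glra.
have Zge y : Q y -> l <= dot y n -> 0 <= D l y + T * psi y.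
  move=> Qy ly; have /andP [p1 p2] := psi1 y ly.
  have [yr|yr] := leP (enorm y) (Num.max r (enorm y0)).
    have := xm y; rewrite /K' /= /cball /= subr0 => /(_ (conj (conj yr Qy) ly)) q.
    have q2 : - T <= D l y / psi y by rewrite /T opprK.
    rewrite ler_pdivlMr in q2; [move: (q2); glra|move: (p1); glra].
  have := hr y Qy; rewrite (le_lt_trans _ yr) ?le_max ?lexx // => /(_ isT) We.
  have := W0 (rf l y); have : T * 1 <= T * psi y by rewrite ler_pM2l.
  by rewrite /D; move: (eT) (We); glra.
have Zx : D l x + T * psi x = 0 by rewrite DxT; ring.
have lx' : l < dot x n.
  rewrite lt_neqAle lx andbT; apply/eqP => E'; move: DxT; rewrite /D rf_fix // subrr mulNr => E2.
  by move: Tp; rewrite -oppr_lt0 -E2 ltxx.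
have Gx : Gc x.
  by apply: contrapT => nG; have := bdD ll llu Qx nG lx'; rewrite DxT mulNr oppr_gt0 ltNge (ltW Tp).
have wpsi : wsol (cap l) psi (fun y => a ^+ 2 * E y).
  apply: wsol_hlap => y _; split => //.
  rewrite -sub0r; apply: hlapB; first exact: hlapC.
  have := @hlap_ridge R N _ n y _ _ (peano_exp (- a) (a * l) (dot y n)).
  rewrite n1 mulr1 sqrrN.
  have EE z : expR (- a * dot z n + a * l) = E z by rewrite /E; congr expR; ring.
  by rewrite EE; rewrite (_ : (fun y => _) = E) //; apply/funext => z; rewrite EE.
have := @locmin R N (cap l) _ _ x (@ocap l) (wsolD (wD ll llu) (wsolZ T wpsi)) (conj Gx lx').
have cF : {for x, continuous (fun y => f (W (rf l y)) - f (W y) + T * (a ^+ 2 * E y))}.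
  apply: ctD; last by apply: ctM; [exact: ctC|apply: ctM; [exact: ctC|exact: cE]].
  by apply: ctB; [apply: (@ct_refl _ _ _ _ (f \o W)) => //|]; exact: cf.
have loc : exists2 r : R, 0 < r & forall y, enorm (y - x) < r -> D l x + T * psi x <= D l y + T * psi y.
  have [r' r'0 hr'] := (openP (cap l)).1 (@ocap l) x (conj Gx lx').
  by exists r' => // y /hr' [Gy ly]; rewrite Zx; apply: Zge; [exact: GcQ|exact: ltW].
move=> /(_ cF loc); apply/negP; rewrite -ltNge.
have /andP [Ex0 _] := E01 x lx.
have TE : 0 < T * (a ^+ 2 * E x) by rewrite !mulr_gt0 // exprn_gt0.
have Wlt : W (rf l x) <= W x.
  by have := DxT; rewrite /D; move: (Tp); glra.
(* In the narrow strip: f(W x) - f(W(rf x)) <= L T psi <= 2 L T < T a^2 E. *)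
have [xs|xs] := ltP (dot x n - l) a^-1.
  have := hL (W (rf l x)) (W x); rewrite Wlt WM => /(_ isT).
  have -> : W x - W (rf l x) = T * psi x by have := DxT; rewrite /D; glra.
  have q1 : L * (T * psi x) <= 2 * L * T.
    by rewrite (_ : 2 * L * T = L * (T * 2)); [rewrite !ler_pM2l //; exact: ltW|ring].
  have q2 : 2 * L * T < T * (a ^+ 2 * E x) by rewrite mulrC ltr_pM2l // /E aL.
  by move: (q1) (q2); glra.
have dx : l0 + h <= dot x n.
  have hh : h + h = a^-1 by rewrite /h -splitr.
  by move: xs l1 et2; rewrite -hh; move: (Num.min eta h) => mm; glra.
have [xrho|xrho] := leP (enorm x) rho.
  have : 0 < D l x.
    by apply: hK; [apply/andP; split=> //; move: (l1) (et1); glra|split=> //; split=> //; rewrite /cball /= subr0].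
  by rewrite DxT mulNr oppr_gt0 => /lt_trans /(_ Tp); rewrite ltxx.
(* Outside radius [rho] both W x and the smaller value at the reflected point are below 1, so the
   two values of f vanish. *)
have Wx1 := hrho x Qx xrho.
by rewrite !fz ?subrr ?add0r // ?(ltW Wx1) //; apply: le_trans Wlt (ltW Wx1).
Qed.

(** When D >= 0, monotonicity of f makes D superharmonic on the convex cap, and [smp] spreads a zero
    to the whole cap. *)
Lemma mp_zero l y : ls < l -> l <= lu -> mp_good l -> Gc y -> l < dot y n -> D l y = 0 ->
  forall z, Gc z -> l < dot z n -> D l z = 0.
Proof.
move=> l00 llu g0 Gy ly D0 z Gz lz; apply/eqP; rewrite eq_le (g0 _ (GcQ Gz) (ltW lz)) andbT leNgt; apply/negP => Dz.
have [fm _ _ _] := gf.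
have cvcap : convexs (cap l).
  move=> u w t [Gu lu1] [Gw lw] /andP [t0 t1]; split; first by apply: cvGc => //; rewrite t0.
  rewrite /= dotDl !dotZl; move: lu1 lw; rewrite /= -subr_gt0 -(subr_gt0 l (dot w n)) => lu1 lw.
  rewrite -subr_gt0 (_ : _ - _ = (1 - t) * (dot u n - l) + t * (dot w n - l)); last by ring.
  have [h|h] := leP t (1 / 2).
    by apply: ltr_pwDl; [rewrite mulr_gt0 //; move: (h); glra|rewrite mulr_ge0 // ltW].
  by apply: ltr_wpDl; [rewrite mulr_ge0 ?(ltW lu1) //; move: (t1); glra|rewrite mulr_gt0 //; move: (h); glra].
suff : 0 < D l y by rewrite D0 ltxx.
apply: (smp N0 (@ocap l) cvcap (wD l00 llu) _ _ (conj Gz lz) (conj Gy ly) Dz) => x [Gx lx]; split.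
- exact: cD.
- by apply: ctB; [apply: (@ct_refl _ _ _ _ (f \o W)) => //|]; exact: cf.
- by apply: g0; [exact: GcQ|exact: ltW].
- by rewrite subr_ge0 fm // -subr_ge0; apply: g0; [exact: GcQ|exact: ltW].
Qed.

(** The infimum [l0] of the good positions is itself good by continuity. If D were positive
    everywhere beyond it, [mp_step] would lower it; so D has a zero there, necessarily in [Gc], and
    [mp_zero] applies. *)
Lemma mp_alt : ls < lu -> (forall l, lu <= l -> mp_good l) ->
  (forall l, ls < l -> mp_good l) \/
  exists l0, (ls < l0 /\ l0 <= lu) /\ (forall l, l0 <= l -> mp_good l) /\
    (forall z, Gc z -> l0 < dot z n -> D l0 z = 0) /\ exists2 z, Gc z & l0 < dot z n.
Proof.
move=> ll1 h1; have [?|/existsNP [lb /not_implyP [llb nb]]] := pselect (forall l, ls < l -> mp_good l); first by left.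
right; pose S := [set l | ls < l /\ forall l', l <= l' -> mp_good l'].
have Sl1 : S lu by [].
have lbS : lbound S lb.
  by move=> l [_ hl]; rewrite leNgt; apply/negP => /ltW /hl.
have hi : has_inf S by split; [exists lu|exists lb].
pose l0 := inf S.
have l0b : lb <= l0 by apply: lb_le_inf => //; exists lu.
have l0u : l0 <= lu by exact: (inf_lbound hi.2).
have l00 : ls < l0 by exact: lt_le_trans l0b.
have gt0 l : l0 < l -> mp_good l.
  by move=> ll; have [s [_ hs] sl] := inf_lt hi.1 ll; apply: hs; exact: ltW.
have g0 : mp_good l0.
  move=> y Qy ly; have [E|ne] := eqVneq (dot y n) l0; first by rewrite /D rf_fix // subrr.
  have ly' : l0 < dot y n by rewrite lt_neqAle eq_sym ne.
  rewrite leNgt; apply/negP => Dy.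
  have Dy2 : 0 < - D l0 y by rewrite oppr_gt0.
  have /contP /(_ _ Dy2) [r r0 hr] := cW (x := rf l0 y).
  pose l := Num.min (dot y n) (l0 + r / 4).
  have ll : l0 < l by rewrite lt_min ly' ltrDl divr_gt0.
  have := gt0 l ll y Qy; rewrite ge_min lexx => /(_ isT).
  have := hr (rf l y); rewrite rf_diff enormZ en1 mulr1 ger0_norm; last by rewrite mulr_ge0 // subr_ge0 ltW.
  have : l <= l0 + r / 4 by rewrite ge_min lexx orbT.
  move=> q1; have -> : 2 * (l - l0) < r by (move: (ll) (q1); glra).
  by move=> /(_ isT); rewrite ltr_norml /D => /andP [_]; glra.
have gall l : l0 <= l -> mp_good l.
  by rewrite le_eqVlt => /predU1P [<-//|]; exact: gt0.
exists l0; split=> //; split=> //.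
have [y [Qy [ly Dy]]] : exists y, Q y /\ l0 < dot y n /\ D l0 y <= 0.
  apply: contrapT => nex; have [|eta eta0 he] := @mp_step l0 l0u.
    by move=> y Qy ly; rewrite ltNge; apply/negP => Dy; apply: nex; exists y.
  pose l := Num.max (l0 - eta) ((ls + l0) / 2).
  have ll0 : l < l0 by rewrite gt_max gtrBl eta0 /=; lra.
  have lsl : ls < l by rewrite lt_max; apply/orP; right; lra.
  have el : l0 - eta <= l by rewrite le_max lexx.
  have : S l.
    split=> // l' ll'; have [l'0|l'0] := leP l' l0; last exact: gt0.
    by apply: he; [exact: lt_le_trans ll'|rewrite l'0 (le_trans el)].
  by move=> /(inf_lbound hi.2); rewrite leNgt -/l0 ll0.
have D0 : D l0 y = 0 by apply/eqP; rewrite eq_le Dy g0 // ltW.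
have Gy : Gc y by apply: contrapT => ng; have := bdD l00 l0u Qy ng ly; rewrite D0 ltxx.
split; last by exists y.
exact: mp_zero l00 l0u g0 Gy ly D0.
Qed.
End MovingPlanes.

(** * Symmetry and classification of entire solutions, nonexistence in half-spaces *)

Section Entire.
Context {R : realType} {N : nat}.
Notation V := 'rV[R]_N.
Implicit Types (W : V -> R) (f : R -> R) (x y z n m : V).

Definition dec0 W := forall e, 0 < e -> exists r : R, forall y, r < enorm y -> W y < e.

Lemma dec0_bd W : continuous W -> dec0 W -> exists M, forall y, W y <= M.
Proof.
move=> cW dW; have [r hr] := dW 1 ltr01.
have K0 : cball (0 : V) (`|r|) !=set0 by exists 0; exact: cball_center.
have [m _ hm] := compact_max K0 (@compact_cball R N 0 `|r|) (fun y _ => cW y).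
exists (Num.max 1 (W m)) => y; rewrite le_max; have [yr|yr] := leP (enorm y) `|r|.
  by rewrite hm ?orbT // /cball /= subr0.
by rewrite (ltW (hr y (le_lt_trans (ler_norm r) yr))).
Qed.

Lemma dec0_max W x0 : continuous W -> dec0 W -> 0 < W x0 -> exists m, forall y, W y <= W m.
Proof.
move=> cW dW p; have [r hr] := dW _ p.
have K0 : cball (0 : V) (Num.max r (enorm x0)) !=set0 by exists x0; rewrite /cball /= subr0 le_max lexx orbT.
have [m _ hm] := compact_max K0 (@compact_cball R N 0 _) (fun y _ => cW y).
exists m => y; have [yr|yr] := leP (enorm y) (Num.max r (enorm x0)).
  by apply: hm; rewrite /cball /= subr0.
have : W x0 <= W m by apply: hm; rewrite /cball /= subr0 le_max lexx orbT.
by apply: le_trans; apply/ltW/hr; apply: le_lt_trans yr; rewrite le_max lexx.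
Qed.

Lemma sqn1_enorm n : sqn n = 1 -> enorm n = 1.
Proof. by move=> n1; rewrite enormE n1 sqrtr1. Qed.
Lemma dot_le y n : sqn n = 1 -> `|dot y n| <= enorm y.
Proof. by move=> /sqn1_enorm h; have := CS y n; rewrite h mulr1. Qed.
Lemma refl_dotl l n y : sqn n = 1 -> dot (refl (l *: n) n y) n = 2 * l - dot y n.
Proof.
move=> n1; have := refl_dot (l *: n) y n1.
rewrite !(dotBl _ (l *: n)) dotZl -/(sqn n) n1; lra.
Qed.

Lemma refl_l l n y : sqn n = 1 -> refl (l *: n) n y = y - (2 * (dot y n - l)) *: n.
Proof. by move=> n1; rewrite /refl dotBl dotZl -/(sqn n) n1 mulr1. Qed.

Section Dir.
Variables (f : R -> R) (W : V -> R) (n : V).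
Hypotheses (N0 : (0 < N)%N) (gf : goodf f) (n1 : sqn n = 1) (cW : continuous W) (W0 : forall y, 0 <= W y) (dW : dec0 W).

(** Reflection in a very low plane throws [x0] out to where W is smaller than W x0, so such a plane
    cannot be good. *)
Let good_bad l x0 : mp_good W setT n l -> l <= dot x0 n -> forall r, (forall y, r < enorm y -> W y < W x0) ->
   r < dot x0 n - 2 * l -> False.
Proof.
move=> g lx r hr rl; have := g x0 I lx; apply/negP; rewrite -ltNge subr_lt0; apply: hr.
have := dot_le (refl (l *: n) n x0) n1; rewrite refl_dotl //; apply: lt_le_trans.
apply: lt_le_trans rl _; rewrite -normrN opprB; exact: ler_norm.
Qed.

(** Planes coming from infinity must stop by [good_bad], which yields a plane of symmetry l0. If the
    maximum were not on it, an intermediate plane would be a second plane of symmetry, W would be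
    periodic along n, and decay would fail. *)
Lemma entire_sym : wsol setT W (f \o W) -> (exists x0, 0 < W x0) -> forall m, (forall y, W y <= W m) ->
  forall y, W (refl m n y) = W y.
Proof.
move=> wW [x0 px0] m mm.
have pm : 0 < W m by exact: lt_le_trans (mm x0).
have [fm fz fL fc] := gf.
have [M WM] := dec0_bd cW dW.
have cf x : {for x, continuous (f \o W)} by apply: (@ct_comp _ _ W f); [exact: cW|exact: fc].
have pm1 : 0 < Num.min 1 (W m) by rewrite lt_min ltr01.
have [r1 hr1] := @dW _ pm1.
have [rm hrm] := dW pm.
pose lu := Num.max r1 (dot m n) + 1.
(* Low enough that the plane at [ls + 1] violates [good_bad] for the maximum point m. *)
pose ls := Num.min (Num.min lu (dot m n - 1)) ((dot m n - rm) / 2 - 2) - 1.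
have [a1 [a2 a3]] : ls < lu /\ ls <= dot m n - 2 /\ ls <= (dot m n - rm) / 2 - 3.
  have b1 : Num.min (Num.min lu (dot m n - 1)) ((dot m n - rm) / 2 - 2) <= lu by rewrite !ge_min lexx.
  have b2 : Num.min (Num.min lu (dot m n - 1)) ((dot m n - rm) / 2 - 2) <= dot m n - 1 by rewrite !ge_min lexx orbT.
  have b3 : Num.min (Num.min lu (dot m n - 1)) ((dot m n - rm) / 2 - 2) <= (dot m n - rm) / 2 - 2 by rewrite !ge_min lexx !orbT.
  by rewrite /ls; lra.
have nbig y l : l <= dot y n -> l <= enorm y.
  by move=> h; apply: le_trans (le_trans h (ler_norm _)) (dot_le y n1).
(* Beyond such a plane W < 1, so f(W) = 0 and the difference has a nonnegative source; decay reduces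
   the maximum principle to a ball. *)
have start l : lu <= l -> mp_good W setT n l.
  move=> ll y0 _ ly0; rewrite leNgt; apply/negP => Dy0.
  pose D y := W (refl (l *: n) n y) - W y.
  pose e := - D y0 / 2.
  have e0 : 0 < e by rewrite divr_gt0 // oppr_gt0.
  have [r hr] := dW e0.
  pose K := cball 0 (Num.max r (enorm y0) + 1) `&` [set y | l <= dot y n].
  have cK : compact K.
    apply: compact_closedI; first exact: compact_cball.
    by apply: (@preimage_closed _ _ (fun y => dot y n) [set t | l <= t]); [move=> y _; exact: cont_dot|exact: closed_ge].
  have cD y : {for y, continuous D} by apply: ctB; [apply: ct_refl => //|]; exact: cW.
  have wZ : wsol setT (fun y => D y + e) (fun y => (f \o W) (refl (l *: n) n y) - (f \o W) y + - 0).
    apply: wsolD; first by apply: wsolB => //; exact: (@wsol_refl R N (l *: n) n setT W _ n1 wW).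
    by apply: wsol_hlap => y _; rewrite opprK; split; [exact: ctC|exact: hlapC].
  have : 0 <= D y0 + e.
    apply: (@minpr0 R N setT K _ _ N0 openT wZ cK) => [y _|y [yr ly] Zy|].
    - by apply: ctD => //; exact: ctC.
    - have Dn : D y < 0 by (move: (e0) (Zy); glra).
      have ly' : l < dot y n.
        rewrite lt_neqAle ly andbT; apply/eqP => E; move: Dn.
        by rewrite /D refl_fix ?subrr ?ltxx // dotBl dotZl -/(sqn n) n1 E mulr1 subrr.
      have yr' : enorm y <= r.
        rewrite leNgt; apply/negP => /hr We; have := W0 (refl (l *: n) n y).
        by move: Zy; rewrite /D; move: (We); glra.
      split=> //; split.
        exists (Num.min (dot y n - l) 1); first by rewrite lt_min subr_gt0 ly' ltr01.
        move=> z; rewrite lt_min => /andP [z1 z2]; split.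
          have : r <= Num.max r (enorm y0) by rewrite le_max lexx.
          by rewrite /cball /= subr0; have := enormD (z - y) y; rewrite subrK; move: (yr') (z2); glra.
        rewrite /=; have := le_trans (ler_norm _) (dot_le (y - z) n1); rewrite dotBl (enormB y z); move: (z1); glra.
      split.
        apply: ctD; last exact: ctC.
        by apply: ctB; [apply: (@ct_refl _ _ _ _ (f \o W)) => //|]; exact: cf.
      rewrite /= (fz (W y)).
        by rewrite !subr0; exact: goodf_ge0.
      apply/ltW; apply: lt_le_trans (hr1 _ _) _; last by rewrite ge_min lexx.
      apply: lt_le_trans (nbig y l ly).
      have r1m : r1 <= Num.max r1 (dot m n) by rewrite le_max lexx.
      by apply: lt_le_trans ll; rewrite /lu; move: (r1m); glra.
    - split; last exact: ly0.
      have : enorm y0 <= Num.max r (enorm y0) by rewrite le_max lexx orbT.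
      by rewrite /cball /= subr0; glra.
  by rewrite /e; have : D y0 < 0 := Dy0; glra.
have cvT : convexs (setT : set V) by [].
have mlu0 : dot m n <= Num.max r1 (dot m n) by rewrite le_max lexx orbT.
have lum : dot m n < lu by rewrite /lu; move: (mlu0); glra.
have decT e : 0 < e -> exists r : R, forall y, setT y -> r < enorm y -> W y < e.
  by move=> /dW [r hr]; exists r => y _; exact: hr.
have rfT l y : ls < l -> l <= lu -> [set: V] y -> l < dot y n -> [set: V] (refl (l *: n) n y) by [].
have bdT l y : ls < l -> l <= lu -> [set: V] y -> ~ [set: V] y -> l < dot y n -> 0 < W (refl (l *: n) n y) - W y by [].
have := mp_alt N0 gf n1 cW wW openT cvT (@subsetT _ _) closedT (@subsetT _ _) W0 WM decT rfT bdT a1 start.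
case=> [all|[l0 [[lsl l0u] [g0 [z0 _]]]]].
  have g := all (ls + 1) ltac:(by rewrite ltrDl).
  by exfalso; apply: (good_bad g (x0 := m) _ hrm); move: (a2) (a3); glra.
have sym l : (forall z, setT z -> l < dot z n -> W (refl (l *: n) n z) - W z = 0) -> forall y, W (refl (l *: n) n y) = W y.
  move=> z0' y; have [h|h|h] := ltgtP l (dot y n).
  - by apply/eqP; rewrite -subr_eq0; apply/eqP; exact: z0'.
  - have := z0' (refl (l *: n) n y) I; rewrite refl_dotl // reflK // => k.
    by apply/esym/eqP; rewrite -subr_eq0; apply/eqP; apply: k; move: (h); glra.
  - by rewrite refl_fix // dotBl dotZl -/(sqn n) n1 h mulr1 subrr.
have S0 := sym _ z0.
have l0lu : l0 < lu.
  rewrite lt_neqAle l0u andbT; apply/eqP => E.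
  have hh : r1 < enorm (refl (l0 *: n) n m).
    apply: lt_le_trans (le_trans (ler_norm _) (dot_le _ n1)); rewrite refl_dotl // E.
    have r1m : r1 <= Num.max r1 (dot m n) by rewrite le_max lexx.
    by move: lum; rewrite /lu; move: (r1m); glra.
  by have := hr1 _ hh; rewrite S0 lt_min ltxx andbF.
suff ml : dot m n = l0.
  by move=> y; rewrite -[RHS]S0; congr W; rewrite /refl !(dotBl y) dotZl -/(sqn n) n1 ml mulr1.
(* At a maximum point m' beyond l0, every good plane between l0 and m' has D = 0 at m', since W
   cannot be larger at its reflection. *)
have key m' : (forall y, W y <= W m') -> l0 < dot m' n -> False.
  move=> mm' lm.
  pose l := Num.min ((l0 + dot m' n) / 2) lu.
  have mlu : l <= lu by rewrite ge_min lexx orbT.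
  have ll : l0 < l by rewrite lt_min l0lu andbT; move: (lm); glra.
  have lm' : l < dot m' n by rewrite gt_min; apply/orP; left; move: (lm); glra.
  have Dl : W (refl (l *: n) n m') - W m' = 0.
    by apply/eqP; rewrite eq_le (g0 _ (ltW ll) m' I (ltW lm')) andbT subr_le0.
  have zl := mp_zero N0 gf n1 cW wW openT cvT (@subsetT _ _) (@subsetT _ _) rfT (lt_trans lsl ll) mlu (g0 l (ltW ll)) I lm' Dl.
  have Sl := sym _ zl.
  pose d := 2 * (l - l0).
  have d0 : 0 < d by rewrite mulr_gt0 // subr_gt0.
  (* The composition of the reflections in two parallel planes is the translation by twice their
     distance. *)
  have tr y : W (y + d *: n) = W y.
    rewrite -(S0 y) -[RHS]Sl; congr W; rewrite (refl_l l) // refl_dotl // (refl_l l0) // /d.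
    by apply/rowP => i; rewrite !mxE; ring.
  have trk k : W (m + (k%:R * d) *: n) = W m.
    elim: k => [|k IH]; first by rewrite mul0r scale0r addr0.
    by rewrite -[RHS]IH -[RHS]tr; congr W; rewrite -addrA -scalerDl; congr (_ + _ *: _); rewrite -natr1; ring.
  pose k := (Num.truncn ((`|rm| + `|dot m n|) / d)).+1.
  have hk : `|rm| + `|dot m n| < k%:R * d by rewrite -ltr_pdivrMr //; exact: Num.Theory.truncnS_gt.
  have hh : rm < enorm (m + (k%:R * d) *: n).
    apply: lt_le_trans (le_trans (ler_norm _) (dot_le _ n1)); rewrite dotDl dotZl -/(sqn n) n1 mulr1.
    by have := ler_norm rm; have := ler_norm (- dot m n); rewrite normrN; move: (hk); glra.
  by have := hrm _ hh; rewrite trk ltxx.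
apply/eqP; rewrite eq_le !leNgt; apply/andP; split; apply/negP => h.
  exact: key mm h.
(* If m lies below l0, its mirror image is also a maximum point and lies beyond l0. *)
by apply: (key (refl (l0 *: n) n m)) => [y|]; [rewrite S0|rewrite refl_dotl //; move: (h); glra].
Qed.

(* Esteban-Lions: sweeping planes in from the boundary, [W] would increase away from it forever. *)
Lemma no_halfspace tau : wsol [set y | dot y n < tau] W (f \o W) -> (forall y, tau <= dot y n -> W y = 0) ->
  (forall y, dot y n < tau -> 0 < W y) -> False.
Proof.
move=> wW Wz Wp.
pose H : set V := [set y | dot y n < tau].
have oH : open H.
  by apply: (@open_comp _ _ (fun y => dot y n) [set t | t < tau]); [move=> y _; exact: cont_dot|exact: open_lt].
have cvH : convexs H.
  move=> u w t; rewrite /H /= => hu hw /andP [t0 t1]; rewrite dotDl !dotZl.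
  rewrite -subr_gt0 (_ : _ - _ = (1 - t) * (tau - dot u n) + t * (tau - dot w n)); last by ring.
  rewrite -subr_gt0 in hu; rewrite -subr_gt0 in hw.
  have [h|h] := leP t (1 / 2).
    by apply: ltr_pwDl; [rewrite mulr_gt0 //; lra|rewrite mulr_ge0 // ltW].
  by apply: ltr_wpDl; [rewrite mulr_ge0 ?(ltW hu) //; lra|rewrite mulr_gt0 //; lra].
have [M WM] := dec0_bd cW dW.
pose m := (tau - 1) *: n.
have mn : dot m n = tau - 1 by rewrite dotZl -/(sqn n) n1 mulr1.
have pm : 0 < W m by apply: Wp; rewrite mn; lra.
have [rm hrm] := @dW _ pm.
pose ls := Num.min (tau - 3) ((dot m n - rm) / 2 - 3).
have [a1 a2] : ls <= tau - 3 /\ ls <= (dot m n - rm) / 2 - 3 by split; rewrite ge_min lexx ?orbT.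
have decT e : 0 < e -> exists r : R, forall y, setT y -> r < enorm y -> W y < e.
  by move=> /dW [r hr]; exists r => y _; exact: hr.
have rfT l y : ls < l -> l <= tau -> H y -> l < dot y n -> H (refl (l *: n) n y).
  by move=> _ lt Hy ly; rewrite /H /= refl_dotl //; lra.
have bdT l y : ls < l -> l <= tau -> [set: V] y -> ~ H y -> l < dot y n -> 0 < W (refl (l *: n) n y) - W y.
  move=> _ lt _ /negP; rewrite -leNgt => hy ly; rewrite (Wz y hy) subr0; apply: Wp; rewrite refl_dotl //; lra.
have start l : tau <= l -> mp_good W setT n l.
  by move=> ll y _ ly; rewrite (Wz y (le_trans ll ly)) subr0.
have lst : ls < tau by lra.
have := mp_alt N0 gf n1 cW wW oH cvH (fun _ h => h) closedT (@subsetT _ _) W0 WM decT rfT bdT lst start.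
case=> [all|[l0 [[lsl l0u] [g0 [z0 [z Hz lz]]]]]].
  have g := all (ls + 1) ltac:(by rewrite ltrDl).
  by apply: (good_bad g (x0 := m) _ hrm); move: (mn) (a1) (a2); glra.
(* [z'] moves z along n to the boundary point at t = 1. Before t = 1 the difference vanishes
   identically; at t = 1 it is positive, since W = 0 there and the reflected point is inside.
   Continuity forbids this. *)
pose z' t := z + (t * (tau - dot z n)) *: n.
have dz' t : dot (z' t) n = dot z n + t * (tau - dot z n) by rewrite dotDl dotZl -/(sqn n) n1 mulr1.
have tz : 0 < tau - dot z n by rewrite subr_gt0.
have D1 : 0 < W (refl (l0 *: n) n (z' 1)) - W (z' 1).
  by apply: bdT => //; [rewrite /H /= dz'; glra|rewrite dz'; move: (lz) (tz); glra].
have /contP /(_ _ D1) [r r0 hr] : {for z' 1, continuous (fun y => W (refl (l0 *: n) n y) - W y)}.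
  by apply: ctB; [apply: ct_refl => //|]; exact: cW.
pose t := 1 - Num.min 1 (r / (2 * (tau - dot z n))).
have m0 : 0 < Num.min 1 (r / (2 * (tau - dot z n))) by rewrite lt_min ltr01 divr_gt0 // mulr_gt0.
have [m1 m2] : Num.min 1 (r / (2 * (tau - dot z n))) <= 1 /\ Num.min 1 (r / (2 * (tau - dot z n))) <= r / (2 * (tau - dot z n)) by split; rewrite ge_min lexx ?orbT.
have := hr (z' t); rewrite (_ : z' t - z' 1 = ((t - 1) * (tau - dot z n)) *: n); last first.
  by rewrite /z'; apply/rowP => i; rewrite !mxE; ring.
have t1 : t - 1 = - Num.min 1 (r / (2 * (tau - dot z n))) by rewrite /t; ring.
rewrite enormZ (sqn1_enorm n1) mulr1 t1 mulNr normrN ger0_norm; last by rewrite mulr_ge0 // ltW.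
rewrite z0; last 2 first.
- by rewrite /H /= dz'; have := mulr_gt0 m0 tz; rewrite /t mulrBl mul1r; glra.
- by rewrite dz'; have : 0 <= t * (tau - dot z n); [rewrite mulr_ge0 ?(ltW tz) // /t; move: (m1); glra|move: (lz); glra].
rewrite ler_pdivlMr ?mulr_gt0 // in m2.
have : Num.min 1 (r / (2 * (tau - dot z n))) * (tau - dot z n) < r by (move: (r0) (m2); glra).
by move=> -> /(_ isT); rewrite sub0r normrN gtr0_norm // ltxx.
Qed.
End Dir.

(** Two points at equal distance from m are exchanged by the reflection through m whose normal is
    their difference. *)
Lemma entire_radial f W m : (0 < N)%N -> goodf f -> continuous W -> (forall y, 0 <= W y) -> dec0 W ->
  wsol setT W (f \o W) -> (exists x0, 0 < W x0) -> (forall y, W y <= W m) ->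
  forall x y, enorm (x - m) = enorm (y - m) -> W x = W y.
Proof.
move=> N0 gf cW W0 dW wW ex mm x y xy.
have [->//|ne] := eqVneq x y.
have p : 0 < enorm (x - y) by rewrite enorm_gt0 // subr_eq0.
pose n := (enorm (x - y))^-1 *: (x - y).
have n1 : sqn n = 1 by rewrite -enorm2 enormZ gtr0_norm ?invr_gt0 // mulVf ?expr1n // gt_eqF.
rewrite -(entire_sym N0 gf n1 cW W0 dW wW ex mm x); congr W; rewrite /refl.
have E : 2 * dot (x - m) (x - y) = enorm (x - y) ^+ 2.
  have -> : x - y = (x - m) - (y - m) by apply/rowP => i; rewrite !mxE; ring.
  have : sqn (x - m) = sqn (y - m) by rewrite -!enorm2 xy.
  move: (x - m) (y - m) => a b ab; rewrite enorm2 (sqnB a b) (dotBr a) -/(sqn a); lra.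
rewrite /n dotZr scalerA (_ : 2 * _ * _ = 1); last first.
  rewrite (_ : 2 * _ * _ = 2 * dot (x - m) (x - y) / enorm (x - y) ^+ 2); last by field; rewrite gt_eqF.
  by rewrite E divff // gt_eqF // exprn_gt0.
by rewrite scale1r; apply/rowP => i; rewrite !mxE; ring.
Qed.

Lemma lip2 f M : goodf f -> exists2 L, 0 < L & forall s t, s <= M -> t <= M -> `|f s - f t| <= L * `|s - t|.
Proof.
move=> [fm _ fL _]; have [L L0 hL] := fL M; exists L => // s t sM tM.
wlog st : s t sM tM / s <= t.
  by move=> h; have /orP [|ts] := le_total s t; [exact: h|rewrite distrC (distrC s); exact: h].
rewrite distrC (distrC s) !ger0_norm ?subr_ge0 ?fm //; apply: hL; by rewrite st.
Qed.

(* On each shell of width [1/K] in [|x|^2] the barrier [exp (K (|x|^2 - rho))] absorbs the Lipschitz nonlinearity. *)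
Lemma radial_unique f M W1 W2 : (0 < N)%N -> goodf f -> continuous W1 -> continuous W2 ->
  (forall y, W1 y <= M) -> (forall y, W2 y <= M) -> wsol setT W1 (f \o W1) -> wsol setT W2 (f \o W2) ->
  (forall x y, enorm x = enorm y -> W1 x = W1 y) -> (forall x y, enorm x = enorm y -> W2 x = W2 y) ->
  W1 0 = W2 0 -> forall x, W1 x = W2 x.
Proof.
move=> N0 gf c1 c2 b1 b2 w1 w2 r1 r2 e0.
have [L L0 hL] := lip2 M gf.
have nR : 1 <= N%:R :> R by rewrite ler1n.
pose D y := W1 y - W2 y.
have cD y : {for y, continuous D} by apply: ctB; [exact: c1|exact: c2].
have [_ _ _ fc] := gf.
have cF y : {for y, continuous (fun y => (f \o W1) y - (f \o W2) y)}.
  by apply: ctB; [apply: (@ct_comp _ _ W1 f)|apply: (@ct_comp _ _ W2 f)]; [exact: c1|exact: fc|exact: c2|exact: fc].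
pose K := L * expR 1 + 1.
have eg : 0 < expR 1 :> R by exact: expR_gt0.
have K0 : 0 < K by rewrite /K ltr_wpDl // mulr_ge0 // ltW.
suff H (j : nat) : forall x, sqn x <= j%:R / K -> D x = 0.
  move=> x; apply/eqP; rewrite -subr_eq0; apply/eqP/(H (Num.truncn (sqn x * K)).+1).
  by rewrite ler_pdivlMr // ltW // Num.Theory.truncnS_gt.
elim: j => [|j IH] x.
  rewrite mul0r => x0; have -> : x = 0 by apply: sqn_eq0; apply/eqP; rewrite eq_le x0 sqn_ge0.
  by rewrite /D e0 subrr.
pose rho := j.+1%:R / K.
have rho0 : 0 < rho by rewrite divr_gt0.
pose B := cball (0 : V) (Num.sqrt rho).
have Bs y : B y <-> sqn y <= rho.
  rewrite /B /cball /= subr0 enormE ler_sqrt //; exact: ltW.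
have B0 : B !=set0 by exists 0; apply/Bs; rewrite /sqn dot0l ltW.
have cB : compact B by exact: compact_cball.
have [m Bm hm] := compact_max B0 cB (fun y _ => cvg_norm (cD y)).
pose mx := `|D m|.
(* On the new shell the exponential is at least 1/e, so c (1 - E) has source at least L mx, which
   dominates the difference of the nonlinearities. Hence D differs by at most c from its constant
   value on the outer sphere; as D 0 = 0, mx <= 2c, and K > L e then forces mx = 0. *)
pose c := L * mx * expR 1 / (2 * N%:R * K).
have mx0 : 0 <= mx by exact: normr_ge0.
have q0 : 0 < 2 * N%:R * K by rewrite !mulr_gt0 // ltr0n.
have c0 : 0 <= c by rewrite divr_ge0 ?(ltW q0) // !mulr_ge0 // ltW.
have cN : c * (2 * N%:R * K) = L * mx * expR 1 by rewrite /c divfK // gt_eqF.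
pose E y := expR (K * sqn (y - 0) + - (K * rho)).
have cE y : {for y, continuous E} by exact: ct_exp.
have key (s d : R) : (`|s| = 1) -> (forall y, sqn y = rho -> D y = d) -> forall y, B y -> 0 <= s * (D y - d) + c * (1 - E y).
  move=> s1 hd; have wZ : wsol setT (fun y => s * (D y - d) + c * (1 - E y))
     (fun y => s * ((f \o W1) y - (f \o W2) y - - 0) + c * ((2 * N%:R * K + 4 * K ^+ 2 * sqn (y - 0)) * E y)).
    apply: wsolD; apply: wsolZ.
      apply: wsolB; first exact: wsolB.
      by apply: wsol_hlap => y _; rewrite opprK; split; [exact: ctC|exact: hlapC].
    apply: wsol_hlap => y _; split; first by apply: ctB; [exact: ctC|exact: cE].
    rewrite -sub0r; apply: hlapB; [exact: hlapC|exact: hlap_exp].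
  apply: (@minpr0 R N setT B _ _ N0 openT wZ cB) => [y _|y By Zy].
    apply: ctD; apply: ctM; try exact: ctC.
      by apply: ctB; [exact: cD|exact: ctC].
    by apply: ctB; [exact: ctC|exact: cE].
  have yr : sqn y < rho.
    rewrite lt_neqAle; apply/andP; split; last exact/Bs.
    apply/eqP => yr; move: Zy; rewrite (hd y yr) subrr mulr0 add0r /E subr0 yr subrr expR0 subrr mulr0 ltxx //.
  split=> //; split.
    have ye : enorm y < Num.sqrt rho by rewrite enormE ltr_sqrt.
    exists (Num.sqrt rho - enorm y); first by rewrite subr_gt0.
    by move=> z hz; rewrite /B /cball /= subr0; have := enormD (z - y) y; rewrite subrK; move: (hz); glra.
  split.
    apply: ctD; apply: ctM; try exact: ctC.
      by apply: ctB; [exact: cF|exact: ctC].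
    apply: ctM; last exact: cE.
    apply: ctD; first exact: ctC.
    by apply: ctM; [exact: ctC|exact: ct_sqnB].
  rewrite oppr0 subr0.
  have p1 : 0 <= (2 * N%:R * K + 4 * K ^+ 2 * sqn (y - 0)) * E y.
    by rewrite mulr_ge0 ?expR_ge0 // addr_ge0 ?mulr_ge0 ?sqn_ge0 ?sqr_ge0 ?ler0n // ltW.
  have [yj|yj] := leP (sqn y) (j%:R / K).
    have -> : (f \o W1) y = (f \o W2) y by rewrite /=; congr f; apply/eqP; rewrite -subr_eq0; apply/eqP; exact: IH.
    by rewrite subrr mulr0 add0r mulr_ge0.
  have F1 : `|s * ((f \o W1) y - (f \o W2) y)| <= L * mx.
    rewrite normrM s1 mul1r; apply: le_trans (hL _ _ (b1 y) (b2 y)) _.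
    by rewrite ler_pM2l //; exact: hm.
  have E1 : expR (-1) <= E y.
    rewrite /E ler_expR subr0 /rho -[j.+1]addn1 natrD.
    have : j%:R <= K * sqn y by rewrite mulrC -ler_pdivrMr // ltW.
    have -> : K * ((j%:R + 1) / K) = j%:R + 1 by field; rewrite gt_eqF.
    glra.
  have p2 : L * mx <= c * ((2 * N%:R * K + 4 * K ^+ 2 * sqn (y - 0)) * E y).
    have -> : L * mx = c * (2 * N%:R * K * expR (-1)).
      by rewrite mulrA cN expRN mulfK // gt_eqF.
    rewrite ler_wpM2l //; apply: ler_pM; rewrite ?expR_ge0 ?(ltW q0) //.
    by rewrite lerDl mulr_ge0 ?sqn_ge0 // mulr_ge0 // sqr_ge0.
  by move: F1; rewrite ler_norml => /andP [F1 _]; move: (p2) (F1); glra.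
move=> xj; have [d hd] : exists d, forall y, sqn y = rho -> D y = d.
  have [[y0 hy0]|no] := pselect (exists y0 : V, sqn y0 = rho).
    exists (D y0) => y hy; have E' : enorm y = enorm y0 by rewrite !enormE hy hy0.
    by rewrite /D (r1 _ _ E') (r2 _ _ E').
  by exists 0 => y hy; exfalso; apply: no; exists y.
have bd y : B y -> `|D y - d| <= c.
  move=> By; have k1 := key 1 d (normr1 _) hd y By.
  have k2 := key (-1) d ltac:(by rewrite normrN1) hd y By.
  have : 0 <= c * E y by rewrite mulr_ge0 // expR_ge0.
  rewrite ler_norml; move: k1 k2; rewrite mul1r mulN1r mulrBr mulr1; glra.
have B00 : B 0 by apply/Bs; rewrite /sqn dot0l ltW.
have D00 : D 0 = 0 by rewrite /D e0 subrr.
have := bd 0 B00; rewrite D00 sub0r normrN => dc.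
have mc : mx <= 2 * c.
  have := bd m Bm; rewrite /mx => h; have := ler_normD (D m - d) d; rewrite subrK; move: (dc) (h); glra.
have mxz : mx = 0.
  apply/eqP; rewrite eq_le mx0 andbT leNgt; apply/negP => mp.
  have h1 : mx * (N%:R * K) <= L * mx * expR 1.
    rewrite -cN; have := ler_wpM2r (_ : 0 <= N%:R * K) mc; rewrite mulr_ge0 ?ler0n ?(ltW K0) // => /(_ isT); glra.
  have h2 : L * mx * expR 1 < mx * K by rewrite (mulrC L) -mulrA ltr_pM2l // /K ltrDl.
  have h3 : mx * K <= mx * (N%:R * K) by rewrite ler_pM2l // ler_peMl // ltW.
  by have := le_lt_trans (le_trans h3 h1) h2; rewrite ltxx.
apply/eqP; rewrite -normr_le0 -mxz; apply: hm; apply/Bs; exact: xj.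
Qed.

(** The equation is invariant under 1 + k (w0(s x) - 1) with k s^2 = k^p. With k chosen to match the
    maximum of W, uniqueness of radial solutions identifies W with this function up to translation,
    and vanishing at infinity leaves only k = 1. *)
Lemma classify p (w0 W : V -> R) : (0 < N)%N -> 1 < p -> continuous w0 -> wsol setT w0 (fp p \o w0) ->
  (forall x, 0 < w0 x) -> dec0 w0 -> (forall x, w0 x <= w0 0) -> 1 < w0 0 ->
  continuous W -> (forall y, 0 <= W y) -> dec0 W -> wsol setT W (fp p \o W) -> (exists x0, 0 < W x0) ->
  exists a, forall x, W x = w0 (x - a).
Proof.
move=> N0 p1 cw ww w0p dw wm w1 cW W0 dW wW [x0 px0].
have gf := goodf_fp p1.
have [m mm] := dec0_max cW dW px0.
have pm : 0 < W m by exact: lt_le_trans (mm x0).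
have Wm1 : 1 < W m.
  (* If W <= 1 everywhere the source vanishes, and a decaying harmonic function cannot have a
     positive maximum. *)
  rewrite ltNge; apply/negP => Wm.
  have fz y : (fp p \o W) y = 0 by have [_ fz _ _] := gf; apply: fz; exact: le_trans (mm y) Wm.
  have p2 : 0 < W m / 2 by rewrite divr_gt0.
  have [r hr] := @dW _ p2.
  pose K := cball (0 : V) (Num.max r (enorm m) + 1).
  have [M1 M2] : r <= Num.max r (enorm m) /\ enorm m <= Num.max r (enorm m) by rewrite !le_max !lexx orbT.
  have wZ : wsol setT (fun y => - W y + W m / 2) (fun y => - (fp p \o W) y + - 0).
    apply: wsolD; first exact: wsolN.
    by apply: wsol_hlap => y _; rewrite opprK; split; [exact: ctC|exact: hlapC].
  have : 0 <= - W m + W m / 2.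
    apply: (@minpr0 R N setT K _ _ N0 openT wZ (@compact_cball R N _ _)) => [y _|y Ky Zy|].
    - by apply: ctD; [apply: ctN; exact: cW|exact: ctC].
    - have yr : enorm y <= r by rewrite leNgt; apply/negP => /hr; move: (Zy); glra.
      split=> //; split.
        by exists 1 => // z hz; rewrite /K /cball /= subr0; have := enormD (z - y) y; rewrite subrK; move: (M1) (yr) (hz); glra.
      rewrite (_ : (fun y => _) = fun=> 0); last by apply/funext => z; rewrite fz oppr0 addr0.
      by split; [exact: ctC|rewrite fz oppr0 addr0].
    - by rewrite /K /cball /= subr0; lra.
  lra.
pose k := (W m - 1) / (w0 0 - 1).
have k0 : 0 < k by rewrite divr_gt0 // subr_gt0.
pose s := powR k ((p - 1) / 2).
have s0 : 0 < s by exact: powR_gt0.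
have ks : k * s ^+ 2 = powR k p.
  rewrite /s -powR_mulrn ?powR_ge0 // -powRrM (_ : (p - 1) / 2 * 2%:R = p - 1); last by field.
  by rewrite -[X in X * _]powRr1 ?ltW // -powRD ?(gt_eqF k0) ?implybT //; congr powR; ring.
pose Wh x := 1 + k * (w0 (s *: x + 0) - 1).
have cWs : continuous (fun x => w0 (s *: x + 0)).
  move=> x; apply: (@ct_lip _ _ _ (fun x => s *: x + 0) s); last exact: cw.
  by move=> y; rewrite !addr0 -scalerBr enormZ gtr0_norm.
have cWh : continuous Wh.
  move=> x; exact: (@ctD R V (fun=> 1) (fun x => k * (w0 (s *: x + 0) - 1)) x (@ctC _ _ 1 x)
    (ctM (@ctC _ _ k x) (ctB (cWs x) (@ctC _ _ 1 x)))).
have wWh : wsol setT Wh (fp p \o Wh).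
  have cst c : wsol setT (fun _ : V => c) (fun _ : V => 0).
    by apply: wsol_hlap => y _; rewrite oppr0; split; [exact: ctC|exact: hlapC].
  have := wsolD (cst 1) (wsolZ k (wsolB (@wsol_dil R N s 0 setT _ _ s0 ww) (cst 1))).
  apply: wsol_ext => y _ //=.
  rewrite add0r subr0 mulrA ks /fp /Wh (addrC 1) addrK /pp.
  have [h|h] := leP (w0 (s *: y + 0) - 1) 0.
    by rewrite (max_idPr _) ?powR0 ?mulr0 ?gt_eqF //; [move: (p1); glra|rewrite pmulr_rle0].
  have kh : 0 <= k * (w0 (s *: y + 0) - 1) by rewrite mulr_ge0 // ltW.
  by rewrite (max_idPl kh) powRM // ltW.
pose Wt x := W (1 *: x + m).
have cWt : continuous Wt.
  move=> x; apply: (@ct_lip _ _ _ (fun x => 1 *: x + m) 1); last exact: cW.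
  by move=> y; rewrite !scale1r opprD addrACA subrr addr0 mul1r.
have wWt : wsol setT Wt (fp p \o Wt).
  by apply: wsol_ext (@wsol_dil R N 1 m setT _ _ ltr01 wW) => y _ //=; rewrite expr1n mul1r.
have rW0 := entire_radial N0 gf cw (fun y => ltW (w0p y)) dw ww (ex_intro _ 0 (w0p 0)) wm.
have rW := entire_radial N0 gf cW W0 dW wW (ex_intro _ x0 px0) mm.
have E : forall x, Wt x = Wh x.
  apply: (@radial_unique (fp p) (Num.max (W m) (Wh 0))) => //.
  - by move=> y; rewrite le_max mm.
  - move=> y; rewrite le_max; apply/orP; right; rewrite /Wh lerD2l ler_pM2l // lerB //.
    by rewrite scaler0 !addr0; exact: wm.
  - by move=> x y xy; apply: rW; rewrite !scale1r !addrK.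
  - by move=> x y xy; rewrite /Wh; congr (1 + k * (_ - 1)); apply: rW0; rewrite !subr0 !addr0 !enormZ xy.
  - rewrite /Wt /Wh !scaler0 !add0r /k divfK ?gt_eqF ?subr_gt0 //; ring.
(* At infinity W tends to 0, whereas the rescaled profile tends to 1 - k; both are evaluated at one
   point far out on an axis. *)
have k1 : k = 1.
  apply/eqP; rewrite -subr_eq0 -normr_le0 leNgt; apply/negP => kp.
  pose e := `|k - 1| / (2 * (k + 1)).
  have ke : 0 < 2 * (k + 1) by rewrite mulr_gt0 // addr_gt0.
  have e0 : 0 < e by rewrite divr_gt0.
  have [r1 h1] := @dw _ e0; have [r2 h2] := @dW _ e0.
  pose T := `|r1| / s + `|r2| + enorm m + 1.
  have T0 : 0 < T by rewrite ltr_wpDl // !addr_ge0 ?enorm_ge0 // divr_ge0 // ltW.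
  pose x : V := T *: ev (Ordinal N0).
  have xn : enorm x = T.
    rewrite enormZ gtr0_norm // sqn1_enorm ?mulr1 // /sqn /dot (bigD1 (Ordinal N0)) //= !mxE !eqxx mulr1.
    rewrite big1 ?addr0 // => i ne; by rewrite !mxE eqxx /= (negPf ne) mulr0.
  have := E x; rewrite /Wt /Wh.
  have a1 : W (1 *: x + m) < e.
    apply: h2; have := enormD (x + m) (- m); rewrite addrK enormN xn scale1r /T.
    have : 0 <= `|r1| / s by rewrite divr_ge0 // ltW.
    by have := ler_norm r2; glra.
  have a2 : w0 (s *: x + 0) < e.
    apply: h1; rewrite addr0 enormZ gtr0_norm // xn /T.
    apply: le_lt_trans (ler_norm r1) _; rewrite -ltr_pdivrMl // mulrC.
    by have := normr_ge0 r2; have := enorm_ge0 m; glra.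
  have b1 := W0 (1 *: x + m); have b2 := w0p (s *: x + 0).
  move=> E1; have E2 : k - 1 = k * w0 (s *: x + 0) - W (1 *: x + m) by rewrite E1; ring.
  have : `|k - 1| <= e * (k + 1).
    rewrite E2 ler_norml; have := ler_wpM2l (ltW k0) (ltW a2); have := mulr_ge0 (ltW k0) (ltW b2).
    by rewrite mulrDr mulr1 (mulrC e); have := mulr_gt0 k0 e0; move: (a1) (b1); glra.
  have -> : e * (k + 1) = `|k - 1| / 2 by rewrite /e; field; rewrite gt_eqF // addr_gt0.
  move: (kp); glra.
exists m => x; have := E (x - m); rewrite /Wt scale1r subrK => ->.
by rewrite /Wh /s k1 powR1 scale1r addr0; ring.
Qed.
End Entire.

(** * One-dimensional integrals of compactly supported continuous functions *)

Section OneDimInt.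
Context {R : realType}.
Implicit Types (g h F : R -> R) (a b t x B M : R).
Local Notation mu := (@lebesgue_measure R).

Lemma ct_idR t : {for t, continuous (fun y : R => y)}.
Proof. exact: (@cvg_id _ (nbhs t)). Qed.
Definition I1 g : R := Rintegral mu setT g.

Lemma int_FTC g F a b : a < b -> continuous g -> (forall t, t <= a \/ b <= t -> g t = 0) ->
  (forall x, a <= x <= b -> hd F x (g x)) -> (\int[mu]_x (g x)%:E)%E = (F b - F a)%:E.
Proof.
move=> ab cg sg hF.
rewrite -(_ : (\int[mu]_(x in `[a, b]) (g x)%:E = \int[mu]_x (g x)%:E)%E).
  rewrite (@continuous_FTC2 R g F a b ab) //.
  - exact: continuous_subspaceT.
  - split.
    + move=> x /[!in_itv] /= /andP [ax xb]; have [//] := hd_is (hF x ltac:(by rewrite !ltW)).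
    + have [d _] := hd_is (hF a ltac:(by rewrite lexx ltW)).
      by apply: cvg_at_right_filter; apply: differentiable_continuous; exact/derivable1_diffP.
    + have [d _] := hd_is (hF b ltac:(by rewrite lexx ltW)).
      by apply: cvg_at_left_filter; apply: differentiable_continuous; exact/derivable1_diffP.
  - move=> x /[!in_itv] /= /andP [ax xb]; rewrite derive1E.
    by have [_ ->] := hd_is (hF x ltac:(by rewrite !ltW)).
rewrite integral_mkcond; apply: eq_integral => x _; rewrite /patch; case: ifPn => // /negP xab.
rewrite sg //; have [|xa] := leP x a; first by left.
have [|xb] := leP b x; first by right.
by exfalso; apply: xab; rewrite inE /= in_itv /= !ltW.
Qed.
Lemma I1E g F a b : a < b -> continuous g -> (forall t, t <= a \/ b <= t -> g t = 0) ->
  (forall x, a <= x <= b -> hd F x (g x)) -> I1 g = F b - F a.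
Proof. by move=> ab cg sg hF; rewrite /I1 /Rintegral (int_FTC ab cg sg hF). Qed.

Lemma prim_ex g a b : a < b -> continuous g -> exists F, forall x, a <= x <= b -> hd F x (g x).
Proof.
move=> ab cg; exists (fun x => \int[mu]_(t in [set` Interval (BLeft (a - 1)) (BRight x)]) g t) => x /andP [ax xb].
apply: is_hd; have [|||d e] := @continuous_FTC1 R g (BLeft (a - 1)) x (b + 1) _ _ _ (cg x).
- by rewrite ltr_pwDr.
- by apply: continuous_compact_integrable; [exact: segment_compact|exact: continuous_subspaceT].
- by rewrite lte_fin; lra.
- by split; [exact: d|rewrite -derive1E].
Qed.

Lemma mvt_ge F g a b m : a <= b -> (forall x, a <= x <= b -> hd F x (g x) /\ m <= g x) -> m * (b - a) <= F b - F a.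
Proof.
move=> ab h.
have [||c /[!in_itv] /= cab ->] := @MVT_segment _ F g a b ab.
- by move=> x /[!in_itv] /= /andP [ax xb]; apply: hd_is; apply: (h x _).1; rewrite !ltW.
- apply: continuous_in_subspaceT => x /set_mem /=; rewrite in_itv /= => xab.
  exact: hd_ct (h x xab).1.
by rewrite ler_wpM2r ?subr_ge0 // (h c cab).2.
Qed.

Definition sup1 g B := forall t, B < `|t| -> g t = 0.

Lemma sup1_out g B M t : sup1 g B -> B < M -> t <= - M \/ M <= t -> g t = 0.
Proof.
move=> s BM [tM|tM]; apply: s.
  by apply: lt_le_trans BM _; rewrite -normrN; apply: le_trans (ler_norm _); rewrite lerNr.
by apply: lt_le_trans BM (le_trans tM (ler_norm _)).
Qed.

(** Every rule below is proved on a primitive: linearity, bounds, translation and dilation become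
    statements about F M - F (- M). *)
Lemma I1_aux g B M : 0 <= B -> B < M -> continuous g -> sup1 g B ->
  exists2 F, forall x, - M <= x <= M -> hd F x (g x) & I1 g = F M - F (- M).
Proof.
move=> B0 BM cg sg; have M0 : - M < M by lra.
have [F hF] := prim_ex M0 cg; exists F => //.
by apply: I1E => // t; exact: (sup1_out sg BM).
Qed.

Lemma I1_lin g h k B : 0 <= B -> continuous g -> continuous h -> sup1 g B -> sup1 h B ->
  I1 (fun t => k * g t + h t) = k * I1 g + I1 h.
Proof.
move=> B0 cg ch sg sh.
have BM : B < B + 1 by rewrite ltrDl.
have [F hF ->] := I1_aux B0 BM cg sg; have [H hH ->] := I1_aux B0 BM ch sh.
rewrite (@I1E _ (fun t => k * F t + H t) (- (B + 1)) (B + 1)); [ring|lra| | |].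
- by move=> x; exact: (ctD (ctM (@ctC _ _ k x) (cg x)) (ch x)).
- by move=> t ht; rewrite (sup1_out sg BM ht) (sup1_out sh BM ht) mulr0 addr0.
- by move=> x hx; apply: hdD; [apply: hdZ; exact: hF|exact: hH].
Qed.

Lemma I1_bd g B e : 0 <= B -> continuous g -> sup1 g B -> (forall t, `|g t| <= e) -> `|I1 g| <= 2 * (B + 1) * e.
Proof.
move=> B0 cg sg ge; have BM : B < B + 1 by rewrite ltrDl.
have [F hF ->] := I1_aux B0 BM cg sg.
have := @mvt1 R F g (- (B + 1)) (B + 1) 0 e.
rewrite mul0r subr0 opprK (ger0_norm (_ : 0 <= B + 1 + (B + 1))); last lra.
rewrite (_ : e * _ = 2 * (B + 1) * e); last by ring.
apply => x; have q : - (B + 1) <= B + 1 by lra.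
rewrite (min_idPl q) (max_idPr q) => hx; split; [exact: hF|by rewrite subr0].
Qed.

Lemma I1_gt0 g B t0 : 0 <= B -> continuous g -> sup1 g B -> (forall t, 0 <= g t) -> 0 < g t0 -> 0 < I1 g.
Proof.
move=> B0 cg sg g0 gt.
have g2 : 0 < g t0 / 2 by rewrite divr_gt0.
have /cvgrPdist_lt /(_ _ g2) := cg t0.
rewrite -nbhs_nearE => /nbhs_ballP [r r0 hr].
pose M := B + `|t0| + r + 1.
have BM : B < M by rewrite /M; have := normr_ge0 t0; have : 0 < r := r0; lra.
have [F hF ->] := I1_aux B0 BM cg sg.
have rp : 0 < r := r0.
have [tn1 tn2] : t0 <= `|t0| /\ - t0 <= `|t0| by rewrite ler_norm -normrN ler_norm.
have s1 : 0 * (t0 - (- M)) <= F t0 - F (- M).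
  by apply: (@mvt_ge F g) => [|x /andP [x1 x2]]; [rewrite /M; move: (B0) (rp) (tn2); glra|split; [apply: hF; rewrite x1 /M; move: (B0) (rp) (tn1) (x2); glra|exact: g0]].
have s2 : g t0 / 2 * (t0 + r / 2 - t0) <= F (t0 + r / 2) - F t0.
  apply: (@mvt_ge F g) => [|x /andP [x1 x2]]; first by lra.
  split; first by apply: hF; rewrite /M; apply/andP; split; move: (B0) (tn2) (x1) (x2) (tn1); glra.
  have := hr x; rewrite /ball /= => /(_ _) k; have : `|g t0 - g x| < g t0 / 2.
    by apply: k; rewrite ltr_norml; apply/andP; split; move: (rp) (x2) (x1); glra.
  by rewrite ltr_norml; glra.
have s3 : 0 * (M - (t0 + r / 2)) <= F M - F (t0 + r / 2).
  apply: (@mvt_ge F g) => [|x /andP [x1 x2]]; first by rewrite /M; move: (B0) (rp) (tn1); glra.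
  by split; [apply: hF; rewrite x2 /M andbT; move: (B0) (rp) (tn2) (x1); glra|exact: g0].
have := mulr_gt0 g2 (_ : 0 < t0 + r / 2 - t0); rewrite addrC addKr divr_gt0 // => /(_ isT).
by rewrite addrC addKr in s2; move: (s1) (s3) (s2); glra.
Qed.

Lemma I1_shift g c B : 0 <= B -> continuous g -> sup1 g B -> I1 (fun t => g (t + c)) = I1 g.
Proof.
move=> B0 cg sg; pose M := B + `|c| + 1.
have BM : B < M by rewrite /M -addrA ltrDl ltr_wpDl.
have [c1 c2] : c <= `|c| /\ - c <= `|c| by rewrite ler_norm -normrN ler_norm.
have MM : - M + c < M + c by rewrite /M; lra.
have [F hF] := prim_ex MM cg.
rewrite (@I1E g F (- M + c) (M + c)) //.
  rewrite (@I1E _ (fun t => F (t + c)) (- M) M) //; first lra.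
  - by move=> x; apply: (@ct_comp _ _ (fun t => t + c) g); [apply: ctD; [exact: ct_idR|exact: ctC]|exact: cg].
  - by move=> t ht; apply: sg; case: ht; rewrite /M => ht; [rewrite -normrN; apply: lt_le_trans (ler_norm _)|apply: lt_le_trans (ler_norm _)]; move: (c1) (ht) (c2); glra.
  - move=> x /andP [x1 x2]; have h : hd F (1 * x + c) (g (x + c)) by rewrite mul1r; apply: hF; rewrite !lerD2r x1.
    have := hd_aff h; rewrite mul1r; apply: hd_ext; exists 1 => // y _; by rewrite mul1r.
by move=> t ht; apply: sg; case: ht; rewrite /M => ht; [rewrite -normrN; apply: lt_le_trans (ler_norm _)|apply: lt_le_trans (ler_norm _)]; lra.
Qed.

Lemma I1_dil g s B : 0 <= B -> 0 < s -> continuous g -> sup1 g B -> I1 (fun t => g (s * t)) = s^-1 * I1 g.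
Proof.
move=> B0 s0 cg sg; have BM : B < B + 1 by rewrite ltrDl.
have [F hF ->] := I1_aux B0 BM cg sg.
pose M := (B + 1) / s; have M0 : 0 < M by rewrite divr_gt0 //; lra.
have sM : s * M = B + 1 by rewrite /M mulrC divfK // gt_eqF.
rewrite (@I1E _ (fun t => s^-1 * F (s * t)) (- M) M); first by rewrite mulrN sM mulrBr.
- by lra.
- by move=> x; apply: (@ct_comp _ _ (fun t => s * t) g); [apply: ctM; [exact: ctC|exact: ct_idR]|exact: cg].
- move=> t ht; apply: (sup1_out sg BM); rewrite -sM -mulrN !ler_pM2l //; exact: ht.
- move=> x /andP [x1 x2]; have h : hd F (s * x + 0) (g (s * x)).
    by rewrite addr0; apply: hF; rewrite -sM -mulrN !ler_pM2l // x1.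
  have := hdZ s^-1 (hd_aff h); rewrite mulrA mulVf ?gt_eqF // mul1r.
  by apply: hd_ext; exists 1 => // y _; rewrite addr0.
Qed.

(* monotone even when [h] is not measurable, as it is a supremum over simple functions *)
Lemma I1_le_nm g h B : 0 <= B -> continuous g -> sup1 g B -> (forall t, 0 <= h t <= g t) -> I1 h <= I1 g.
Proof.
move=> B0 cg sg hh; rewrite /I1 /Rintegral.
have h0 t : 0 <= h t by have /andP [] := hh t.
have g0 t : 0 <= g t by have /andP [a b] := hh t; exact: le_trans b.
have le : (\int[mu]_(x in setT) (h x)%:E <= \int[mu]_(x in setT) (g x)%:E)%E.
  rewrite !ge0_integralTE; try by move=> x _ || move=> x; rewrite lee_fin.
  apply: le_ereal_sup => _ [u hu <-]; exists u => // x; apply: le_trans (hu x) _.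
  by rewrite lee_fin; have /andP [] := hh x.
have fg : (\int[mu]_(x in setT) (g x)%:E)%E \is a fin_num.
  have BM : B < B + 1 by rewrite ltrDl.
  have M0 : - (B + 1) < B + 1 by lra.
  have [F hF] := prim_ex M0 cg.
  by rewrite (int_FTC M0 cg (fun t ht => sup1_out sg BM ht) hF).
apply: fine_le => //.
rewrite ge0_fin_numE; last by apply: integral_ge0 => x _; rewrite lee_fin.
apply: le_lt_trans le _; rewrite -ge0_fin_numE //; apply: integral_ge0 => x _; by rewrite lee_fin.
Qed.
End OneDimInt.

(** * The iterated integral over R^N *)

Section MultiInt.
Context {R : realType} {N : nat}.
Notation V := 'rV[R]_N.
Implicit Types (f g : V -> R) (x y h : V) (B e t s : R) (k : nat).

Definition ucont f := forall e, 0 < e -> exists2 d : R, 0 < d & forall x y, enorm (x - y) < d -> `|f x - f y| <= e.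
(** Only the coordinates of index at least k are constrained: this is the support property that
    survives after the first k coordinates have been integrated out. *)
Definition supk k f B := forall x (i : 'I_N), (k <= i)%N -> B < `|x ord0 i| -> f x = 0.

Lemma upd_in x k (i : 'I_N) t : nat_of_ord i = k -> upd x k t ord0 i = t.
Proof. by move=> ik; rewrite mxE ik eqxx. Qed.
Lemma upd_out x k (i : 'I_N) t : nat_of_ord i <> k -> upd x k t ord0 i = x ord0 i.
Proof. by move=> /eqP ik; rewrite mxE (negPf ik). Qed.
Lemma upd_dist x y k t : enorm (upd x k t - upd y k t) <= enorm (x - y).
Proof.
rewrite !enormE ler_sqrt ?sqn_ge0 //; apply: ler_sum => i _; rewrite !mxE.
by case: ifP => _; [rewrite subrr mul0r -expr2 sqr_ge0|].
Qed.
Lemma upd_dist2 x k s t : enorm (upd x k s - upd x k t) <= `|s - t|.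
Proof.
have [kN|kN] := ltnP k N.
  have -> : upd x k s - upd x k t = (s - t) *: ev (Ordinal kN).
    apply/rowP => i; rewrite !mxE eqxx /= -[i == Ordinal kN]/(nat_of_ord i == k); case: ifP => _; rewrite ?mulr1 ?mulr0 ?subrr //.
  rewrite enormZ enormE (_ : sqn _ = 1) ?sqrtr1 ?mulr1 //.
  rewrite /sqn /dot (bigD1 (Ordinal kN)) //= !mxE !eqxx mulr1.
  by rewrite big1 ?addr0 // => i ne; rewrite !mxE eqxx /= (negPf ne) mulr0.
have -> : upd x k s - upd x k t = 0; last by rewrite enorm0.
by apply/rowP => i; rewrite !mxE; case: eqP => [ik|_]; [move: (ltn_ord i); rewrite ik ltnNge kN|rewrite subrr].
Qed.

Lemma sec_cont k f x : ucont f -> continuous (fun t => f (upd x k t)).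
Proof.
move=> uf t; apply/cvgrPdist_le => e e0; have [d d0 hd'] := uf e e0.
apply/nbhs_ballP; exists d => //= s; rewrite /ball /= => st.
by apply: hd'; apply: le_lt_trans (upd_dist2 _ _ _ _) st.
Qed.
Lemma sec_sup k f x B : (k < N)%N -> supk k f B -> sup1 (fun t => f (upd x k t)) B.
Proof. by move=> kN sf t ht; apply: (sf _ (Ordinal kN)) => //; rewrite upd_in. Qed.

Arguments sec_cont {k f} x _.
Arguments sec_sup {k f} x {B} _ _.

(** The induction invariant: every section met in the next integration is again continuous with
    bounded support, so the one-dimensional rules apply. *)
Lemma iint_ucc f B k : 0 <= B -> (k <= N)%N -> ucont f -> supk 0 f B -> ucont (iint k f) /\ supk k (iint k f) B.
Proof.
move=> B0 + uf sf; elim: k => [|k IH] kN; first by split.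
have [u s] := IH (ltnW kN); split.
  move=> e e0; have e1 : 0 < e / (2 * (B + 1)) by rewrite divr_gt0 // mulr_gt0 //; lra.
  have [d d0 hd'] := u _ e1; exists d => // x y xy /=.
  have cx := @sec_cont k _ x u; have cy := @sec_cont k _ y u.
  have sx := sec_sup x kN s; have sy := sec_sup y kN s.
  have := I1_lin (-1) B0 cy cx sy sx; rewrite /I1 => E.
  have -> : (\int[lebesgue_measure]_t iint k f (upd x k t) - \int[lebesgue_measure]_t iint k f (upd y k t))%R
     = I1 (fun t => -1 * iint k f (upd y k t) + iint k f (upd x k t)).
    by rewrite /I1 E mulN1r addrC.
  have -> : e = 2 * (B + 1) * (e / (2 * (B + 1))) by field; rewrite gt_eqF //; move: (B0); glra.
  apply: I1_bd => //.
  - by move=> t; exact: (ctD (ctM (@ctC _ _ (-1) t) (cy t)) (cx t)).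
  - by move=> t ht; rewrite sx // sy // mulr0 addr0.
  - by move=> t; rewrite mulN1r addrC; apply: hd'; apply: le_lt_trans (upd_dist _ _ _ _) xy.
move=> x i ki xi /=; rewrite (_ : (fun t => _) = fun=> 0); first by rewrite /Rintegral integral0.
apply/funext => t; apply: (s _ i (ltnW ki)); rewrite upd_out //.
by move=> ik; move: ki; rewrite ik ltnn.
Qed.

Definition cc f := continuous f /\ exists B, forall x, B < enorm x -> f x = 0.

Lemma cc_bd f : cc f -> exists B, [/\ 0 <= B, ucont f & supk 0 f B].
Proof.
move=> [cf [B hB]]; exists `|B|; split=> //; last first.
  by move=> x i _ xi; apply: hB; apply: le_lt_trans (ler_norm B) (lt_le_trans xi (coord_le x i)).
move=> e e0; have [d d0 hd'] := unif_cont (@compact_cball R N 0 (`|B| + 1)) (fun x _ => cf x) e0.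
exists (Num.min d 1); first by rewrite lt_min d0 ltr01.
move=> x y; rewrite lt_min => /andP [xyd xy1].
have Bn := ler_norm B.
have [xB|xB] := leP (enorm x) (`|B| + 1).
  by rewrite distrC ltW // hd' //; [rewrite /cball /= subr0|rewrite enormB].
have yB : B < enorm y by have := enormD (x - y) y; rewrite subrK; lra.
by rewrite (hB x) ?(hB y) ?subrr ?normr0 ?(ltW e0) //; lra.
Qed.

Lemma iint_lin k f g a : (k <= N)%N -> cc f -> cc g -> forall x,
  iint k (fun x => a * f x + g x) x = a * iint k f x + iint k g x.
Proof.
move=> kN cf cg; have [B [B0 uf sf]] := cc_bd cf; have [B' [B'0 ug sg]] := cc_bd cg.
elim: k kN => [//|k IH] kN x /=.
rewrite (_ : (fun t => _) = fun t => a * iint k f (upd x k t) + iint k g (upd x k t)); last first.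
  by apply/funext => t; rewrite IH // ltnW.
have [u s] := iint_ucc B0 (ltnW kN) uf sf; have [u' s'] := iint_ucc B'0 (ltnW kN) ug sg.
have [m1 m2] : B <= Num.max B B' /\ B' <= Num.max B B' by rewrite !le_max !lexx orbT.
apply: (@I1_lin R _ _ a (Num.max B B')); [lra|exact: sec_cont|exact: sec_cont| |].
- by move=> t ht; apply: (sec_sup x kN s); exact: le_lt_trans ht.
- by move=> t ht; apply: (sec_sup x kN s'); exact: le_lt_trans ht.
Qed.

Lemma iint_ge0 k f x : (forall x, 0 <= f x) -> 0 <= iint k f x.
Proof. by move=> h; elim: k x => [|k IH] x //=; apply: Rintegral_ge0. Qed.

Lemma iint_gt0 k f : (k <= N)%N -> cc f -> (forall x, 0 <= f x) -> forall x, 0 < f x -> 0 < iint k f x.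
Proof.
move=> kN cf f0; have [B [B0 uf sf]] := cc_bd cf; elim: k kN => [//|k IH] kN x fx /=.
have [u s] := iint_ucc B0 (ltnW kN) uf sf.
apply: (@I1_gt0 R _ B (x ord0 (Ordinal kN)) B0 (sec_cont x u) (sec_sup x kN s)).
  by move=> t; exact: iint_ge0.
have -> : upd x k (x ord0 (Ordinal kN)) = x; last by apply: IH => //; exact: ltnW.
by apply/rowP => i; rewrite mxE; case: eqP => // ik; congr (x _ _); exact: val_inj.
Qed.

Lemma iint_le_nm k f g : (k <= N)%N -> cc g -> (forall x, 0 <= f x <= g x) -> forall x, 0 <= iint k f x <= iint k g x.
Proof.
move=> kN cg fg; have [B [B0 ug sg]] := cc_bd cg.
elim: k kN => [//|k IH] kN x.
rewrite iint_ge0 /=; last by move=> y; have /andP [] := fg y.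
have [u s] := iint_ucc B0 (ltnW kN) ug sg.
by apply: (I1_le_nm B0 (sec_cont x u) (sec_sup x kN s)) => t; apply: IH; exact: ltnW.
Qed.

Lemma iint_shift k f h : (k <= N)%N -> cc f -> forall x, iint k (fun x => f (x + h)) x = iint k f (x + h).
Proof.
move=> kN cf; have [B [B0 uf sf]] := cc_bd cf; elim: k kN => [//|k IH] kN x /=.
have [u s] := iint_ucc B0 (ltnW kN) uf sf.
rewrite (_ : (fun t => _) = fun t => iint k f (upd (x + h) k (t + h ord0 (Ordinal kN)))).
  exact: (I1_shift (h ord0 (Ordinal kN)) B0 (sec_cont (x + h) u) (sec_sup (x + h) kN s)).
apply/funext => t; rewrite IH ?(ltnW kN) //; congr (iint k f _).
by apply/rowP => i; rewrite !mxE; case: eqP => // ik; congr (_ + h _ _); exact: val_inj.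
Qed.

Lemma iint_dil k f s : (k <= N)%N -> 0 < s -> cc f -> forall x, iint k (fun x => f (s *: x)) x = (s ^+ k)^-1 * iint k f (s *: x).
Proof.
move=> kN s0 cf; have [B [B0 uf sf]] := cc_bd cf; elim: k kN => [|k IH] kN x /=; first by rewrite expr0 invr1 mul1r.
have [u sk] := iint_ucc B0 (ltnW kN) uf sf.
have E : (fun t => iint k (fun x => f (s *: x)) (upd x k t)) = fun t => (s ^+ k)^-1 * iint k f (upd (s *: x) k (s * t)) + 0.
  apply/funext => t; rewrite IH ?(ltnW kN) // addr0; congr (_ * iint k f _).
  by apply/rowP => i; rewrite !mxE; case: eqP.
rewrite E; pose g t := iint k f (upd (s *: x) k t).
have cg : continuous g by exact: sec_cont.
have sg : sup1 g B by exact: sec_sup.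
have cgs : continuous (fun t => g (s * t)).
  by move=> t; apply: (@ct_comp _ _ (fun t => s * t) g); [apply: ctM; [exact: ctC|exact: ct_idR]|exact: cg].
have Bs : 0 <= B / s by rewrite divr_ge0 // ltW.
have sgs : sup1 (fun t => g (s * t)) (B / s).
  by move=> t ht; apply: sg; rewrite normrM (gtr0_norm s0) mulrC -ltr_pdivrMr.
have := I1_lin (s ^+ k)^-1 Bs cgs (fun t => @ctC R _ 0 t) sgs (fun t _ => erefl).
rewrite (I1_dil B0 s0 cg sg) /I1 => ->; rewrite [X in _ + X](_ : _ = 0) ?addr0; last by rewrite /Rintegral integral0.
by rewrite exprS invfM mulrA (mulrC (s ^+ k)^-1).
Qed.

Lemma iint_dep k f x y : (k <= N)%N -> (forall i : 'I_N, (k <= i)%N -> x ord0 i = y ord0 i) -> iint k f x = iint k f y.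
Proof.
elim: k x y => [|k IH] x y kN h /=; first by congr f; apply/rowP => i; exact: h.
congr (Rintegral _ _ _); apply/funext => t; apply: IH => [|i ki]; first exact: ltnW.
rewrite !mxE; case: eqP => // ik; apply: h; rewrite ltn_neqAle ki andbT eq_sym; exact/eqP.
Qed.
Lemma iintN f x : iint N f x = intRN f.
Proof. by apply: iint_dep => // i Ni; move: (ltn_ord i); rewrite ltnNge Ni. Qed.

Lemma int_lin f g a : cc f -> cc g -> intRN (fun x => a * f x + g x) = a * intRN f + intRN g.
Proof. by move=> cf cg; exact: iint_lin. Qed.
Lemma int_ge0 f : (forall x, 0 <= f x) -> 0 <= intRN f.
Proof. exact: iint_ge0. Qed.
Lemma int_gt0 f x : cc f -> (forall x, 0 <= f x) -> 0 < f x -> 0 < intRN f.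
Proof. by move=> cf f0 fx; rewrite -(iintN f x); exact: iint_gt0. Qed.
Lemma int_le_nm f g : cc g -> (forall x, 0 <= f x <= g x) -> intRN f <= intRN g.
Proof. by move=> cg h; have /andP [] := iint_le_nm (leqnn N) cg h 0. Qed.
Lemma int_shift f h : cc f -> intRN (fun x => f (x + h)) = intRN f.
Proof. by move=> cf; rewrite -[RHS](iintN f (0 + h)); exact: iint_shift. Qed.
Lemma int_dil f s : 0 < s -> cc f -> intRN (fun x => f (s *: x)) = (s ^+ N)^-1 * intRN f.
Proof. by move=> s0 cf; rewrite -[X in _ * X](iintN f (s *: 0)); exact: iint_dil. Qed.

Lemma cc0 : cc (fun=> 0).
Proof. by split; [move=> x; exact: ctC|exists 0]. Qed.
Lemma int0 : intRN (fun _ : V => 0) = 0.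
Proof.
have := int_lin 1 cc0 cc0; rewrite (_ : (fun x : V => 1 * 0 + 0) = fun=> 0); first by rewrite mul1r; lra.
by apply/funext => x; rewrite mulr0 addr0.
Qed.
Lemma ccD f g : cc f -> cc g -> cc (fun x => f x + g x).
Proof.
move=> [cf [B hB]] [cg [B' hB']]; split; first by move=> x; exact: (ctD (cf x) (cg x)).
exists (Num.max B B') => x; rewrite gt_max => /andP [h1 h2]; by rewrite hB // hB' // addr0.
Qed.
Lemma ccM f g : continuous f -> cc g -> cc (fun x => f x * g x).
Proof.
move=> cf [cg [B hB]]; split; first by move=> x; exact: (ctM (cf x) (cg x)).
by exists B => x h; rewrite hB // mulr0.
Qed.
Lemma ccZ a g : cc g -> cc (fun x => a * g x).
Proof. by move=> h; apply: ccM h; move=> x; exact: ctC. Qed.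
Lemma cc_aff g (s : R) (h : V) : 0 < s -> cc g -> cc (fun x => g (s *: x + h)).
Proof.
move=> s0 [cg [B hB]]; split.
  move=> x; apply: (@ct_lip _ _ _ (fun x => s *: x + h) s); last exact: cg.
  by move=> y; rewrite opprD addrACA subrr addr0 -scalerBr enormZ gtr0_norm.
exists ((B + enorm h) / s) => x; rewrite ltr_pdivrMr // => hx; apply: hB.
have := enormD (s *: x + h) (- h); rewrite addrK enormN enormZ gtr0_norm //; lra.
Qed.
Lemma cc_shift g (h : V) : cc g -> cc (fun x => g (x + h)).
Proof. by move=> /(cc_aff h ltr01); congr cc; apply/funext => x; rewrite scale1r. Qed.
Lemma int_aff f s h : 0 < s -> cc f -> intRN (fun x => f (s *: x + h)) = (s ^+ N)^-1 * intRN f.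
Proof. by move=> s0 cf; rewrite -(int_shift h cf) (int_dil s0 (cc_shift h cf)). Qed.
Lemma int_Z f a : cc f -> intRN (fun x => a * f x) = a * intRN f.
Proof.
move=> cf; rewrite -[RHS]addr0 -int0 -(int_lin a cf cc0); congr intRN.
by apply/funext => x; rewrite addr0.
Qed.
Lemma int_D f g : cc f -> cc g -> intRN (fun x => f x + g x) = intRN f + intRN g.
Proof.
move=> cf cg; rewrite -[X in X + _]mul1r -(int_lin 1 cf cg); congr intRN.
by apply/funext => x; rewrite mul1r.
Qed.
Lemma int_sum (I : Type) (r : seq I) (F : I -> V -> R) : (forall i, cc (F i)) ->
  cc (fun x => \sum_(i <- r) F i x) /\ intRN (fun x => \sum_(i <- r) F i x) = \sum_(i <- r) intRN (F i).
Proof.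
move=> h; elim: r => [|i r [IH1 IH2]].
  rewrite big_nil (_ : (fun x => _) = fun=> 0); first by split; [exact: cc0|exact: int0].
  by apply/funext => x; rewrite big_nil.
rewrite big_cons -IH2 -int_D // (_ : (fun x => _) = fun x => F i x + \sum_(i <- r) F i x).
  by split => //; exact: ccD.
by apply/funext => x; rewrite big_cons.
Qed.
Lemma int_le f g : cc f -> cc g -> (forall x, f x <= g x) -> intRN f <= intRN g.
Proof.
move=> cf cg h; have := int_lin (-1) cf cg; rewrite mulN1r => E.
have : 0 <= intRN (fun x => -1 * f x + g x) by apply: int_ge0 => x; rewrite mulN1r addrC subr_ge0.
by rewrite E addrC subr_ge0.
Qed.
(** Summation by parts at a fixed step h, from translation invariance alone. It plays the role of
    Green's identity. *)
Lemma int_sd (phi b : V -> R) h : continuous phi -> cc b ->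
  intRN (fun x => phi x * sd b x h) = intRN (fun x => sd phi x h * b x).
Proof.
move=> cp cb.
have ch (h' : V) : continuous (fun x => phi (x + h')).
  move=> x; apply: (@ct_lip _ _ _ (fun x => x + h') 1); last exact: cp.
  by move=> y; rewrite mul1r opprD addrACA subrr addr0.
have c1 := ccM cp (cc_shift h cb); have c2 := ccM cp (cc_shift (- h) cb).
have c3 := ccZ (-2) (ccM cp cb).
have c4 := ccM (ch h) cb; have c5 := ccM (ch (- h)) cb.
rewrite (_ : (fun x => phi x * sd b x h) = (fun x => phi x * b (x + h) + (phi x * b (x - h) + -2 * (phi x * b x)))); last first.
  by apply/funext => x; rewrite /sd; ring.
rewrite (_ : (fun x => sd phi x h * b x) = (fun x => phi (x - h) * b x + (phi (x + h) * b x + -2 * (phi x * b x)))); last first.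
  by apply/funext => x; rewrite /sd; ring.
rewrite (int_D c1 (ccD c2 c3)) (int_D c2 c3) (int_D c5 (ccD c4 c3)) (int_D c4 c3).
have e1 := int_shift h c5; have e2 := int_shift (- h) c4.
rewrite -e1 -e2; congr (_ + (_ + _)); congr intRN; apply/funext => x; first by rewrite addrK.
by rewrite subrK.
Qed.
Lemma int_abs f e (g : V -> R) : cc f -> cc g -> (forall x, `|f x| <= e * g x) -> `|intRN f| <= e * intRN g.
Proof.
move=> cf cg h; rewrite ler_norml -mulNr -!(int_Z _ cg) !int_le //; try exact: ccZ.
  by move=> x; have := h x; rewrite ler_norml => /andP [].
by move=> x; have := h x; rewrite ler_norml => /andP []; rewrite mulNr.
Qed.
Lemma cc_tent (a : V) r : cc (fun x => Num.max (r - enorm (x - a)) 0).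
Proof.
split; first by move=> x; exact: (ct_max (ctB (@ctC _ _ r x) (@ct_enB R N a x)) (@ctC _ _ 0 x)).
exists (r + enorm a) => x hx; apply: max_r.
by have := enormD (x - a) a; rewrite subrK; lra.
Qed.
End MultiInt.

(** * Geometry of the domain near its boundary *)

Section Domain.
Context {R : realType} {N : nat}.
Notation V := 'rV[R]_N.
Implicit Types (x y z : V) (Om G : set V) (e t s r d : R).

(* All that is used of the smoothness of the boundary. *)
Definition flat Om := exists nu : V -> V, (forall xb, bdry Om xb -> sqn (nu xb) = 1) /\
  forall del, 0 < del -> exists2 s0, 0 < s0 & forall xb, bdry Om xb -> forall y, enorm (y - xb) <= s0 ->
   (dot (y - xb) (nu xb) < - del * enorm (y - xb) -> Om y) /\ (del * enorm (y - xb) < dot (y - xb) (nu xb) -> ~ Om y).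
Lemma bdry_open Om x : open Om -> bdry Om x -> closure Om x /\ ~ Om x.
Proof. by move=> oO [cx ix]; split => // Ox; apply: ix; move: oO; rewrite openE; apply. Qed.

Lemma closure_bd Om M : (forall x, Om x -> enorm x <= M) -> forall x, closure Om x -> enorm x <= M.
Proof.
move=> h; have sub : Om `<=` [set x | enorm x <= M] by move=> x /h.
have cl : closed [set x : V | enorm x <= M].
  rewrite (_ : [set x | _] = cball 0 M); first exact: closed_cball.
  by apply/seteqP; split => x; rewrite /cball /= subr0.
move=> x cx; have := closure_subset sub cx; by rewrite -(closure_id _).1.
Qed.

Lemma compact_bdry Om : open Om -> (exists M, forall x, Om x -> enorm x <= M) -> compact (bdry Om).
Proof.
move=> oO [M hM]; apply: closed_bounded_compact.
  rewrite /bdry setDE; apply: closedI; first exact: closed_closure.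
  by apply: open_closedC; exact: open_interior.
by exists M => x [cx _]; exact: (closure_bd hM).
Qed.

(** The normal is the normalised gradient of the defining function. On the compact boundary this
    gradient is bounded below and the partial derivatives are uniformly continuous, so the
    first-order expansion has an error that is uniform in the boundary point. *)
Lemma flat_smooth Om : smooth_bounded_domain Om -> flat Om.
Proof.
move=> [oO [bd [rho [sm [OE gr]]]]].
have cO := compact_bdry oO bd; have [M hM] := bd.
have [cr dr] := sm [::]; have ci i : continuous (pd i rho) := (sm [:: i]).1.
have r0 x : bdry Om x -> rho x = 0.
  move=> bx; have [cx nx] := bdry_open oO bx; apply/eqP; rewrite eq_le; apply/andP; split.
    have sub : Om `<=` [set x | rho x <= 0] by rewrite OE => y /= /ltW.
    have cl : closed [set x | rho x <= 0] by apply: (@preimage_closed _ _ rho [set t | t <= 0]) => [y _|]; [exact: cr|exact: closed_le].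
    by have := closure_subset sub cx; rewrite -(closure_id _).1.
  by rewrite leNgt; apply/negP => h; apply: nx; rewrite OE.
pose g x := sqn (grad rho x).
have cg x : {for x, continuous g}.
  rewrite /g /sqn /dot; elim: (index_enum _) => [|i l IH].
    by rewrite (_ : (fun y => _) = fun=> 0); [exact: ctC|apply/funext => y; rewrite big_nil].
  rewrite (_ : (fun y => _) = fun y => pd i rho y * pd i rho y + \sum_(i <- l) (grad rho y ord0 i * grad rho y ord0 i)).
    exact: (ctD (ctM (ci i x) (ci i x)) IH).
  by apply/funext => y; rewrite big_cons !mxE.
have [[x0 bx0]|nb] := pselect (bdry Om !=set0); last first.
  by exists (fun=> 0); split => [xb bx|del _]; [|exists 1 => // xb bx]; exfalso; apply: nb; exists xb.
have [m bm hm] := compact_min (ex_intro _ x0 bx0) cO (fun x _ => cg x).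
have gp x : bdry Om x -> 0 < g x.
  move=> bx; have [i gi] := gr x (r0 x bx).
  rewrite lt_neqAle sqn_ge0 andbT eq_sym; apply/eqP => /sqn_eq0 E; move: gi.
  by have := congr1 (fun w : V => w ord0 i) E; rewrite !mxE => ->; rewrite eqxx.
pose c := enorm (grad rho m).
have c0 : 0 < c by rewrite /c enormE sqrtr_gt0; exact: gp.
have cmin x : bdry Om x -> c <= enorm (grad rho x).
  by move=> bx; rewrite /c !enormE ler_sqrt ?sqn_ge0 //; exact: hm.
have N1 : 0 < N%:R + 1 :> R by rewrite ltr_wpDl.
exists (fun x => (enorm (grad rho x))^-1 *: grad rho x); split => [xb bx|del del0].
  have Gp : 0 < enorm (grad rho xb) := lt_le_trans c0 (cmin xb bx).
  by rewrite -enorm2 enormZ gtr0_norm ?invr_gt0 // mulVf ?expr1n // gt_eqF.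
pose e := del * c / (2 * (N%:R + 1)).
have e0 : 0 < e by rewrite divr_gt0 ?mulr_gt0.
have [d d0 hd'] : exists2 d : R, 0 < d & forall i : 'I_N, forall x y, bdry Om x -> enorm (y - x) < d -> `|pd i rho y - pd i rho x| <= e.
  apply: fin_r => [i r r' /andP [_ rr] h x y bx yr|i].
    by apply: h => //; exact: lt_le_trans yr rr.
  have [d d0 hd'] := unif_cont cO (fun x _ => ci i x) e0; exists d => // x y bx xy; exact: ltW (hd' x y bx xy).
exists (d / 2); first by rewrite divr_gt0.
move=> xb bx; pose G := grad rho xb; have Gp : 0 < enorm G := lt_le_trans c0 (cmin xb bx).
move=> y hy; pose h := y - xb.
have hyd : enorm h < d by rewrite /h; move: (d0) (hy); glra.
have := @c1_expand R N rho xb d G e _ h hyd.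
have H1 : forall y0, enorm (y0 - xb) < d -> forall i, derivable rho y0 (ev i) /\ `|pd i rho y0 - G ord0 i| <= e.
  by move=> y0 hy0 i; split; [exact: dr|rewrite mxE; exact: hd'].
have xh : xb + h = y by rewrite /h addrC subrK.
move=> /(_ H1); rewrite xh (r0 xb bx) subr0 => E.
have E2 : `|rho y - dot G h| <= del * c / 2 * enorm h.
  apply: le_trans E _; apply: le_trans (ler_wpM2l (ltW e0) (l1_le h)) _.
  rewrite mulrA ler_wpM2r ?enorm_ge0 // /e mulrAC ler_pdivrMr ?mulr_gt0 //.
  have := mulr_gt0 del0 c0; have : 0 <= del * c * N%:R by exact: mulr_ge0 (ltW (mulr_gt0 del0 c0)) (ler0n _ _). 
  gnra.
have dn : dot h ((enorm G)^-1 *: G) = dot G h / enorm G by rewrite dotZr dotC mulrC.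
have k2 : del * c * enorm h <= del * enorm h * enorm G.
  by rewrite mulrAC ler_wpM2l ?cmin // mulr_ge0 ?enorm_ge0 // ltW.
rewrite -/h dn; split.
  rewrite mulNr ltrNr -mulNr ltr_pdivlMr // => k1.
  rewrite OE /=; move: E2; rewrite ler_norml; have := mulr_ge0 (ltW (mulr_gt0 del0 c0)) (enorm_ge0 h); move: (k2) (k1); glra.
rewrite ltr_pdivlMr // => k1; rewrite OE /=; apply/negP; rewrite -leNgt.
by move: E2; rewrite ler_norml; have := mulr_ge0 (ltW (mulr_gt0 del0 c0)) (enorm_ge0 h); move: (k2) (k1); glra.
Qed.

(** On a segment from x to a point outside Om, the infimum of the exit times gives a boundary point
    closer than r. *)
Lemma ball_in Om x r : open Om -> Om x -> (forall xb, bdry Om xb -> r < enorm (x - xb)) -> cball x r `<=` Om.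
Proof.
move=> oO Ox h z zr; apply: contrapT => nz.
pose P t := x + t *: (z - x).
pose S := [set t | 0 <= t <= 1 /\ ~ Om (P t)].
have P1 : P 1 = z by rewrite /P scale1r addrC subrK.
have S1 : S 1 by rewrite /S /= P1 ler01 lexx.
have lbS : lbound S 0 by move=> t [/andP []].
have hi : has_inf S by split; [exists 1|exists 0].
pose tau := inf S.
have t0 : 0 <= tau by apply: lb_le_inf => //; exists 1.
have t1 : tau <= 1 by apply: (inf_lbound hi.2).
have dP s t : enorm (P s - P t) = `|s - t| * enorm (z - x).
  by rewrite -enormZ; congr enorm; rewrite /P; apply/rowP => i; rewrite !mxE; ring.
have [E|zx] := eqVneq (enorm (z - x)) 0.
  by apply: nz; have := enorm_eq0 E => /subr0_eq ->.
have zx0 : 0 < enorm (z - x) by rewrite lt_neqAle eq_sym zx enorm_ge0.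
have nOt : ~ Om (P tau).
  move=> Ot; have [q q0 hq] := (openP Om).1 oO _ Ot.
  have [s Ss st] : exists2 s, S s & s < tau + q / enorm (z - x).
    by apply: inf_lt; [exact: hi.1|rewrite ltrDl divr_gt0].
  have [/andP [s0 s1] ns] := Ss.
  apply: ns; apply: hq; rewrite dP ger0_norm; last by rewrite subr_ge0; exact: (inf_lbound hi.2).
  by rewrite -ltr_pdivlMr //; lra.
have bt : bdry Om (P tau).
  split; last by move=> /interior_subset.
  move=> B /nbhs_eballP [q q0 hq].
  have tp : 0 < tau.
    rewrite lt_neqAle t0 andbT; apply/eqP => E; apply: nOt; rewrite -E /P scale0r addr0 //.
  pose s := tau - Num.min tau (q / (2 * enorm (z - x))).
  have [m1 m2] : Num.min tau (q / (2 * enorm (z - x))) <= tau /\ Num.min tau (q / (2 * enorm (z - x))) <= q / (2 * enorm (z - x)) by split; rewrite ge_min lexx ?orbT.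
  have m0 : 0 < Num.min tau (q / (2 * enorm (z - x))) by rewrite lt_min tp divr_gt0 // mulr_gt0.
  have sS : ~ S s by move=> /(inf_lbound hi.2); rewrite -/tau /s; move: (m0); glra.
  exists (P s); split.
    apply: contrapT => ns; apply: sS; split => //; rewrite /s; apply/andP; split; move: (m1) (t1) (m0); glra.
  apply: hq; rewrite dP /s addrC addKr normrN gtr0_norm //.
  by move: m2; rewrite ler_pdivlMr ?mulr_gt0 //; have := mulr_gt0 m0 zx0; glra.
have := h _ bt; rewrite /P opprD addrA subrr add0r enormN enormZ ger0_norm //.
apply/negP; rewrite -leNgt; apply: le_trans (_ : 1 * enorm (z - x) <= r); last by rewrite mul1r.
by rewrite ler_wpM2r // enorm_ge0.
Qed.

(** [barrier] with an exterior ball of radius s centred on the outer normal. The ball is pushed off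
    the tangent plane by t s / 4 so that mere flatness of the boundary makes it exterior. *)
Lemma bdy_small Om t : (0 < N)%N -> open Om -> flat Om -> 0 < t <= 1 -> exists2 s0, 0 < s0 &
  forall (W F : V -> R) M B s xb, 0 < s <= s0 -> 0 <= M -> 0 <= B -> bdry Om xb -> continuous W -> (forall z, ~ Om z -> W z <= 0) ->
   wsol Om W F -> (forall z, Om z -> {for z, continuous F}) ->
   (forall z, enorm (z - xb) <= 5 * s -> Om z -> W z <= M /\ F z <= B) ->
   forall y, enorm (y - xb) <= t / 4 * s -> W y <= 3 * N%:R * (2 * M + B * s ^+ 2 * expR (3 * N%:R)) * t.
Proof.
move=> N0 oO [nuf [nu1 fl]] /andP [t0 t1].
(* Points of the ball are within 3s of xb, where flatness t/12 allows a deviation of t s / 4,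
   exactly the gap left between ball and tangent plane. *)
have [s1 s10 h1] := fl (t / 12) ltac:(by rewrite divr_gt0).
exists (s1 / 3); first by rewrite divr_gt0.
move=> W F M B s xb /andP [s0 ss] M0 B0 bx cW W0 wW cF bd y yx.
have hn := h1 xb bx; have n1 := nu1 xb bx; set nu := nuf xb in hn n1.
have nn : enorm nu = 1 by rewrite enormE n1 sqrtr1.
pose a := xb + ((1 + t / 4) * s) *: nu.
have ax : enorm (a - xb) = (1 + t / 4) * s.
  by rewrite xhx enormZ nn mulr1 ger0_norm // mulr_ge0 ?(ltW s0) //; move: (t0); glra.
have ts : t * s <= s by rewrite ler_piMl // ltW.
have ts0 : 0 < t * s by rewrite mulr_gt0.
apply: (@barrier R N a s Om W F M B) => //.
- move=> z za; apply: bd; have : enorm (z - a) <= 2 * s := za; have := enormBD z a xb; rewrite ax; move: (ts) (ts0); glra.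
- move=> z za; have zx : enorm (z - xb) <= 3 * s by have := enormBD z a xb; rewrite ax; move: (ts) (ts0) (za); glra.
  have [|_] := hn z; first by (move: (ss) (zx); glra).
  apply; have -> : z - xb = (z - a) + ((1 + t / 4) * s) *: nu by rewrite /a; apply/rowP => i; rewrite !mxE; ring.
  rewrite dotDl dotZl -/(sqn nu) n1 mulr1.
  have -> : z - a + ((1 + t / 4) * s) *: nu = z - xb by rewrite /a; apply/rowP => i; rewrite !mxE; ring.
  have : - enorm (z - a) <= dot (z - a) nu by have := CS (z - a) nu; rewrite nn mulr1 ler_norml => /andP [].
  have : t / 12 * enorm (z - xb) <= t / 12 * (3 * s) by rewrite ler_pM2l // divr_gt0.
  move: (za); glra.
- by rewrite (ltW t0) t1.
- have := enormBD y xb a; rewrite (enormB xb a) ax; move: (yx) (ts0); glra.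
Qed.
End Domain.

(* [u n] is [v n] extended by zero, [e n] the length scale [mu_n^(-1/2)]. *)
Record pde_seq (R : realType) (N : nat) (Om : set 'rV[R]_N) (p : R) (u : nat -> 'rV[R]_N -> R) (e : nat -> R) (C0 : R) : Prop := PdeSeq {
  ps_N : (2 < N)%N;
  ps_p : 1 < p;
  ps_pN : p * (N%:R - 2) < N%:R;
  ps_open : open Om;
  ps_bd : exists M, forall x, Om x -> enorm x <= M;
  ps_flat : flat Om;
  ps_cont : forall n, continuous (u n);
  ps_out : forall n x, ~ Om x -> u n x = 0;
  ps_eq : forall n x, Om x -> hlap (u n) x (- ((e n)^-1 ^+ 2 * fp p (u n x)));
  ps_sd : forall n K eta, compact K -> K `<=` Om -> 0 < eta -> exists2 h0 : R, 0 < h0 & forall x h, K x -> 0 < h < h0 ->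
    `|\sum_(i < N) sd (u n) x (h *: ev i) + h ^+ 2 * ((e n)^-1 ^+ 2 * fp p (u n x))| <= eta * h ^+ 2;
  ps_e : forall n, 0 < e n;
  ps_e0 : forall d, 0 < d -> \forall n \near \oo, e n < d;
  ps_mass : forall n, (e n)^-1 ^+ N * intRN (fun x => fp p (u n x)) <= C0 }.

Arguments ps_cont {R N Om p u e C0} _ n x.
Arguments ps_out {R N Om p u e C0} _ n x _.
Arguments ps_eq {R N Om p u e C0} _ n x _.
Arguments ps_sd {R N Om p u e C0} _ n K eta _ _ _.
Arguments ps_e {R N Om p u e C0} _ n.
Arguments ps_mass {R N Om p u e C0} _ n.

(** * Mass of a spike and the uniform bound *)

Section Seq.
Context {R : realType} {N : nat} (Om : set 'rV[R]_N) (p : R) (u : nat -> 'rV[R]_N -> R) (eps : nat -> R) (C0 : R).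
Hypothesis H : pde_seq Om p u eps C0.
Notation V := 'rV[R]_N.
Implicit Types (x y z : V) (n : nat).
Let f := fp p.

Lemma ps_N0 : (0 < N)%N.
Proof. by apply: leq_trans (ps_N H). Qed.
Lemma ps_gf : goodf (fp p).
Proof. exact: goodf_fp (ps_p H). Qed.
Lemma ps_wsol n : wsol Om (u n) (fun x => (eps n)^-1 ^+ 2 * f (u n x)).
Proof. by apply: wsol_hlap => y Oy; split; [exact: (ps_cont H n)|exact: (ps_eq H n)]. Qed.
Lemma ps_cf n : continuous (fun x => f (u n x)).
Proof. by move=> x; have [_ _ _ cf] := ps_gf; apply: (@ct_comp _ _ (u n) f); [exact: (ps_cont H n)|exact: cf]. Qed.
Lemma ps_cF n : continuous (fun x => (eps n)^-1 ^+ 2 * f (u n x)).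
Proof. by move=> x; exact: (ctM (@ctC _ _ ((eps n)^-1 ^+ 2) x) (@ps_cf n x)). Qed.

Lemma ps_ge0 n x : 0 <= u n x.
Proof.
have [Ox|nx] := pselect (Om x); last by rewrite (ps_out H).
have [M hM] := ps_bd H.
have cK := @compact_cball R N 0 (M + 1).
apply: (@minpr0 R N Om _ _ _ ps_N0 (ps_open H) (ps_wsol n) cK) => [y _|y yM uy|].
- exact: (ps_cont H n).
- have Oy : Om y by apply: contrapT => /(ps_out H n) E; move: uy; rewrite E ltxx.
  split=> //; split.
    exists 1 => // z zy; have := hM y Oy; rewrite /cball /= subr0; have := enormD (z - y) y; rewrite subrK; lra.
  by split; [exact: (@ps_cF n y)|rewrite mulr_ge0 ?sqr_ge0 // goodf_ge0 //; exact: ps_gf].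
- by rewrite /cball /= subr0; have := hM x Ox; lra.
Qed.

Lemma ps_cc n : cc (fun x => f (u n x)).
Proof.
split; first exact: ps_cf.
have [M hM] := ps_bd H; exists M => x xM; rewrite (ps_out H) ?/f.
  by have [_ fz _ _] := ps_gf; apply: fz.
by move=> /hM; rewrite leNgt xM.
Qed.

(** A tent replaces the indicator of the unit ball, so that only continuous functions are
    integrated; [T1] takes the place of the volume constant. *)
Definition T1 : R := intRN (fun x : V => Num.max (1 - enorm (x - 0)) 0).
Lemma T1_gt0 : 0 < T1.
Proof.
apply: (int_gt0 (x := 0)); first exact: cc_tent.
  by move=> x; rewrite le_max lexx orbT.
by rewrite subrr enorm0 subr0 lt_max ltr01.
Qed.
Lemma int_tent x r : 0 < r -> intRN (fun y => Num.max (r - enorm (y - x)) 0) = r ^+ N.+1 * T1.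
Proof.
move=> r0; have ri : 0 < r^-1 by rewrite invr_gt0.
have := int_aff (- (r^-1 *: x)) ri (cc_tent (0 : V) 1).
rewrite -/T1 exprVn invrK => E.
rewrite exprS -mulrA -E -(int_Z r (cc_aff _ ri (cc_tent (0 : V) 1))); congr intRN; apply/funext => y.
rewrite subr0 -scalerBr enormZ gtr0_norm // maxr_pMr ?(ltW r0) // mulr0; congr (Num.max _ 0).
by field; rewrite gt_eqF.
Qed.

(** Disjoint tents of height f c under the graph of f(u). *)
Lemma mass_low n k (z : 'I_k -> V) r c : 0 < r -> 1 < c ->
  (forall i j, i != j -> 2 * r <= enorm (z i - z j)) -> (forall i y, enorm (y - z i) <= r -> c <= u n y) ->
  k%:R * (f c * r ^+ N * T1) <= intRN (fun x => f (u n x)).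
Proof.
move=> r0 c1 sep hc.
have [fm _ _ _] := ps_gf.
have fc0 : 0 < f c by rewrite /f /fp pp_gt0 // subr_gt0.
pose F i y := (f c / r) * Num.max (r - enorm (y - z i)) 0.
have cF i : cc (F i) by apply: ccZ; exact: cc_tent.
have [cS iS] := int_sum (index_enum 'I_k) cF.
have -> : k%:R * (f c * r ^+ N * T1) = intRN (fun x => \sum_(i < k) F i x).
  rewrite iS (eq_bigr (fun=> f c * r ^+ N * T1)); last first.
    move=> i _; rewrite int_Z ?int_tent //; last exact: cc_tent.
    by rewrite exprS; field; rewrite gt_eqF.
  by rewrite big_const_ord iter_addr addr0 -[RHS]mulr_natl.
apply: int_le => //; first exact: ps_cc.
move=> x; have F0 i : 0 <= F i x by rewrite mulr_ge0 ?le_max ?lexx ?orbT // divr_ge0 // ltW.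
have [[i ir]|no] := pselect (exists i, enorm (x - z i) < r).
  rewrite (bigD1 i) //= big1 ?addr0; last first.
    move=> j ji; rewrite /F max_r ?mulr0 // subr_le0.
    by have := sep j i ji; have := enormBD (z j) x (z i); rewrite (enormB (z j) x); move: (ir); glra.
  rewrite /F max_l ?subr_ge0 ?(ltW ir) //; apply: le_trans (fm _ _ (hc i x (ltW ir))).
  rewrite mulrAC ler_pdivrMr // ler_pM2l // gerBl; exact: enorm_ge0.
rewrite big1; first by apply: goodf_ge0; exact: ps_gf.
move=> i _; rewrite /F max_r ?mulr0 // subr_le0 leNgt; apply/negP => ir; by apply: no; exists i.
Qed.

Lemma ps_max n : exists m, forall y, u n y <= u n m.
Proof.
have [M hM] := ps_bd H.
have K0 : cball (0 : V) `|M| !=set0 by exists 0; apply: cball_center.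
have [m _ hm] := compact_max K0 (@compact_cball R N 0 `|M|) (fun x _ => ps_cont H n x).
exists m => y; have [Oy|ny] := pselect (Om y); last by rewrite (ps_out H) // ps_ge0.
by apply: hm; rewrite /cball /= subr0; apply: le_trans (hM y Oy) (ler_norm M).
Qed.

Lemma fp_le p' (M : R) : 1 < p' -> 0 <= M -> fp p' M <= powR M p'.
Proof. by move=> p1 M0; rewrite -(pp_pos p' M0); apply: pp_mono; lra. Qed.

(** Let M be the maximum of u and s = eps M^(-(p-1)/2), the scale at which the source is at most M /
    s^2. At this scale the boundary estimate keeps the maximum away from the boundary and the
    gradient estimate gives u >= M/2 on a ball of radius comparable to s. Its mass is of order M^p
    s^N, that is, eps^N M^q with q > 0, and this is bounded by eps^N C0. *)
Lemma sup_bound : exists2 M, 1 <= M & \forall n \near \oo, forall x, u n x <= M.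
Proof.
have p1 := ps_p H; have N0 := ps_N0.
have N1 : 1 <= N%:R :> R by rewrite ler1n.
pose C := 3 * N%:R * (2 + expR (3 * N%:R)) : R.
have e1 : 1 <= expR (3 * N%:R) :> R by rewrite -expR0 ler_expR mulr_ge0 // ler0n.
have C1 : 1 <= C by rewrite /C; nra.
(* Within t s / 4 of the boundary the estimate reads u <= C t M = M/2, which excludes the maximum
   point. *)
pose t := (2 * C)^-1.
have t0 : 0 < t by rewrite invr_gt0; lra.
have t1 : t <= 1 by rewrite invf_le1; lra.
have Ct : C * t = 1 / 2 by rewrite /t; field; lra.
have tt : 0 < t <= 1 by rewrite t0.
have [s0 s00 hs] := bdy_small N0 (ps_open H) (ps_flat H) tt.
(* The radius, in units of s, on which the Lipschitz estimate loses at most M/2. *)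
pose kap := Num.min (t / 16) (1 / (2 * (16 * N%:R / t + t / 32))).
have D0 : 0 < 16 * N%:R / t + t / 32 by rewrite addr_gt0 ?divr_gt0 // mulr_gt0 // ltr0n.
have kap0 : 0 < kap by rewrite lt_min !divr_gt0 // mulr_gt0.
have [k1 k2] : kap <= t / 16 /\ kap <= 1 / (2 * (16 * N%:R / t + t / 32)) by split; rewrite ge_min lexx ?orbT.
(* Equal to (N - p (N-2)) / 2, positive exactly because p < N/(N-2). *)
pose q := p - N%:R * ((p - 1) / 2).
have q0 : 0 < q by have := ps_pN H; rewrite /q; glra.
have T10 := T1_gt0.
pose c1 := kap ^+ N * T1 * powR (4^-1) p.
have c10 : 0 < c1 by rewrite /c1 !mulr_gt0 ?exprn_gt0 ?powR_gt0.
exists (Num.max 4 (powR (`|C0| / c1) q^-1)); first by rewrite le_max; apply/orP; left; glra.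
near=> n => x; have [m hm] := ps_max n; apply: le_trans (hm x) _.
(* Above 4 one has M/2 - 1 >= M/4, so f(M/2) >= (M/4)^p. *)
have [le4|M4] : u n m <= 4 \/ 4 < u n m by case: (lerP (u n m) 4) => h; [left|right].
  by rewrite le_max le4.
rewrite le_max.
set M := u n m in hm M4 *; apply/orP; right.
have M0 : 0 < M by (move: (M4); glra).
have Om_m : Om m by apply: contrapT => /(ps_out H n); rewrite -/M; move: (M0); glra.
pose b := powR M (- ((p - 1) / 2)).
have b0 : 0 < b by exact: powR_gt0.
have b1 : b <= 1.
  have : powR M (- ((p - 1) / 2)) <= powR M 0 by apply: ler_powR; move: (M4) (p1); glra.
  by rewrite powRr0.
pose s := eps n * b.
have s_0 : 0 < s by rewrite mulr_gt0 // (ps_e H).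
have ss : s <= s0.
  apply: le_trans (_ : eps n * 1 <= _); first by rewrite ler_pM2l // (ps_e H).
  rewrite mulr1; apply: ltW; near: n; exact: (ps_e0 H).
pose B := M / s ^+ 2.
have s2 : 0 < s ^+ 2 by rewrite exprn_gt0.
have B0 : 0 <= B by rewrite divr_ge0 // ltW.
have FB z : (eps n)^-1 ^+ 2 * f (u n z) <= B.
  have b2 : b ^+ 2 = powR M (- (p - 1)).
    by rewrite /b -powR_mulrn ?powR_ge0 // -powRrM; congr powR; field.
  have Mb : powR M p * b ^+ 2 = M.
    rewrite b2 -powRD; last by rewrite (gt_eqF M0) /= implybT.
    by rewrite (_ : p + _ = 1) ?powRr1 ?ltW //; ring.
  have fM : f (u n z) <= powR M p.
    have [fm _ _ _] := ps_gf; apply: le_trans (fm _ _ (hm z)) _; exact: fp_le (ltW M0).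
  apply: le_trans (ler_wpM2l (sqr_ge0 _) fM) _.
  rewrite /B /s -[X in _ <= X / _]Mb exprMn exprVn le_eqVlt; apply/orP; left; apply/eqP; field.
  by rewrite !gt_eqF // (ps_e H).
have far xb : bdry Om xb -> t / 4 * s < enorm (m - xb).
  move=> bx; rewrite ltNge; apply/negP => close.
  have := @hs (u n) (fun x => (eps n)^-1 ^+ 2 * f (u n x)) M B s xb.
  rewrite s_0 ss => /(_ isT (ltW M0) B0 bx (ps_cont H n)).
  have o0 z : ~ Om z -> u n z <= 0 by move=> /(ps_out H n) ->.
  move=> /(_ o0 (ps_wsol n) (fun z _ => @ps_cF n z)).
  move=> /(_ (fun z _ _ => conj (hm z) (FB z)) m close); rewrite -/M.
  have -> : B * s ^+ 2 = M by rewrite /B divfK // gt_eqF.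
  have -> : 3 * N%:R * (2 * M + M * expR (3 * N%:R)) * t = M * (C * t) by rewrite /C; ring.
  by rewrite Ct; move: (M0); glra.
have ts0 : 0 < t * s by rewrite mulr_gt0.
have inO : cball m (t / 4 * s) `<=` Om by apply: ball_in (ps_open H) Om_m far.
have low y : enorm (y - m) <= kap * s -> M / 2 <= u n y.
  move=> ym; pose d := t / 16 * s.
  have d0 : 0 < d by rewrite mulr_gt0 // divr_gt0.
  have ks : kap * s <= t / 16 * s by rewrite ler_pM2r.
  have mid : enorm (2^-1 *: (y + m) - m) <= d.
    rewrite (_ : _ - m = 2^-1 *: (y - m)); last by apply/rowP => i; rewrite !mxE; field.
    rewrite enormZ gtr0_norm ?invr_gt0 //; rewrite /d; move: (ts0) (ym) (ks); glra.
  have sub z : cball (2^-1 *: (y + m)) d z -> Om z.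
    by move=> zd; apply: inO; have : enorm (z - _) <= d := zd; have := enormBD z (2^-1 *: (y + m)) m; rewrite /cball /= /d in mid *; move: (ts0) (mid); glra.
  have := @lip_est R N y m Om (u n) (fun x => (eps n)^-1 ^+ 2 * f (u n x)) M B d N0 (ps_open H) (ps_wsol n) d0 sub.
  move=> /(_ (fun z _ => conj (ps_cont H n z) (@ps_cF n z))) L.
  have : `|u n y - u n m| <= enorm (y - m) * (N%:R * M / d + B * d / 2).
    apply: L => [z _|]; last by rewrite /d; move: (ts0) (ym) (ks); glra.
    have f0 : 0 <= f (u n z) by apply: goodf_ge0; exact: ps_gf.
    have F0 : 0 <= (eps n)^-1 ^+ 2 * f (u n z) by exact: mulr_ge0 (sqr_ge0 _) f0.
    by split; rewrite ger0_norm ?ps_ge0.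
  rewrite -/M ler_norml => /andP [low _].
  have E : N%:R * M / d + B * d / 2 = M / s * (16 * N%:R / t + t / 32).
    by rewrite /d /B; field; rewrite !gt_eqF.
  have E2 : enorm (y - m) * (N%:R * M / d + B * d / 2) <= M / 2.
    rewrite E; apply: le_trans (ler_wpM2r _ ym) _; first by rewrite mulr_ge0 ?divr_ge0 // ltW.
    rewrite (_ : kap * s * _ = M * (kap * (16 * N%:R / t + t / 32))); last by field; rewrite !gt_eqF.
    rewrite ler_pM2l //; apply: le_trans (ler_wpM2r (ltW D0) k2) _.
    by rewrite le_eqVlt; apply/orP; left; apply/eqP; field; rewrite !gt_eqF // ?addr_gt0 ?mulr_gt0 ?ltr0n //.
  by move: (low) (E2); glra.
have ks0 : 0 < kap * s by rewrite mulr_gt0.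
have M21 : 1 < M / 2 by (move: (M4); glra).
have := @mass_low n 1 (fun=> m) (kap * s) (M / 2) ks0 M21.
have sep (i j : 'I_1) : i != j -> 2 * (kap * s) <= enorm (m - m) by rewrite !ord1 eqxx.
move=> /(_ sep (fun _ y => low y)); rewrite mul1r => ml.
have en := ps_e H n.
have eN : 0 < (eps n)^-1 ^+ N by rewrite exprn_gt0 // invr_gt0.
have := le_trans (ler_wpM2l (ltW eN) ml) (ps_mass H n).
have fl : powR (4^-1) p * powR M p <= f (M / 2).
  rewrite -powRM ?invr_ge0 // ?(ltW M0) // -pp_pos ?mulr_ge0 ?invr_ge0 ?(ltW M0) //.
  by apply: pp_mono; move: (p1) (M4); glra.
have bN : b ^+ N = powR M (- (N%:R * ((p - 1) / 2))).
  by rewrite /b -powR_mulrn ?powR_ge0 // -powRrM; congr powR; ring.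
have E3 : (eps n)^-1 ^+ N * (f (M / 2) * (kap * s) ^+ N * T1) = kap ^+ N * T1 * (f (M / 2) * b ^+ N).
  by rewrite /s !exprMn exprVn; field; rewrite expf_neq0 // gt_eqF.
rewrite E3 => le1.
have le2 : c1 * powR M q <= C0.
  apply: le_trans le1; rewrite /c1 -!mulrA ler_pM2l ?exprn_gt0 // ler_pM2l // /q powRB //; last by rewrite (gt_eqF M0) implybT.
  rewrite bN powRN; set X := powR M (N%:R * _); have X0 : 0 <= X^-1 by rewrite invr_ge0 powR_ge0.
  by have := ler_wpM2r X0 fl; rewrite -mulrA.
have le3 : powR M q <= `|C0| / c1.
  by rewrite ler_pdivlMr // mulrC; apply: le_trans le2 (ler_norm C0).
have := ge0_ler_powR (_ : 0 <= q^-1) _ _ le3.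
rewrite invr_ge0 (ltW q0) !nnegrE powR_ge0 divr_ge0 ?(ltW c10) // => /(_ isT isT isT).
by rewrite -powRrM mulfV ?gt_eqF // powRr1 // ltW.
Unshelve. all: by end_near. Qed.
End Seq.

(** * Second differences of the test function (1+|y|^2)^(-1/2) *)

Section UnifSd.
Context {R : realType} {N : nat}.
Notation V := 'rV[R]_N.
Implicit Types (u D : V -> R) (x y q : V) (h t eta B : R).

(** A remainder estimate with an explicit constant: uniform control of the oscillation [eta] of the
    second derivative gives uniformity in x. *)
Lemma sd_unif u (D1 D2 : V -> R) x q h eta : 0 < h -> (forall t, `|t| <= h -> hd (fun s => u (x + s *: q)) t (D1 (x + t *: q)) /\
    hd (fun s => D1 (x + s *: q)) t (D2 (x + t *: q)) /\ `|D2 (x + t *: q) - D2 x| <= eta) ->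
  `|sd u x (h *: q) - h ^+ 2 * D2 x| <= 2 * eta * h ^+ 2.
Proof.
move=> h_gt0 H; have h0 := ltW h_gt0; have eta0 : 0 <= eta by have [|_ [_]] := H 0; [rewrite normr0|exact: le_trans (normr_ge0 _)].
have D1e t : `|t| <= h -> `|D1 (x + t *: q) - D1 x - D2 x * t| <= eta * `|t|.
  move=> th; have := @mvt1 R (fun s => D1 (x + s *: q)) (fun s => D2 (x + s *: q)) 0 t (D2 x) eta.
  rewrite scale0r addr0 subr0; apply => s /andP [s1 s2].
  have sh : `|s| <= h.
    apply: le_trans th; move: s1 s2; rewrite /Num.min /Num.max; case: ltP => t0 s1 s2.
      by rewrite !ger0_norm // ?(le_trans s1) // ltW.
    by rewrite !ler0_norm ?lerN2 //.
  by have [_ [h1 h2]] := H s sh.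
pose G t := u (x + t *: q) + u (x + (- t) *: q) - D2 x * t ^+ 2.
have := @mvt1 R G (fun t => D1 (x + t *: q) - D1 (x + (- t) *: q) - D2 x * (2 * t)) 0 h 0 (2 * eta * h).
rewrite /sd /G oppr0 !scale0r !addr0 expr0n /= mulr0 mul0r !subr0 (ger0_norm h0) => L.
have -> : u (x + h *: q) + u (x - h *: q) - 2 * u x - h ^+ 2 * D2 x =
  u (x + h *: q) + u (x + - h *: q) - D2 x * h ^+ 2 - (u x + u x) by rewrite scaleNr; ring.
have -> : 2 * eta * h ^+ 2 = 2 * eta * h * h by ring.
apply: L => s; rewrite /Num.min /Num.max; case: ltP => [_|hle] sh; last first.
  by lra.
have s0 : `|s| <= h by rewrite ger0_norm; move: (sh); glra.
have s0' : `|- s| <= h by rewrite normrN.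
have [d1 _] := H s s0; have [d1' _] := H (- s) s0'; split.
  have d2 := @hd_aff R (fun s => u (x + s *: q)) s (-1) 0 (D1 (x + (- s) *: q)).
  rewrite mulN1r addr0 in d2.
  have := hdB (hdD d1 (d2 d1')) (hdZ (D2 x) (hdM (hd_id s) (hd_id s))).
  move=> d; apply: hd_ext (hd_eq d _); last by ring.
  by exists 1 => // y _; rewrite mulN1r addr0.
rewrite addr0; have := D1e s s0; have := D1e (- s) s0'; rewrite normrN (ger0_norm (_ : 0 <= s)); last by (move: (sh); glra).
rewrite !ler_norml; have : eta * s <= eta * h by rewrite ler_wpM2l //; move: (sh); glra.
glra.
Qed.

Definition psi (k : R) y := powR (1 + sqn y) k.

Lemma psi_gt0 k y : 0 < psi k y.
Proof. by rewrite powR_gt0 // ltr_wpDr ?sqn_ge0. Qed.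

Lemma hd_psi k x q t : hd (fun s => psi k (x + s *: q)) t (2 * k * dot (x + t *: q) q * psi (k - 1) (x + t *: q)).
Proof.
have E s : 1 + sqn (x + s *: q) = 1 + sqn x + 2 * dot x q * s + sqn q * (s * s).
  by rewrite sqnD /sqn !dotE; ring.
have P : 0 < 1 + sqn x + 2 * dot x q * t + sqn q * (t * t) by rewrite -E ltr_wpDr ?sqn_ge0.
have h1 := hdD (hdD (hdC (1 + sqn x) t) (hdZ (2 * dot x q) (hd_id t))) (hdZ (sqn q) (hdM (hd_id t) (hd_id t))).
have := hd_comp h1 (@hd_powR R k _ P) => h2.
apply: hd_ext (hd_eq h2 _); first by exists 1 => // y _; rewrite /psi E.
by rewrite /psi E !dotE -/(sqn q); ring.
Qed.

Lemma ct_psi k x : {for x, continuous (psi k)}.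
Proof.
have P : 0 < 1 + sqn x by rewrite ltr_wpDr ?sqn_ge0.
by apply: (@ct_comp R _ (fun y => 1 + sqn y) (fun t => powR t k)); [exact: ctD (@ctC _ _ 1 x) (@cont_sqn _ _ x)|exact: hd_ct (hd_powR k P)].
Qed.

Definition phi0 := psi (- 2^-1).

Lemma sqn_ev (i : 'I_N) : sqn (ev i : V) = 1.
Proof.
rewrite /sqn /dot (bigD1 i) //= big1 ?addr0; first by rewrite /ev mxE !eqxx mulr1.
by move=> j ji; rewrite /ev mxE eqxx (negbTE ji) mul0r.
Qed.

Lemma dot_ev x (i : 'I_N) : dot x (ev i) = x ord0 i.
Proof.
rewrite /dot (bigD1 i) //= big1 ?addr0; first by rewrite /ev mxE !eqxx mulr1.
by move=> j ji; rewrite /ev mxE eqxx (negbTE ji) mulr0.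
Qed.

(** The Laplacian of (1+|y|^2)^(-1/2) is - (N + (N-3)|y|^2) (1+|y|^2)^(-5/2), at most -
    (1+|y|^2)^(-5/2) because N >= 3. The step h0 is uniform on bounded sets, as the inequality is
    later integrated at a fixed h. *)
Lemma phi0_sd B eta : (2 < N)%N -> 0 < eta -> exists2 h0 : R, 0 < h0 & forall y h, enorm y <= B -> 0 < h < h0 ->
  \sum_(i < N) sd phi0 y (h *: ev i) <= h ^+ 2 * (eta - psi (- (5 / 2)) y).
Proof.
move=> N2 eta0; have N0 : 0 < N%:R :> R by rewrite ltr0n; lia.
pose D1 (i : 'I_N) y : R := - (dot y (ev i)) * psi (- (3 / 2)) y.
pose D2 (i : 'I_N) y : R := - psi (- (3 / 2)) y + 3 * (dot y (ev i) * dot y (ev i)) * psi (- (5 / 2)) y.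
have cD2 i y : {for y, continuous (D2 i)}.
  have h := @cont_dot _ _ (ev i) y.
  have h2 := ctM (ctM (@ctC R V 3 y) (ctM h h)) (@ct_psi (- (5 / 2)) y).
  exact: ctD (ctN (@ct_psi _ y)) h2.
pose e1 := eta / (2 * N%:R).
have e10 : 0 < e1 by rewrite divr_gt0 // mulr_gt0.
have U (i : 'I_N) : exists2 d : R, 0 < d & forall x y, cball (0 : V) B x -> enorm (y - x) < d -> `|D2 i y - D2 i x| < e1.
  by apply: unif_cont e10; [exact: compact_cball|move=> x _; exact: cD2].
have [h0 h00 hU] := @fin_r R N (fun i d => forall x y, cball (0 : V) B x -> enorm (y - x) < d -> `|D2 i y - D2 i x| < e1)
  (fun i r r' rr cl x y xB xy => cl x y xB (lt_le_trans xy (proj2 (andP rr)))) U.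
exists h0 => // y h yB /andP [hp hh].
have E i : `|sd phi0 y (h *: ev i) - h ^+ 2 * D2 i y| <= 2 * e1 * h ^+ 2.
  apply: (@sd_unif phi0 (D1 i) (D2 i) y (ev i) h e1 hp) => t th; split; [|split].
  - apply: hd_eq (hd_psi _ _ _ _) _; rewrite /D1 (_ : - 2^-1 - 1 = - (3 / 2)); last by field.
    by field.
  - have h1 : hd (fun s => - dot (y + s *: ev i) (ev i)) t (- 1).
      apply: hd_ext (hd_eq (hdN (hdD (hdC (dot y (ev i)) t) (hd_id t))) _); last by rewrite add0r.
      by exists 1 => // s _; rewrite !dotE -/(sqn _) sqn_ev mulr1.
    apply: hd_eq (hdM h1 (hd_psi (- (3 / 2)) y (ev i) t)) _.
    rewrite /D2 (_ : - (3 / 2) - 1 = - (5 / 2)); last by field.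
    by field.
  - apply: ltW; apply: hU; first by rewrite /cball /= subr0.
    by rewrite xhx enormZ enormE sqn_ev sqrtr1 mulr1; exact: le_lt_trans hh.
have S : \sum_(i < N) D2 i y <= - psi (- (5 / 2)) y.
  rewrite /D2; under eq_bigr do rewrite -expr2.
  rewrite big_split /= -mulr_suml -mulr_sumr big_const_ord iter_addr addr0 -[_ *+ N]mulr_natl.
  have -> : \sum_(i < N) dot y (ev i) ^+ 2 = sqn y.
    by rewrite /sqn /dot; apply: eq_bigr => i _; rewrite -/(dot _ _) dot_ev expr2.
  have -> : psi (- (3 / 2)) y = (1 + sqn y) * psi (- (5 / 2)) y.
    have P : 0 < 1 + sqn y by rewrite ltr_wpDr ?sqn_ge0.
    rewrite /psi -[X in X * powR _ _]powRr1 ?ltW // -powRD; last by rewrite (gt_eqF P) implybT.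
    by congr powR; field.
  have := psi_gt0 (- (5 / 2)) y; have := sqn_ge0 y; set P := psi _ y; set s := sqn y => s0 P0.
  have N3 : 3 <= N%:R :> R by rewrite ler_nat.
  have : 0 <= s * P * (N%:R - 3) by rewrite mulr_ge0 ?mulr_ge0 ?subr_ge0 // ltW.
  have : 3 * P <= N%:R * P by rewrite ler_pM2r.
  move: (P0); gnra.
have S1 : \sum_(i < N) sd phi0 y (h *: ev i) <= \sum_(i < N) (h ^+ 2 * D2 i y + 2 * e1 * h ^+ 2).
  by apply: ler_sum => i _; have := E i; rewrite ler_norml => /andP [_]; glra.
apply: le_trans S1 _; rewrite big_split /= -mulr_sumr big_const_ord iter_addr addr0 -[_ *+ N]mulr_natl.
have -> : N%:R * (2 * e1 * h ^+ 2) = eta * h ^+ 2 by rewrite /e1; field; rewrite gt_eqF.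
have : h ^+ 2 * \sum_(i < N) D2 i y <= h ^+ 2 * - psi (- (5 / 2)) y by rewrite ler_wpM2l ?sqr_ge0.
by rewrite mulrBr mulrN [eta * _]mulrC; glra.
Qed.
End UnifSd.
Section Capacity.
Context {R : realType} {N : nat} (Om : set 'rV[R]_N) (p : R) (u : nat -> 'rV[R]_N -> R) (eps : nat -> R) (C0 : R).
Hypothesis H : pde_seq Om p u eps C0.
Notation V := 'rV[R]_N.
Implicit Types (x y z : V) (n : nat).
Let f := fp p.
Let N0 := ps_N0 H.

Lemma ct_resc (g : V -> R) (s : R) (x0 : V) : 0 < s -> continuous g -> continuous (fun y => g (s *: y + x0)).
Proof.
move=> s0 cg y; apply: (@ct_lip _ _ g (fun y => s *: y + x0) s) (cg _) => z.
by rewrite opprD addrACA subrr addr0 -scalerBr enormZ gtr0_norm.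
Qed.

(** A discrete Kato inequality: truncation from below does not decrease second differences where w
    >= a, and makes them nonnegative elsewhere. *)
Lemma sd_max (w : V -> R) (a : R) x h : sd (fun y => Num.max (w y - a) 0) x h >= (if a <= w x then sd w x h else 0).
Proof.
have m0 (t : R) : 0 <= Num.max t 0 by rewrite le_max lexx orbT.
have mt (t : R) : t <= Num.max t 0 by rewrite le_max lexx.
have [ax|ax] : a <= w x \/ w x < a by case: (lerP a (w x)) => hh; [left|right].
  rewrite ax /sd.
  have E : Num.max (w x - a) 0 = w x - a by rewrite max_l // subr_ge0.
  by rewrite E; have := mt (w (x + h) - a); have := mt (w (x - h) - a); lra.
have E : Num.max (w x - a) 0 = 0 by rewrite max_r // subr_le0 ltW.
have -> : (a <= w x) = false by apply/negbTE; rewrite -ltNge.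
rewrite /sd E; have := m0 (w (x + h) - a); have := m0 (w (x - h) - a); lra.
Qed.

Lemma ps_Rbd : exists2 B, 0 <= B & forall x, Om x -> enorm x <= B.
Proof.
have [B hB] := ps_bd H; exists `|B| => // x /hB h; exact: le_trans h (ler_norm _).
Qed.

(* [- lap] tested against the superharmonic function [(1+|y|^2)^(-1/2)] centred at [x0], at scale [s]. *)
Lemma capacity n x0 s a : 0 < s -> 0 < a <= 1 ->
  intRN (fun y => psi (- (5 / 2)) y * Num.max (u n (s *: y + x0) - a) 0) <= (s / eps n) ^+ 2 * ((eps n / s) ^+ N * C0).
Proof.
move=> s0 /andP [a0 a1]; pose U y := u n (s *: y + x0); pose b y := Num.max (U y - a) 0.
have e0 := ps_e H n.
have cU : continuous U by exact: ct_resc s0 (ps_cont H n).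
have [B0 B00 hB0] := ps_Rbd; pose B := (B0 + enorm x0) / s.
have U0 y : B < enorm y -> U y = 0.
  move=> By; apply: (ps_out H) => /hB0; apply/negP; rewrite -ltNge.
  have : enorm (s *: y) <= enorm (s *: y + x0) + enorm (- x0).
    by have := enormD (s *: y + x0) (- x0); rewrite addrK.
  move: By; rewrite /B ltr_pdivrMr // enormZ enormN gtr0_norm // [_ * s]mulrC; lra.
have cb : cc b.
  split; first by move=> x; exact: ct_max (ctB (cU x) (@ctC _ _ a x)) (@ctC _ _ 0 x).
  by exists B => x /U0 U0x; rewrite /b U0x max_r //; lra.
have b0 y : 0 <= b y by rewrite le_max lexx orbT.
have [B' hB'] : exists B', forall y, b y != 0 -> enorm y <= B'.
  exists B => y; apply: contraR; rewrite -ltNge => /U0 U0y; rewrite /b U0y max_r //; lra.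
(* At least 1 wherever b is positive and of compact support; it carries the o(h^2) error of the
   equation through the integration. *)
pose chi y := Num.max (B + 1 - enorm (y - 0)) 0.
have cchi : cc chi by exact: cc_tent.
have chi0 y : 0 <= chi y by rewrite le_max lexx orbT.
have cfU : cc (fun y => f (U y)) by exact: (cc_aff x0 s0 (ps_cc H n)).
have f0 t : 0 <= f t by apply: goodf_ge0; exact: ps_gf H.
set kap := (s / eps n) ^+ 2.
have kap0 : 0 <= kap by exact: sqr_ge0.
have IU : intRN (fun y => f (U y)) <= (eps n / s) ^+ N * C0.
  have -> : intRN (fun y => f (U y)) = (s ^+ N)^-1 * intRN (fun x => f (u n x)).
    exact: (int_aff x0 s0 (ps_cc H n)).
  have m := ps_mass H n; have eN : eps n ^+ N != 0 by rewrite expf_neq0 // gt_eqF.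
  have -> : (s ^+ N)^-1 * intRN (fun x => f (u n x)) = (eps n / s) ^+ N * ((eps n)^-1 ^+ N * intRN (fun x => f (u n x))).
    by rewrite exprMn !exprVn; field; rewrite eN expf_neq0 // gt_eqF.
  by rewrite ler_wpM2l // exprn_ge0 // divr_ge0 // ltW.
have phi1 y : 0 <= phi0 y <= 1.
  rewrite /phi0 /psi powR_ge0 /= powRN invf_le1 ?powR_gt0 ?ltr_wpDr ?sqn_ge0 //.
  have : powR 1 2^-1 <= powR (1 + sqn y) 2^-1.
    by apply: ge0_ler_powR; rewrite ?invr_ge0 ?nnegrE // ?ler_wpDr ?sqn_ge0 // addr_ge0 ?sqn_ge0.
  by rewrite powR1.
have cpsi : continuous (psi (N := N) (- (5 / 2)) : V -> R) by move=> y; exact: ct_psi.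
have cphi : continuous (phi0 : V -> R) by move=> y; exact: ct_psi.
(* The inequality is proved with an error proportional to [eta], which comes from a fixed finite
   step h; then eta tends to 0. *)
suff key eta : 0 < eta -> intRN (fun y => psi (- (5 / 2)) y * b y) <= kap * intRN (fun y => f (U y)) + eta * (intRN b + intRN chi).
  have Ib : 0 <= intRN b + intRN chi by rewrite addr_ge0 // int_ge0.
  apply: le_trans (ler_wpM2l kap0 IU).
  apply/ler_addgt0Pr => e' e'0.
  have := key (e' / (intRN b + intRN chi + 1)); rewrite divr_gt0 ?ltr_wpDl // => /(_ isT) k.
  apply: le_trans k _; rewrite lerD2l mulrAC ler_pdivrMr ?ltr_wpDl // ler_wpM2l ?(ltW e'0) //; glra.
move=> eta0.
(* Truncation at a positive level confines the use of the equation to a compact subset of Om, where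
   [ps_sd] is uniform. *)
pose K := [set x | a <= u n x].
have KOm : K `<=` Om.
  by move=> x ax; apply: contrapT => /(ps_out H n) z; have : a <= u n x := ax; rewrite z; lra.
have cK : compact K.
  apply: closed_bounded_compact.
    have -> : K = (u n) @^-1` [set t | a <= t] by [].
    by apply: closed_comp; [move=> x _; exact: ps_cont H n x|exact: closed_ge].
  by exists B0 => x /KOm /hB0.
have es0 : 0 < eta / s ^+ 2 by rewrite divr_gt0 // exprn_gt0.
have [h1 h10 hsd] := ps_sd H n K _ cK KOm es0.
have [h2 h20 hphi] := @phi0_sd R N B' eta (ps_N H) eta0.
pose h := Num.min (h1 / s) h2 / 2.
have [m1 m2] : Num.min (h1 / s) h2 <= h1 / s /\ Num.min (h1 / s) h2 <= h2 by split; rewrite ge_min lexx ?orbT.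
have m0 : 0 < Num.min (h1 / s) h2 by rewrite lt_min h20 divr_gt0.
have h0 : 0 < h by rewrite /h divr_gt0.
have hlt1 : h < h1 / s by rewrite /h; move: (m1) (m0); glra.
have hlt2 : 0 < h < h2 by rewrite h0 /h; move: (m2) (m0); glra.
have sdb y : \sum_(i < N) sd b y (h *: ev i) >= - (h ^+ 2 * (kap * f (U y) + eta * chi y)).
  have [ay|ya] : a <= U y \/ U y < a by case: (lerP a (U y)) => hh; [left|right].
    have sU (i : 'I_N) : sd U y (h *: ev i) = sd (u n) (s *: y + x0) ((s * h) *: ev i).
      by rewrite /sd /U !scalerDr scalerN scalerA -!addrA [x0 + _]addrC [x0 - _]addrC.
    have S1 : \sum_(i < N) sd U y (h *: ev i) <= \sum_(i < N) sd b y (h *: ev i).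
      by apply: ler_sum => i _; have := sd_max U a y (h *: ev i); rewrite ay.
    apply: le_trans S1; under eq_bigr do rewrite sU.
    have shh : 0 < s * h < h1 by rewrite mulr_gt0 //= -ltr_pdivlMl // mulrC.
    have := hsd (s *: y + x0) (s * h) ay shh; rewrite -/f -/(U y) ler_norml => /andP [lo _].
    have chi1 : 1 <= chi y.
      rewrite /chi subr0 le_max; apply/orP; left.
      have : enorm y <= B by rewrite leNgt; apply/negP => /U0 z; move: ay; rewrite z; move: (a0); glra.
      by glra.
    have E1 : eta / s ^+ 2 * (s * h) ^+ 2 = eta * h ^+ 2 by field; rewrite gt_eqF.
    have E2 : (s * h) ^+ 2 * ((eps n)^-1 ^+ 2 * f (U y)) = h ^+ 2 * (kap * f (U y)) by rewrite /kap; ring.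
    rewrite E1 E2 in lo.
    have : eta * h ^+ 2 <= h ^+ 2 * (eta * chi y) by rewrite [h ^+ 2 * (eta * _)]mulrCA ler_pM2l // ler_peMr // sqr_ge0.
    by rewrite mulrDr; move: (lo); glra.
  apply: le_trans (_ : 0 <= _).
    by rewrite oppr_le0 mulr_ge0 ?sqr_ge0 // addr_ge0 // mulr_ge0 // ltW.
  by apply: sumr_ge0 => i _; have := sd_max U a y (h *: ev i); have -> : (a <= U y) = false by apply/negbTE; rewrite -ltNge.
have csdb (i : 'I_N) : cc (sd b ^~ (h *: ev i)).
  have h1' := cc_shift (h *: ev i) cb; have h2' := cc_shift (- (h *: ev i)) cb.
  have E : (fun y => (b (y + h *: ev i) + b (y - h *: ev i)) + (-2) * b y) = sd b ^~ (h *: ev i).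
    by apply/funext => y; rewrite /sd; ring.
  by rewrite -E; exact: ccD (ccD h1' h2') (ccZ _ cb).
have csp (i : 'I_N) : continuous (sd phi0 ^~ (h *: ev i) : V -> R).
  move=> y; have c1 := @ct_resc phi0 1 (h *: ev i) ltr01 cphi y; have c2 := @ct_resc phi0 1 (- (h *: ev i)) ltr01 cphi y.
  have E : (fun y : V => (phi0 (1 *: y + h *: ev i) + phi0 (1 *: y + (- (h *: ev i)))) - 2 * phi0 y) = sd phi0 ^~ (h *: ev i).
    by apply/funext => z; rewrite /sd !scale1r.
  by rewrite -E; exact: ctB (ctD c1 c2) (ctM (@ctC _ _ 2 y) (cphi y)).
have [c1 I1] := int_sum (index_enum 'I_N) (fun i => ccM cphi (csdb i)).
have [c2 I2] := int_sum (index_enum 'I_N) (fun i => ccM (csp i) cb).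
(* Both sides are now integrals at the same step h, and the second difference has moved from b to
   [phi0]. *)
have I12 : intRN (fun x => \sum_(i < N) phi0 x * sd b x (h *: ev i)) = intRN (fun x => \sum_(i < N) sd phi0 x (h *: ev i) * b x).
  by rewrite I1 I2; apply: eq_bigr => i _; exact: int_sd cphi cb.
have cR1 : cc (fun y => kap * f (U y) + eta * chi y) by exact: ccD (ccZ _ cfU) (ccZ _ cchi).
have L1 : - (h ^+ 2 * intRN (fun y => kap * f (U y) + eta * chi y)) <= intRN (fun x => \sum_(i < N) phi0 x * sd b x (h *: ev i)).
  rewrite -mulNr -int_Z //; apply: int_le => // [|y]; first exact: ccZ.
  have := sdb y; have /andP [p0 p1] := phi1 y; rewrite -mulr_sumr; set S := \sum_(i < N) _ => s1.
  have X0 : 0 <= h ^+ 2 * (kap * f (U y) + eta * chi y).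
    by rewrite mulr_ge0 ?sqr_ge0 // addr_ge0 // mulr_ge0 // ltW.
  by rewrite mulNr; move: X0 s1; set X := h ^+ 2 * _ => X0 s1; move: (p0) (p1) (X0) (s1); gnra.
have cR2 : cc (fun y => eta * b y + - 1 * (psi (- (5 / 2)) y * b y)) by exact: ccD (ccZ _ cb) (ccZ _ (ccM cpsi cb)).
have L2 : intRN (fun x => \sum_(i < N) sd phi0 x (h *: ev i) * b x) <= h ^+ 2 * intRN (fun y => eta * b y + - 1 * (psi (- (5 / 2)) y * b y)).
  rewrite -int_Z //; apply: int_le => // [|y]; first exact: ccZ.
  rewrite -mulr_suml; have [->|/hB' yB] := eqVneq (b y) 0; first by rewrite !mulr0 addr0 mulr0.
  apply: le_trans (ler_wpM2r (b0 y) (hphi y h yB hlt2)) _.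
  by rewrite le_eqVlt; apply/orP; left; apply/eqP; ring.
have h2p : 0 < h ^+ 2 by rewrite exprn_gt0.
have := le_trans L1 (eq_ind _ (fun t => t <= _) L2 _ (esym I12)).
rewrite -mulrN ler_pM2l //.
have -> : intRN (fun y => kap * f (U y) + eta * chi y) = kap * intRN (fun y => f (U y)) + eta * intRN chi.
  by rewrite (int_D (ccZ kap cfU) (ccZ eta cchi)) (int_Z kap cfU) (int_Z eta cchi).
have -> : intRN (fun y => eta * b y + - 1 * (psi (- (5 / 2)) y * b y)) = eta * intRN b + - 1 * intRN (fun y => psi (- (5 / 2)) y * b y).
  by rewrite (int_D (ccZ eta cb) (ccZ (-1) (ccM cpsi cb))) (int_Z eta cb) (int_Z (-1) (ccM cpsi cb)).
by glra.
Qed.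
End Capacity.

Lemma nearI2 (P Q S : nat -> Prop) : (\forall n \near \oo, P n) -> (\forall n \near \oo, Q n) ->
  (forall n, P n -> Q n -> S n) -> \forall n \near \oo, S n.
Proof. by move=> hP hQ hS; near=> n; apply: hS; near: n. Unshelve. all: by end_near. Qed.

(** * From small positive levels to levels above 1 *)

Section Peaks.
Context {R : realType} {N : nat} (Om : set 'rV[R]_N) (p : R) (u : nat -> 'rV[R]_N -> R) (eps : nat -> R) (C0 : R).
Hypothesis H : pde_seq Om p u eps C0.
Notation V := 'rV[R]_N.
Implicit Types (x y z : V) (n : nat).
Let f := fp p.
Let N0 := ps_N0 H.

Lemma f_ge0 t : 0 <= f t.
Proof. by apply: goodf_ge0; exact: ps_gf H. Qed.

Lemma f_mono s t : s <= t -> f s <= f t.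
Proof. by have [m _ _ _] := ps_gf H; exact: m. Qed.

Lemma inner_lip n x y (d M B : R) : 0 < d -> cball (2^-1 *: (x + y)) (d * eps n) `<=` Om ->
  (forall z, cball (2^-1 *: (x + y)) (d * eps n) z -> u n z <= M /\ f (u n z) <= B) -> enorm (x - y) <= 2 * d * eps n ->
  `|u n x - u n y| <= enorm (x - y) / eps n * (N%:R * M / d + B * d / 2).
Proof.
move=> d0 sub bd xy; have e0 := ps_e H n; have de0 : 0 < d * eps n by rewrite mulr_gt0.
have := @lip_est R N x y Om (u n) (fun x => (eps n)^-1 ^+ 2 * f (u n x)) M (B / eps n ^+ 2) (d * eps n) N0 (ps_open H) (@ps_wsol _ _ _ _ _ _ _ H n) de0 sub.
move=> /(_ (fun z _ => conj (ps_cont H n z) (@ps_cF _ _ _ _ _ _ _ H n z))) L.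
have -> : enorm (x - y) / eps n * (N%:R * M / d + B * d / 2) = enorm (x - y) * (N%:R * M / (d * eps n) + B / eps n ^+ 2 * (d * eps n) / 2).
  by field; rewrite !gt_eqF.
apply: L => [z /bd [uM fB]|]; last by rewrite mulrA.
have F0 : 0 <= (eps n)^-1 ^+ 2 * f (u n z) by exact: mulr_ge0 (sqr_ge0 _) (f_ge0 _).
split; first by rewrite ger0_norm // (ps_ge0 H).
by rewrite ger0_norm // mulrC exprVn ler_pM2r // invr_gt0 exprn_gt0.
Qed.

Lemma bdy_eps (t K : R) : 0 < t <= 1 -> 0 < K -> \forall n \near \oo, forall xb (M B : R), bdry Om xb -> 0 <= M -> 0 <= B ->
  (forall z, enorm (z - xb) <= 5 * K * eps n -> Om z -> u n z <= M /\ f (u n z) <= B) ->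
  forall y, enorm (y - xb) <= t / 4 * K * eps n -> u n y <= 3 * N%:R * (2 * M + B * K ^+ 2 * expR (3 * N%:R)) * t.
Proof.
move=> tt K0; have [s0 s00 hs] := bdy_small N0 (ps_open H) (ps_flat H) tt.
have := ps_e0 H (divr_gt0 s00 K0); apply: filterS => n en xb M B bx M0 B0 bd y yx.
have e0 := ps_e H n; have Ke0 : 0 < K * eps n by rewrite mulr_gt0.
have := @hs (u n) (fun x => (eps n)^-1 ^+ 2 * f (u n x)) M (B / eps n ^+ 2) (K * eps n) xb.
have le0 : K * eps n <= s0 by rewrite mulrC -ler_pdivlMr // ltW.
have Be0 : 0 <= B / eps n ^+ 2 by rewrite divr_ge0 ?sqr_ge0.
rewrite Ke0 le0 => /(_ isT M0 Be0 bx (ps_cont H n)).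
have o0 z : ~ Om z -> u n z <= 0 by move=> /(ps_out H n) ->.
move=> /(_ o0 (@ps_wsol _ _ _ _ _ _ _ H n) (fun z _ => @ps_cF _ _ _ _ _ _ _ H n z)).
have -> : B / eps n ^+ 2 * (K * eps n) ^+ 2 = B * K ^+ 2 by field; rewrite gt_eqF.
apply; last by rewrite mulrA.
move=> z zx /(bd _ _) [|uM fB]; first by move: zx; rewrite mulrA.
by split=> //; rewrite mulrC exprVn ler_pM2r // invr_gt0 exprn_gt0.
Qed.

Lemma C0_ge0 : 0 <= C0.
Proof.
apply: le_trans (ps_mass H 0); apply: mulr_ge0; last by apply: int_ge0 => x; exact: f_ge0.
by rewrite exprn_ge0 // invr_ge0 ltW // (ps_e H).
Qed.

(* a large ball on which [u >= theta/2] would need too much mass, by [capacity] *)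
Lemma plateau (th : R) : 0 < th <= 1 -> exists2 K : R, 1 <= K & forall n x0,
  (forall y, enorm (y - x0) <= K * eps n -> th / 2 <= u n y) -> False.
Proof.
move=> /andP [th0 th1]; pose c5 : R := powR 2 (- (5 / 2)).
have c50 : 0 < c5 by rewrite powR_gt0.
have T0 : 0 < @T1 R N := T1_gt0.
have q0 : 0 < th / 4 * c5 * @T1 R N by rewrite !mulr_gt0 // divr_gt0.
(* Makes C0 / K smaller than the lower bound th/4 * c5 * T1, where [c5] is the least value of
   (1+|y|^2)^(-5/2) on the unit ball. *)
pose K := 1 + C0 / (th / 4 * c5 * @T1 R N).
have K1 : 1 <= K by rewrite /K lerDl divr_ge0 ?C0_ge0 // ltW.
have K0 : 0 < K by lra.
exists K => // n x0 low; have e0 := ps_e H n; have s0 : 0 < K * eps n by rewrite mulr_gt0.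
have ath : 0 < th / 4 <= 1 by lra.
have := capacity H n x0 s0 ath; set b := (fun y => _).
have cU : continuous (fun y => u n ((K * eps n) *: y + x0)) by exact: ct_resc s0 (ps_cont H n).
have [B0 B00 hB0] := ps_Rbd H.
have cb : cc b.
  apply: ccM; first by move=> y; exact: ct_psi.
  split; first by move=> x; exact: ct_max (ctB (cU x) (@ctC _ _ (th / 4) x)) (@ctC _ _ 0 x).
  exists ((B0 + enorm x0) / (K * eps n)) => y By; rewrite (ps_out H) ?max_r //; first by (move: (ath); glra).
  move=> /hB0; apply/negP; rewrite -ltNge.
  have := enormD ((K * eps n) *: y + x0) (- x0); rewrite addrK enormN enormZ gtr0_norm //.
  by move: By; rewrite ltr_pdivrMr // [_ * (K * eps n)]mulrC; glra.
have lowb : th / 4 * c5 * @T1 R N <= intRN b.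
  rewrite /T1 -int_Z; last exact: cc_tent.
  apply: int_le => // [|y]; first by apply: ccZ; exact: cc_tent.
  have m0 : 0 <= Num.max (u n ((K * eps n) *: y + x0) - th / 4) 0 by rewrite le_max lexx orbT.
  rewrite subr0; have [y1|y1] : 1 <= enorm y \/ enorm y < 1 by case: (lerP 1 (enorm y)) => hh; [left|right].
    by rewrite max_r ?subr_le0 // mulr0 /b mulr_ge0 // ltW // psi_gt0.
  rewrite max_l ?subr_ge0 ?(ltW y1) //.
  have bt : th / 4 <= Num.max (u n ((K * eps n) *: y + x0) - th / 4) 0.
    rewrite le_max; apply/orP; left; have : th / 2 <= u n ((K * eps n) *: y + x0); last by glra.
    by apply: low; rewrite addrK enormZ gtr0_norm // ler_piMr // ltW.
  have c5b : c5 <= psi (- (5 / 2)) y.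
    rewrite /c5 /psi !powRN lef_pV2 ?posrE ?powR_gt0 // ?ltr_wpDr ?sqn_ge0 //.
    have sy : sqn y <= 1 by rewrite -enorm2 expr_le1 ?enorm_ge0 // ltW.
    apply: ge0_ler_powR; rewrite ?nnegrE ?divr_ge0 //; have := sqn_ge0 y; move: (sy); glra.
  apply: le_trans (_ : th / 4 * c5 * 1 <= _).
    by rewrite ler_wpM2l ?mulr_ge0 ?divr_ge0 ?(ltW c50) ?(ltW th0) //; have := enorm_ge0 y; glra.
  by rewrite mulr1 /b mulrC ler_pM ?(ltW c50) // divr_ge0 // ltW.
move=> up; have := le_trans lowb up.
have -> : K * eps n / eps n = K by rewrite mulfK // gt_eqF.
have -> : eps n / (K * eps n) = K^-1 by field; rewrite !gt_eqF.
have N3 := ps_N H.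
(* Here N >= 3 enters: K^2 K^(-N) <= 1/K for K >= 1. *)
have KN : K ^+ 2 * (K^-1 ^+ N * C0) <= C0 / K.
  have -> : K^-1 ^+ N = (K ^+ 2)^-1 * (K^-1 * K^-1 ^+ (N - 3)).
    rewrite -{1}(subnK N3) exprD [LHS]mulrC mulrA; congr (_ * _).
    by field; rewrite gt_eqF.
  have -> : K ^+ 2 * ((K ^+ 2)^-1 * (K^-1 * K^-1 ^+ (N - 3)) * C0) = C0 / K * K^-1 ^+ (N - 3).
    by field; rewrite gt_eqF.
  by rewrite ler_piMr ?divr_ge0 ?C0_ge0 ?(ltW K0) // exprn_ile1 ?invr_ge0 ?(ltW K0) // invf_le1.
move=> /le_trans /(_ KN); rewrite ler_pdivlMr // /K mulrDr mulr1 [_ * (C0 / _)]mulrC divfK ?gt_eqF //; move: (q0); glra.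
Qed.

(** If u < 1 + sg on a large ball about x0, the source is tiny there. Near the boundary this makes u
    x0 smaller than th by the boundary estimate; away from it u varies by at most th/2 on a ball of
    radius K1 eps, contradicting [plateau]. *)
Lemma peak (th : R) : 0 < th <= 1 -> exists K sg : R, [/\ 0 < K, 0 < sg & \forall n \near \oo, forall x0, th <= u n x0 ->
  exists2 x, enorm (x - x0) <= K * eps n & 1 + sg <= u n x].
Proof.
move=> tt; have /andP [th0 th1] := tt.
have [M M1 hM] := sup_bound H; have [K1 K11 hK1] := plateau tt.
have N1 : 1 <= N%:R :> R by rewrite ler1n.
pose C : R := 3 * N%:R * (2 * M + 1).
have C1 : 1 <= C by rewrite /C; nra.
pose t := th / (2 * C).
have t0 : 0 < t by rewrite divr_gt0 // mulr_gt0 //; lra.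
have Ct : C * t = th / 2 by rewrite /t; field; lra.
have t1 : t <= 1 by rewrite /t ler_pdivrMr; move: (C1) (th1); glra.
(* The radius used in the gradient estimate: the contribution K1 N M / rho of the sup norm becomes
   th/4. *)
pose rho := 4 * K1 * N%:R * M / th.
have MN : 1 <= N%:R * M by nra.
have rK : K1 <= rho by rewrite /rho ler_pdivlMr //; move: (K11) (MN) (th1); gnra.
have r0 : 0 < rho by (move: (K11) (rK); glra).
(* The boundary estimate at scale K' eps controls distances up to t/4 * K' eps, which has to reach
   (K1 + rho) eps. *)
pose K' := 4 * (K1 + rho) / t.
have K'0 : 0 < K' by rewrite divr_gt0 //; move: (K11) (r0); glra.
have tK' : t / 4 * K' = K1 + rho by rewrite /K'; field; rewrite gt_eqF.
have K'b : K1 + rho <= K' by rewrite -tK'; move: (t1) (K'0); gnra.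
(* Admissible size of the source: the first term makes its share of the gradient estimate at most
   th/4, the second makes its share of the boundary estimate at most 1. *)
pose e2 := Num.min (th / (2 * K1 * rho)) (1 / (K' ^+ 2 * expR (3 * N%:R))).
have d1 : 0 < 2 * K1 * rho by apply: mulr_gt0 => //; move: (K11); glra.
have d2 : 0 < K' ^+ 2 * expR (3 * N%:R) by rewrite mulr_gt0 ?expR_gt0 ?exprn_gt0.
have e20 : 0 < e2 by rewrite lt_min !divr_gt0.
have [m1 m2] : e2 <= th / (2 * K1 * rho) /\ e2 <= 1 / (K' ^+ 2 * expR (3 * N%:R)) by split; rewrite ge_min lexx ?orbT.
have tt1 : 0 < t <= 1 by rewrite t0.
have [sg sg0 hsg] := @pp_small R p e2 (lt_trans ltr01 (ps_p H)) e20.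
suff main : \forall n \near \oo, forall x0, th <= u n x0 -> exists2 x, enorm (x - x0) <= 6 * K' * eps n & 1 + sg <= u n x.
  by exists (6 * K'), sg; split => //; move: (K'0); glra.
apply: nearI2 hM (bdy_eps tt1 K'0) _ => n uM bn x0 ux0; apply: contrapT => no.
have e0 := ps_e H n.
have fs z : enorm (z - x0) <= 6 * K' * eps n -> f (u n z) <= e2.
  move=> zx; rewrite /f /fp; apply: hsg; rewrite lerBlDl leNgt; apply/negP => h; apply: no.
  by exists z => //; exact: ltW.
have ux : Om x0 by apply: contrapT => /(ps_out H n) z; move: ux0; rewrite z; move: (th0); glra.
have far xb : bdry Om xb -> (K1 + rho) * eps n < enorm (x0 - xb).
  move=> bx; rewrite ltNge; apply/negP; rewrite -tK' => close.
  have M0 : 0 <= M by (move: (M1); glra).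
  have bd z : enorm (z - xb) <= 5 * K' * eps n -> Om z -> u n z <= M /\ f (u n z) <= e2.
    move=> zx _; split => //; apply: fs; have := enormBD z xb x0; rewrite [enorm (xb - x0)]enormB.
    have : (K1 + rho) * eps n <= K' * eps n by rewrite ler_pM2r.
    by move: close; rewrite tK'; move: (zx); glra.
  have : u n x0 <= 3 * N%:R * (2 * M + e2 * K' ^+ 2 * expR (3 * N%:R)) * t.
    exact: bn bx M0 (ltW e20) bd _ close.
  have : e2 * K' ^+ 2 * expR (3 * N%:R) <= 1.
    by rewrite -mulrA -(ler_pdivlMr _ _ d2).
  move=> le1; have : 3 * N%:R * (2 * M + e2 * K' ^+ 2 * expR (3 * N%:R)) * t <= C * t.
    by rewrite ler_pM2r // ler_pM2l ?lerD2l // mulr_gt0 //; move: (N1); glra.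
  by rewrite Ct; move: (ux0) (th0); glra.
have inO : cball x0 ((K1 + rho) * eps n) `<=` Om by apply: ball_in (ps_open H) ux far.
apply: (hK1 n x0) => y yx.
have mid z : cball (2^-1 *: (x0 + y)) (rho * eps n) z -> enorm (z - x0) <= (K1 + rho) * eps n.
  move=> zm; have := enormBD z (2^-1 *: (x0 + y)) x0; have : enorm (z - _) <= _ := zm.
  rewrite (_ : 2^-1 *: (x0 + y) - x0 = 2^-1 *: (y - x0)); last by apply/rowP => i; rewrite !mxE; field.
  by rewrite enormZ gtr0_norm ?invr_gt0 //; have := enorm_ge0 (y - x0); move: (yx); glra.
have := @inner_lip n x0 y rho M e2 r0 (fun z zm => inO z (mid z zm)).
have bd z : cball (2^-1 *: (x0 + y)) (rho * eps n) z -> u n z <= M /\ f (u n z) <= e2.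
  move=> /mid zm; split => //; apply: fs; apply: le_trans zm _; rewrite ler_pM2r //; move: (K'0) (K'b); glra.
have Kr : K1 * eps n <= rho * eps n by rewrite ler_pM2r.
have rr0 : 0 <= rho * eps n by rewrite mulr_ge0 ?ltW.
have xy2 : enorm (x0 - y) <= 2 * rho * eps n by rewrite enormB; move: (yx) (Kr) (rr0); glra.
move=> /(_ bd xy2); rewrite ler_norml => /andP [_].
have le1 : enorm (x0 - y) / eps n <= K1 by rewrite ler_pdivrMr // enormB.
have G0 : 0 <= N%:R * M / rho + e2 * rho / 2 by exact: addr_ge0 (divr_ge0 (mulr_ge0 (ler0n _ _) (le_trans ler01 M1)) (ltW r0)) (divr_ge0 (mulr_ge0 (ltW e20) (ltW r0)) (ler0n R 2)).
have le2 : enorm (x0 - y) / eps n * (N%:R * M / rho + e2 * rho / 2) <= K1 * (N%:R * M / rho + e2 * rho / 2) by rewrite ler_wpM2r.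
have E1 : K1 * (N%:R * M / rho) = th / 4 by rewrite /rho; field; rewrite !gt_eqF //; move: (K11) (N1) (M1); glra.
have E2 : K1 * (e2 * rho / 2) <= th / 4.
  have := m1; rewrite ler_pdivlMr; last exact: d1.
  glra.
by move: le2; rewrite [K1 * _]mulrDr E1; move: (ux0) (E2); glra.
Qed.
End Peaks.

(** * Limits along an ultrafilter *)

Section Ultra.
Context {R : realType} {N : nat}.
Notation V := 'rV[R]_N.
Variables (U : set_system nat).
Hypotheses (UU : UltraFilter U) (Uoo : forall A : set nat, nbhs \oo A -> U A).
Implicit Types (A B C : set nat) (n : nat) (e : R).

Lemma uS A B : U A -> (forall n, A n -> B n) -> U B.
Proof. by move=> UA sub; apply: filterS UA. Qed.

Lemma uI A B C : U A -> U B -> (forall n, A n -> B n -> C n) -> U C.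
Proof. by move=> UA UB sub; apply: uS (filterI UA UB) _ => n [a b]; exact: sub. Qed.

Lemma uE A : U A -> exists n, A n.
Proof. exact: filter_ex. Qed.

Lemma uN A : ~ U A -> U (~` A).
Proof. by move=> nA; have [//|] := in_ultra_setVsetC A UU. Qed.

Lemma u_all k (A : 'I_k -> set nat) : (forall i, U (A i)) -> U [set n | forall i, A i n].
Proof.
move=> h; suff : U [set n | forall i, i \in enum 'I_k -> A i n].
  by move=> g; apply: uS g _ => n hn i; apply: hn; rewrite mem_enum.
elim: (enum 'I_k) => [|i s IH]; first by apply: uS filterT _ => n _ i; rewrite in_nil.
apply: uI (h i) IH _ => n ai hs j; rewrite inE => /orP [/eqP ->|] //; exact: hs.
Qed.

(** Without a limit, each point of K has a neighbourhood that the sequence avoids for U-many n;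
    compactness makes this uniform and contradicts membership in K. *)
Lemma ulim_pt (K : set V) (x : nat -> V) : compact K -> U [set n | K (x n)] ->
  exists2 c, K c & forall e, 0 < e -> U [set n | enorm (x n - c) < e].
Proof.
move=> cK UK; apply: contrapT => no.
have [n []] : exists n, (forall y, K y -> x n <> y) /\ K (x n).
  apply: uE; apply: uI UK _ (fun n a b => conj b a).
  apply: (@compact_near R N K nat U (fun n y => x n <> y) _ cK) => c Kc.
  have [e [e0 he]] : exists e, 0 < e /\ ~ U [set n | enorm (x n - c) < e].
    apply: contrapT => h; apply: no; exists c => // e e0; apply: contrapT => hh.
    by apply: h; exists e.
  by exists e => //; apply: uS (uN he) _ => n /= h y yc xy; apply: h; rewrite xy.
by move=> h Kx; exact: (h _ Kx).
Qed.
End Ultra.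

Section UltraR.
Context {R : realType}.
Variables (U : set_system nat).
Hypotheses (UU : UltraFilter U).
Implicit Types (a : nat -> R) (e : R).

Lemma ulim a B : U [set n | `|a n| <= B] -> exists l, forall e, 0 < e -> U [set n | `|a n - l| < e].
Proof.
move=> h; have E (t : R) : enorm (const_mx t : 'rV[R]_1) = `|t|.
  by rewrite enormE /sqn /dot big_ord1 !mxE -expr2 sqrtr_sqr.
have [|c _ hc] := @ulim_pt R 1 U UU (cball 0 B) (fun n => const_mx (a n)) (@compact_cball _ _ 0 B).
  by apply: (uS UU h) => n /=; rewrite /cball /= subr0 E.
exists (c ord0 ord0) => e e0; apply: (uS UU (hc e e0)) => n /=.
have -> : const_mx (a n) - c = const_mx (a n - c ord0 ord0) :> 'rV[R]_1 by apply/rowP => i; rewrite !mxE !ord1.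
by rewrite E.
Qed.
End UltraR.

Section Limits.
Context {R : realType} {N : nat} (Om : set 'rV[R]_N) (p : R) (u : nat -> 'rV[R]_N -> R) (eps : nat -> R) (C0 : R).
Hypothesis H : pde_seq Om p u eps C0.
Notation V := 'rV[R]_N.
Implicit Types (x y z : V) (n : nat).
Let f := fp p.
Let N0 := ps_N0 H.

(** Equicontinuity at scale eps up to the boundary: farther than t/8 eps from the boundary the
    gradient estimate applies, closer to it both values are small. *)
Lemma equi (e : R) : 0 < e -> exists2 d : R, 0 < d & \forall n \near \oo, forall x y, enorm (x - y) <= d * eps n -> `|u n x - u n y| <= e.
Proof.
move=> e0; have [M M1 hM] := sup_bound H.
have N1 : 1 <= N%:R :> R by rewrite ler1n.
have fM0 : 0 <= f M := f_ge0 H M.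
pose C : R := 3 * N%:R * (2 * M + f M * expR (3 * N%:R)).
have C1 : 1 <= C.
  have : 0 <= f M * expR (3 * N%:R) by rewrite mulr_ge0 ?expR_ge0.
  by rewrite /C; nra.
pose t := Num.min 1 (e / C).
have [t1 t2] : t <= 1 /\ t <= e / C by split; rewrite ge_min lexx ?orbT.
have t0 : 0 < t by rewrite lt_min ltr01 divr_gt0 //; lra.
have tt : 0 < t <= 1 by rewrite t0.
have Ct : C * t <= e by rewrite mulrC -ler_pdivlMr //; lra.
pose G := N%:R * M / (t / 16) + f M * (t / 16) / 2.
have G0 : 0 < G.
  have g1 : 0 < N%:R * M / (t / 16) by apply: divr_gt0; [move: (M1) (N1); gnra|move: (tt); glra].
  have g2 : 0 <= f M * (t / 16) / 2 by apply: divr_ge0 => //; apply: mulr_ge0; move: (fM0) (tt); glra.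
  by rewrite /G; move: (g1) (g2); glra.
pose d := Num.min (t / 16) (e / G).
have [d1 d2] : d <= t / 16 /\ d <= e / G by split; rewrite ge_min lexx ?orbT.
have d0 : 0 < d by rewrite lt_min !divr_gt0.
exists d => //; apply: nearI2 hM (bdy_eps H tt ltr01) _ => n uM bn x y xy.
have e0' := ps_e H n; have u0 := ps_ge0 H n.
have dt : d * eps n <= t / 16 * eps n by rewrite ler_pM2r.
have te0 : 0 < t / 16 * eps n by rewrite mulr_gt0 // divr_gt0.
have [[xb bx xbx]|far] := pselect (exists2 xb, bdry Om xb & enorm (x - xb) <= t / 8 * eps n).
  have small z : enorm (z - xb) <= t / 4 * eps n -> u n z <= e.
    move=> zx; apply: le_trans _ Ct.
    have := bn xb M (f M) bx (le_trans ler01 M1) fM0; rewrite expr1n mulr1; apply; last by rewrite mulr1.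
    by move=> w _ _; split; [exact: uM|by have := f_mono H (uM w)].
  have ux : u n x <= e by apply: small; move: (te0) (xbx); glra.
  have uy : u n y <= e by apply: small; have := enormBD y x xb; rewrite [enorm (y - x)]enormB; move: (xy) (dt) (te0) (xbx); glra.
  by rewrite ler_norml; have := u0 x; have := u0 y; move: (ux) (uy); glra.
have far' xb : bdry Om xb -> t / 8 * eps n < enorm (x - xb).
  by move=> bx; rewrite ltNge; apply/negP => h; apply: far; exists xb.
have [ox|nox] := pselect (Om x).
  have inO := ball_in (ps_open H) ox far'.
  have mid z : cball (2^-1 *: (x + y)) (t / 16 * eps n) z -> Om z.
    move=> zm; apply: inO; have := enormBD z (2^-1 *: (x + y)) x; have : enorm (z - _) <= _ := zm.
    rewrite (_ : 2^-1 *: (x + y) - x = 2^-1 *: (y - x)); last by apply/rowP => i; rewrite !mxE; field.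
    by rewrite enormZ gtr0_norm ?invr_gt0 // [enorm (y - x)]enormB /cball /=; move: (xy) (dt) (te0); glra.
  have xy2 : enorm (x - y) <= 2 * (t / 16) * eps n by (move: (xy) (dt) (te0); glra).
  have L := inner_lip H (_ : 0 < t / 16) mid (fun z _ => conj (uM z) (f_mono H (uM z))) xy2.
  apply: le_trans (L _) _; first by (move: (d1) (d0); glra).
  have xe : enorm (x - y) / eps n <= d by rewrite ler_pdivrMr.
  apply: le_trans (ler_wpM2r (ltW G0) xe) _.
  by rewrite -ler_pdivlMr.
have noy : ~ Om y.
  move=> oy; apply: nox; have fary xb : bdry Om xb -> t / 16 * eps n < enorm (y - xb).
    by move=> /far'; have := enormBD x y xb; move: (xy) (dt); glra.
  by apply: (ball_in (ps_open H) oy fary); rewrite /cball /=; move: (xy) (dt); glra.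
by rewrite !(ps_out H n) // subrr normr0 ltW.
Qed.

(** Each point of level th has a peak within K eps, and around the peak u >= 1 + sg/2 on a ball of
    radius d eps by [equi]. Separation by D eps makes these balls disjoint, and each carries the
    mass m eps^N. *)
Lemma few (th : R) : 0 < th -> exists (D : R) (k : nat), 0 < D /\ \forall n \near \oo, forall z : 'I_k -> V,
  (forall i, th <= u n (z i)) -> (forall i j, i != j -> D * eps n <= enorm (z i - z j)) -> False.
Proof.
move=> th0; pose th' := Num.min th 1.
have [t1 t2] : th' <= th /\ th' <= 1 by split; rewrite ge_min lexx ?orbT.
have tt : 0 < th' <= 1 by rewrite lt_min th0 ltr01.
have [K [sg [K0 sg0 hp]]] := peak H tt.
have sg2 : 0 < sg / 2 by lra.
have [d d0 he] := equi sg2.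
have c1 : 1 < 1 + sg / 2 by lra.
have f1 : 0 < f (1 + sg / 2) by rewrite /f /fp pp_gt0 //; move: (c1); glra.
pose m := f (1 + sg / 2) * d ^+ N * @T1 R N.
have m0 : 0 < m by rewrite !mulr_gt0 ?exprn_gt0 // T1_gt0.
pose k := (Num.truncn (C0 / m)).+1.
have hk : C0 / m < k%:R by exact: Num.Theory.truncnS_gt.
exists (2 * (K + d)), k; split; first by (move: (K0) (d0); glra).
apply: nearI2 hp he _ => n hp' he' z zth sep.
have e0 := ps_e H n.
have pk i : exists x, enorm (x - z i) <= K * eps n /\ 1 + sg <= u n x.
  by have [x h1 h2] := hp' (z i) (le_trans t1 (zth i)); exists x.
have [x hx] := choice pk.
have de0 : 0 < d * eps n by rewrite mulr_gt0.
have sep' i j : i != j -> 2 * (d * eps n) <= enorm (x i - x j).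
  move=> ij; have := sep i j ij; have [h1 _] := hx i; have [h2 _] := hx j.
  have := enormBD (z i) (x i) (z j); have := enormBD (x i) (x j) (z j); rewrite [enorm (z i - x i)]enormB; move: (h1) (h2); glra.
have low i y : enorm (y - x i) <= d * eps n -> 1 + sg / 2 <= u n y.
  by move=> /he'; have [_ h2] := hx i; rewrite ler_norml; move: (h2); glra.
have := @mass_low _ _ _ _ _ _ _ H n k x (d * eps n) (1 + sg / 2) de0 c1 sep' low.
have en : 0 < (eps n)^-1 ^+ N by rewrite exprn_gt0 // invr_gt0.
move=> ml; have := le_trans (ler_wpM2l (ltW en) ml) (ps_mass H n).
have -> : (eps n)^-1 ^+ N * (k%:R * (fp p (1 + sg / 2) * (d * eps n) ^+ N * @T1 R N)) = k%:R * m.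
  by rewrite /m exprMn exprVn /f; field; rewrite expf_neq0 // gt_eqF.
by rewrite leNgt -ltr_pdivrMr // hk.
Qed.
End Limits.

(** * Blow-up limits *)

Section Profile.
Context {R : realType} {N : nat} (Om : set 'rV[R]_N) (p : R) (u : nat -> 'rV[R]_N -> R) (eps : nat -> R) (C0 : R).
Hypothesis H : pde_seq Om p u eps C0.
Notation V := 'rV[R]_N.
Variables (U : set_system nat).
Hypotheses (UU : UltraFilter U) (Uoo : forall A : set nat, nbhs \oo A -> U A).
Variables (th : R) (xs : nat -> V).
Hypotheses (th0 : 0 < th) (hth : U [set n | th <= u n (xs n)]).
Implicit Types (x y z : V) (n : nat) (W : V -> R).
Let f := fp p.
Let N0 := ps_N0 H.
Let un n y := u n (eps n *: y + xs n).

Lemma aff_dist n y z : enorm ((eps n *: y + xs n) - (eps n *: z + xs n)) = eps n * enorm (y - z).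
Proof. by rewrite opprD addrACA subrr addr0 -scalerBr enormZ gtr0_norm // (ps_e H). Qed.

Lemma ct_un n : continuous (un n).
Proof. exact: ct_resc (ps_e H n) (ps_cont H n). Qed.

Lemma un_equi (e : R) : 0 < e -> exists2 d : R, 0 < d & U [set n | forall y z, enorm (y - z) <= d -> `|un n y - un n z| <= e].
Proof.
move=> e0; have [d d0 hd] := equi H e0; exists d => //.
apply: (uS UU (Uoo hd)) => n /= hn y z yz; apply: hn.
by rewrite aff_dist mulrC ler_pM2r // (ps_e H).
Qed.

(** Pointwise ultralimits exist by boundedness; equicontinuity makes the limit continuous and the
    convergence uniform on balls. *)
Lemma wlim_ex : exists W M, [/\ continuous W, forall y, 0 <= W y <= M, U [set n | forall x, u n x <= M] &
  forall r e, 0 < e -> U [set n | forall y, enorm y <= r -> `|un n y - W y| <= e]].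
Proof.
have [M M1 hM] := sup_bound H; have UM := Uoo hM.
have l1 y : exists l, forall e : R, 0 < e -> U [set n | `|un n y - l| < e].
  apply: (@ulim R U UU (fun n => un n y) M); apply: (uS UU UM) => n /= h.
  by rewrite ger0_norm ?(ps_ge0 H) // h.
have [W hW] := choice l1; exists W, M.
have Weq (e : R) : 0 < e -> exists2 d : R, 0 < d & forall y z, enorm (y - z) <= d -> `|W y - W z| <= e.
  move=> e0; have e3 : 0 < e / 3 by lra.
  have [d d0 hd] := un_equi e3; exists d => // y z yz.
  have [n [[h1 h2] h3]] := uE UU (filterI (filterI (hW y _ e3) (hW z _ e3)) hd).
  by move: h1 h2 (h3 y z yz); rewrite /= !ltr_norml !ler_norml; glra.
split=> //.
- move=> x; apply/contP => e e0; have [d d0 hd] := Weq (e / 2) (divr_gt0 e0 (ltr0n _ 2)).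
  by exists d => // y yx; have := hd y x (ltW yx); rewrite ler_norml ltr_norml; move: (e0); glra.
- move=> y; apply/andP; split.
    apply/ler_addgt0Pr => e e0; have [n h] := uE UU (hW y _ e0); have := ps_ge0 H n (eps n *: y + xs n).
    by move: h; rewrite /= ltr_norml /un; lra.
  apply/ler_addgt0Pr => e e0; have [n [h h']] := uE UU (filterI (hW y _ e0) UM); have := h' (eps n *: y + xs n).
  by move: h; rewrite /= ltr_norml /un; lra.
- move=> r e e0; have e3 : 0 < e / 3 by lra.
  suff : U [set n | forall y, cball (0 : V) r y -> `|un n y - W y| <= e].
    by move=> h; apply: (uS UU h) => n /= hn y yr; apply: hn; rewrite /cball /= subr0.
  apply: (@compact_near R N _ nat U (fun n y => `|un n y - W y| <= e) _ (@compact_cball R N 0 r)) => x _.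
  have [d d0 hd] := un_equi e3; have [d' d'0 hd'] := Weq (e / 3) e3.
  exists (Num.min d d'); first by rewrite lt_min d0.
  apply: (uI UU hd (hW x _ e3)) => n /= h1 h2 y; rewrite lt_min => /andP [yd yd'].
  by have := h1 y x (ltW yd); have := hd' y x (ltW yd'); move: h2; rewrite ltr_norml !ler_norml; glra.
Qed.

Variables (W : V -> R) (M : R).
Hypotheses (cW : continuous W) (W0M : forall y, 0 <= W y <= M) (uM : U [set n | forall x, u n x <= M])
  (hW : forall r e, 0 < e -> U [set n | forall y, enorm y <= r -> `|un n y - W y| <= e]).

Lemma W_pos : th <= W 0.
Proof.
apply/ler_addgt0Pr => e e0; have [n [h1 h2]] := uE UU (filterI hth (hW 0 e0)).
by have := h2 0; rewrite enorm0 lexx => /(_ isT); move: h1; rewrite /= /un scaler0 add0r ler_norml; lra.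
Qed.

(** Otherwise W >= e at infinitely many points whose norms grow by at least D at each step;
    transported back to u they contradict [few]. *)
Lemma W_dec : dec0 W.
Proof.
move=> e e0; apply: contrapT => no.
have far (r : R) : exists y, r < enorm y /\ e <= W y.
  apply: contrapT => h; apply: no; exists r => y yr; rewrite ltNge; apply/negP => We.
  by apply: h; exists y.
have e20 : 0 < e / 2 by lra.
have [D [k [D0 hf]]] := few H e20.
have [y hy] : exists y : nat -> V, forall i, e <= W (y i) /\ forall j, (j < i)%N -> enorm (y j) + D <= enorm (y i).
  have [g hg] := choice far.
  pose F := fix F (i : nat) : V := if i is j.+1 then g (enorm (F j) + D) else g 0.
  exists F => i; split; first by case: i => [|i]; exact: (hg _).2.
  elim: i => [//|i IH] j; rewrite ltnS leq_eqVlt => /orP [/eqP ->|ji].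
    exact: ltW (hg _).1.
  have := IH j ji; have := (hg (enorm (F i) + D)).1; rewrite -/(F i.+1); lra.
have big : U [set n | forall i : 'I_k, e / 2 <= un n (y i)].
  apply: u_all => // i; apply: (uS UU (hW (enorm (y i)) e20)).
  by move=> n /= /(_ (y i) (lexx _)); have [h _] := hy i; rewrite ler_norml; lra.
have [n [h1 h2]] := uE UU (filterI big (Uoo hf)).
apply: (h2 (fun i : 'I_k => eps n *: y i + xs n)) => // i j ij.
rewrite aff_dist mulrC ler_pM2l ?(ps_e H) //.
have [lt|lt] : (i < j)%N \/ (j < i)%N by move: ij; rewrite -val_eqE /=; case: ltngtP => // _ _; [left|right].
  by have := (hy j).2 i lt; have := enormD (y j - y i) (y i); rewrite subrK [enorm (y i - y j)]enormB; lra.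
by have := (hy i).2 j lt; have := enormD (y i - y j) (y j); rewrite subrK; lra.
Qed.

(** The rescaled solutions themselves are the approximants required by [wsol]; the Lipschitz bound
    of f turns their uniform closeness into closeness of the sources. *)
Lemma W_sol (G : set V) : (forall a r, 0 < r -> cball a r `<=` G -> U [set n | forall y, cball a r y -> Om (eps n *: y + xs n)]) ->
  wsol G W (f \o W).
Proof.
move=> hG a r r0 sub e e0; have [fm f1 fl fc] := ps_gf H.
have [L L0 hL] := lip2 M (ps_gf H).
pose e' := Num.min e (e / L).
have [m1 m2] : e' <= e /\ e' <= e / L by split; rewrite ge_min lexx ?orbT.
have e'0 : 0 < e' by rewrite lt_min e0 divr_gt0.
have [n [[h1 h2] h3]] := uE UU (filterI (filterI (hG a r r0 sub) (hW (enorm a + r) e'0)) uM).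
exists (un n); split=> [y ya|y ya].
  by split; [exact: ct_un|apply: le_trans m1; apply: h2; exact: cball_sub].
have yc : cball a r y by exact: ltW.
exists (- f (un n y)); split.
  have e00 := ps_e H n.
  have := hlap_dil e00 (ps_eq H n _ (h1 y yc)).
  by rewrite mulrN mulrA -exprMn mulfV ?gt_eqF // expr1n mul1r.
rewrite addrC distrC; apply: le_trans (hL _ _ (h3 _) (_ : W y <= M)) _; first by have /andP [] := W0M y.
rewrite mulrC -ler_pdivlMr //; apply: le_trans m2; exact: h2 (cball_sub yc).
Qed.

Lemma W_interior w0 : (forall K, U [set n | forall xb, bdry Om xb -> K * eps n < enorm (xs n - xb)]) ->
  continuous w0 -> wsol setT w0 (f \o w0) -> (forall x, 0 < w0 x) -> dec0 w0 -> (forall x, w0 x <= w0 0) -> 1 < w0 0 ->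
  exists a, forall x, W x = w0 (x - a).
Proof.
move=> far cw ww wp dw wm w1.
apply: (classify N0 (ps_p H) cw ww wp dw wm w1 cW _ W_dec); first by move=> y; have /andP [] := W0M y.
  apply: W_sol => a r r0 _.
  apply: (uI UU (far (enorm a + r)) hth) => n /= h1 h2 y ya.
  have Ox : Om (xs n) by apply: contrapT => /(ps_out H n) z; by move: h2; rewrite z leNgt th0.
  apply: (ball_in (ps_open H) Ox h1); rewrite /cball /= addrK enormZ gtr0_norm ?(ps_e H) // mulrC.
  by rewrite ler_pM2r ?(ps_e H) //; exact: cball_sub.
by exists 0; apply: lt_le_trans W_pos.
Qed.

Section Boundary.
Variable K : R.
Hypothesis close : U [set n | exists2 xb, bdry Om xb & enorm (xs n - xb) <= K * eps n].

(** At bounded rescaled distance from the boundary the domains converge to a half-space, whose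
    normal v and height z0.v are ultralimits of the normals and of the rescaled boundary points. The
    limit W is positive inside and zero outside, against [no_halfspace]. *)
Lemma W_boundary : False.
Proof.
have [nu [nu1 hfl]] := ps_flat H.
have ex n : exists b, (exists2 b, bdry Om b & enorm (xs n - b) <= K * eps n) -> bdry Om b /\ enorm (xs n - b) <= K * eps n.
  have [[b b1 b2]|nb] := pselect (exists2 b, bdry Om b & enorm (xs n - b) <= K * eps n); first by exists b.
  by exists 0 => h.
have [xb hxb] := choice ex.
have bx : U [set n | bdry Om (xb n) /\ enorm (xs n - xb n) <= K * eps n] by apply: (uS UU close) => n /= /hxb.
pose ze n := (eps n)^-1 *: (xb n - xs n).
have zeE n y : (eps n *: y + xs n) - xb n = eps n *: (y - ze n).
  have en : eps n != 0 by rewrite gt_eqF // (ps_e H).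
  by apply/rowP => i; rewrite !mxE; field.
have zeK n : enorm (xs n - xb n) <= K * eps n -> enorm (ze n) <= K.
  by move=> h; rewrite /ze enormZ gtr0_norm ?invr_gt0 ?(ps_e H) // mulrC ler_pdivrMr ?(ps_e H) // enormB.
have [z0 z0K hz] : exists2 c, cball 0 K c & forall e, 0 < e -> U [set n | enorm (ze n - c) < e].
  apply: (ulim_pt UU (@compact_cball _ _ 0 K)); apply: (uS UU bx) => n /= [_ /zeK h].
  by rewrite /cball /= subr0.
rewrite /cball /= subr0 in z0K.
have [v v1 hv] : exists2 c, cball 0 1 c & forall e, 0 < e -> U [set n | enorm (nu (xb n) - c) < e].
  apply: (ulim_pt UU (@compact_cball _ _ 0 1)); apply: (uS UU bx) => n /= [/nu1 h _].
  by rewrite /cball /= subr0 (sqn1_enorm h).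
have nv : sqn v = 1.
  have E : enorm v = 1.
    apply/eqP; rewrite eq_sym -subr_eq0 -normr_le0; apply/ler_addgt0Pr => e e0.
    have [n [[h1 _] h2]] := uE UU (filterI bx (hv e e0)); rewrite add0r.
    by have := enorm_sub (nu (xb n)) v; rewrite (sqn1_enorm (nu1 _ h1)) => h; exact: le_trans h (ltW h2).
  by rewrite -enorm2 E expr1n.
have nv1 := sqn1_enorm nv.
(* Flatness with slope g / (4 B1), where B1 bounds the rescaled distance to the boundary point:
   within the ball of radius B only the layer of thickness g about the limit plane stays
   undecided. *)
have split (B g : R) : 0 <= B -> 0 < g -> U [set n | forall y, enorm y <= B ->
   (dot (y - z0) v <= - g -> Om (eps n *: y + xs n)) /\ (g <= dot (y - z0) v -> ~ Om (eps n *: y + xs n))].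
  move=> B0 g0; have K0 : 0 <= K := le_trans (enorm_ge0 _) z0K.
  pose B1 := B + K + 1; have B10 : 0 < B1 by rewrite /B1; lra.
  have d0 : 0 < g / (4 * B1) by rewrite divr_gt0 // mulr_gt0.
  have [s0 s00 hs] := hfl _ d0; have g4 : 0 < g / 4 by (move: (g0); glra).
  have es : U [set n | eps n < s0 / B1] by apply: Uoo; apply: (ps_e0 H); rewrite divr_gt0.
  apply: (uI UU (filterI bx es) (filterI (hz _ g4) (hv _ d0))) => n /= [[b1 b2] e1] [h1 h2] y yB.
  have en := ps_e H n.
  have yz : enorm (y - ze n) <= B1.
    have := enormBD y 0 (ze n); rewrite subr0 sub0r enormN; have := zeK n b2; rewrite /B1; move: (yB); glra.
  have small : enorm ((eps n *: y + xs n) - xb n) <= s0.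
    rewrite zeE enormZ gtr0_norm //; apply: le_trans (_ : eps n * B1 <= _); first by rewrite ler_pM2l.
    by move: e1; rewrite ltr_pdivlMr // => /ltW.
  have dd : `|dot (y - ze n) (nu (xb n)) - dot (y - z0) v| <= g / 2.
    have -> : dot (y - ze n) (nu (xb n)) - dot (y - z0) v = dot (z0 - ze n) v + dot (y - ze n) (nu (xb n) - v).
      by rewrite !dotE; ring.
    apply: le_trans (ler_normD _ _) _; apply: le_trans (lerD (CS _ _) (CS _ _)) _.
    rewrite nv1 mulr1 [enorm (z0 - _)]enormB; have : enorm (y - ze n) * enorm (nu (xb n) - v) <= B1 * (g / (4 * B1)).
      by apply: ler_pM => //; rewrite ?enorm_ge0 //; exact: ltW h2.
    by rewrite (_ : B1 * _ = g / 4); [move: (h1); glra|field; rewrite gt_eqF].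
  have de : g / (4 * B1) * enorm ((eps n *: y + xs n) - xb n) < eps n * (g / 2).
    rewrite zeE enormZ gtr0_norm // mulrCA ltr_pM2l //.
    apply: le_lt_trans (_ : g / (4 * B1) * B1 < _); first by rewrite ler_pM2l.
    by rewrite (_ : _ * B1 = g / 4); [move: (g4); glra|field; rewrite gt_eqF].
  have dn : dot ((eps n *: y + xs n) - xb n) (nu (xb n)) = eps n * dot (y - ze n) (nu (xb n)) by rewrite zeE dotZl.
  move: dd; rewrite ler_norml => /andP [dd1 dd2].
  have [s1 s2] := hs _ b1 _ small; split => yg.
    apply: s1; rewrite dn mulNr.
    have : eps n * dot (y - ze n) (nu (xb n)) <= eps n * - (g / 2) by rewrite ler_pM2l //; move: (dd2) (yg); glra.
    by rewrite mulrN; move: (de); glra.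
  apply: s2; rewrite dn; apply: lt_le_trans de _; rewrite ler_pM2l //; move: (dd1) (yg); glra.
pose tau := dot z0 v.
have W0 y : 0 <= W y by have /andP [] := W0M y.
have gf := ps_gf H; have [_ _ _ fc] := gf.
have wW : wsol [set y | dot y v < tau] W (f \o W).
  apply: W_sol => a r r0 sub.
  have : dot (a + r *: v) v < tau.
    by apply: sub; rewrite /cball /= xhx enormZ nv1 mulr1 gtr0_norm.
  rewrite !dotE -/(sqn v) nv mulr1 => ar.
  have g0 : 0 < tau - (dot a v + r) by (move: (ar); glra).
  have aB : 0 <= enorm a + r by rewrite addr_ge0 ?enorm_ge0 // ltW.
  apply: (uS UU (split _ _ aB g0)) => n /= hn y ya.
  apply: (hn y (cball_sub ya)).1; rewrite dotBl -/tau.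
  have := CS1 (y - a) v; rewrite dotBl nv1 mulr1; have : enorm (y - a) <= r := ya; glra.
have Wz1 y : tau < dot y v -> W y = 0.
  move=> yt; apply/eqP; rewrite eq_le W0 andbT; apply/ler_addgt0Pr => e e0.
  have g0 : 0 < dot y v - tau by (move: (yt); glra).
  have [n [h1 h2]] := uE UU (filterI (split _ _ (enorm_ge0 y) g0) (hW (enorm y) e0)).
  have := h2 y (lexx _); have /(ps_out H n) : ~ Om (eps n *: y + xs n) by apply: (h1 y (lexx _)).2; rewrite dotBl.
  by rewrite /un => ->; rewrite ler_norml; glra.
have Wz y : tau <= dot y v -> W y = 0.
  move=> yt; apply/eqP; rewrite eq_le W0 andbT; apply/ler_addgt0Pr => e e0.
  have [r r0 hr] := (contP W y).1 (@cW y) e e0.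
  have := hr (y + (r / 2) *: v); rewrite xhx enormZ nv1 mulr1 gtr0_norm ?divr_gt0 // => /(_ ltac:(move: (r0); glra)).
  rewrite (Wz1 (y + _)); first by rewrite ltr_norml; glra.
  by rewrite !dotE -/(sqn v) nv mulr1; move: (yt) (r0); glra.
have Wp y : dot y v < tau -> 0 < W y.
  have in0 : dot 0 v < tau.
    by rewrite ltNge; apply/negP => /Wz; have := W_pos; move=> h E; move: h; rewrite E leNgt th0.
  have oG : open [set y | dot y v < tau].
    apply/openP => x xt; exists (tau - dot x v); first by rewrite subr_gt0.
    by move=> x' /= xx; have := CS1 (x' - x) v; rewrite dotBl nv1 mulr1; move: (xx); glra.
  have cvG : convexs [set y | dot y v < tau].
    move=> a b t /= ha hb /andP [t0 t1]; rewrite !dotE.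
    have m : Num.max (dot a v) (dot b v) < tau by rewrite gt_max ha.
    have [m1 m2] : dot a v <= Num.max (dot a v) (dot b v) /\ dot b v <= Num.max (dot a v) (dot b v) by rewrite !le_max !lexx orbT.
    have t1' : 0 <= 1 - t by rewrite subr_ge0.
    by have := ler_wpM2l t0 m2; have := ler_wpM2l t1' m1; move: (m); glra.
  move=> yt; apply: (@smp _ _ _ W (f \o W) N0 oG cvG wW _ _ 0 y) => //.
  - by move=> z _; split; [exact: cW|apply: ct_comp (@cW z) _; exact: fc].
  - by move=> z _; split; [exact: W0|exact: goodf_ge0 gf].
  - exact: lt_le_trans W_pos.
exact: (no_halfspace N0 gf nv cW W0 W_dec wW Wz Wp).
Qed.
End Boundary.
End Profile.

Section ProfileThm.
Context {R : realType} {N : nat} (Om : set 'rV[R]_N) (p : R) (u : nat -> 'rV[R]_N -> R) (eps : nat -> R) (C0 : R).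
Hypothesis H : pde_seq Om p u eps C0.
Notation V := 'rV[R]_N.
Variables (U : set_system nat).
Hypotheses (UU : UltraFilter U) (Uoo : forall A : set nat, nbhs \oo A -> U A).
Variable w0 : V -> R.
Hypotheses (cw : continuous w0) (ww : wsol setT w0 (fp p \o w0)) (wp : forall x, 0 < w0 x) (dw : dec0 w0)
  (wm : forall x, w0 x <= w0 0) (w1 : 1 < w0 0).

Theorem profile (th : R) (xs : nat -> V) : 0 < th -> U [set n | th <= u n (xs n)] ->
  (forall K, U [set n | forall xb, bdry Om xb -> K * eps n < enorm (xs n - xb)]) /\
  exists a, forall r e, 0 < e -> U [set n | forall y, enorm y <= r -> `|u n (eps n *: y + xs n) - w0 (y - a)| <= e].
Proof.
move=> th0 hth; have [W [M [cW W0M uM hW]]] := wlim_ex H UU Uoo xs.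
have far K : U [set n | forall xb, bdry Om xb -> K * eps n < enorm (xs n - xb)].
  apply: contrapT => /(uN UU) no.
  apply: (W_boundary H UU Uoo th0 hth cW W0M uM hW (K := K)).
  apply: (uS UU no) => n /= h; apply: contrapT => h'; apply: h => xb bx.
  by rewrite ltNge; apply/negP => hh; apply: h'; exists xb.
split=> //; have [a ha] := W_interior H UU Uoo th0 hth cW W0M uM hW far cw ww wp dw wm w1.
by exists a => r e e0; apply: (uS UU (hW r e e0)) => n /= h y /h; rewrite ha.
Qed.
End ProfileThm.

(** * Newtonian kernels and comparison in exterior domains *)

Section Newton.
Context {R : realType} {N : nat}.
Notation V := 'rV[R]_N.
Implicit Types (x y z a : V) (e r : R).

(** The fundamental solution without its constant. At the pole the convention for the inverse of 0
    gives the value 0 when N > 2, so poles are always excluded explicitly. *)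
Definition nwt x : R := (enorm x ^+ (N - 2))^-1.

Lemma nwt_ge0 x : 0 <= nwt x.
Proof. by rewrite invr_ge0 exprn_ge0 // enorm_ge0. Qed.

Lemma nwtZ k x : 0 < k -> nwt (k *: x) = (k ^+ (N - 2))^-1 * nwt x.
Proof. by move=> k0; rewrite /nwt enormZ gtr0_norm // exprMn invfM. Qed.

Lemma nwt_le x r : 0 < r -> r <= enorm x -> nwt x <= (r ^+ (N - 2))^-1.
Proof.
move=> r0 rx; rewrite lef_pV2 ?posrE ?exprn_gt0 //; last exact: lt_le_trans r0 rx.
by apply: lerXn2r; rewrite ?nnegrE ?(ltW r0) ?enorm_ge0.
Qed.

Lemma nwt_powR x : x != 0 -> (2 < N)%N -> nwt x = powR (sqn x + 0) ((2 - N%:R) / 2).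
Proof.
move=> x0 N2; rewrite addr0 -enorm2 -powR_mulrn ?enorm_ge0 // -powRrM /nwt.
rewrite (_ : 2%:R * ((2 - N%:R) / 2) = - (N - 2)%:R); last by rewrite natrB ?(ltnW N2) //; field.
by rewrite powRN powR_mulrn // enorm_ge0.
Qed.

Lemma sqn_gt0 x : x != 0 -> 0 < sqn x.
Proof. by move=> x0; rewrite -enorm2 exprn_gt0 // enorm_gt0. Qed.

Lemma ct_nwt x : x != 0 -> {for x, continuous nwt}.
Proof.
move=> x0; apply: ctV; first by rewrite expf_neq0 // gt_eqF // enorm_gt0.
elim: (N - 2)%N => [|k IH].
  by rewrite (_ : (fun y => _) = fun=> 1); [exact: ctC|apply/funext => y; rewrite expr0].
rewrite (_ : (fun y => _) = fun y => enorm y * enorm y ^+ k); last by apply/funext => y; rewrite exprS.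
exact: ctM (@cont_enorm _ _ x) IH.
Qed.

Lemma ct_nwtB a x : x != a -> {for x, continuous (fun y => nwt (y - a))}.
Proof.
move=> xa; apply: (@ct_lip _ _ nwt (fun y => y - a) 1); last by apply: ct_nwt; rewrite subr_eq0.
by move=> y; rewrite opprB addrA subrK mul1r.
Qed.

(** With the exponent q = (2-N)/2 of |x|^2, the radial formula gives 2Nq + 4q(q-1) = 0 times a
    power. *)
Lemma hlap_nwt a x : (2 < N)%N -> x != a -> hlap (fun y => nwt (y - a)) x 0.
Proof.
move=> N2 xa; have x0 : x - a != 0 by rewrite subr_eq0.
have s0 := sqn_gt0 x0; have s0' : 0 < sqn (x - a) + 0 by rewrite addr0.
have := hlap_radial (peano_pow ((2 - N%:R) / 2) s0').
set q := (2 - N%:R) / 2; rewrite !addr0 => h.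
have {}h : hlap (fun y => powR (sqn (y - a) + 0) q) x 0.
  move=> Q oQ e e0; have [r r0 hr] := h Q oQ e e0; exists r => // t tr; have := hr t tr.
  rewrite (_ : 2 * N%:R * _ + _ = 0) //.
  have -> : powR (sqn (x - a)) (q - 1) = sqn (x - a) * powR (sqn (x - a)) (q - 1 - 1).
    rewrite -[X in _ = X * _]powRr1 ?ltW // -powRD; last by rewrite (gt_eqF s0) implybT.
    by congr powR; ring.
  by rewrite /q; field.
apply: hlap_loc h; exists (enorm (x - a)); first exact: enorm_gt0.
move=> y yx; rewrite nwt_powR // subr_eq0; apply/eqP => E; move: yx; rewrite E enormB ltxx //.
Qed.

Lemma wsolC (G : set V) (c : R) : wsol G (fun=> c) (fun=> 0).
Proof. by apply: wsol_hlap => y _; split; [exact: ctC|rewrite oppr0; exact: hlapC]. Qed.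

Lemma wsol_nwt a (G : set V) : (2 < N)%N -> ~ G a -> wsol G (fun y => nwt (y - a)) (fun=> 0).
Proof.
move=> N2 Ga; apply: wsol_hlap => y Gy; have ya : y != a by apply/eqP => E; apply: Ga; rewrite -E.
by split; [exact: ct_nwtB|rewrite oppr0; exact: hlap_nwt].
Qed.

Lemma dec_nwt : (2 < N)%N -> dec0 nwt.
Proof.
move=> N2 e e0; exists (Num.max 1 e^-1) => y; rewrite gt_max => /andP [y1 ye].
have y0 : 0 < enorm y := lt_trans ltr01 y1.
rewrite /nwt invf_plt ?posrE ?exprn_gt0 //; apply: lt_le_trans ye _.
have : (0 < N - 2)%N by rewrite subn_gt0.
case: (N - 2)%N => [//|k] _; rewrite exprS ler_peMr ?(ltW y0) //; apply: exprn_ege1; exact: ltW.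
Qed.

(** As A tends to 0 and B >= 0, B - A + e is positive on large spheres, so the comparison takes
    place on a bounded shell; then e tends to 0. *)
Lemma ext_comp (A B : V -> R) r : (2 < N)%N -> 0 < r ->
  (forall x, r <= enorm x -> {for x, continuous A} /\ {for x, continuous B} /\ 0 <= B x) ->
  wsol [set x | r < enorm x] A (fun=> 0) -> wsol [set x | r < enorm x] B (fun=> 0) -> dec0 A ->
  (forall x, enorm x = r -> A x <= B x) -> forall x, r <= enorm x -> A x <= B x.
Proof.
move=> N2 r0 hAB wA wB dA bd x rx; apply/ler_addgt0Pr => e e0.
have [s hs] := dA e e0; pose q := Num.max s (enorm x) + 1.
have [q1 q2] : s < q /\ enorm x < q.
  by split; rewrite /q; apply: le_lt_trans (_ : Num.max s (enorm x) < _); rewrite ?ltrDl // le_max lexx ?orbT.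
pose K : set V := [set y | r <= enorm y] `&` cball 0 q.
have oG : open [set y : V | r < enorm y].
  by apply: (@open_comp _ _ (@enorm R N) [set t | r < t]) => [y _|]; [exact: cont_enorm|exact: open_gt].
have cK : compact K.
  apply: closed_bounded_compact.
    apply: closedI; last exact: closed_cball.
    by apply: (@preimage_closed _ _ (@enorm R N) [set t | r <= t]) => [y _|]; [exact: cont_enorm|exact: closed_ge].
  by exists q => y [_]; rewrite /cball /= subr0.
have wW := wsolD (wsolB wB wA) (@wsolC [set y : V | r < enorm y] e).
have := @minpr0 R N _ K _ _ (ltn_trans (isT : (0 < 2)%N) N2) oG wW cK.
move=> /(_ _ _ x) h; suff : 0 <= B x - A x + e by glra.
apply: h => [y [yr _]|y [yr yq] neg|].
- have [c1 [c2 _]] := hAB y yr; exact: ctD (ctB c2 c1) (@ctC _ _ e y).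
- have ry : r < enorm y.
    rewrite lt_neqAle yr andbT eq_sym; apply/eqP => /bd h; move: neg; lra.
  have yq' : enorm y < q.
    rewrite ltNge; apply/negP => qy; have := hs y (lt_le_trans q1 qy); have [_ [_ B0]] := hAB y yr.
    by move: neg; move: (B0); glra.
  split=> //; split; last by split; [exact: ctC|rewrite subrr addr0].
  exists (Num.min (enorm y - r) (q - enorm y)); first by rewrite lt_min !subr_gt0 ry.
  move=> z; rewrite lt_min => /andP [z1 z2]; split.
    by rewrite /=; have := enorm_sub y z; rewrite [enorm (y - z)]enormB ler_norml; move: (z1); glra.
  by rewrite /cball /= subr0; have := enorm_sub z y; rewrite ler_norml; move: (z2); glra.
- by split=> //; rewrite /cball /= subr0 ltW.
Qed.
End Newton.

Section ProfileFacts.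
Context {R : realType} {N : nat} (p : R) (w0 : 'rV[R]_N -> R) (R0 : R).
Notation V := 'rV[R]_N.
Hypotheses (N2 : (2 < N)%N) (p1 : 1 < p) (cw : continuous w0) (ww : wsol setT w0 (fp p \o w0)) (wp : forall x, 0 < w0 x) (dw : dec0 w0)
  (wm : forall x, w0 x <= w0 0) (w1 : 1 < w0 0) (hR0 : forall x, 1 < w0 x <-> enorm x < R0).
Let N0 : (0 < N)%N. Proof. by apply: leq_ltn_trans N2. Qed.

Lemma R0_gt0 : 0 < R0.
Proof. by have := (hR0 0).1 w1; rewrite enorm0. Qed.

Lemma w0_radial x y : enorm x = enorm y -> w0 x = w0 y.
Proof.
have h := entire_radial N0 (goodf_fp p1) cw (fun y => ltW (wp y)) dw ww (ex_intro _ 0 (wp 0)) wm.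
by have := h x y; rewrite !subr0.
Qed.

(** If w0(- a) is the maximum, the translate is also radial about 0 and has the same value there;
    uniqueness of radial solutions identifies it with w0. *)
Lemma w0_shift a : w0 (- a) = w0 0 -> forall x, w0 (x - a) = w0 x.
Proof.
move=> Ea x; pose W (x : V) := w0 (1 *: x - a).
have WE y : W y = w0 (y - a) by rewrite /W scale1r.
have cW : continuous W by exact: ct_resc ltr01 cw.
have wW : wsol setT W (fp p \o W).
  have := @wsol_dil _ _ 1 (- a) _ _ _ ltr01 ww; rewrite expr1n.
  by apply: wsol_ext => // y _; rewrite mul1r.
have dW : dec0 W.
  move=> e e0; have [r hr] := dw e0; exists (r + enorm a) => y yr; rewrite WE; apply: hr.
  by have := enormD (y - a) a; rewrite subrK; lra.
have W00 : W 0 = w0 0 by rewrite WE sub0r.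
have Wm y : W y <= W 0 by rewrite W00 WE.
have Wr : forall x y, enorm x = enorm y -> W x = W y.
  have h := entire_radial N0 (goodf_fp p1) cW (fun y => ltW (wp _)) dW wW (ex_intro _ 0 (wp _)) Wm.
  by move=> y z; have := h y z; rewrite !subr0.
rewrite -WE; apply: (@radial_unique R N _ (w0 0) W w0 N0 (goodf_fp p1)) => //; first by move=> y; rewrite -W00.
exact: w0_radial.
Qed.

(** Outside the ball w0 <= 1 is harmonic and decays, and it equals 1 on the sphere by continuity
    from inside; comparison in both directions with the kernel determines it. *)
Lemma w0_out x : R0 <= enorm x -> w0 x = R0 ^+ (N - 2) * nwt x.
Proof.
have r0 := R0_gt0; have c0 : 0 < R0 ^+ (N - 2) by rewrite exprn_gt0.
have x0 (y : V) : R0 <= enorm y -> y != 0 by move=> h; apply/eqP => E; move: h; rewrite E enorm0 leNgt r0.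
have le1 y : R0 <= enorm y -> w0 y <= 1 by move=> h; rewrite leNgt; apply/negP => /hR0; rewrite ltNge h.
have eq1 y : enorm y = R0 -> w0 y = 1.
  move=> yR; apply/eqP; rewrite eq_le le1 ?yR //=; apply/ler_addgt0Pr => e e0.
  have [r rp hr] := (contP w0 y).1 (@cw y) e e0.
  pose t := Num.min (1 / 2) (r / (2 * R0)).
  have [t1 t2] : t <= 1 / 2 /\ t <= r / (2 * R0) by split; rewrite ge_min lexx ?orbT.
  have t0 : 0 < t by rewrite lt_min !divr_gt0 // mulr_gt0.
  have tR : t * R0 <= r / 2.
    by rewrite -ler_pdivlMr // (le_trans t2) // le_eqVlt; apply/orP; left; apply/eqP; field; rewrite gt_eqF.
  have := hr ((1 - t) *: y); rewrite (_ : _ - y = (- t) *: y); last by apply/rowP => i; rewrite !mxE; ring.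
  rewrite enormZ normrN gtr0_norm // yR => /(_ ltac:(move: (rp) (tR); glra)).
  have : 1 < w0 ((1 - t) *: y).
    by apply/hR0; rewrite enormZ yR gtr0_norm ?gtr_pMl //; move: (t0) (t1); glra.
  by rewrite ltr_norml; lra.
have nE (y : V) : enorm y = R0 -> R0 ^+ (N - 2) * nwt y = 1 by move=> yR; rewrite /nwt yR mulfV // gt_eqF.
have Gn : ~ [set y : V | R0 < enorm y] 0 by rewrite /= enorm0 => h; move: (lt_trans r0 h); rewrite ltxx.
have wn : wsol [set y : V | R0 < enorm y] (fun y => R0 ^+ (N - 2) * nwt y) (fun=> 0).
  have := wsolZ (R0 ^+ (N - 2)) (wsol_nwt N2 Gn).
  by apply: wsol_ext => y _; rewrite ?subr0 ?mulr0.
have wo : wsol [set y : V | R0 < enorm y] w0 (fun=> 0).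
  have := wsol_sub (@subsetT _ [set y : V | R0 < enorm y]) ww.
  apply: wsol_ext => // y /= yR; have [_ f1 _ _] := goodf_fp p1.
  by apply: f1; apply: le1; exact: ltW.
have cn (y : V) : R0 <= enorm y -> {for y, continuous (fun y => R0 ^+ (N - 2) * nwt y)}.
  by move=> /x0 h; exact: ctM (@ctC _ _ _ y) (ct_nwt h).
have dn : dec0 (fun y : V => R0 ^+ (N - 2) * nwt y).
  move=> e e0; have [r hr] := dec_nwt N2 (divr_gt0 e0 c0); exists r => y /hr.
  by rewrite ltr_pdivlMr // mulrC.
move=> xR; apply/eqP; rewrite eq_le; apply/andP; split.
  apply: (@ext_comp R N w0 (fun y => R0 ^+ (N - 2) * nwt y) R0) => //.
    by move=> y yR; split; [exact: cw|split; [exact: cn|rewrite mulr_ge0 ?nwt_ge0 // ltW]].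
  by move=> y yR; rewrite eq1 // nE.
apply: (@ext_comp R N (fun y => R0 ^+ (N - 2) * nwt y) w0 R0) => //.
  by move=> y yR; split; [exact: cn|split; [exact: cw|exact: ltW]].
by move=> y yR; rewrite eq1 // nE.
Qed.
End ProfileFacts.

Section Sums.
Context {R : realType} {N : nat}.
Notation V := 'rV[R]_N.

Definition snwt k (P : pred 'I_k) (z : 'I_k -> V) (x : V) : R := \sum_(i | P i) nwt (x - z i).

Lemma snwt_ge0 k (P : pred 'I_k) z x : 0 <= snwt P z x.
Proof. by apply: sumr_ge0 => i _; exact: nwt_ge0. Qed.

Lemma snwt_ge k (P : pred 'I_k) z x i : P i -> nwt (x - z i) <= snwt P z x.
Proof. by move=> Pi; rewrite /snwt (bigD1 i) //= lerDl sumr_ge0 // => j _; exact: nwt_ge0. Qed.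

Lemma snwt_le k (P : pred 'I_k) z x (c : R) : 0 <= c -> (forall i, P i -> nwt (x - z i) <= c) -> snwt P z x <= k%:R * c.
Proof.
move=> c0 h; rewrite /snwt; apply: le_trans (_ : \sum_(i | P i) c <= _); first exact: ler_sum.
rewrite sumr_const -[c *+ _]mulr_natl ler_wpM2r // ler_nat.
by apply: leq_trans (max_card _) _; rewrite card_ord.
Qed.

Lemma wsol_snwt k (P : pred 'I_k) (z : 'I_k -> V) G : (2 < N)%N -> (forall i, P i -> ~ G (z i)) -> wsol G (snwt P z) (fun=> 0).
Proof.
move=> N2 h; rewrite /snwt; elim: (index_enum _) => [|i s IH].
  by apply: wsol_ext (wsolC (0 : R)) => // y _; rewrite big_nil.
case Pi : (P i); last by apply: wsol_ext IH => // y _; rewrite big_cons Pi.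
have h1 := wsolD (wsol_nwt N2 (h i Pi)) IH.
by apply: wsol_ext h1 => y _; rewrite ?addr0 // big_cons Pi.
Qed.

Lemma ct_snwt k (P : pred 'I_k) (z : 'I_k -> V) x : (forall i, P i -> x != z i) -> {for x, continuous (snwt P z)}.
Proof.
move=> h; rewrite /snwt; elim: (index_enum _) => [|i s IH].
  rewrite (_ : (fun y => _) = fun=> 0); first exact: ctC.
  by apply/funext => y; rewrite big_nil.
case Pi : (P i).
  rewrite (_ : (fun y => _) = fun y => nwt (y - z i) + \sum_(j <- s | P j) nwt (y - z j)).
    exact: ctD (ct_nwtB (h i Pi)) IH.
  by apply/funext => y; rewrite big_cons Pi.
rewrite (_ : (fun y => _) = fun y => \sum_(j <- s | P j) nwt (y - z j)) //.
by apply/funext => y; rewrite big_cons Pi.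
Qed.
End Sums.

Section Diag.
Variables (U : set_system nat).
Hypotheses (UU : UltraFilter U) (Uoo : forall A : set nat, nbhs \oo A -> U A).

(** At index n a point is taken that satisfies the strongest available condition of order at most n;
    no uniformity in k is needed because the conditions are nested. *)
Lemma diag (T : Type) (t0 : T) (P : nat -> nat -> T -> Prop) : (forall k n x, P k.+1 n x -> P k n x) ->
  (forall k, U [set n | exists x, P k n x]) -> exists x : nat -> T, forall k, U [set n | P k n (x n)].
Proof.
move=> mono h.
have le_mono n x k j : (j <= k)%N -> P k n x -> P j n x.
  by elim: k => [|k IH]; [rewrite leqn0 => /eqP ->|rewrite leq_eqVlt => /orP [/eqP -> //|]; rewrite ltnS => /IH g /mono].
have ex n : exists x, forall k, (k <= n)%N -> (exists y, P k n y) -> P k n x.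
  move: {1}n => m; elim: m => [|m [x hx]].
    have [[y Py]|no] := pselect (exists y, P 0%N n y).
      by exists y => k; rewrite leqn0 => /eqP ->.
    by exists t0 => k; rewrite leqn0 => /eqP -> /no.
  have [[y Py]|no] := pselect (exists y, P m.+1 n y).
    by exists y => k km _; exact: le_mono km Py.
  by exists x => k; rewrite leq_eqVlt => /orP [/eqP -> /no //|]; exact: hx.
have [x hx] := choice ex; exists x => k.
by apply: (uI UU (h k) (Uoo (nbhs_infty_ge k))) => n /= h1 h2; exact: hx.
Qed.
End Diag.

(** * Extraction of the spikes *)

Section Spikes.
Context {R : realType} {N : nat} (Om : set 'rV[R]_N) (p : R) (u : nat -> 'rV[R]_N -> R) (eps : nat -> R) (C0 : R).
Hypothesis H : pde_seq Om p u eps C0.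
Notation V := 'rV[R]_N.
Variables (U : set_system nat).
Hypotheses (UU : UltraFilter U) (Uoo : forall A : set nat, nbhs \oo A -> U A).
Variable (w0 : V -> R) (R0 : R).
Hypotheses (cw : continuous w0) (ww : wsol setT w0 (fp p \o w0)) (wp : forall x, 0 < w0 x) (dw : dec0 w0)
  (wm : forall x, w0 x <= w0 0) (w1 : 1 < w0 0) (hR0 : forall x, 1 < w0 x <-> enorm x < R0).
Hypothesis big : U [set n | exists x, 1 <= u n x].
Let N2 := ps_N H.
Let p1 := ps_p H.
Let f := fp p.

(** A family of mutually remote points of level 1 with the largest possible number of members; [few]
    bounds this number. *)
Lemma family : exists (k : nat) (xs : 'I_k -> nat -> V) (R1 : R), [/\ (0 < k)%N, forall i, U [set n | 1 <= u n (xs i n)],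
  forall i j, i != j -> forall K : R, U [set n | K * eps n < enorm (xs i n - xs j n)] &
  U [set n | forall x, 1 <= u n x -> exists i, enorm (x - xs i n) <= R1 * eps n]].
Proof.
pose Fam k := exists xs : 'I_k -> nat -> V, (forall i, U [set n | 1 <= u n (xs i n)]) /\
  (forall i j, i != j -> forall K : R, U [set n | K * eps n < enorm (xs i n - xs j n)]).
have [D [k0 [D0 hf]]] := few H (@ltr01 R).
have nF : ~ Fam k0.
  move=> [xs [h1 h2]].
  have a2 : U [set n | forall i j, i != j -> D * eps n < enorm (xs i n - xs j n)].
    apply: u_all => // i; apply: u_all => // j; have [->|ij] := eqVneq i j.
      by apply: (uS UU filterT).
    by apply: (uS UU (h2 i j ij D)) => n /= h _.
  have [n [[n1 n2] n3]] := uE UU (filterI (filterI (u_all UU h1) a2) (Uoo hf)).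
  by apply: (n3 (fun i => xs i n) n1) => i j ij; apply: ltW; exact: n2.
have [k [[xs [h1 h2]] nk]] : exists k, Fam k /\ ~ Fam k.+1.
  apply: contrapT => no; apply: nF; elim: k0 {hf} => [|k IH].
    by exists (fun _ _ => 0); split; case.
  by apply: contrapT => nk; apply: no; exists k.
have [R1 hR1] : exists R1 : R, U [set n | forall x, 1 <= u n x -> exists i, enorm (x - xs i n) <= R1 * eps n].
  apply: contrapT => no; apply: nk.
  (* If no radius R1 covered the level set, a diagonal choice would give one more sequence remote
     from all the others, against maximality. *)
  have [x hx] : exists x : nat -> V, forall m : nat, U [set n | 1 <= u n (x n) /\ forall i, m%:R * eps n < enorm (x n - xs i n)].
    apply: (@diag U UU Uoo V 0 (fun m n x => 1 <= u n x /\ forall i, m%:R * eps n < enorm (x - xs i n))).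
      move=> m n x [x1 x2]; split=> // i; apply: le_lt_trans (x2 i).
      by rewrite ler_pM2r ?(ps_e H) // ler_nat.
    move=> m; have nm : ~ U [set n | forall x, 1 <= u n x -> exists i, enorm (x - xs i n) <= m%:R * eps n] by move=> h; apply: no; exists m%:R.
    apply: (uS UU (uN UU nm)) => n /= h; apply: contrapT => h'; apply: h => x x1.
    apply: contrapT => h; apply: h'; exists x; split=> // i; rewrite ltNge; apply/negP => hh.
    by apply: h; exists i.
  exists (fun i : 'I_k.+1 => if unlift ord_max i is Some j then xs j else x).
  have far (K : R) i : U [set n | K * eps n < enorm (x n - xs i n)].
    apply: (uS UU (hx (Num.truncn K).+1)) => n /= [_ /(_ i)]; apply: le_lt_trans.
    by rewrite ler_pM2r ?(ps_e H) // ltW // truncnS_gt.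
  split=> [i|i j ij K].
    case: (unliftP ord_max i) => [i' _|_]; first exact: h1.
    by apply: (uS UU (hx 0%N)) => n /= [].
  case: (unliftP ord_max i) => [i' Ei|Ei]; case: (unliftP ord_max j) => [j' Ej|Ej].
  - by apply: h2; apply: contraNneq ij => E; rewrite Ei Ej E.
  - by apply: (uS UU (far K i')) => n /=; rewrite enormB.
  - exact: far.
  - by rewrite Ei Ej eqxx in ij.
exists k, xs, R1; split=> //; rewrite lt0n; apply/eqP => k0'.
have [n [[x x1] h]] := uE UU (filterI big hR1).
by have [i _] := h x x1; move: i; rewrite k0'; case.
Qed.

(** The points of the family are replaced by maximum points over balls large enough to contain the
    centres of the limit profiles; this recentres every limit at w0 itself. *)
Lemma spikes : exists (k : nat) (zz : 'I_k -> nat -> V) (R1 : R), [/\ (0 < k)%N /\ 0 <= R1,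
  forall i (r e : R), 0 < e -> U [set n | forall y, enorm y <= r -> `|u n (eps n *: y + zz i n) - w0 y| <= e],
  forall i j, i != j -> forall K : R, U [set n | K * eps n < enorm (zz i n - zz j n)],
  forall i (K : R), U [set n | forall xb, bdry Om xb -> K * eps n < enorm (zz i n - xb)] &
  U [set n | forall x, 1 <= u n x -> exists2 i, enorm (x - zz i n) <= R1 * eps n & u n x <= u n (zz i n)]].
Proof.
have [k [xs [R1 [k0 h1 h2 h3]]]] := family.
have pr i := profile H UU Uoo cw ww wp dw wm w1 ltr01 (h1 i).
have [a ha] := choice (fun i => (pr i).2).
pose R2 := `|R1| + \sum_i enorm (a i).
have aR i : enorm (a i) <= R2.
  rewrite /R2 (bigD1 i) //= [enorm (a i) + _]addrC addrA lerDr addr_ge0 // sumr_ge0 // => j _; exact: enorm_ge0.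
have RR : R1 <= R2.
  by apply: le_trans (ler_norm _) _; rewrite lerDl sumr_ge0 // => j _; exact: enorm_ge0.
have R20 : 0 <= R2 by rewrite addr_ge0 // sumr_ge0 // => j _; exact: enorm_ge0.
have ex i : exists z : nat -> V, forall n, cball (xs i n) (R2 * eps n) (z n) /\ forall x, cball (xs i n) (R2 * eps n) x -> u n x <= u n (z n).
  have e1 n : exists z, cball (xs i n) (R2 * eps n) z /\ forall x, cball (xs i n) (R2 * eps n) x -> u n x <= u n z.
    have [|z z1 z2] := compact_max _ (@compact_cball _ _ (xs i n) (R2 * eps n)) (fun x _ => ps_cont H n x); last by exists z.
    by exists (xs i n); apply: cball_center; rewrite mulr_ge0 // ltW // (ps_e H).
  by have [z hz] := choice e1; exists z.
have [zz hzz] := choice ex.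
have z1 i : U [set n | 1 <= u n (zz i n)].
  apply: (uS UU (h1 i)) => n /= h; apply: le_trans h ((hzz i n).2 _ _).
  by apply: cball_center; rewrite mulr_ge0 // ltW // (ps_e H).
have pz i := profile H UU Uoo cw ww wp dw wm w1 ltr01 (z1 i).
exists k, zz, (2 * R2); split.
- by split=> //; rewrite mulr_ge0.
- move=> i r e e0; have [b hb] := (pz i).2.
  (* The maximum dominates the value at the centre a_i of the old profile, which tends to w0 0; so
     the new limit takes its top value at the origin and [w0_shift] applies. *)
  have Eb : w0 (- b) = w0 0.
    apply/eqP; rewrite eq_le wm /=; apply/ler_addgt0Pr => d d0; have d2 : 0 < d / 2 by (move: (d0); glra).
    have [n [n1 n2]] := uE UU (filterI (ha i (enorm (a i)) _ d2) (hb 0 _ d2)).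
    have := n1 (a i) (lexx _); have := n2 0; rewrite enorm0 lexx => /(_ isT).
    rewrite scaler0 add0r sub0r subrr.
    have : u n (eps n *: a i + xs i n) <= u n (zz i n).
      by apply: (hzz i n).2; rewrite /cball /= addrK enormZ gtr0_norm ?(ps_e H) // mulrC ler_pM2r ?(ps_e H).
    by rewrite !ler_norml; glra.
  by apply: (uS UU (hb r e e0)) => n /= h y /h; rewrite (w0_shift N2 p1 cw ww wp dw wm Eb).
- move=> i j ij K; apply: (uS UU (h2 i j ij (K + 2 * R2))) => n /=.
  have [a1 _] := hzz i n; have [a2 _] := hzz j n; move: a1 a2; rewrite /cball /=.
  have := enormBD (xs i n) (zz i n) (xs j n); have := enormBD (zz i n) (zz j n) (xs j n).
  by rewrite [enorm (xs i n - zz i n)]enormB; glra.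
- by move=> i K; exact: (pz i).1.
- apply: (uS UU h3) => n /= h x /h [i xi]; exists i.
    have [a1 _] := hzz i n; move: a1; rewrite /cball /= => a1; have := enormBD x (xs i n) (zz i n); rewrite [enorm (xs i n - zz i n)]enormB.
    have : R1 * eps n <= R2 * eps n by rewrite ler_pM2r // (ps_e H).
    move: (xi) (a1); glra.
  by apply: (hzz i n).2; rewrite /cball /=; apply: le_trans xi _; rewrite ler_pM2r // (ps_e H).
Qed.
End Spikes.

(** * Two-sided bounds by sums of Newtonian kernels *)

Section NewtonBounds.
Context {R : realType} {N : nat} (Om : set 'rV[R]_N) (p : R) (u : nat -> 'rV[R]_N -> R) (eps : nat -> R) (C0 : R).
Hypothesis H : pde_seq Om p u eps C0.
Notation V := 'rV[R]_N.
Variables (U : set_system nat).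
Hypotheses (UU : UltraFilter U) (Uoo : forall A : set nat, nbhs \oo A -> U A).
Variable (w0 : V -> R) (R0 : R).
Hypotheses (cw : continuous w0) (ww : wsol setT w0 (fp p \o w0)) (wp : forall x, 0 < w0 x) (dw : dec0 w0)
  (wm : forall x, w0 x <= w0 0) (w1 : 1 < w0 0) (hR0 : forall x, 1 < w0 x <-> enorm x < R0).
Variables (k : nat) (zz : 'I_k -> nat -> V) (R1 : R).
Hypotheses (R10 : 0 <= R1)
  (hC : forall i (r e : R), 0 < e -> U [set n | forall y, enorm y <= r -> `|u n (eps n *: y + zz i n) - w0 y| <= e])
  (hS : forall i j, i != j -> forall K : R, U [set n | K * eps n < enorm (zz i n - zz j n)])
  (hT : U [set n | forall x, 1 <= u n x -> exists2 i, enorm (x - zz i n) <= R1 * eps n & u n x <= u n (zz i n)]).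
Let N2 := ps_N H.
Let N0 := ps_N0 H.
Let f := fp p.

(** Normalised so that amp * nwt(x - z) is the exterior part of w0 transplanted to scale eps at
    z. *)
Definition amp n : R := (R0 * eps n) ^+ (N - 2).

Let R00 : 0 < R0. Proof. exact: R0_gt0 w1 hR0. Qed.

Lemma amp_gt0 n : 0 < amp n.
Proof. by rewrite exprn_gt0 // mulr_gt0 // (ps_e H). Qed.

Lemma on_sphere n i x (r : R) : R0 <= r -> enorm (x - zz i n) = r * eps n ->
  exists y, [/\ x = eps n *: y + zz i n, enorm y = r, w0 y = R0 ^+ (N - 2) / r ^+ (N - 2) & amp n * nwt (x - zz i n) = w0 y].
Proof.
move=> rR xr; have e0 := ps_e H n; exists ((eps n)^-1 *: (x - zz i n)).
have yr : enorm ((eps n)^-1 *: (x - zz i n)) = r.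
  by rewrite enormZ gtr0_norm ?invr_gt0 // xr mulrC mulfK // gt_eqF.
have wy : w0 ((eps n)^-1 *: (x - zz i n)) = R0 ^+ (N - 2) / r ^+ (N - 2).
  by rewrite (w0_out N2 (ps_p H) cw ww wp dw w1 hR0) ?yr // /nwt yr.
split=> //; first by rewrite scalerA mulfV ?gt_eqF // scale1r subrK.
rewrite wy /amp /nwt xr !exprMn; field.
by rewrite !expf_neq0 // gt_eqF //; exact: lt_le_trans rR.
Qed.

Lemma open_off n (P : pred 'I_k) (r : R) : open [set x | forall i, P i -> r < enorm (x - zz i n)].
Proof.
apply/openP => x hx.
have ex i : exists2 d : R, 0 < d & P i -> forall y, enorm (y - x) < d -> r < enorm (y - zz i n).
  case Pi : (P i); last by exists 1.
  exists (enorm (x - zz i n) - r); first by rewrite subr_gt0 hx.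
  by move=> _ y yx; have := enormBD x y (zz i n); rewrite [enorm (x - y)]enormB; lra.
have [d d0 hd] := fin_r (fun i d d' dd (h : P i -> forall y, enorm (y - x) < d -> r < enorm (y - zz i n)) Pi y yd =>
  h Pi y (lt_le_trans yd (proj2 (andP dd)))) ex.
by exists d => // y yd i Pi; exact: hd.
Qed.

Lemma closed_off n (P : pred 'I_k) (r : R) : closed [set x | forall i, P i -> r <= enorm (x - zz i n)].
Proof.
have -> : [set x | forall i, P i -> r <= enorm (x - zz i n)] = \bigcap_(i in [set i | P i]) [set x | r <= enorm (x - zz i n)].
  by apply/seteqP; split=> [x h i Pi|x h i Pi]; exact: h.
apply: closed_bigI => i _.
by apply: (@preimage_closed _ _ (fun x : V => enorm (x - zz i n)) [set t | r <= t]) => [y _|]; [exact: ct_enB|exact: closed_ge].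
Qed.

Lemma amp_far n i x (K : R) : 0 < K -> K * eps n <= enorm (x - zz i n) -> amp n * nwt (x - zz i n) <= R0 ^+ (N - 2) / K ^+ (N - 2).
Proof.
move=> K0 h; have e0 := ps_e H n; have Ke0 : 0 < K * eps n by rewrite mulr_gt0.
apply: le_trans (ler_wpM2l (ltW (amp_gt0 n)) (nwt_le Ke0 h)) _.
rewrite le_eqVlt; apply/orP; left; apply/eqP; rewrite /amp !exprMn; field.
by rewrite !expf_neq0 // gt_eqF.
Qed.

(** Off the balls of radius r eps one has u <= 1, so u is harmonic. On their boundary spheres u is
    close to w0, which is one of the kernels; the factor 1 + eta absorbs the error of
    convergence. *)
Lemma upper (eta : R) : 0 < eta -> exists2 r : R, 0 < r & U [set n | forall x, (forall i, r * eps n <= enorm (x - zz i n)) ->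
  u n x <= (1 + eta) * (amp n * snwt predT (zz ^~ n) x)].
Proof.
move=> eta0; pose r := Num.max R0 R1 + 1.
have [r1 r2] : R0 <= r /\ R1 < r.
  split; rewrite /r; last by apply: le_lt_trans (_ : Num.max R0 R1 < _); rewrite ?ltrDl // le_max lexx orbT.
  by apply: le_trans (_ : Num.max R0 R1 <= _); rewrite ?lerDl // le_max lexx.
have r0 : 0 < r := lt_le_trans R00 r1.
exists r => //; pose t := R0 ^+ (N - 2) / r ^+ (N - 2).
have t0 : 0 < t by rewrite divr_gt0 // exprn_gt0.
have et0 : 0 < eta * t by rewrite mulr_gt0.
apply: (uI UU hT (u_all UU (fun i => hC i r et0))) => n /= n1 n2 x xr.
have e0 := ps_e H n; have [B B0 hB] := ps_Rbd H.
have [xB|xB] : enorm x <= B + 1 \/ B + 1 < enorm x by case: (lerP (enorm x) (B + 1)) => hh; [left|right].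
  2: { rewrite (ps_out H); first by apply: mulr_ge0; [move: (eta0); glra|rewrite mulr_ge0 ?snwt_ge0 // ltW // amp_gt0].
       by move=> /hB; lra. }
pose K : set V := [set x | forall i, predT i -> r * eps n <= enorm (x - zz i n)] `&` cball 0 (B + 1).
pose G : set V := Om `&` [set x | forall i, predT i -> r * eps n < enorm (x - zz i n)].
have oG : open G by apply: openI; [exact: ps_open H|exact: open_off].
have cK : compact K.
  apply: closed_bounded_compact; first by apply: closedI; [exact: closed_off|exact: closed_cball].
  by exists (B + 1) => y [_]; rewrite /cball /= subr0.
have re0 : 0 < r * eps n by rewrite mulr_gt0.
have nG i : predT i -> ~ G (zz i n) by move=> _ [_ /(_ i isT)]; rewrite subrr enorm0 => h; move: (lt_trans re0 h); rewrite ltxx.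
have wS := wsolZ (1 + eta) (wsolZ (amp n) (wsol_snwt N2 nG)).
have wu : wsol G (u n) (fun x => (eps n)^-1 ^+ 2 * f (u n x)).
  by apply: wsol_sub (@ps_wsol _ _ _ _ _ _ _ H n) => y [].
have wW := wsolB wS wu.
have := @minpr0 R N G K _ _ N0 oG wW cK => /(_ _ _ x) h.
rewrite -subr_ge0; apply: h => [y [yK _]|y [yK yB] neg|].
- have cs : {for y, continuous (snwt predT (zz ^~ n))}.
    apply: ct_snwt => i _; apply/eqP => E; have := yK i isT; rewrite E subrr enorm0; move: (re0); glra.
  exact: ctB (ctM (@ctC _ _ _ y) (ctM (@ctC _ _ _ y) cs)) (ps_cont H n y).
- have uS : (1 + eta) * (amp n * snwt predT (zz ^~ n) y) < u n y by (move: (neg); glra).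
  have S0 : 0 <= (1 + eta) * (amp n * snwt predT (zz ^~ n) y).
    by apply: mulr_ge0; [move: (eta0); glra|rewrite mulr_ge0 ?snwt_ge0 // ltW // amp_gt0].
  have Oy : Om y by apply: contrapT => /(ps_out H n) z; move: uS; rewrite z; move: (S0); glra.
  have Gy : G y.
    split=> // i _; rewrite lt_neqAle yK // andbT eq_sym; apply/eqP => E.
    have [y' [Ey y'r wy aw]] := on_sphere r1 E.
    have := n2 i y'; rewrite y'r lexx -Ey => /(_ isT).
    have := snwt_ge (zz ^~ n) y (isT : predT i); move/(ler_wpM2l (ltW (amp_gt0 n))); rewrite aw wy -/t => h1.
    have : (1 + eta) * t <= (1 + eta) * (amp n * snwt predT (zz ^~ n) y) by rewrite ler_pM2l //; move: (eta0); glra.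
    by rewrite ler_norml; move: (uS); glra.
  have u1 : u n y <= 1.
    rewrite leNgt; apply/negP => u1; have [i yi _] := n1 y (ltW u1).
    have := Gy.2 i isT; have : R1 * eps n < r * eps n by rewrite ltr_pM2r.
    move: (yi); glra.
  have [_ f1 _ fc] := ps_gf H.
  split=> //; split; last split.
  + have oG' := (openP G).1 oG y Gy; have [d d0 hd] := oG'; exists (Num.min d 1); first by rewrite lt_min d0 ltr01.
    move=> z; rewrite lt_min => /andP [zd z1]; have [Oz hz] := hd z zd; split; first by move=> i Pi; exact: ltW (hz i Pi).
    by rewrite /cball /= subr0; have := hB z Oz; glra.
  + have cc1 := @ctC _ _ ((1 + eta) * (amp n * 0)) y.
    exact: ctB cc1 (@ps_cF _ _ _ _ _ _ _ H n y).
  + by rewrite /f f1 // !mulr0 subrr.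
- by split; [move=> i _; exact: xr|rewrite /cball /= subr0].
Qed.

(** For any subfamily of the spikes: u is superharmonic, and [c] compensates for the boundary values
    of the kernels. On a sphere around one spike the other kernels are negligible because the spikes
    are remote at scale eps. *)
Lemma lower (P : pred 'I_k) (eta : R) : 0 < eta <= 1 -> exists2 r : R, 0 < r & U [set n | forall c : R,
  (forall x, bdry Om x -> amp n * snwt P (zz ^~ n) x <= c) -> 0 <= c ->
  forall x, Om x -> (forall i, P i -> r * eps n <= enorm (x - zz i n)) ->
  (1 - eta) * (amp n * snwt P (zz ^~ n) x) <= u n x + c].
Proof.
move=> /andP [eta0 eta1]; pose r := R0 + 1; have r0 : 0 < r := addr_gt0 R00 ltr01.
exists r => //; pose t := R0 ^+ (N - 2) / r ^+ (N - 2).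
have t0 : 0 < t by rewrite divr_gt0 // exprn_gt0.
pose e := eta * t / 2; have e0 : 0 < e by rewrite divr_gt0 // mulr_gt0.
have k1 : 0 < k%:R + 1 :> R by rewrite ltr_wpDl.
(* The distance, in units of eps, beyond which k kernels together contribute at most e. *)
have [q q0 hq] : exists2 q : R, 0 < q & k%:R * (R0 ^+ (N - 2) / q ^+ (N - 2)) <= e.
  have c0 : 0 < R0 ^+ (N - 2) by rewrite exprn_gt0.
  have x0 : 0 < e / ((k%:R + 1) * R0 ^+ (N - 2)) by rewrite divr_gt0 // mulr_gt0.
  have [s hs] := @dec_nwt R N N2 _ x0.
  pose q := Num.max s 0 + 1.
  have [q1 q2] : s < q /\ 0 < q by split; rewrite /q; apply: le_lt_trans (_ : Num.max s 0 < _); rewrite ?ltrDl // le_max lexx ?orbT.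
  exists q => //.
  pose i0 : 'I_N := Ordinal N0.
  have ee : enorm (q *: (ev i0 : V)) = q by rewrite enormZ enormE sqn_ev sqrtr1 mulr1 gtr0_norm.
  have := hs (q *: ev i0); rewrite ee => /(_ q1); rewrite /nwt ee ltr_pdivlMr ?mulr_gt0 // => h.
  have qi : 0 < (q ^+ (N - 2))^-1 by rewrite invr_gt0 exprn_gt0.
  have := mulr_gt0 qi c0; move: h; rewrite mulrDl mul1r mulrDr; glra.
have sepA : U [set n | forall i j, i != j -> (q + r) * eps n < enorm (zz i n - zz j n)].
  apply: u_all => // i; apply: u_all => // j; have [->|ij] := eqVneq i j; first by apply: (uS UU filterT).
  by apply: (uS UU (hS ij (q + r))) => n /= h _.
apply: (uI UU sepA (u_all UU (fun i => hC i r e0))) => n /= n1 n2 c bc c0 x Ox xr.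
have en := ps_e H n; have [B B0 hB] := ps_Rbd H.
pose K : set V := closure Om `&` [set x | forall i, P i -> r * eps n <= enorm (x - zz i n)].
pose G : set V := Om `&` [set x | forall i, P i -> r * eps n < enorm (x - zz i n)].
have oG : open G by apply: openI; [exact: ps_open H|exact: open_off].
have cK : compact K.
  apply: closed_bounded_compact; first by apply: closedI; [exact: closed_closure|exact: closed_off].
  by exists B => y [cy _]; exact: closure_bd hB _ cy.
have re0 : 0 < r * eps n by rewrite mulr_gt0.
have nG i : P i -> ~ G (zz i n) by move=> Pi [_ /(_ i Pi)]; rewrite subrr enorm0 => h; move: (lt_trans re0 h); rewrite ltxx.
have wS := wsolZ (1 - eta) (wsolZ (amp n) (wsol_snwt N2 nG)).
have wu : wsol G (u n) (fun x => (eps n)^-1 ^+ 2 * f (u n x)).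
  by apply: wsol_sub (@ps_wsol _ _ _ _ _ _ _ H n) => y [].
have wW := wsolB (wsolD wu (@wsolC _ _ G c)) wS.
have := @minpr0 R N G K _ _ N0 oG wW cK => /(_ _ _ x) h.
rewrite -subr_ge0; apply: h => [y [_ yK]|y [yB yK] neg|].
- have cs : {for y, continuous (snwt P (zz ^~ n))}.
    apply: ct_snwt => i Pi; apply/eqP => E; have := yK i Pi; rewrite E subrr enorm0; move: (re0); glra.
  exact: ctB (ctD (ps_cont H n y) (@ctC _ _ _ y)) (ctM (@ctC _ _ _ y) (ctM (@ctC _ _ _ y) cs)).
- have S0 : 0 <= amp n * snwt P (zz ^~ n) y by rewrite mulr_ge0 ?snwt_ge0 // ltW // amp_gt0.
  have uS : u n y + c < (1 - eta) * (amp n * snwt P (zz ^~ n) y) by (move: (neg); glra).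
  have Oy : Om y.
    apply: contrapT => nO; have bY : bdry Om y by split=> //; move=> /interior_subset.
    by have := bc y bY; move: uS; rewrite (ps_out H n _ nO); move: (eta0) (S0); gnra.
  have Gy : G y.
    split=> // i Pi; rewrite lt_neqAle yK // andbT eq_sym; apply/eqP => E.
    have rR : R0 <= r by rewrite /r; glra.
    have [y' [Ey y'r wy aw]] := on_sphere rR E.
    have := n2 i y'; rewrite y'r lexx -Ey => /(_ isT); rewrite wy -/t ler_norml => /andP [ut _].
    have St : amp n * snwt P (zz ^~ n) y <= t + e.
      rewrite /snwt (bigD1 i) //= mulrDr aw wy -/t lerD2l; apply: le_trans hq.
      have qN : 0 <= R0 ^+ (N - 2) / q ^+ (N - 2) by rewrite divr_ge0 ?exprn_ge0 // ltW.
      have qa : 0 <= (amp n)^-1 * (R0 ^+ (N - 2) / q ^+ (N - 2)) by rewrite mulr_ge0 // invr_ge0 ltW // amp_gt0.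
      have := @snwt_le R N k (fun j => P j && (j != i)) (zz ^~ n) y _ qa.
      move=> h; have {}h : snwt (fun j => P j && (j != i)) (zz ^~ n) y <= k%:R * ((amp n)^-1 * (R0 ^+ (N - 2) / q ^+ (N - 2))).
        apply: h => j /andP [Pj ji]; rewrite mulrC ler_pdivlMr ?amp_gt0 // mulrC; apply: amp_far => //.
        have ij : i != j by rewrite eq_sym.
        have := n1 i j ij; have := enormBD (zz i n) y (zz j n); rewrite [enorm (zz i n - y)]enormB E; glra.
      have := ler_wpM2l (ltW (amp_gt0 n)) h; rewrite mulrCA mulVKf ?gt_eqF ?amp_gt0 //.
    have : (1 - eta) * (amp n * snwt P (zz ^~ n) y) <= (1 - eta) * (t + e) by rewrite ler_wpM2l // subr_ge0.
    have : 0 <= eta * e by rewrite mulr_ge0 // ltW.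
    have : e * 2 = eta * t by rewrite /e divfK.
    move: uS; rewrite mulrBl mul1r mulrDr; move: (c0) (ut); glra.
  split=> //; split; last split.
  + have [d d0 hd] := (openP G).1 oG y Gy; exists d => // z zd; have [Oz hz] := hd z zd; split; first exact: subset_closure.
    by move=> i Pi; exact: ltW (hz i Pi).
  + have cc1 := @ctC _ _ ((1 - eta) * (amp n * 0)) y.
    exact: ctB (ctD (@ps_cF _ _ _ _ _ _ _ H n y) (@ctC _ _ 0 y)) cc1.
  + by rewrite !mulr0 addr0 subr0; exact: mulr_ge0 (sqr_ge0 _) (f_ge0 H _).
- by split=> //; exact: subset_closure.
Qed.
End NewtonBounds.

Lemma mul_cancel (F : fieldType) (x k y : F) : x != 0 -> x * (k * (x^-1 * y)) = k * y.
Proof. by move=> x0; field. Qed.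

Section PowIneq.
Context {R : realType}.
Implicit Types (q r Q : R) (m : nat).

Lemma pow_gain m q r Q : 0 < r -> r <= q -> q <= Q -> (q - r) / Q ^+ m.+2 <= (r ^+ m.+1)^-1 - (q ^+ m.+1)^-1.
Proof.
move=> r0 rq qQ; have q0 := lt_le_trans r0 rq; have Q0 := lt_le_trans q0 qQ.
have ti : q^-1 <= r^-1 by rewrite lef_pV2.
have tq : 0 <= q^-1 by rewrite invr_ge0 ltW.
have h1 : (r^-1 - q^-1) * q^-1 ^+ m <= (r ^+ m.+1)^-1 - (q ^+ m.+1)^-1.
  have E x : (x ^+ m.+1)^-1 = x^-1 * x^-1 ^+ m :> R by rewrite -exprVn exprS.
  have rm : r^-1 * q^-1 ^+ m <= r^-1 * r^-1 ^+ m.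
    apply: ler_wpM2l; first by rewrite invr_ge0 ltW.
    by apply: lerXn2r => //; rewrite nnegrE invr_ge0 ltW.
  by rewrite !E mulrBl; lra.
apply: le_trans h1.
have -> : (q - r) / Q ^+ m.+2 = (q - r) / Q ^+ 2 * Q^-1 ^+ m.
  by rewrite -addn2 exprD exprVn; field; rewrite expf_neq0 gt_eqF.
have Qi : Q^-1 <= q^-1 by rewrite lef_pV2.
apply: ler_pM.
- by rewrite divr_ge0 ?subr_ge0 // exprn_ge0 // ltW.
- by rewrite exprn_ge0 // invr_ge0 ltW.
- have -> : r^-1 - q^-1 = (q - r) / (q * r) by field; rewrite !gt_eqF.
  rewrite ler_wpM2l ?subr_ge0 // lef_pV2 ?posrE ?mulr_gt0 //.
  by rewrite expr2; apply: ler_pM; rewrite ?(ltW q0) ?(ltW r0) //; exact: le_trans rq qQ.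
- by apply: lerXn2r => //; rewrite nnegrE invr_ge0 ltW.
Qed.

Lemma pow_loss m q r : 0 < q -> q <= r -> (q ^+ m.+1)^-1 - (r ^+ m.+1)^-1 <= m.+1%:R * (r - q) / q ^+ m.+2.
Proof.
move=> q0 qr; have r0 := lt_le_trans q0 qr.
have ti : r^-1 <= q^-1 by rewrite lef_pV2.
have t0 : 0 <= r^-1 by rewrite invr_ge0 ltW.
have t0' : 0 <= q^-1 by rewrite invr_ge0 ltW.
have h (j : nat) : q^-1 ^+ j.+1 - r^-1 ^+ j.+1 <= j.+1%:R * q^-1 ^+ j * (q^-1 - r^-1).
  elim: j => [|j IH]; first by rewrite !expr1 expr0 !mul1r.
  have -> : q^-1 ^+ j.+2 - r^-1 ^+ j.+2 = q^-1 * (q^-1 ^+ j.+1 - r^-1 ^+ j.+1) + r^-1 ^+ j.+1 * (q^-1 - r^-1).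
    by rewrite !exprS; ring.
  have le1 := ler_wpM2l t0' IH.
  have le2 : r^-1 ^+ j.+1 * (q^-1 - r^-1) <= q^-1 ^+ j.+1 * (q^-1 - r^-1).
    by rewrite ler_wpM2r ?subr_ge0 //; apply: lerXn2r; rewrite ?nnegrE.
  apply: le_trans (lerD le1 le2) _.
  by rewrite le_eqVlt; apply/orP; left; apply/eqP; rewrite -[j.+2]addn1 natrD exprS; ring.
rewrite -[(q ^+ m.+1)^-1]exprVn -[(r ^+ m.+1)^-1]exprVn; apply: le_trans (h m) _.
have -> : m.+1%:R * (r - q) / q ^+ m.+2 = m.+1%:R * q^-1 ^+ m * ((r - q) / q ^+ 2).
  by rewrite -addn2 exprD exprVn; field; rewrite expf_neq0 gt_eqF.
rewrite ler_wpM2l ?mulr_ge0 ?exprn_ge0 //.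
have -> : q^-1 - r^-1 = (r - q) / (q * r) by field; rewrite !gt_eqF.
by rewrite ler_wpM2l ?subr_ge0 // lef_pV2 ?posrE ?mulr_gt0 // expr2 ler_pM2l.
Qed.

Lemma pow_lip m q r s : 0 < s -> s <= q -> s <= r -> `|(q ^+ m.+1)^-1 - (r ^+ m.+1)^-1| <= m.+1%:R * `|q - r| / s ^+ m.+2.
Proof.
move=> s0; wlog qr : q r / q <= r => [hw sq sr|sq sr].
  have [h|h] := leP q r; first exact: hw.
  by rewrite distrC [`|q - r|]distrC; apply: hw => //; exact: ltW.
have q0 := lt_le_trans s0 sq; have r0 := lt_le_trans q0 qr.
rewrite ger0_norm; last by rewrite subr_ge0 lef_pV2 ?posrE ?exprn_gt0 //; apply: lerXn2r => //; rewrite nnegrE ltW.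
rewrite distrC ger0_norm ?subr_ge0 //; apply: le_trans (pow_loss m q0 qr) _.
rewrite ler_wpM2l ?mulr_ge0 ?subr_ge0 // lef_pV2 ?posrE ?exprn_gt0 //.
by apply: lerXn2r => //; rewrite nnegrE ltW.
Qed.
End PowIneq.

(** Pigeonhole along an ultrafilter: a choice among finitely many values is eventually constant. *)
Lemma u_ex (U : set_system nat) (UU : UltraFilter U) k (A : 'I_k -> set nat) : U [set n | exists i, A i n] -> exists i, U (A i).
Proof.
move=> h; apply: contrapT => no.
have h2 : U [set n | forall i, ~ A i n] by apply: u_all => // i; apply: uN => // UA; apply: no; exists i.
by have [n [[i Ai] n2]] := uE UU (filterI h h2); exact: n2 Ai.
Qed.

Lemma goodf_Z (R : realType) (f : R -> R) (c : R) : 0 < c -> goodf f -> goodf (fun t => c * f t).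
Proof.
move=> c0 [m f1 L fc]; split.
- by move=> s t st; rewrite ler_pM2l // m.
- by move=> t t1; rewrite f1 // mulr0.
- move=> M; have [l l0 hl] := L M; exists (c * l); first by rewrite mulr_gt0.
  by move=> s t st; rewrite -mulrBr -mulrA ler_pM2l // hl.
- by move=> t; exact: ctM (@ctC _ _ c t) (fc t).
Qed.

(** * Convergence to a sum of kernels at the scale of a cluster *)

Section Cluster.
Context {R : realType} {N : nat} (Om : set 'rV[R]_N) (p : R) (u : nat -> 'rV[R]_N -> R) (eps : nat -> R) (C0 : R).
Hypothesis H : pde_seq Om p u eps C0.
Notation V := 'rV[R]_N.
Variables (U : set_system nat).
Hypotheses (UU : UltraFilter U) (Uoo : forall A : set nat, nbhs \oo A -> U A).
Variable (w0 : V -> R) (R0 : R).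
Hypotheses (cw : continuous w0) (ww : wsol setT w0 (fp p \o w0)) (wp : forall x, 0 < w0 x) (dw : dec0 w0)
  (wm : forall x, w0 x <= w0 0) (w1 : 1 < w0 0) (hR0 : forall x, 1 < w0 x <-> enorm x < R0).
Variables (k : nat) (zz : 'I_k -> nat -> V) (R1 : R).
Hypotheses (R10 : 0 <= R1)
  (hC : forall i (r e : R), 0 < e -> U [set n | forall y, enorm y <= r -> `|u n (eps n *: y + zz i n) - w0 y| <= e])
  (hS : forall i j, i != j -> forall K : R, U [set n | K * eps n < enorm (zz i n - zz j n)])
  (hT : U [set n | forall x, 1 <= u n x -> exists2 i, enorm (x - zz i n) <= R1 * eps n & u n x <= u n (zz i n)]).
Variables (z : V) (P : pred 'I_k) (a : 'I_k) (d : nat -> R) (ze : 'I_k -> V).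
Hypotheses (zO : Om z) (Pa : P a)
  (hP : forall i, P i -> forall e : R, 0 < e -> U [set n | enorm (zz i n - z) < e])
  (hQ : forall i, ~~ P i -> exists2 e : R, 0 < e & U [set n | e <= enorm (zz i n - z)])
  (d_gt0 : forall n, 0 < d n) (hd0 : forall e : R, 0 < e -> U [set n | d n < e]) (hdK : forall K : R, U [set n | K * eps n < d n])
  (hze : forall i, P i -> forall e : R, 0 < e -> U [set n | enorm ((d n)^-1 *: (zz i n - zz a n) - ze i) < e]).
Let N2 := ps_N H.
Let A : nat -> R := @amp R N eps R0.
Let b n := A n / d n ^+ (N - 2).
Let A0 n : 0 < A n. Proof. by have := amp_gt0 H w1 hR0 n. Qed.
Let b0 n : 0 < b n. Proof. by rewrite divr_gt0 // exprn_gt0 // d_gt0. Qed.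

(** [upper] and [lower] squeeze u between multiples of the cluster's kernel sum. The kernels of the
    other spikes, and those of the cluster on the boundary, are of order amp, negligible against b =
    amp / d^(N-2) because d tends to 0. The remaining error comes from the convergence of the
    rescaled poles. *)
Lemma cluster_conv (r0 e : R) : 0 < r0 -> 0 < e -> U [set n | forall y, enorm y <= 1 -> (forall i, P i -> r0 <= enorm (y - ze i)) ->
  `|u n (d n *: y + zz a n) / b n - snwt P ze y| <= e].
Proof.
move=> r00 e0; have [m Nm] : exists m, (N - 2 = m.+1)%N by case E : (N - 2)%N => [|m]; [move: E; lia|exists m].
pose s := r0 / 2; have s0 : 0 < s by rewrite divr_gt0.
pose h1 := k%:R / s ^+ (N - 2); have h10 : 0 <= h1 by rewrite divr_ge0 // exprn_ge0 // ltW.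
have k0 : 0 <= k%:R :> R by [].
(* Three tolerances follow: [eta] for the relative error of the two bounds, [tau] for the ratio
   (d/q)^(N-2), [e3] for the displacement of the poles. *)
pose eta := Num.min 1 (e / (4 * (h1 + 1))).
have [eta1 eta2] : eta <= 1 /\ eta <= e / (4 * (h1 + 1)) by split; rewrite ge_min lexx ?orbT.
have eta0 : 0 < eta by rewrite lt_min ltr01 divr_gt0 // mulr_gt0 //; lra.
have etah : eta * h1 <= e / 4.
  have : eta * (4 * (h1 + 1)) <= e by rewrite -ler_pdivlMr // mulr_gt0 //; lra.
  nra.
pose tau := Num.min 1 (e / (8 * (k%:R + 1))).
have [tau1 tau2] : tau <= 1 /\ tau <= e / (8 * (k%:R + 1)) by split; rewrite ge_min lexx ?orbT.
have tau0 : 0 < tau by rewrite lt_min ltr01 divr_gt0 // mulr_gt0 //; lra.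
have tauk : k%:R * tau <= e / 8.
  have : tau * (8 * (k%:R + 1)) <= e by rewrite -ler_pdivlMr // mulr_gt0 //; lra.
  move: (tau0); gnra.
pose e3 := Num.min s (e / (4 * ((k * m.+1)%:R + 1)) * s ^+ m.+2).
have sm0 : 0 < s ^+ m.+2 by rewrite exprn_gt0.
have [e31 e32] : e3 <= s /\ e3 <= e / (4 * ((k * m.+1)%:R + 1)) * s ^+ m.+2 by split; rewrite ge_min lexx ?orbT.
have km0 : 0 <= (k * m.+1)%:R :> R by [].
have e30 : 0 < e3 by rewrite lt_min s0 mulr_gt0 // divr_gt0 // mulr_gt0 //; lra.
have e3k : (k * m.+1)%:R * (e3 / s ^+ m.+2) <= e / 4.
  have : e3 / s ^+ m.+2 <= e / (4 * ((k * m.+1)%:R + 1)) by rewrite ler_pdivrMr.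
  have c4 : 0 < 4 * ((k * m.+1)%:R + 1) :> R by rewrite mulr_gt0 // ltr_wpDl.
  rewrite ler_pdivlMr //.
  have : 0 <= e3 / s ^+ m.+2 by rewrite divr_ge0 // ltW.
  gnra.
have [ru ru0 hu] := upper H UU cw ww wp dw w1 hR0 hC hT eta0.
have eta01 : 0 < eta <= 1 by rewrite eta0.
have [rl rl0 hl] := lower H UU cw ww wp dw w1 hR0 hC hS P eta01.
pose r := Num.max ru rl.
have [rr1 rr2] : ru <= r /\ rl <= r by split; rewrite le_max lexx ?orbT.
have rp : 0 < r := lt_le_trans ru0 rr1.
have [q1 q10 hq1] : exists2 q : R, 0 < q & forall i, ~~ P i -> U [set n | q <= enorm (zz i n - z)].
  apply: fin_r => [i c c' /andP [_ cc] h nP|i].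
    by apply: (uS UU (h nP)) => n /=; exact: le_trans.
  case Pi : (P i); first by exists 1.
  by have [c c0 hc] := hQ (negbT Pi); exists c.
have [q2 q20 hq2] := (openP Om).1 (ps_open H) z zO.
pose q := Num.min q1 q2 / 4.
have [m1 m2] : Num.min q1 q2 <= q1 /\ Num.min q1 q2 <= q2 by split; rewrite ge_min lexx ?orbT.
have mq : Num.min q1 q2 = 4 * q by rewrite /q mulrC divfK.
have q0 : 0 < q by rewrite divr_gt0 // lt_min q10.
clearbody q.
have E1 : U [set n | forall i, P i -> enorm (zz i n - z) < q].
  apply: u_all => // i; case Pi : (P i); first by apply: (uS UU (hP Pi q0)) => n /= h _.
  by apply: (uS UU filterT).
have E3 : U [set n | forall i, ~~ P i -> 4 * q <= enorm (zz i n - z)].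
  apply: u_all => // i; case Pi : (P i); first by apply: (uS UU filterT).
  by apply: (uS UU (hq1 i (negbT Pi))) => n /= h _; move: (m1) (mq) (h); glra.
have E8 : U [set n | forall i, P i -> enorm ((d n)^-1 *: (zz i n - zz a n) - ze i) < e3].
  apply: u_all => // i; case Pi : (P i); first by apply: (uS UU (hze Pi e30)) => n /= h _.
  by apply: (uS UU filterT).
have E5 : U [set n | eps n < q / r] by apply: Uoo; apply: (ps_e0 H); rewrite divr_gt0.
have tq0 : 0 < tau * q by rewrite mulr_gt0.
apply: (uI UU (filterI (filterI E1 E3) (filterI E8 E5)) (filterI (filterI (hd0 tq0) (hdK (r / s))) (filterI hu hl))).
move=> n /= [[n1 n3] [n8 n5]] [[nd nK] [nu nl]] y y1 yr.
have en := ps_e H n; have dn := d_gt0 n.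
set x := d n *: y + zz a n.
have dq : d n <= q by have : tau * q <= q by [rewrite ler_piMl // ltW]; move: (nd); glra.
have xz : enorm (x - z) <= 2 * q.
  have := enormBD x (zz a n) z; rewrite {1}/x addrK enormZ gtr0_norm //.
  by have := n1 a Pa; have := enorm_ge0 y; move: (y1) (dn) (dq); gnra.
have Ox : Om x by apply: hq2; move: (m2) (mq) (dn) (dq) (xz); glra.
have re : r * eps n <= q by move: n5; rewrite ltr_pdivlMr // mulrC => /ltW.
pose zn i := (d n)^-1 *: (zz i n - zz a n).
have xE i : x - zz i n = d n *: (y - zn i).
  rewrite /x /zn scalerBr scalerA mulfV ?gt_eqF // scale1r opprB addrA; by apply/rowP => j; rewrite !mxE; ring.
have yz i : P i -> s <= enorm (y - zn i).
  move=> Pi; have := n8 i Pi; have := yr i Pi; have := enormBD y (zn i) (ze i); rewrite -/(zn i) /s in e31 *; move: (e31); glra.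
have far i : r * eps n <= enorm (x - zz i n).
  case Pi : (P i).
    rewrite xE enormZ gtr0_norm //; apply: le_trans (_ : d n * s <= _); last by rewrite ler_pM2l // yz.
    by move: nK; rewrite mulrAC ltr_pdivrMr // => /ltW.
  by have := n3 i (negbT Pi); have := enormBD (zz i n) x z; rewrite [enorm (zz i n - x)]enormB; move: (dn) (dq) (xz) (re); glra.
have An i : A n * nwt (x - zz i n) = b n * nwt (y - zn i).
  by rewrite xE nwtZ // /b; field; rewrite expf_neq0 // gt_eqF.
have dtau : (d n / q) ^+ (N - 2) <= tau.
  have t1 : d n / q <= tau by rewrite ler_pdivrMr // ltW.
  have t0 : 0 <= d n / q by rewrite divr_ge0 // ltW.
  have t2 := le_trans t1 tau1; apply: le_trans t1; rewrite Nm exprS.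
  by apply: ler_piMr => //; exact: exprn_ile1.
have Afar (v : V) : q <= enorm v -> A n * nwt v <= b n * tau.
  move=> qv; apply: le_trans (ler_wpM2l (ltW (A0 n)) (nwt_le q0 qv)) _.
  have -> : A n * (q ^+ (N - 2))^-1 = b n * (d n / q) ^+ (N - 2).
    by rewrite /b exprMn exprVn; field; rewrite !expf_neq0 // gt_eqF.
  by rewrite ler_pM2l.
have Hn : A n * snwt P (zz ^~ n) x = b n * snwt P zn y.
  by rewrite /snwt !mulr_sumr; apply: eq_bigr => i _; rewrite An.
have Hn1 : snwt P zn y <= h1.
  rewrite /h1; apply: snwt_le => [|i Pi]; first by rewrite invr_ge0 exprn_ge0 // ltW.
  by apply: nwt_le => //; exact: yz.
have Hn0 : 0 <= snwt P zn y by exact: snwt_ge0.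
have HnH : `|snwt P zn y - snwt P ze y| <= e / 4.
  apply: le_trans e3k; rewrite /snwt -sumrB; apply: le_trans (ler_norm_sum _ _ _) _.
  apply: le_trans (_ : \sum_(i | P i) (m.+1%:R * (e3 / s ^+ m.+2)) <= _).
    apply: ler_sum => i Pi; rewrite /nwt Nm.
    have h2 : s <= enorm (y - ze i) by have := yr i Pi; rewrite /s; move: (r00); glra.
    apply: le_trans (pow_lip m s0 (yz i Pi) h2) _; rewrite -mulrA ler_wpM2l // ler_wpM2r ?invr_ge0 ?(ltW sm0) //.
    apply: le_trans (enorm_sub _ _) _; have := n8 i Pi; rewrite -/(zn i).
    rewrite (_ : y - zn i - (y - ze i) = - (zn i - ze i)); last by apply/rowP => j; rewrite !mxE; ring.
    by rewrite enormN => /ltW.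
  rewrite sumr_const -[X in X <= _]mulr_natl natrM -[X in _ <= X]mulrA; apply: ler_wpM2r.
    by rewrite mulr_ge0 // divr_ge0 // ltW.
  by rewrite ler_nat; apply: leq_trans (max_card _) _; rewrite card_ord.
have up : u n x <= (1 + eta) * (b n * (snwt P zn y + k%:R * tau)).
  apply: le_trans (nu x (fun i => le_trans _ (far i))) _; first by rewrite ler_pM2r.
  rewrite ler_pM2l; last by (move: (eta01); glra).
  have -> : snwt predT (zz ^~ n) x = snwt P (zz ^~ n) x + snwt (fun i => ~~ P i) (zz ^~ n) x.
    by rewrite /snwt (bigID P).
  rewrite -/(A n) mulrDr Hn mulrDr lerD2l mulrCA.
  have bt : 0 <= (A n)^-1 * (b n * tau) by rewrite mulr_ge0 ?invr_ge0 ?(ltW (A0 n)) // mulr_ge0 // ltW.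
  have h : snwt (fun i => ~~ P i) (zz ^~ n) x <= k%:R * ((A n)^-1 * (b n * tau)).
    apply: snwt_le => // i nP; rewrite mulrC ler_pdivlMr // mulrC; apply: Afar.
    by have := n3 i nP; have := enormBD (zz i n) x z; rewrite [enorm (zz i n - x)]enormB; move: (dn) (dq) (xz); glra.
  by have := ler_wpM2l (ltW (A0 n)) h; rewrite mul_cancel // gt_eqF.
have lo : (1 - eta) * (b n * snwt P zn y) <= u n x + b n * (k%:R * tau).
  rewrite -Hn; apply: nl => [x' bx'||//|i Pi].
  - have bt : 0 <= (A n)^-1 * (b n * tau) by rewrite mulr_ge0 ?invr_ge0 ?(ltW (A0 n)) // mulr_ge0 // ltW.
    have h : snwt P (zz ^~ n) x' <= k%:R * ((A n)^-1 * (b n * tau)).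
      apply: snwt_le => // i Pi; rewrite mulrC ler_pdivlMr // mulrC; apply: Afar.
      have : q2 <= enorm (x' - z).
        by rewrite leNgt; apply/negP => /hq2; exact: (bdry_open (ps_open H) bx').2.
      by have := n1 i Pi; have := enormBD x' (zz i n) z; move: (m2) (mq) (dn) (dq); glra.
    by have := ler_wpM2l (ltW (A0 n)) h; rewrite mul_cancel ?gt_eqF // [k%:R * (b n * _)]mulrCA.
  - by rewrite mulr_ge0 ?(ltW (b0 n)) // mulr_ge0 // ltW.
  - by apply: le_trans (far i); rewrite ler_pM2r.
have up' : u n x / b n <= (1 + eta) * (snwt P zn y + k%:R * tau).
  by rewrite ler_pdivrMr // -mulrA [_ * b n]mulrC.
have lo' : (1 - eta) * snwt P zn y - k%:R * tau <= u n x / b n.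
  rewrite ler_pdivlMr // mulrBl -[(1 - eta) * _ * _]mulrA [snwt _ _ _ * b n]mulrC [k%:R * tau * b n]mulrC; move: (lo); glra.
have e1 : eta * snwt P zn y <= e / 4 by apply: le_trans etah; rewrite ler_pM2l.
have e2 : eta * (k%:R * tau) <= e / 8.
  by apply: le_trans tauk; rewrite ler_piMl // mulr_ge0 // ltW.
move: HnH up' lo'; rewrite !ler_norml mulrDl mul1r mulrDr mulrBl mul1r; move: (tauk) (e1) (e2); glra.
Qed.
End Cluster.

Section PoleGain.
Context {R : realType} {N : nat}.
Notation V := 'rV[R]_N.
Variables (k : nat) (P : pred 'I_k) (ze : 'I_k -> V) (bb : 'I_k).
Hypotheses (N2 : (2 < N)%N) (Pb : P bb) (zb : enorm (ze bb) = 1) (zib : forall i, P i -> enorm (ze i - ze bb) <= 1)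
  (zi : forall i, P i -> enorm (ze i) <= 1).
Let e := - ze bb.

(* All poles other than [0] lie strictly on one side of the plane through [0] orthogonal to [e], so reflecting
   across a plane slightly beyond [0] brings every point closer to them; this gain outweighs the loss at [0]. *)
Lemma pole_gain : exists rho del g : R, [/\ 0 < rho /\ 8 * rho <= 1, 0 < del <= rho, 0 < g,
  forall i, P i -> ze i != 0 -> 8 * rho <= enorm (ze i) &
  forall (l : R) y, enorm y = rho -> - del < l -> l < dot y e -> refl (l *: e) e y != 0 -> (forall i, P i -> ze i != 0 -> refl (l *: e) e y != ze i) ->
    g * (dot y e - l) <= snwt P ze (refl (l *: e) e y) - snwt P ze y].
Proof.
have [m Nm] : exists m, (N - 2 = m.+1)%N by case E : (N - 2)%N => [|m]; [move: E; lia|exists m].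
have en1 : enorm e = 1 by rewrite /e enormN.
have n1 : sqn e = 1 by rewrite -enorm2 en1 expr1n.
(* The pole [ze bb] is at the maximal distance 1 from 0, so every other pole lies within 1 of it;
   expanding the square puts it on the negative side of the plane normal to e, quantitatively. *)
have ext i : P i -> dot (ze i) e <= - (sqn (ze i) / 2).
  move=> Pi; have : sqn (ze i - ze bb) <= 1 by rewrite -enorm2 expr_le1 ?enorm_ge0 // zib.
  have -> : ze i - ze bb = ze i + e by [].
  by rewrite sqnD n1; lra.
have [de de0 hde] : exists2 de : R, 0 < de & forall i, P i && (ze i != 0) -> de <= enorm (ze i).
  apply: fin_r => [i c c' /andP [_ cc] h Pi|i]; first exact: le_trans cc (h Pi).
  have [E|nz] := eqVneq (ze i) 0; first by exists 1 => //; rewrite andbF.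
  by exists (enorm (ze i)) => //; exact: enorm_gt0.
have zb0 : ze bb != 0 by apply/eqP => E; move: zb; rewrite E enorm0 => /esym/eqP; rewrite oner_eq0.
have de1 : de <= 1 by rewrite -zb hde // Pb.
pose rho := de / 8; have rho0 : 0 < rho by rewrite divr_gt0.
have rde : de = 8 * rho by rewrite /rho; field.
pose c1 := de ^+ 2 / 4; have c10 : 0 < c1 by rewrite divr_gt0 // exprn_gt0.
pose g := c1 / 2 ^+ m.+2; have g0 : 0 < g by rewrite divr_gt0 // exprn_gt0.
have k0 : 0 <= k%:R :> R by [].
have rm0 : 0 < rho ^+ m.+3 by rewrite exprn_gt0.
have M0 : 0 < 4 * (k%:R + 1) * m.+1%:R :> R by rewrite mulr_gt0 // mulr_gt0 // ltr_wpDl.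
(* The last bound makes the total loss at the poles located at 0 at most half of the gain, which
   comes already from [ze bb] alone. *)
pose del := Num.min c1 (Num.min rho (g * rho ^+ m.+3 / (4 * (k%:R + 1) * m.+1%:R))).
have [dl1 dl2 dl3] : [/\ del <= c1, del <= rho & del <= g * rho ^+ m.+3 / (4 * (k%:R + 1) * m.+1%:R)].
  by split; rewrite !ge_min lexx ?orbT.
have del0 : 0 < del by rewrite !lt_min c10 rho0 divr_gt0 // mulr_gt0.
pose L := m.+1%:R * (2 * del / rho) / rho ^+ m.+2.
have kL : k%:R * L <= g / 2.
  have h1 : del * (4 * (k%:R + 1) * m.+1%:R) <= g * rho ^+ m.+3 by rewrite -ler_pdivlMr.
  have -> : L = 2 * m.+1%:R * del / rho ^+ m.+3 by rewrite /L [rho ^+ m.+3]exprS; field; rewrite ?expf_neq0 gt_eqF.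
  rewrite mulrA ler_pdivrMr //.
  have : 0 <= m.+1%:R * del by rewrite mulr_ge0 // ltW.
  move: (h1); glra.
have L0 : 0 <= L.
  apply: divr_ge0; last by rewrite exprn_ge0 // ltW.
  by rewrite mulr_ge0 // divr_ge0 ?(ltW rho0) // mulr_ge0 // ltW.
have gE : g = c1 / 2 ^+ m.+2 by [].
clearbody del; clearbody g.
exists rho, del, (g / 2); split; [by move: (de1) (rde) (dl2) (del0); glra|by rewrite del0|by rewrite divr_gt0|by move=> i Pi zi0; rewrite -rde hde // Pi|].
move=> l y yr ls ly nz nzi.
have rfE : refl (l *: e) e y = y - (2 * (dot y e - l)) *: e by exact: refl_l.
set yl := refl (l *: e) e y in nz nzi rfE *.
set s := dot y e - l in rfE *; have s0 : 0 < s by rewrite subr_gt0.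
(* The exact change of squared distance under reflection; its sign is decided by the side of the
   plane on which w lies. *)
have dist w : sqn (yl - w) = sqn (y - w) - 4 * s * (l - dot w e).
  have -> : yl - w = (y - w) - (2 * s) *: e by rewrite rfE; apply/rowP => j; rewrite !mxE; ring.
  have E2 : sqn ((2 * s) *: e) = (2 * s) * (2 * s) by rewrite /sqn dotZl dotZr -/(sqn e) n1; ring.
  by rewrite (sqnB (y - w)) E2 dotZr dotBl /s; ring.
have gain i : P i -> ze i != 0 -> g * s <= nwt (yl - ze i) - nwt (y - ze i).
  move=> Pi zi0; have dz : de <= enorm (ze i) by apply: hde; rewrite Pi.
  have q0 : 0 < enorm (y - ze i).
    by have := enorm_sub y (ze i); rewrite yr ler_norml; move: (rde) (dl2) (del0) (dz); glra.
  have q'0 : 0 < enorm (yl - ze i) by apply: enorm_gt0; rewrite subr_eq0; exact: nzi.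
  have Q2 : enorm (y - ze i) <= 2.
    by have := enormD y (- ze i); rewrite enormN yr; have := zi Pi; move: (rde) (dz); glra.
  have cc : c1 <= l - dot (ze i) e.
    have : de ^+ 2 <= sqn (ze i) by rewrite -enorm2; apply: lerXn2r => //; rewrite nnegrE ?enorm_ge0 // ltW.
    have c1E : c1 * 4 = de ^+ 2 by rewrite /c1 divfK.
    by have := ext i Pi; move: (dl1) (ls) (c1E); glra.
  have qq : 4 * s * c1 <= enorm (y - ze i) ^+ 2 - enorm (yl - ze i) ^+ 2.
    rewrite !enorm2 dist; have : 4 * s * c1 <= 4 * s * (l - dot (ze i) e) by rewrite ler_pM2l // mulr_gt0.
    glra.
  move: q0 q'0 Q2 qq; rewrite /nwt; set q := enorm (y - ze i); set q' := enorm (yl - ze i) => q0 q'0 Q2 qq.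
  have sc : 0 < s * c1 by rewrite mulr_gt0.
  have qq' : q' <= q.
    rewrite leNgt; apply/negP => h; have : q ^+ 2 < q' ^+ 2 by rewrite ltr_sqr ?nnegrE ?ltW.
    move: (qq) (sc); glra.
  have d1 : s * c1 <= q - q'.
    have h1 : 4 * (s * c1) <= (q - q') * (q + q') by rewrite -subr_sqr; move: (qq); glra.
    have h2 : (q - q') * (q + q') <= (q - q') * 4 by rewrite ler_wpM2l ?subr_ge0 //; move: (Q2) (qq'); glra.
    move: (h1) (h2); glra.
  rewrite Nm; apply: le_trans (pow_gain m q'0 qq' Q2).
  by rewrite gE mulrAC ler_pM2r ?invr_gt0 ?exprn_gt0 // mulrC.
(* Several spikes may collapse to the pole 0 at scale d; each of them loses at most L s, whence the
   factor k in [kL]. *)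
have loss i : ze i = 0 -> - (L * s) <= nwt (yl - ze i) - nwt (y - ze i).
  move=> ->; rewrite !subr0 lerNl opprB /nwt Nm yr; have yl0 := enorm_gt0 nz.
  have [h|h] := leP rho (enorm yl); last first.
    apply: le_trans (_ : 0 <= _); last by rewrite mulr_ge0 // ltW.
    rewrite subr_le0 lef_pV2 ?posrE ?exprn_gt0 //; apply: lerXn2r; rewrite ?nnegrE //; exact: ltW.
  apply: le_trans (pow_loss m rho0 h) _.
  have -> : L * s = m.+1%:R * (2 * del / rho * s) / rho ^+ m.+2 by rewrite /L; ring.
  rewrite ler_pM2r ?invr_gt0 ?exprn_gt0 // ler_pM2l //.
  have := dist 0; rewrite !subr0 dot0l subr0 -!enorm2 yr => E.
  have h1 : (enorm yl - rho) * (enorm yl + rho) <= 4 * s * del.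
    rewrite -subr_sqr E; have : 4 * s * (- l) <= 4 * s * del by rewrite ler_pM2l ?mulr_gt0 //; move: (ls); glra.
    glra.
  have h2 : (enorm yl - rho) * (2 * rho) <= (enorm yl - rho) * (enorm yl + rho) by rewrite ler_wpM2l ?subr_ge0 //; move: (h); glra.
  by rewrite [2 * del / rho * s]mulrAC ler_pdivlMr //; move: (h1) (h2); glra.
rewrite /snwt -sumrB (bigD1 bb) //=.
have Gb := gain bb Pb zb0.
have rest : - (k%:R * (L * s)) <= \sum_(i | P i && (i != bb)) (nwt (yl - ze i) - nwt (y - ze i)).
  apply: le_trans (_ : \sum_(i | P i && (i != bb)) - (L * s) <= _).
    rewrite sumr_const -[X in _ <= X]mulr_natl mulrN lerN2; apply: ler_wpM2r; first by rewrite mulr_ge0 // ltW.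
    by rewrite ler_nat; apply: leq_trans (max_card _) _; rewrite card_ord.
  apply: ler_sum => i /andP [Pi _]; have [E|nzi0] := eqVneq (ze i) 0; first exact: loss.
  apply: le_trans (gain i Pi nzi0); apply: le_trans (_ : 0 <= _); last by rewrite mulr_ge0 // ltW.
  by rewrite oppr_le0 mulr_ge0 // ltW.
have : k%:R * (L * s) <= g / 2 * s by rewrite mulrA ler_pM2r.
move: (Gb) (rest); glra.
Qed.
End PoleGain.

(** * Moving planes in a small ball around a pole *)

Section BallPlanes.
Context {R : realType} {N : nat}.
Notation V := 'rV[R]_N.
Implicit Types (W E : V -> R) (x y e : V) (rho del s l : R).
Hypothesis N0 : (0 < N)%N.

Definition oball (r : R) : set V := [set y | enorm y < r].

Lemma open_oball r : open (oball r).
Proof. by apply: (@open_comp _ _ (@enorm R N) [set t | t < r]) => [y _|]; [exact: cont_enorm|exact: open_lt]. Qed.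

Lemma super_min W (F : V -> R) (r c : R) : 0 < r -> r < 1 -> wsol (oball 1) W F -> (forall y, {for y, continuous W} /\ {for y, continuous F}) ->
  (forall y, 0 <= F y) -> (forall y, enorm y = r -> c <= W y) -> forall x, enorm x <= r -> c <= W x.
Proof.
move=> r0 r1 wW cWF F0 bd x xr.
have s1 : oball r `<=` oball 1 by move=> y y1; exact: lt_trans y1 r1.
have wW' := wsolB (wsol_sub s1 wW) (@wsolC R N (oball r) c).
have := @minpr0 R N (oball r) (cball 0 r) _ _ N0 (@open_oball r) wW' (@compact_cball _ _ 0 r) => /(_ _ _ x) h.
rewrite -subr_ge0; apply: h => [y _|y yr neg|].
- exact: ctB (cWF y).1 (@ctC _ _ _ y).
- have yr' : enorm y <= r by move: yr; rewrite /cball /= subr0.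
  have Gy : enorm y < r.
    by rewrite lt_neqAle yr' andbT; apply/eqP => /bd; rewrite leNgt -subr_lt0 neg.
  split=> //; split; last split.
  + exists (r - enorm y); first by rewrite subr_gt0.
    by move=> y' yy; rewrite /cball /= subr0; have := enorm_sub y' y; rewrite ler_norml; lra.
  + exact: ctB (cWF y).2 (@ctC _ _ 0 y).
  + by rewrite subr0.
- by rewrite /cball /= subr0.
Qed.

Definition ann rho : set V := [set y | rho / 2 < enorm y < 3 / 2 * rho].

Lemma open_ann rho : open (ann rho).
Proof.
apply/openP => y /andP [y1 y2]; exists (Num.min (enorm y - rho / 2) (3 / 2 * rho - enorm y)).
  by rewrite lt_min !subr_gt0 y1 y2.
by move=> x; rewrite lt_min => /andP [x1 x2]; rewrite /ann /=; have := enorm_sub x y; rewrite ler_norml; lra.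
Qed.

Lemma ann_lip E rho (d : R) y y' : 0 < rho -> 0 <= d -> wsol (ann rho) E (fun=> 0) -> (forall x, ann rho x -> {for x, continuous E} /\ `|E x| <= d) ->
  enorm y = rho -> enorm (y - y') <= rho / 4 -> `|E y - E y'| <= enorm (y - y') * (d * N%:R * 4 / rho).
Proof.
move=> rho0 d0 wE hE yr yy'; have r40 : 0 < rho / 4 by rewrite divr_gt0.
have E1 : 2^-1 *: (y + y') - y = 2^-1 *: (y' - y) by apply/rowP => i; rewrite !mxE; field.
have E2 : enorm (2^-1 *: (y + y') - y) <= rho / 8 by rewrite E1 enormZ gtr0_norm ?invr_gt0 // [enorm (y' - y)]enormB; lra.
have mid x : cball (2^-1 *: (y + y')) (rho / 4) x -> ann rho x.
  move=> xm; have {}xm : enorm (x - 2^-1 *: (y + y')) <= rho / 4 := xm.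
  have := enormBD x (2^-1 *: (y + y')) y; have := enorm_sub x y; rewrite yr ler_norml /ann /=; move: (r40) (E2) (xm); glra.
have := @lip_est R N y y' (ann rho) E (fun=> 0) d 0 (rho / 4) N0 (@open_ann rho) wE r40 mid (fun x Ax => conj (hE x Ax).1 (@ctC _ _ 0 x)).
move=> h; apply: le_trans (h _ _) _.
- by move=> x /mid /hE [_ x2]; rewrite normr0.
- move: (yy') (r40); glra.
- rewrite mul0r mul0r addr0 le_eqVlt; apply/orP; left; apply/eqP; field; rewrite gt_eqF //.
Qed.

(* [A] is [C^1]-close to [B] near the sphere [|y| = rho], and [B] gains under reflection, hence so does [A]. *)
Lemma refl_gain (A B : V -> R) rho (d g s : R) y yl : 0 < rho -> 0 < g -> 0 < s -> 0 <= d -> d <= g * rho / 64 -> d <= g * rho / (16 * N%:R) ->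
  wsol (ann rho) A (fun=> 0) -> wsol (ann rho) B (fun=> 0) -> (forall x, ann rho x -> [/\ {for x, continuous A}, {for x, continuous B} & `|A x - B x| <= d]) ->
  `|A yl - B yl| <= d -> `|A y - B y| <= d -> enorm y = rho -> enorm (y - yl) = 2 * s -> g * s <= B yl - B y -> A y < A yl.
Proof.
move=> rho0 g0 s0 d0 d1 d2 wA wB hAB c1 c2 yr yyl Bg.
have NR : 0 < N%:R :> R by rewrite ltr0n.
have wE : wsol (ann rho) (fun x => A x - B x) (fun=> 0).
  by apply: wsol_ext (wsolB wA wB) => // x _; rewrite subrr.
suff : (A y - B y) - (A yl - B yl) < g * s by (move: (Bg); glra).
(* For small displacements the gradient estimate for the harmonic difference A - B gives an error
   linear in s; for large ones the crude bound 2d suffices. *)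
have [sl|sg] : s <= rho / 8 \/ rho / 8 < s by case: (lerP s (rho / 8)) => h; [left|right].
  have hE x : ann rho x -> {for x, continuous (fun x => A x - B x)} /\ `|A x - B x| <= d.
    by move=> /hAB [ca cb h]; split=> //; exact: ctB ca cb.
  have yl4 : enorm (y - yl) <= rho / 4 by rewrite yyl; move: (sl); glra.
  have := ann_lip rho0 d0 wE hE yr yl4; rewrite yyl => h.
  have : 2 * s * (d * N%:R * 4 / rho) <= g * s / 2.
    have -> : g * s / 2 = 2 * s * (g * rho / (16 * N%:R) * N%:R * 4 / rho) by field; rewrite !gt_eqF.
    rewrite ler_pM2l ?mulr_gt0 // ler_pM2r ?invr_gt0 // ler_pM2r // ler_pM2r //.
  by have := mulr_gt0 g0 s0; move: h; rewrite ler_norml; glra.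
have : g * (rho / 8) < g * s by rewrite ltr_pM2l.
by have := mulr_gt0 g0 rho0; move: c1 c2; rewrite !ler_norml; move: (d1); glra.
Qed.

(** Planes start at l = rho, where the cap is empty. They cannot stop, since the strict inequality
    on the sphere excludes identical vanishing on a cap; so they pass the centre. *)
Lemma ball_planes f W e rho del (M : R) : goodf f -> sqn e = 1 -> continuous W -> wsol (oball 1) W (f \o W) -> (forall y, 0 <= W y) -> (forall y, W y <= M) ->
  0 < rho -> 8 * rho <= 1 -> 0 < del -> del <= rho ->
  (forall l y, - del < l -> enorm y = rho -> l < dot y e -> W y < W (refl (l *: e) e y)) -> W 0 <= W (- (del *: e)).
Proof.
move=> gf n1 cW wW W0 hM rho0 rho1 del0 dr bd; have en1 := sqn1_enorm n1.
pose Gc := oball rho.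
have dle y : dot y e <= enorm y by have := CS1 y e; rewrite en1 mulr1.
have bdD l y : - del < l -> l <= rho -> cball 0 rho y -> ~ Gc y -> l < dot y e -> 0 < W (refl (l *: e) e y) - W y.
  move=> ls lu Qy nG ly; rewrite subr_gt0; apply: bd => //; apply/eqP; rewrite eq_le.
  by move: Qy; rewrite /cball /= subr0 => -> /=; rewrite leNgt; exact/negP.
have cvGc : convexs Gc.
  move=> x y t; rewrite /Gc /oball /= => xr yr /andP [t0 t1]; apply: le_lt_trans (enormD _ _) _.
  have t1' : 0 <= 1 - t by rewrite subr_ge0.
  rewrite !enormZ !ger0_norm //.
  have mm : Num.max (enorm x) (enorm y) < rho by rewrite gt_max xr.
  have [m1 m2] : enorm x <= Num.max (enorm x) (enorm y) /\ enorm y <= Num.max (enorm x) (enorm y) by rewrite !le_max !lexx orbT.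
  by have := ler_wpM2l t0 m2; have := ler_wpM2l t1' m1; move: (mm); glra.
have GcG : Gc `<=` oball 1.
  by move=> y y1; have {}y1 : enorm y < rho := y1; rewrite /oball /=; lra.
have GcQ : Gc `<=` cball 0 rho by move=> y y1; rewrite /cball /= subr0; exact: ltW.
have dec (t : R) : 0 < t -> exists r : R, forall y, cball 0 rho y -> r < enorm y -> W y < t.
  by move=> _; exists rho => y; rewrite /cball /= subr0 leNgt => /negP.
have rfG l y : - del < l -> l <= rho -> Gc y -> l < dot y e -> oball 1 (refl (l *: e) e y).
  move=> ls lu Gy ly; have {Gy}yr : enorm y < rho := Gy; rewrite /oball /= refl_l //.
  have de1 := dle y; have s0 : 0 <= 2 * (dot y e - l) by rewrite mulr_ge0 // subr_ge0 ltW.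
  have := enormD y (- ((2 * (dot y e - l)) *: e)); rewrite enormN enormZ en1 mulr1 ger0_norm //; move: (rho1) (dr) (ls) (yr) (de1); glra.
have lst : - del < rho by lra.
have start l : rho <= l -> mp_good W (cball 0 rho) e l.
  move=> lr y Qy ly; have E1 : dot y e = l.
    apply/eqP; rewrite eq_le ly andbT; have := dle y; move: Qy; rewrite /cball /= subr0; move: (lr); glra.
  by rewrite refl_l // E1 subrr mulr0 scale0r subr0 subrr.
have := mp_alt N0 gf n1 cW wW (@open_oball rho) cvGc GcG (@closed_cball _ _ 0 rho) GcQ W0 hM dec rfG bdD lst start.
move=> [good|[l0 [[l01 l02] [_ [Dz [z1 Gz1 lz1]]]]]].
  (* The plane at - del / 2 reflects 0 to - del e. *)
  have ll : - del < - del / 2 by lra.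
  have Q0 : cball 0 rho (0 : V) by rewrite /cball /= subr0 enorm0 ltW.
  have := good _ ll 0 Q0; rewrite dot0l => /(_ ltac:(move: (ll); glra)); rewrite refl_l // dot0l subr_ge0.
  by rewrite sub0r (_ : 2 * _ = del) //; field.
exfalso; have {Gz1}Gz1' : enorm z1 < rho := Gz1.
(* From a point z1 of the cap one moves in the direction e to the sphere point [ys] above it. Cap
   points tending to [ys] have zero difference, although it is positive at [ys]. *)
pose w := z1 - dot z1 e *: e.
have sw : sqn w = sqn z1 - dot z1 e ^+ 2.
  by rewrite /w sqnB {2}/sqn !dotE -/(sqn e) n1; ring.
have we : dot w e = 0 by rewrite /w !dotE -/(sqn e) n1; ring.
clearbody w.
have z1r : sqn z1 < rho ^+ 2 by rewrite -enorm2 ltr_sqr ?nnegrE ?enorm_ge0 // ltW.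
have tp : 0 <= rho ^+ 2 - sqn w by rewrite sw; have := sqr_ge0 (dot z1 e); move: (z1r); glra.
pose tt := Num.sqrt (rho ^+ 2 - sqn w).
have tt2 : tt ^+ 2 = rho ^+ 2 - sqn w by rewrite /tt sqr_sqrtr.
have tt0 : 0 <= tt by exact: sqrtr_ge0.
clearbody tt.
have dtt : dot z1 e < tt.
  rewrite ltNge; apply/negP => h; have : tt ^+ 2 <= dot z1 e ^+ 2.
    by apply: lerXn2r => //; rewrite nnegrE //; exact: le_trans h.
  by rewrite tt2 sw; move: (z1r); glra.
pose ys := w + tt *: e.
have ysr : enorm ys = rho.
  have E2 : sqn ys = rho ^+ 2.
    by rewrite /ys sqnD dotZr we /sqn dotZl dotZr -!/(sqn _) n1; have := tt2; glra.
  by rewrite enormE E2 sqrtr_sqr gtr0_norm.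
have yse : dot ys e = tt by rewrite /ys !dotE we -/(sqn e) n1; ring.
clearbody ys.
have ly0 : l0 < dot ys e by rewrite yse; exact: lt_trans dtt.
have D0 : 0 < W (refl (l0 *: e) e ys) - W ys by rewrite subr_gt0; exact: bd.
have cD : {for ys, continuous (fun y => W (refl (l0 *: e) e y) - W y)}.
  apply: ctB; last exact: cW.
  by apply: ct_refl n1 _; exact: cW.
have [r rr hr] := (contP _ ys).1 cD _ D0.
have zs0 := enorm_ge0 (z1 - ys).
have zs1 : 0 < 2 * (enorm (z1 - ys) + 1) by (move: (zs0); glra).
pose t := Num.min 1 (r / (2 * (enorm (z1 - ys) + 1))).
have [t1 t2] : t <= 1 /\ t <= r / (2 * (enorm (z1 - ys) + 1)) by split; rewrite ge_min lexx ?orbT.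
have t0 : 0 < t by rewrite lt_min ltr01 divr_gt0.
clearbody t; rewrite ler_pdivlMr // in t2.
pose y := ys + t *: (z1 - ys).
have yr : enorm (y - ys) < r by rewrite /y xhx enormZ gtr0_norm //; move: (zs1) (t0) (t2); gnra.
have Gy : Gc y.
  rewrite /Gc /oball /= (_ : y = (1 - t) *: ys + t *: z1); last by apply/rowP => i; rewrite !mxE; ring.
  have t1' : 0 <= 1 - t by rewrite subr_ge0.
  apply: le_lt_trans (enormD _ _) _; rewrite !enormZ ysr (ger0_norm (ltW t0)) (ger0_norm t1').
  have : t * enorm z1 < t * rho by rewrite ltr_pM2l.
  glra.
have ly : l0 < dot y e.
  rewrite /y !dotE yse; have : 0 <= (1 - t) * (tt - dot z1 e) by rewrite mulr_ge0 ?subr_ge0 // ltW.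
  move: (lz1); glra.
have := hr y yr; rewrite (Dz y Gy ly) sub0r normrN gtr0_norm // ltxx //.
Qed.
End BallPlanes.

Section ClusterAbsurd.
Context {R : realType} {N : nat} (Om : set 'rV[R]_N) (p : R) (u : nat -> 'rV[R]_N -> R) (eps : nat -> R) (C0 : R).
Hypothesis H : pde_seq Om p u eps C0.
Notation V := 'rV[R]_N.
Variables (U : set_system nat).
Hypotheses (UU : UltraFilter U) (Uoo : forall A : set nat, nbhs \oo A -> U A).
Variable (w0 : V -> R) (R0 : R).
Hypotheses (cw : continuous w0) (ww : wsol setT w0 (fp p \o w0)) (wp : forall x, 0 < w0 x) (dw : dec0 w0)
  (wm : forall x, w0 x <= w0 0) (w1 : 1 < w0 0) (hR0 : forall x, 1 < w0 x <-> enorm x < R0).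
Variables (k : nat) (zz : 'I_k -> nat -> V) (R1 : R).
Hypotheses (R10 : 0 <= R1)
  (hC : forall i (r e : R), 0 < e -> U [set n | forall y, enorm y <= r -> `|u n (eps n *: y + zz i n) - w0 y| <= e])
  (hS : forall i j, i != j -> forall K : R, U [set n | K * eps n < enorm (zz i n - zz j n)])
  (hT : U [set n | forall x, 1 <= u n x -> exists2 i, enorm (x - zz i n) <= R1 * eps n & u n x <= u n (zz i n)]).
Variables (z : V) (P : pred 'I_k) (a : 'I_k) (d : nat -> R) (ze : 'I_k -> V).
Hypotheses (zO : Om z) (Pa : P a)
  (hP : forall i, P i -> forall e : R, 0 < e -> U [set n | enorm (zz i n - z) < e])
  (hQ : forall i, ~~ P i -> exists2 e : R, 0 < e & U [set n | e <= enorm (zz i n - z)])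
  (d_gt0 : forall n, 0 < d n) (hd0 : forall e : R, 0 < e -> U [set n | d n < e]) (hdK : forall K : R, U [set n | K * eps n < d n])
  (hze : forall i, P i -> forall e : R, 0 < e -> U [set n | enorm ((d n)^-1 *: (zz i n - zz a n) - ze i) < e]).
Let N2 := ps_N H.
Let A : nat -> R := @amp R N eps R0.
Let b n := A n / d n ^+ (N - 2).
Let A0 n : 0 < A n. Proof. by have := amp_gt0 H w1 hR0 n. Qed.
Let b0 n : 0 < b n. Proof. by rewrite divr_gt0 // exprn_gt0 // d_gt0. Qed.


(** For one suitable index n, u is rescaled at d around the spike a. The gain of the kernel sum on
    |y| = rho passes to u, so [ball_planes] gives W 0 <= W(- del e); but W 0 >= 1 while W < 1 away
    from the poles. *)
Lemma cluster_absurd bb : P bb -> ze a = 0 -> enorm (ze bb) = 1 -> (forall i, P i -> enorm (ze i - ze bb) <= 1) ->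
  (forall i, P i -> enorm (ze i) <= 1) -> False.
Proof.
move=> Pb za zb zib zi; have N0 := ps_N0 H.
have [m Nm] : exists m, (N - 2 = m.+1)%N by case E : (N - 2)%N => [|m]; [move: E; lia|exists m].
have [rho [del [g [[rho0 rho1] /andP [del0 dr] g0 farz gain]]]] := pole_gain N2 Pb zb zib zi.
set e := - ze bb in gain.
have en1 : enorm e = 1 by rewrite /e enormN.
have n1 : sqn e = 1 by rewrite -enorm2 en1 expr1n.
clearbody e.
have k0 : 0 <= k%:R :> R by [].
have NR : 1 <= N%:R :> R by rewrite ler1n.
pose h3 := k%:R / rho ^+ (N - 2).
have h30 : 0 <= h3 by rewrite divr_ge0 // exprn_ge0 // ltW.
pose r0 := Num.min (rho / 2) (Num.min del (1 / (h3 + 4))).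
have [r01 r02 r03] : [/\ r0 <= rho / 2, r0 <= del & r0 <= 1 / (h3 + 4)] by split; rewrite !ge_min lexx ?orbT.
have r00 : 0 < r0 by rewrite !lt_min del0 !divr_gt0 //; move: (h30); glra.
have r0big : h3 + 4 <= (r0 ^+ (N - 2))^-1.
  have h4 : 0 < h3 + 4 by (move: (h30); glra).
  have i1 : h3 + 4 <= r0^-1 by rewrite -div1r ler_pdivlMr // mulrC -ler_pdivlMr.
  apply: le_trans i1 _; rewrite lef_pV2 ?posrE ?exprn_gt0 // Nm exprS.
  by apply: ler_piMr; [exact: ltW|apply: exprn_ile1; [exact: ltW|move: (rho1) (r01); glra]].
pose h2 := k%:R / r0 ^+ (N - 2).
have h20 : 0 <= h2 by rewrite divr_ge0 // exprn_ge0 // ltW.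
pose eo := Num.min 1 (Num.min (g * rho / 64) (g * rho / (16 * N%:R))).
have [eo1 eo2 eo3] : [/\ eo <= 1, eo <= g * rho / 64 & eo <= g * rho / (16 * N%:R)] by split; rewrite !ge_min lexx ?orbT.
have gr0 : 0 < g * rho by rewrite mulr_gt0.
have eo0 : 0 < eo by rewrite !lt_min ltr01 !divr_gt0 // mulr_gt0 //; move: (NR); glra.
clearbody eo r0.
have [q q0 hq] := (openP Om).1 (ps_open H) z zO.
have q20 : 0 < q / 2 by rewrite divr_gt0.
have w10 : 0 < w0 0 - 1 by rewrite subr_gt0.
have h21 : 0 < h2 + 2 by (move: (h20); glra).
have := uE UU (filterI (filterI (cluster_conv H UU Uoo cw ww wp dw w1 hR0 R10 hC hS hT zO Pa hP hQ d_gt0 hd0 hdK hze r00 eo0)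
  (hC a 0 w10)) (filterI (filterI (hP Pa q20) (hd0 q20)) (hdK (R0 * (h2 + 2))))).
move=> [n [[hV0 ha] [[hz hd] hK]]].
have {}hz : enorm (zz a n - z) < q / 2 := hz.
have {}hd : d n < q / 2 := hd.
have {}hK : R0 * (h2 + 2) * eps n < d n := hK.
have dn := d_gt0 n; have en := ps_e H n; have R00 := R0_gt0 w1 hR0.
pose W y := u n (d n *: y + zz a n); pose bn := b n; have bn0 : 0 < bn := b0 n.
(* Since [h2] bounds the kernel sum off the poles, W < 1 there, and W is harmonic in the annulus
   used for the gradient estimate. *)
have bsmall : bn * (h2 + 2) < 1.
  have t1 : R0 * eps n / d n < (h2 + 2)^-1.
    rewrite ltr_pdivrMr // ltr_pdivlMl //.
    by move: (hK); glra.
  have t0 : 0 <= R0 * eps n / d n by rewrite divr_ge0 ?mulr_ge0 ?ltW.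
  have t2 : (h2 + 2)^-1 <= 1 by rewrite invf_le1 //; move: (h20); glra.
  have t3 : (R0 * eps n / d n) ^+ (N - 2) <= R0 * eps n / d n.
    rewrite Nm exprS; apply: ler_piMr => //; apply: exprn_ile1 => //; exact: le_trans (ltW t1) t2.
  have -> : bn = (R0 * eps n / d n) ^+ (N - 2) by rewrite /bn /b /A /amp [RHS]exprMn exprVn.
  by rewrite -ltr_pdivlMr // div1r; exact: le_lt_trans t3 t1.
have hV1 : forall y, enorm y <= 1 -> (forall i, P i -> r0 <= enorm (y - ze i)) -> `|W y / bn - snwt P ze y| <= eo := hV0.
clearbody bn.
have W01 : 1 <= W 0.
  have := ha 0; rewrite enorm0 lexx => /(_ isT); rewrite !scaler0 add0r /W scaler0 add0r ler_norml; glra.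
have hG y : enorm y <= 1 -> Om (d n *: y + zz a n).
  move=> y1; apply: hq; have := enormBD (d n *: y + zz a n) (zz a n) z; rewrite addrK enormZ gtr0_norm //.
  have : d n * enorm y <= d n by rewrite ler_piMr // ltW.
  move: (hz) (hd); glra.
have off y : r0 <= enorm y -> enorm y <= 7 * rho -> forall i, P i -> r0 <= enorm (y - ze i).
  move=> y1 y2 i Pi; have [->|nz] := eqVneq (ze i) 0; first by rewrite subr0.
  by have := farz i Pi nz; have := enorm_sub y (ze i); rewrite ler_norml; move: (r01) (y2); glra.
have hV y : r0 <= enorm y -> enorm y <= 7 * rho -> `|W y / bn - snwt P ze y| <= eo.
  by move=> y1 y2; apply: hV1; [move: (rho1) (y2); glra|exact: off].
have Hle y : r0 <= enorm y -> enorm y <= 7 * rho -> snwt P ze y <= h2.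
  move=> y1 y2; apply: snwt_le => [|i Pi]; first by rewrite invr_ge0 exprn_ge0 // ltW.
  by apply: nwt_le => //; exact: off.
have Hle3 y : enorm y = rho -> snwt P ze y <= h3.
  move=> yr; apply: snwt_le => [|i Pi]; first by rewrite invr_ge0 exprn_ge0 // ltW.
  apply: nwt_le => //; have [->|nz] := eqVneq (ze i) 0; first by rewrite subr0 yr.
  by have := farz i Pi nz; have := enorm_sub y (ze i); rewrite yr ler_norml; glra.
clearbody h2 h3.
have Wlt1 y : r0 <= enorm y -> enorm y <= 7 * rho -> W y < 1.
  move=> y1 y2; have := hV y y1 y2; have := Hle y y1 y2; rewrite ler_norml => h /andP [_ h'].
  have : W y / bn <= h2 + 1 by (move: (eo1) (h') (h); glra).
  rewrite ler_pdivrMr // mulrC; have : bn * (h2 + 1) <= bn * (h2 + 2) by rewrite ler_pM2l //; glra.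
  move: (bsmall); glra.
have cW : continuous W by exact: ct_resc dn (ps_cont H n).
pose kap := (d n / eps n) ^+ 2; have kap0 : 0 < kap by rewrite exprn_gt0 // divr_gt0.
pose fk t := kap * fp p t.
have gfk : goodf fk by exact: goodf_Z kap0 (ps_gf H).
have wW : wsol (oball 1) W (fk \o W).
  have w2 := @wsol_dil R N (d n) (zz a n) _ _ _ dn (@ps_wsol _ _ _ _ _ _ _ H n).
  apply: (wsol_ext _ _ (wsol_sub _ w2)) => [y _|y _|y y1]; first by rewrite /W.
    by rewrite /comp /fk /kap exprMn exprVn mulrA.
  by apply: hG; exact: ltW.
have [fk_m fk1 _ fkc] := gfk.
have cfW x : {for x, continuous (fk \o W)} by apply: ct_comp (cW x) (fkc _).
have fk0 t : 0 <= fk t by exact: mulr_ge0 (ltW kap0) (f_ge0 H _).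
have W0 y : 0 <= W y by exact: ps_ge0 H n _.
have [Mx hM] : exists Mx, forall y, W y <= Mx by have [x hx] := ps_max H n; exists (u n x) => y; exact: hx.
clearbody W fk.
have annR (y : V) : ann rho y -> r0 <= enorm y /\ enorm y <= 7 * rho by move=> /andP [y1 y2]; split; move: (r01) (y1) (y2); glra.
have AnO y : ann rho y -> forall i, P i -> y != ze i.
  move=> /annR [y1 y2] i Pi; have := off y y1 y2 i Pi.
  by apply: contraTneq => ->; rewrite subrr enorm0 -ltNge.
have wV : wsol (ann rho) (fun y => bn^-1 * W y) (fun=> 0).
  have s1 : (ann rho : set V) `<=` oball 1 by move=> y Ay; have y2 := proj2 (annR y Ay); rewrite /oball /=; apply: le_lt_trans y2 _; move: (rho1); glra.
  apply: (wsol_ext _ _ (wsolZ bn^-1 (wsol_sub s1 wW))) => [y _|y Ay]; first by [].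
  have [y1 y2] := annR y Ay.
  by rewrite /comp fk1 ?mulr0 // ltW // Wlt1.
have wB : wsol (ann rho) (snwt P ze) (fun=> 0).
  by apply: wsol_snwt N2 _ => i Pi /AnO /(_ i Pi); rewrite eqxx.
have hV' y : r0 <= enorm y -> enorm y <= 7 * rho -> `|bn^-1 * W y - snwt P ze y| <= eo.
  by move=> y1 y2; rewrite mulrC; exact: hV.
have hAB y : ann rho y -> [/\ {for y, continuous (fun y => bn^-1 * W y)}, {for y, continuous (snwt P ze)} & `|bn^-1 * W y - snwt P ze y| <= eo].
  move=> Ay; have [y1 y2] := annR y Ay; split; [|exact: ct_snwt (AnO y Ay)|exact: hV'].
  exact: ctM (@ctC _ _ _ y) (cW y).
have r0r : r0 <= rho by (move: (r01) (r00); glra).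
have r7 : rho <= 7 * rho by (move: (r00) (r0r); glra).
have inner x : enorm x <= r0 -> bn * (h3 + 3) <= W x.
  have r01' : r0 < 1 by (move: (rho1) (r0r); glra).
  apply: (super_min N0 r00 r01' wW (fun y => conj (cW y) (cfW y)) (fun y => fk0 _)) => y Ey.
  have y1 : r0 <= enorm y by rewrite Ey.
  have y2 : enorm y <= 7 * rho by rewrite Ey; move: (r0r) (r7); glra.
  have := hV y y1 y2; have := snwt_ge ze y Pa; rewrite za subr0 /nwt Ey ler_norml => hs /andP [lo _].
  have : h3 + 3 <= W y / bn by (move: (r0big) (eo1) (hs) (lo); glra).
  by rewrite ler_pdivlMr // mulrC.
have bdD l y : - del < l -> enorm y = rho -> l < dot y e -> W y < W (refl (l *: e) e y).
  move=> ls yr ly; have Hg := gain l y yr ls ly.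
  have sE : refl (l *: e) e y = y - (2 * (dot y e - l)) *: e by exact: refl_l.
  have s0 : 0 < dot y e - l by rewrite subr_gt0.
  have s2 : dot y e - l <= 2 * rho by have := CS1 y e; rewrite en1 mulr1 yr; move: (dr) (ls); glra.
  have yyl : enorm (y - refl (l *: e) e y) = 2 * (dot y e - l).
    by rewrite sE opprB addrCA subrr addr0 enormZ en1 mulr1 gtr0_norm // mulr_gt0.
  move: Hg s0 s2 yyl {sE ls ly}; move: (dot y e - l) (refl (l *: e) e y) => s yl Hg s0 s2 yyl.
  have yl5 : enorm yl <= 5 * rho by have := enormBD yl y 0; rewrite !subr0 [enorm (yl - y)]enormB yyl yr; move: (s2); glra.
  have yr0 : r0 <= enorm y by rewrite yr.
  have yr7 : enorm y <= 7 * rho by rewrite yr.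
  (* If the reflected point is within r0 of the pole, superharmonicity ([inner]) already makes W
     larger there than anywhere on the sphere; otherwise [refl_gain] applies. *)
  have [ylr|ylr] : enorm yl < r0 \/ r0 <= enorm yl by case: (lerP r0 (enorm yl)) => h; [right|left].
    apply: lt_le_trans (inner yl (ltW ylr)).
    have Hy := Hle3 y yr; have := hV y yr0 yr7; rewrite ler_norml => /andP [_ V2].
    have : W y / bn < h3 + 3 by (move: (eo1) (Hy) (V2); glra).
    by rewrite ltr_pdivrMr // mulrC.
  have yl7 : enorm yl <= 7 * rho by apply: le_trans yl5 _; rewrite ler_pM2r // ler_nat.
  have nz : yl != 0 by apply/eqP => Y0; move: ylr; rewrite Y0 enorm0 leNgt r00.
  have nzi i : P i -> ze i != 0 -> yl != ze i.
    move=> Pi zi0; apply/eqP => Y0; have := farz i Pi zi0; rewrite -Y0 leNgt.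
    by rewrite (le_lt_trans yl7) // ltr_pM2r // ltr_nat.
  have := refl_gain N0 rho0 g0 s0 (ltW eo0) eo2 eo3 wV wB hAB (hV' yl ylr yl7) (hV' y yr0 yr7) yr yyl (Hg nz nzi).
  by rewrite ltr_pM2l ?invr_gt0.
have := ball_planes N0 gfk n1 cW wW W0 hM rho0 rho1 del0 dr bdD.
have ye : enorm (- (del *: e)) = del by rewrite enormN enormZ en1 mulr1 gtr0_norm.
have := Wlt1 (- (del *: e)); rewrite ye => /(_ r02 (le_trans dr r7)) lt1 le1.
by have := lt_le_trans (le_lt_trans le1 lt1) W01; rewrite ltxx.
Qed.
End ClusterAbsurd.

(** * Choice of the cluster scale and simplicity of interior spikes *)

Section Simple.
Context {R : realType} {N : nat} (Om : set 'rV[R]_N) (p : R) (u : nat -> 'rV[R]_N -> R) (eps : nat -> R) (C0 : R).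
Hypothesis H : pde_seq Om p u eps C0.
Notation V := 'rV[R]_N.
Variables (U : set_system nat).
Hypotheses (UU : UltraFilter U) (Uoo : forall A : set nat, nbhs \oo A -> U A).
Variable (w0 : V -> R) (R0 : R).
Hypotheses (cw : continuous w0) (ww : wsol setT w0 (fp p \o w0)) (wp : forall x, 0 < w0 x) (dw : dec0 w0)
  (wm : forall x, w0 x <= w0 0) (w1 : 1 < w0 0) (hR0 : forall x, 1 < w0 x <-> enorm x < R0).
Variables (k : nat) (zz : 'I_k -> nat -> V) (R1 : R).
Hypotheses (R10 : 0 <= R1)
  (hC : forall i (r e : R), 0 < e -> U [set n | forall y, enorm y <= r -> `|u n (eps n *: y + zz i n) - w0 y| <= e])
  (hS : forall i j, i != j -> forall K : R, U [set n | K * eps n < enorm (zz i n - zz j n)])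
  (hT : U [set n | forall x, 1 <= u n x -> exists2 i, enorm (x - zz i n) <= R1 * eps n & u n x <= u n (zz i n)]).
Let N2 := ps_N H.

(** The cluster consists of all spikes with the same limit. The pair at maximal mutual distance can
    be taken constant along U; this distance is the scale d, and it makes the second spike of the
    pair an extremal pole. *)
Lemma simple (lim : 'I_k -> V) : (forall i (e : R), 0 < e -> U [set n | enorm (zz i n - lim i) < e]) ->
  forall i j, Om (lim i) -> lim i = lim j -> i = j.
Proof.
move=> hl i j Oi Eij; apply/eqP; apply: contrapT => /negP nij; pose z := lim i.
pose P : pred 'I_k := fun i => lim i == z.
have Pi : P i by rewrite /P.
have Pj : P j by rewrite /P -Eij.
have hP i' : P i' -> forall e : R, 0 < e -> U [set n | enorm (zz i' n - z) < e].
  by move=> /eqP <- e e0; exact: hl.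
have hQ i' : ~~ P i' -> exists2 e : R, 0 < e & U [set n | e <= enorm (zz i' n - z)].
  move=> nP; have d0 : 0 < enorm (lim i' - z) by apply: enorm_gt0; rewrite subr_eq0.
  exists (enorm (lim i' - z) / 2); first by rewrite divr_gt0.
  apply: (uS UU (hl i' _ (divr_gt0 d0 (ltr0n _ 2)))) => n /= h.
  have := enormBD (lim i') (zz i' n) z; rewrite [enorm (lim i' - zz i' n)]enormB; lra.
have ex n : exists ab : 'I_k * 'I_k, (P ab.1 && P ab.2) /\ forall i' j', P i' -> P j' -> enorm (zz i' n - zz j' n) <= enorm (zz ab.1 n - zz ab.2 n).
  pose Q := fun ab : 'I_k * 'I_k => P ab.1 && P ab.2.
  have Q0 : Q (i, j) by rewrite /Q Pi Pj.
  case: (arg_maxP (fun ab : 'I_k * 'I_k => enorm (zz ab.1 n - zz ab.2 n)) Q0) => ab Qab h.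
  by exists ab; split=> // i' j' Pi' Pj'; have := h (i', j'); rewrite /Q Pi' Pj' => /(_ isT).
have [ab hab] := choice ex.
have [a [b [Pa [Pb hm]]]] : exists a b, P a /\ P b /\ U [set n | forall i' j', P i' -> P j' -> enorm (zz i' n - zz j' n) <= enorm (zz a n - zz b n)].
  have [a ha] : exists a, U [set n | (ab n).1 = a] by apply: u_ex => //; apply: (uS UU filterT) => n _; exists (ab n).1.
  have [b hb] : exists b, U [set n | (ab n).2 = b] by apply: u_ex => //; apply: (uS UU filterT) => n _; exists (ab n).2.
  have [n [n1 n2]] := uE UU (filterI ha hb); have [/andP [P1 P2] _] := hab n.
  exists a, b; rewrite -n1 -n2; split=> //; split=> //.
  by apply: (uI UU ha hb) => n' /= E1 E2; have [_] := hab n'; rewrite E1 E2 n1 n2.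
have hd1 (K : R) : U [set n | K * eps n < enorm (zz a n - zz b n)].
  apply: (uI UU (hS nij K) hm) => n /= h1 h2; exact: lt_le_trans h1 (h2 i j Pi Pj).
have nab : a != b.
  apply/eqP => E; have [n] := uE UU (hd1 0); rewrite /= E mul0r subrr enorm0 ltxx //.
(* The default value 1 keeps d positive at indices where the two spikes coincide; such indices are
   U-negligible. *)
pose d n := if enorm (zz a n - zz b n) == 0 then 1 else enorm (zz a n - zz b n).
have d_gt0 n : 0 < d n.
  by rewrite /d; case: eqVneq => // h; rewrite lt_neqAle eq_sym h enorm_ge0.
have dE : U [set n | d n = enorm (zz a n - zz b n)].
  by apply: (uS UU (hd1 0)) => n /=; rewrite mul0r /d => h; rewrite gt_eqF.
have hd0 (e : R) : 0 < e -> U [set n | d n < e].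
  move=> e0; have e2 : 0 < e / 2 by rewrite divr_gt0.
  apply: (uI UU dE (filterI (hP a Pa _ e2) (hP b Pb _ e2))) => n /= -> [h1 h2].
  by have := enormBD (zz a n) z (zz b n); rewrite [enorm (z - zz b n)]enormB; move: (h1) (h2); glra.
have hdK (K : R) : U [set n | K * eps n < d n] by apply: (uI UU dE (hd1 K)) => n /= ->.
pose zn i' n : V := (d n)^-1 *: (zz i' n - zz a n).
have nz n i' j' : d n = enorm (zz a n - zz b n) -> enorm (zz i' n - zz j' n) <= enorm (zz a n - zz b n) -> enorm (zn i' n - zn j' n) <= 1.
  move=> E h; rewrite /zn -scalerBr opprB addrA subrK enormZ gtr0_norm ?invr_gt0 // mulrC ler_pdivrMr // mul1r E //.
have zna n : zn a n = 0 by rewrite /zn subrr scaler0.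
have exl i' : exists l : V, P i' -> forall e : R, 0 < e -> U [set n | enorm (zn i' n - l) < e].
  case Pi' : (P i'); last by exists 0.
  have [|l _ hl'] := @ulim_pt R N U UU (cball 0 1) (zn i') (@compact_cball _ _ 0 1); last by exists l.
  apply: (uI UU dE hm) => n /= E h; rewrite /cball /=.
  by have := nz n i' a E (h i' a Pi' Pa); rewrite zna.
have [ze hze] := choice exl.
have pass i' j' (c : R) : P i' -> P j' -> U [set n | enorm (zn i' n - zn j' n) <= c] -> enorm (ze i' - ze j') <= c.
  move=> Pi' Pj' hc; apply/ler_addgt0Pr => e e0; have e2 : 0 < e / 2 by rewrite divr_gt0.
  have [n [[n1 n2] n3]] := uE UU (filterI (filterI (hze i' Pi' _ e2) (hze j' Pj' _ e2)) hc).
  have {}n1 : enorm (zn i' n - ze i') < e / 2 := n1.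
  have {}n2 : enorm (zn j' n - ze j') < e / 2 := n2.
  have {}n3 : enorm (zn i' n - zn j' n) <= c := n3.
  have := enormBD (ze i') (zn i' n) (ze j'); have := enormBD (zn i' n) (zn j' n) (ze j').
  by rewrite [enorm (ze i' - zn i' n)]enormB; move: (n1) (n2) (n3); glra.
have le1 i' j' : P i' -> P j' -> enorm (ze i' - ze j') <= 1.
  by move=> Pi' Pj'; apply: pass => //; apply: (uI UU dE hm) => n /= E h; apply: nz => //; exact: h.
have za : ze a = 0.
  apply: enorm_eq0; apply/eqP; rewrite eq_le enorm_ge0 andbT; apply/ler_addgt0Pr => e e0.
  have [n h] := uE UU (hze a Pa e e0); have {h} : enorm (zn a n - ze a) < e := h.
  by rewrite zna sub0r enormN add0r => /ltW.
have zb : enorm (ze b) = 1.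
  apply/eqP; rewrite eq_le; apply/andP; split; first by have := le1 b a Pb Pa; rewrite za subr0.
  apply/ler_addgt0Pr => e e0; have [n [n1 n2]] := uE UU (filterI (hze b Pb e e0) dE).
  have {}n1 : enorm (zn b n - ze b) < e := n1.
  have {}n2 : d n = enorm (zz a n - zz b n) := n2.
  have E : enorm (zn b n) = 1.
    by rewrite /zn enormZ gtr0_norm ?invr_gt0 // [enorm (zz b n - _)]enormB -n2 mulVf // gt_eqF.
  by have := enormD (zn b n - ze b) (ze b); rewrite subrK E; move: (n1); glra.
have hze' i' : P i' -> forall e : R, 0 < e -> U [set n | enorm ((d n)^-1 *: (zz i' n - zz a n) - ze i') < e] by exact: hze.
have leb i' : P i' -> enorm (ze i' - ze b) <= 1 by move=> Pi'; exact: le1.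
have lea i' : P i' -> enorm (ze i') <= 1 by move=> Pi'; have := le1 i' a Pi' Pa; rewrite za subr0.
exact: (cluster_absurd H UU Uoo cw ww wp dw w1 hR0 R10 hC hS hT Oi Pa hP hQ d_gt0 hd0 hdK hze' Pb za zb leb lea).
Qed.
End Simple.

Section Lines.
Context {R : realType} {N : nat}.
Notation V := 'rV[R]_N.
Implicit Types (u g : V -> R) (x y q : V) (t s h e : R).

Lemma der_hd u x q : derivable u x q -> hd (fun t => u (x + t *: q)) 0 ('D_q u x).
Proof.
move=> dk; apply: is_hd.
have E : (fun t => t^-1 *: (((fun s => u (x + s *: q)) \o shift 0) (t *: 1) - u (x + 0 *: q))) = (fun t => t^-1 *: ((u \o shift x) (t *: q) - u x)).
  apply/funext => t; rewrite /shift /= [t%:A]mulr1 scale0r !addr0; congr (_ *: (u _ - _)).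
  by rewrite addrC.
by split; [rewrite /derivable E|rewrite /derive E].
Qed.

Lemma hd_pd u x q d : hd (fun t => u (x + t *: q)) 0 d -> derivable u x q /\ 'D_q u x = d.
Proof.
move=> /hd_is [h1 h2].
have E : (fun t => t^-1 *: (((fun s => u (x + s *: q)) \o shift 0) (t *: 1) - u (x + 0 *: q))) = (fun t => t^-1 *: ((u \o shift x) (t *: q) - u x)).
  apply/funext => t; rewrite /shift /= [t%:A]mulr1 scale0r !addr0; congr (_ *: (u _ - _)).
  by rewrite addrC.
by move: h1 h2; rewrite /derivable /derive E.
Qed.

Lemma hd_base g y q s d : hd (fun t => g (y + s *: q + t *: q)) 0 d -> hd (fun t => g (y + t *: q)) s d.
Proof.
move=> h e e0; have [r r0 hr] := h e e0; exists r => // t tr; have := hr t tr.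
by rewrite add0r scale0r addr0 scalerDl addrA.
Qed.

Lemma hd_bound (g : R -> R) d e : hd g 0 d -> (exists2 r : R, 0 < r & forall t, `|t| < r -> `|g t - g 0| <= e * `|t|) -> `|d| <= e.
Proof.
move=> h [r r0 hr]; apply/ler_addgt0Pr => e' e'0; have [r' r'0 hr'] := h e' e'0.
pose t := Num.min r r' / 2; have m0 : 0 < Num.min r r' by rewrite lt_min r0.
have [m1 m2] : Num.min r r' <= r /\ Num.min r r' <= r' by split; rewrite ge_min lexx ?orbT.
have t0 : 0 < t by rewrite divr_gt0.
have tn : `|t| = t by rewrite gtr0_norm.
have := hr t; have := hr' t; rewrite tn add0r => /(_ ltac:(rewrite /t; move: (m0) (m2); glra)) h1 /(_ ltac:(rewrite /t; move: (m0) (m1); glra)) h2.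
have : `|d * t| <= (e + e') * t.
  have -> : d * t = (g t - g 0) - (g t - g 0 - d * t) by ring.
  by apply: le_trans (ler_normB _ _) _; move: (h1) (h2); glra.
by rewrite normrM tn ler_pM2r.
Qed.
End Lines.

Section PpUnif.
Context {R : realType}.
Implicit Types (q s t M : R).

Lemma ctR_intro (g : R -> R) t : (forall e, 0 < e -> exists2 r : R, 0 < r & forall s, `|s - t| < r -> `|g s - g t| <= e) -> {for t, continuous g}.
Proof.
move=> h; apply/cvgrPdist_le => e e0; have [r r0 hr] := h e e0.
by apply/nbhs_ballP; exists r => // s; rewrite /ball /= distrC => ts; rewrite distrC; exact: hr.
Qed.

Lemma ct_ppq q t : 0 < q -> {for t, continuous (pp q)}.
Proof.
move=> q0; apply: ctR_intro => e e0; have q1 : q != 0 by rewrite gt_eqF.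
have [t0|t0|t0] := ltgtP t 0.
- exists (- t); first by rewrite oppr_gt0.
  move=> s; rewrite ltr_norml => st; rewrite !pp_neg ?subrr ?normr0 ?(ltW e0) ?(ltW t0) //; lra.
- have [r r0 hr] := hd_powR q t0 ltr01; pose c := q * powR t (q - 1).
  pose m := `|c| + 1; have m0 : 0 < m by rewrite ltr_wpDl.
  exists (Num.min (Num.min r t) (e / m)); first by rewrite !lt_min r0 t0 divr_gt0.
  move=> s; rewrite !lt_min => /andP [/andP [s1 s2] s3].
  have s0 : 0 <= s by move: s2; rewrite ltr_norml; glra.
  have := hr _ s1; rewrite [t + (s - t)]addrC subrK -/c !pp_pos ?(ltW t0) // mul1r => h.
  have -> : powR s q - powR t q = (powR s q - powR t q - c * (s - t)) + c * (s - t) by ring.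
  apply: le_trans (ler_normD _ _) _; rewrite normrM; move: s3; rewrite ltr_pdivlMr // /m.
  move: (h); glra.
- rewrite t0; have [r r0 hr] := pp_small q0 e0; exists r => // s; rewrite subr0 ltr_norml => /andP [_ sr].
  by rewrite (pp_neg q1 (lexx 0)) subr0 ger0_norm ?pp_ge0 //; apply: hr; exact: ltW.
Qed.

Lemma pp_unif q M e : 0 < q -> 0 < e -> exists2 d : R, 0 < d & forall s t, `|s| <= M -> `|s - t| < d -> `|pp q (s - 1) - pp q (t - 1)| <= e.
Proof.
move=> q0 e0; pose W (v : 'rV[R]_1) := pp q (v ord0 ord0 - 1).
have cc (v : 'rV[R]_1) : {for v, continuous (fun v : 'rV[R]_1 => v ord0 ord0)}.
  apply/contP => d d0; exists d => // y; apply: le_lt_trans.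
  by have := coord_le (y - v) ord0; rewrite !mxE.
have cW v : {for v, continuous W}.
  by apply: (@ct_comp _ _ (fun v : 'rV[R]_1 => v ord0 ord0 - 1) (pp q) v); [exact: ctB (cc v) (@ctC _ _ 1 v)|exact: ct_ppq].
have En (t : R) : enorm (const_mx t : 'rV[R]_1) = `|t|.
  by rewrite enormE /sqn /dot big_ord1 !mxE -expr2 sqrtr_sqr.
have [d d0 hd] := unif_cont (@compact_cball _ _ (0 : 'rV[R]_1) M) (fun v _ => cW v) e0.
exists d => // s t sM st; have := hd (const_mx s) (const_mx t); rewrite /cball /= subr0 En => /(_ sM).
rewrite (_ : const_mx t - const_mx s = const_mx (t - s)); last by apply/rowP => i; rewrite !mxE.
by rewrite En [`|t - s|]distrC => /(_ st); rewrite /W !mxE distrC => /ltW.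
Qed.
End PpUnif.

(** * Convergence of first and second derivatives *)

Section C1Close.
Context {R : realType} {N : nat} (p : R) (w0 : 'rV[R]_N -> R) (w1 : 'I_N -> 'rV[R]_N -> R).
Notation V := 'rV[R]_N.
Implicit Types (x y : V) (r e d h M K : R).
Hypotheses (N0 : (0 < N)%N) (p1 : 1 < p) (cw : continuous w0) (ww : wsol setT w0 (fp p \o w0)) (w00 : forall x, 0 <= w0 x)
  (hw1 : forall i x, hd (fun t => w0 (x + t *: ev i)) 0 (w1 i x)).
Let f := fp p.
Let f' t := p * pp (p - 1) (t - 1).

Let hdf (t : R) : hd f t (f' t).
Proof.
have h : hd (fun t => t - 1) t (1 - 0) by exact: hdB (hd_id t) (hdC 1 t).
have := hd_comp h (hd_pp (t - 1) p1); rewrite subr0 mulr1; exact.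
Qed.

(* The gradient estimate is applied to [u - w0], and to its difference quotients for the second derivatives. *)
Lemma c1_close r e M K : 0 < e -> 0 <= M -> 0 <= K -> (forall x, w0 x <= M) -> (forall i x, enorm x < r + 3 -> `|w1 i x| <= K) ->
  exists2 d : R, 0 < d & forall (u : V -> R) (u1 : 'I_N -> V -> R), continuous u -> wsol (oball (r + 3)) u (f \o u) ->
   (forall x, 0 <= u x <= M) -> (forall i x, enorm x < r + 3 -> hd (fun t => u (x + t *: ev i)) 0 (u1 i x)) ->
   (forall x, enorm x < r + 3 -> `|u x - w0 x| <= d) ->
   forall i x, enorm x < r -> `|u1 i x - w1 i x| <= e /\
     forall y, enorm y < r -> enorm (x - y) <= 1 -> `|(u1 i x - w1 i x) - (u1 i y - w1 i y)| <= e * enorm (x - y).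
Proof.
have p1' := p1; move=> e0 M0 K0 wM wK; have NR : 1 <= N%:R :> R by rewrite ler1n.
have [L L0 hL] := lip2 M (goodf_fp p1).
pose Lf := f' M; have Lf0 : 0 <= Lf by rewrite /Lf /f' mulr_ge0 ?pp_ge0 //; lra.
have p0 : 0 < p by lra.
have f'0 t : 0 <= f' t by rewrite /f' mulr_ge0 ?pp_ge0 //; lra.
have f'M t : t <= M -> f' t <= Lf by move=> tM; rewrite /Lf /f' ler_pM2l; [apply: pp_mono; move: (p1') (tM); glra|move: (p0); glra].
(* The derivative f' need not be Lipschitz when p < 2, so only its modulus of continuity is used,
   with tolerance [om] against the gradient bound K. *)
pose om := e / (K + 1); have om0 : 0 < om by rewrite divr_gt0 //; lra.
have Kom : K * om <= e by rewrite /om mulrCA ler_piMr ?(ltW e0) // ler_pdivrMr; move: (K0); glra.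
have p10 : 0 < p - 1 by lra.
have [dl dl0 hdl] := pp_unif M p10 (divr_gt0 om0 p0).
pose c := N%:R + L / 2; have c0 : 0 < c by rewrite /c; move: (NR) (L0); glra.
pose C := (N%:R + Lf / 2 + 1) * c; have C0 : 0 < C by rewrite mulr_gt0 //; move: (NR) (Lf0); glra.
pose d := Num.min (dl / 2) (e / (2 * C)).
have [d1 d2] : d <= dl / 2 /\ d <= e / (2 * C) by split; rewrite ge_min lexx ?orbT.
have d0 : 0 < d by rewrite lt_min !divr_gt0 // mulr_gt0.
have Cd : C * d <= e / 2.
  by move: d2; rewrite ler_pdivlMr ?mulr_gt0 //; move: (NR) (Lf0); glra.
clearbody d om Lf.
have Cd1 : (N%:R + Lf / 2 + 1) * (c * d) <= e / 2 by move: Cd; rewrite /C mulrA.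
have cE : N%:R * d / 1 + L * d * 1 / 2 = c * d by rewrite /c; field.
clearbody C c.
exists d => // u u1 cu wu u0M hu1 hd_ i x xr.
have uM y : u y <= M by have /andP [] := u0M y.
have u0 y : 0 <= u y by have /andP [] := u0M y.
have cd0 : 0 < c * d by rewrite mulr_gt0.
pose D y := u y - w0 y; pose F y := f (u y) - f (w0 y).
have [_ _ _ fc] := goodf_fp p1.
have cD y : {for y, continuous D} by exact: ctB (cu y) (@cw y).
have cF y : {for y, continuous F} by exact: ctB (ct_comp (cu y) (fc _)) (ct_comp (@cw y) (fc _)).
have wD : wsol (oball (r + 3)) D F.
  by exact: wsolB wu (wsol_sub (@subsetT _ _) ww).
have Fd y : enorm y < r + 3 -> `|F y| <= L * d.
  by move=> yr; apply: le_trans (hL _ _ (uM y) (wM y)) _; rewrite ler_pM2l // hd_.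
have mid (y y' x' : V) (s t : R) : enorm y < s -> enorm y' < s -> enorm (x' - 2^-1 *: (y + y')) <= t -> enorm x' < s + t.
  move=> ys ys' h; have := enormBD x' (2^-1 *: (y + y')) 0; rewrite !subr0.
  by have := enormD y y'; rewrite enormZ gtr0_norm ?invr_gt0 //; move: (ys) (ys') (h); glra.
(* First application of [lip_est]: u - w0 is at most d with source at most L d, so its Lipschitz
   constant is c d. *)
have step1 y y' : enorm y < r + 2 -> enorm y' < r + 2 -> enorm (y - y') <= 2 -> `|D y - D y'| <= enorm (y - y') * (c * d).
  move=> yr yr' yy'.
  have sub : cball (2^-1 *: (y + y')) 1 `<=` oball (r + 3).
    by move=> x' h; have := mid y y' x' (r + 2) 1 yr yr' h; rewrite /oball /=; glra.
  have := @lip_est R N y y' _ D F d (L * d) 1 N0 (@open_oball _ _ _) wD ltr01 sub (fun x' _ => conj (cD x') (cF x')).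
  move=> h; apply: le_trans (h _ _) _.
  - by move=> x' /sub x'r; split; [exact: hd_|exact: Fd].
  - move: (yy'); glra.
  - by rewrite cE.
have hdD1 y : enorm y < r + 3 -> hd (fun t => D (y + t *: ev i)) 0 (u1 i y - w1 i y).
  by move=> yr; exact: hdB (hu1 i y yr) (hw1 i y).
have ev1 : enorm (ev i : V) = 1 by rewrite enormE sqn_ev sqrtr1.
have b1 y : enorm y < r + 2 -> `|u1 i y - w1 i y| <= c * d.
  move=> yr; apply: hd_bound (hdD1 y _) _; first by (move: (yr); glra).
  exists (Num.min 1 (r + 2 - enorm y)); first by rewrite lt_min ltr01 subr_gt0.
  move=> t; rewrite lt_min scale0r addr0 => /andP [t1 t2].
  have en : enorm (y + t *: ev i - y) = `|t| by rewrite xhx enormZ ev1 mulr1.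
  have := step1 (y + t *: ev i) y; rewrite en [_ * (c * d)]mulrC; apply=> //; last by (move: (t1); glra).
  by have := enormD y (t *: ev i); rewrite enormZ ev1 mulr1; move: (t2); glra.
have cde : c * d <= e.
  have : 1 * (c * d) <= (N%:R + Lf / 2 + 1) * (c * d) by rewrite ler_pM2r //; move: (NR) (Lf0); glra.
  move: (Cd1) (cd0); glra.
split; first by apply: le_trans (b1 x _) cde; move: (xr); glra.
move=> y yr xy.
pose e2 := Lf * (c * d) + K * om.
have e20 : 0 <= e2 by rewrite addr_ge0 ?mulr_ge0 // ltW.
have sm : N%:R * (c * d) + e2 / 2 <= e.
  have := Cd1; rewrite !mulrDl /e2 mul1r; move: (Kom) (cd0); glra.
have dF z (h : R) : 0 <= h <= 1 -> enorm z < r + 1 -> `|F (z + h *: ev i) - F z| <= e2 * h.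
  move=> /andP [h0 h1] zr.
  have := @mvt1 R (fun t => F (z + t *: ev i)) (fun t => f' (u (z + t *: ev i)) * u1 i (z + t *: ev i) - f' (w0 (z + t *: ev i)) * w1 i (z + t *: ev i)) 0 h 0 e2.
  rewrite scale0r addr0 mul0r !subr0 (ger0_norm h0); apply => t; rewrite (min_idPl h0) (max_idPr h0) => /andP [t0 th].
  set y' := z + t *: ev i; have y'r : enorm y' < r + 2.
    have := enormD z (t *: ev i); rewrite enormZ ev1 mulr1 ger0_norm // -/y'; move: (h1) (zr) (th); glra.
  have y'r3 : enorm y' < r + 3 by (move: (y'r); glra).
  split.
    have h2 : hd (fun t => u (z + t *: ev i)) t (u1 i y') by apply: hd_base; exact: hu1.
    have h3 : hd (fun t => w0 (z + t *: ev i)) t (w1 i y') by apply: hd_base; exact: hw1.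
    exact: hdB (hd_comp h2 (hdf _)) (hd_comp h3 (hdf _)).
  rewrite subr0 (_ : _ - _ = f' (u y') * (u1 i y' - w1 i y') + (f' (u y') - f' (w0 y')) * w1 i y'); last by ring.
  apply: le_trans (ler_normD _ _) _; rewrite [X in X + _]normrM [X in _ + X]normrM; apply: lerD.
    by apply: ler_pM; rewrite ?normr_ge0 ?b1 // ger0_norm ?f'M.
  rewrite mulrC; apply: ler_pM; rewrite ?normr_ge0 ?wK //.
  rewrite /f' -mulrBr normrM gtr0_norm // mulrC -ler_pdivlMr //; apply: hdl; first by rewrite ger0_norm.
  have h2 := hd_ y' y'r3; move: (d0) (h2) (d1); glra.
(* Second application, to the increment of u - w0 over h ev_i: it is at most h c d by [step1] and
   its source at most h e2 by [dF]. Dividing by h and letting h tend to 0 gives the Lipschitz bound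
   for the derivative. *)
have quot (h : R) : 0 < h <= 1 -> `|(D (x + h *: ev i) - D x) - (D (y + h *: ev i) - D y)| <= h * (enorm (x - y) * e).
  move=> /andP [h0 h1]; have hh : 0 <= h <= 1 by rewrite ltW.
  pose Dh z := D (1 *: z + h *: ev i) - D z.
  pose Fh z := 1 ^+ 2 * F (1 *: z + h *: ev i) - F z.
  have inc z : enorm z < r + 2 -> enorm (1 *: z + h *: ev i) < r + 3.
    by move=> zr; have := enormD (1 *: z) (h *: ev i); rewrite scale1r enormZ ev1 mulr1 gtr0_norm //; move: (hh) (zr); glra.
  have wDh : wsol (oball (r + 2)) Dh Fh.
    apply: wsolB; last by apply: wsol_sub wD => z zr; have : enorm z < r + 2 := zr; rewrite /oball /=; glra.
    by apply: wsol_sub (wsol_dil (b := h *: ev i) ltr01 wD) => z zr; exact: inc.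
  have cDh z : {for z, continuous Dh} by exact: ctB (@ct_resc _ _ D 1 (h *: ev i) ltr01 cD z) (cD z).
  have cFh z : {for z, continuous Fh}.
    exact: ctB (ctM (@ctC _ _ _ z) (@ct_resc _ _ F 1 (h *: ev i) ltr01 cF z)) (cF z).
  have sub : cball (2^-1 *: (x + y)) 1 `<=` oball (r + 2).
    by move=> z hz; have := mid x y z r 1 xr yr hz; rewrite /oball /=; glra.
  have := @lip_est R N x y _ Dh Fh (h * (c * d)) (e2 * h) 1 N0 (@open_oball _ _ _) wDh ltr01 sub (fun z _ => conj (cDh z) (cFh z)).
  move=> hq; have := hq _ _; rewrite /Dh !scale1r => {}hq; apply: le_trans (hq _ _) _.
  - move=> z hz; have zr := mid x y z r 1 xr yr hz; rewrite /Fh expr1n mul1r !scale1r; split; last exact: dF.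
    have := step1 (z + h *: ev i) z; rewrite xhx enormZ ev1 mulr1 gtr0_norm //; apply; last by (move: (hh); glra).
      by have := enormD z (h *: ev i); rewrite enormZ ev1 mulr1 gtr0_norm //; move: (hh) (zr); glra.
    move: (zr); glra.
  - move: (xy); glra.
  - have -> : N%:R * (h * (c * d)) / 1 + e2 * h * 1 / 2 = h * (N%:R * (c * d) + e2 / 2) by field.
    rewrite [X in X <= _]mulrCA; apply: ler_wpM2l; first exact: ltW.
    by apply: ler_wpM2l; [exact: enorm_ge0|exact: sm].
have hx := hdD1 x ltac:(move: (xr); glra); have hy := hdD1 y ltac:(move: (yr); glra).
have hxy := hdB hx hy.
rewrite leNgt; apply/negP => big.
set q := (u1 i x - w1 i x) - (u1 i y - w1 i y) in hxy big.
pose gap := `|q| - e * enorm (x - y); have g0 : 0 < gap by rewrite subr_gt0.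
have [s s0 hs] := hxy (gap / 2) (divr_gt0 g0 (ltr0n _ 2)).
pose h := Num.min 1 (s / 2); have [h1 h2] : h <= 1 /\ h <= s / 2 by split; rewrite ge_min lexx ?orbT.
have h0 : 0 < h by rewrite lt_min ltr01 divr_gt0.
clearbody h.
have hn : `|h| = h by rewrite gtr0_norm.
have := hs h; rewrite hn add0r !scale0r !addr0 => /(_ ltac:(move: (h2) (h0); glra)) k1.
have hh1 : 0 < h <= 1 by rewrite h0.
have k2 := quot h hh1.
have : `|q * h| <= h * (enorm (x - y) * e) + gap / 2 * h.
  have -> : q * h = ((D (x + h *: ev i) - D x) - (D (y + h *: ev i) - D y)) - (D (x + h *: ev i) - D (y + h *: ev i) - (D x - D y) - q * h) by ring.
  by apply: le_trans (ler_normB _ _) _; exact: lerD.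
rewrite normrM hn (_ : _ + _ = (e * enorm (x - y) + gap / 2) * h); last by ring.
by rewrite ler_pM2r // /gap; move: g0; rewrite /gap; glra.
Qed.
End C1Close.

Section FinBd.
Context {R : realType}.
Lemma fin_bd n (P : 'I_n -> R -> Prop) : (forall i K K', K <= K' -> P i K -> P i K') ->
  (forall i, exists2 K : R, 0 <= K & P i K) -> exists2 K : R, 0 <= K & forall i, P i K.
Proof.
move=> mono /(_ _)/cid2-/all_sig [k hk].
exists (\sum_(i < n) k i); first by apply: sumr_ge0 => i _; have [] := hk i.
move=> i; have [_] := hk i; apply: mono.
by rewrite (bigD1 i) //= lerDl; apply: sumr_ge0 => j _; have [] := hk j.
Qed.
End FinBd.

Section C2Conv.
Context {R : realType} {N : nat} (Om : set 'rV[R]_N) (p : R) (u v : nat -> 'rV[R]_N -> R) (eps : nat -> R) (C0 : R).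
Hypothesis H : pde_seq Om p u eps C0.
Notation V := 'rV[R]_N.
Implicit Types (x y : V) (n : nat).
Hypotheses (uv : forall n x, Om x -> u n x = v n x) (dv1 : forall n i x, Om x -> derivable (v n) x (ev i))
  (dv2 : forall n i j x, Om x -> derivable (pd i (v n)) x (ev j)).
Variables (U : set_system nat).
Hypotheses (UU : UltraFilter U) (Uoo : forall A : set nat, nbhs \oo A -> U A).
Variable (w0 : V -> R).
Hypotheses (cw : continuous w0) (ww : wsol setT w0 (fp p \o w0)) (wp : forall x, 0 < w0 x)
  (wm : forall x, w0 x <= w0 0) (w1 : 1 < w0 0) (dw1 : forall i x, derivable w0 x (ev i))
  (dw2 : forall i j x, derivable (pd i w0) x (ev j)) (cw1 : forall i, continuous (pd i w0)).
Variable z : nat -> V.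
Hypotheses (hC : forall r e : R, 0 < e -> U [set n | forall y, enorm y <= r -> `|u n (eps n *: y + z n) - w0 y| <= e])
  (hB : forall K : R, U [set n | forall xb, bdry Om xb -> K * eps n < enorm (z n - xb)]).

Lemma spike_in (r : R) : U [set n | forall y, enorm y <= r -> Om (eps n *: y + z n)].
Proof.
have g0 : 0 < (w0 0 - 1) / 2 by rewrite divr_gt0 // subr_gt0.
apply: (uI UU (hC 0 g0) (hB (Num.max r 0))) => n h1 h2 y yr; have e0 := ps_e H n.
have Oz : Om (z n).
  apply: contrapT => nO; have := h1 0; rewrite enorm0 lexx scaler0 add0r (ps_out H n (z n) nO) => /(_ isT).
  rewrite sub0r normrN gtr0_norm //; have := w1; lra.
apply: (ball_in (ps_open H) Oz h2); rewrite /cball /= addrK enormZ gtr0_norm // mulrC ler_pM2r //.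
by rewrite le_max yr.
Qed.

(** [c1_close] controls the difference of the gradients and its Lipschitz constant; [hd_bound] turns
    the latter into a bound on second derivatives. *)
Lemma C2_conv (r e : R) : 0 < e -> U [set n | let d := fun y : V => v n (eps n *: y + z n) - w0 y in
  forall y, enorm y < r -> `|d y| <= e /\ (forall a, `|pd a d y| <= e) /\ (forall a b, `|pd b (pd a d) y| <= e)].
Proof.
move=> e0; have [M M1 hM] := sup_bound H; have := Uoo hM => {}hM.
have N0 := ps_N0 H; have p1 := ps_p H.
pose M' := Num.max M (w0 0).
have M'0 : 0 <= M' by rewrite le_max (ltW (wp 0)) orbT.
have wM x : w0 x <= M' by rewrite le_max wm orbT.
have [K K0 hK] : exists2 K : R, 0 <= K & forall i : 'I_N, forall x, enorm x <= r + 3 -> `|pd i w0 x| <= K.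
  apply: fin_bd => [i K K' KK h x xr|i]; first by apply: le_trans (h x xr) KK.
  have [r0|r0] := ltP (r + 3) 0.
    by exists 0 => // x xr; have := enorm_ge0 x; move: xr r0; lra.
  have [c _ hc] := @compact_max _ _ (fun x => `|pd i w0 x|) (cball 0 (r + 3)) (ex_intro _ 0 (cball_center 0 r0)) (@compact_cball _ _ _ _) (fun x _ => ct_comp (@cw1 i x) (@norm_continuous _ _ _)).
  by exists `|pd i w0 c|; rewrite ?normr_ge0 // => x xr; apply: hc; rewrite /cball /= subr0.
have hw1 i x : hd (fun t => w0 (x + t *: ev i)) 0 (pd i w0 x) by exact: der_hd.
have hw2 i j x : hd (fun t => pd i w0 (x + t *: ev j)) 0 (pd j (pd i w0) x) by exact: der_hd.
have [d d0 hd_] := @c1_close R N p w0 (fun i => pd i w0) N0 p1 cw ww hw1 r e M' K e0 M'0 K0 wM (fun i x xr => hK i x (ltW xr)).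
have m0 : 0 < Num.min d e by rewrite lt_min d0.
apply: (uI UU (uI UU hM (hC (r + 3) m0) (fun n a b => conj a b)) (spike_in (r + 3))) => n [uM hc] hO dd y yr.
have en := ps_e H n.
pose Un y := u n (eps n *: y + z n).
pose U1 i y := eps n * pd i (v n) (eps n *: y + z n).
pose U2 i j y := eps n * (eps n * pd j (pd i (v n)) (eps n *: y + z n)).
have opn x : enorm x < r + 3 -> exists2 s : R, 0 < s & forall t (q : V), enorm q = 1 -> `|t| < s -> enorm (x + t *: q) < r + 3.
  move=> xr; exists (r + 3 - enorm x); first by rewrite subr_gt0.
  by move=> t q q1 ts; have := enormD x (t *: q); rewrite enormZ q1 mulr1; move: (ts); glra.
have ev1 i : enorm (ev i : V) = 1 by rewrite enormE sqn_ev sqrtr1.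
have aff (g : V -> R) x q dg : hd (fun t => g (eps n *: x + z n + t *: q)) 0 dg -> hd (fun t => g (eps n *: (x + t *: q) + z n)) 0 (eps n * dg).
  move=> h; have := @hd_aff R (fun t => g (eps n *: x + z n + t *: q)) 0 (eps n) 0 dg.
  rewrite mulr0 addr0 => /(_ h); congr (hd _ _ _); apply/funext => t; congr g.
  by rewrite addr0 scalerDr scalerA addrAC.
have hv1 i x : enorm x < r + 3 -> hd (fun t => v n (eps n *: (x + t *: ev i) + z n)) 0 (U1 i x).
  by move=> xr; apply: aff; apply: der_hd; apply: dv1; apply: hO; exact: ltW.
have hU1 i x : enorm x < r + 3 -> hd (fun t => Un (x + t *: ev i)) 0 (U1 i x).
  move=> xr; apply: hd_ext (hv1 i x xr); have [s s0 hs] := opn x xr; exists s => // t; rewrite subr0 => ts.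
  by rewrite /Un uv //; apply: hO; apply: ltW; exact: hs.
have hU2 i j x : enorm x < r + 3 -> hd (fun t => U1 i (x + t *: ev j)) 0 (U2 i j x).
  move=> xr; apply: hdZ; apply: aff; apply: der_hd; apply: dv2; apply: hO; exact: ltW.
have cU : continuous Un by move=> x; exact: ct_resc (ps_cont H n) x.
have wU : wsol (oball (r + 3)) Un (fp p \o Un).
  apply: wsol_sub (wsol_ext _ _ (wsol_dil (b := z n) en (ps_wsol H n))); first by move=> x xr; apply: hO; exact: ltW.
    by [].
  by move=> x _ /=; rewrite mulrA -exprMn divff ?gt_eqF // expr1n mul1r.
have key := hd_ Un U1 cU wU _ hU1 _.
have {}key : forall i x, enorm x < r -> `|U1 i x - pd i w0 x| <= e /\
     forall y, enorm y < r -> enorm (x - y) <= 1 -> `|(U1 i x - pd i w0 x) - (U1 i y - pd i w0 y)| <= e * enorm (x - y).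
  apply: key => x; first by rewrite (ps_ge0 H) /= le_max uM.
  by move=> xr; apply: le_trans (hc x (ltW xr)) _; rewrite ge_min lexx.
have pd1 i x : enorm x < r + 3 -> pd i dd x = U1 i x - pd i w0 x.
  by move=> xr; have [] := @hd_pd _ _ dd x (ev i) _ (hdB (hv1 i x xr) (hw1 i x)).
have yr3 : enorm y < r + 3 by (move: (yr); glra).
split; last split.
- rewrite /dd -uv; last by apply: hO; exact: ltW.
  by apply: le_trans (hc y (ltW yr3)) _; rewrite ge_min lexx orbT.
- by move=> a; rewrite pd1 //; have [] := key a y yr.
- move=> a b; have h2 := hdB (hU2 a b y yr3) (hw2 a b y).
  have h3 : hd (fun t => pd a dd (y + t *: ev b)) 0 (U2 a b y - pd b (pd a w0) y).
    apply: hd_ext h2; have [s s0 hs] := opn y yr3; exists s => // t; rewrite subr0 => ts.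
    by rewrite pd1 //; exact: hs.
  have [_ pE] := hd_pd h3; rewrite /pd in pE *; rewrite pE.
  apply: hd_bound h2 _; exists (Num.min 1 (r - enorm y)); first by rewrite lt_min ltr01 subr_gt0.
  move=> t; rewrite lt_min scale0r addr0 => /andP [t1 t2].
  have yt : enorm (y + t *: ev b) < r by have := enormD y (t *: ev b); rewrite enormZ ev1 mulr1; move: (t2); glra.
  have [_ /(_ y yr)] := key a _ yt; rewrite xhx enormZ ev1 mulr1; apply; exact: ltW.
Qed.
End C2Conv.

Section Cutoff.
Context {R : realType} {N : nat} (r : R).
Notation V := 'rV[R]_N.
Implicit Types (x y a : V) (s : R).
(** A difference of two tents, equal to 1 up to radius (r+1) s and to 0 beyond (r+2) s; continuity
    and compact support come from the tents. *)
Definition cutoff a s x : R := (Num.max ((r + 2) * s - enorm (x - a)) 0 - Num.max ((r + 1) * s - enorm (x - a)) 0) / s.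

Lemma cutoff1 a s x : 0 < s -> enorm (x - a) <= (r + 1) * s -> cutoff a s x = 1.
Proof.
move=> s0 h; rewrite /cutoff (max_idPl _); last by lra.
by rewrite (max_idPl _); [field; rewrite gt_eqF|lra].
Qed.

Lemma cutoff0 a s x : 0 < s -> (r + 2) * s <= enorm (x - a) -> cutoff a s x = 0.
Proof.
move=> s0 h; rewrite /cutoff (max_idPr _); last by lra.
by rewrite (max_idPr _) ?subrr ?mul0r //; lra.
Qed.

Lemma cutoff_itv a s x : 0 < s -> 0 <= cutoff a s x <= 1.
Proof.
move=> s0; rewrite /cutoff divr_ge0 ?(ltW s0) ?ler_pdivrMr //=.
  have [h|h] : 0 <= (r + 1) * s - enorm (x - a) \/ (r + 1) * s - enorm (x - a) < 0.
    by case: (lerP 0 ((r + 1) * s - enorm (x - a))) => hh; [left|right].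
  - by rewrite (max_idPl _) ?(max_idPl h); lra.
  - rewrite [X in _ - X](max_idPr (ltW h)) subr0 ge_max; lra.
rewrite subr_ge0 ge_max !le_max lexx orbT andbT; apply/orP; left; lra.
Qed.

Lemma cutoff_dil a s y : 0 < s -> cutoff a s (s *: y + a) = cutoff 0 1 y.
Proof.
move=> s0; rewrite /cutoff addrK subr0 enormZ gtr0_norm // !mulr1 divr1.
have E (t : R) : Num.max (t * s - s * enorm y) 0 = s * Num.max (t - enorm y) 0.
  by rewrite maxr_pMr ?(ltW s0) // mulr0 mulrBr [t * s]mulrC.
by rewrite !E; field; rewrite gt_eqF.
Qed.

Lemma cc_cutoff a s : cc (cutoff a s).
Proof.
have E : cutoff a s = (fun x => s^-1 * (Num.max ((r + 2) * s - enorm (x - a)) 0 + -1 * Num.max ((r + 1) * s - enorm (x - a)) 0)).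
  by apply/funext => x; rewrite /cutoff mulN1r mulrC.
by rewrite E; apply: ccZ; apply: ccD; [exact: cc_tent|apply: ccZ; exact: cc_tent].
Qed.
End Cutoff.

Section CtPatch.
Context {R : realType} {N : nat}.
Notation V := 'rV[R]_N.
Implicit Types (A : set V) (g h : V -> R) (x : V).

Lemma within_ct A g x : {within A, continuous g} -> A x ->
  forall e, 0 < e -> exists2 d : R, 0 < d & forall y, A y -> enorm (y - x) < d -> `|g y - g x| < e.
Proof.
move=> /subspace_continuousP cg Ax e e0.
have /cvgrPdist_lt /(_ e e0) := cg x Ax.
rewrite /= /prop_near1 /within /= => /nbhs_eballP [d d0 hd]; exists d => // y Ay yd.
by rewrite distrC; exact: hd.
Qed.

Lemma ct_mul_patch A (K : set V) g h : open A -> closed K -> K `<=` A -> {within closure A, continuous g} ->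
  continuous h -> (forall x, ~ K x -> h x = 0) -> continuous (fun x => h x * patch (fun=> 0) A g x).
Proof.
move=> oA cK KA cg ch h0 x; have [Ax|nAx] := pselect (A x).
  apply: ctM; first exact: ch.
  have [r r0 hr] := (openP A).1 oA x Ax.
  apply/contP => e e0; have [d d0 hd] := within_ct cg (subset_closure Ax) e0.
  exists (Num.min r d); first by rewrite lt_min r0.
  move=> y; rewrite lt_min => /andP [yr yd]; have Ay := hr y yr.
  by rewrite !patchE !mem_set //; apply: hd => //; exact: subset_closure.
have nK : (~` K) x by move=> /KA.
have oK : open (~` K) by exact: closed_openC.
have [r r0 hr] := (openP _).1 oK x nK.
apply/contP => e e0; exists r => // y yr.
by rewrite (h0 y (hr y yr)) (h0 x nK) !mul0r subrr normr0.
Qed.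
End CtPatch.

(** * Convergence of the masses *)

Section Mass.
Context {R : realType} {N : nat} (Om : set 'rV[R]_N) (p : R) (u v : nat -> 'rV[R]_N -> R) (eps : nat -> R) (C0 : R).
Hypothesis H : pde_seq Om p u eps C0.
Notation V := 'rV[R]_N.
Implicit Types (x y : V) (n : nat) (e : R).
Hypotheses (uv : forall n x, Om x -> u n x = v n x).
Variables (U : set_system nat).
Hypotheses (UU : UltraFilter U) (Uoo : forall A : set nat, nbhs \oo A -> U A).
Variables (w0 : V -> R) (R0 : R).
Hypotheses (cw : continuous w0) (wm : forall x, w0 x <= w0 0) (hR0 : forall x, 1 < w0 x <-> enorm x < R0).
Variables (k : nat) (zz : 'I_k -> nat -> V) (R1 : R).
Hypotheses (R10 : 0 <= R1) (R01 : R0 <= R1)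
  (hC : forall i (r e : R), 0 < e -> U [set n | forall y, enorm y <= r -> `|u n (eps n *: y + zz i n) - w0 y| <= e]).
Let f := fp p.
Let M0 := intRN (fun y => f (w0 y)).

Definition config n := [/\ forall x, 1 <= u n x -> exists i, enorm (x - zz i n) <= R1 * eps n,
  forall i j, i != j -> (2 * R1 + 2) * eps n <= enorm (zz i n - zz j n) &
  forall i y, enorm y <= R1 + 2 -> Om (eps n *: y + zz i n)].
(** The mass carried by one spike, cut off continuously. The cutoff varies only where f(u) vanishes,
    so nothing is lost and the parts sum to f(u). *)
Definition part n i x := f (u n x) * cutoff R1 (zz i n) (eps n) x.

Let f0 t : t <= 1 -> f t = 0.
Proof. by have [_ h _ _] := ps_gf H; exact: h. Qed.

Lemma part_ge0 n i x : 0 <= part n i x.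
Proof. by rewrite mulr_ge0 ?(f_ge0 H) //; have /andP [] := cutoff_itv R1 (zz i n) x (ps_e H n). Qed.

Lemma cc_part n i : cc (part n i).
Proof.
have h := @ccM _ _ (fun x => f (u n x)) (cutoff R1 (zz i n) (eps n)) (@ps_cf _ _ _ _ _ _ _ H n) (cc_cutoff _ _ _).
exact: h.
Qed.

Lemma part_near n i x : enorm (x - zz i n) <= (R1 + 1) * eps n -> part n i x = f (u n x).
Proof. by move=> h; rewrite /part cutoff1 ?mulr1 ?(ps_e H). Qed.

Lemma part_far n i x : (R1 + 2) * eps n <= enorm (x - zz i n) -> part n i x = 0.
Proof. by move=> h; rewrite /part cutoff0 ?mulr0 ?(ps_e H). Qed.

Lemma part_off n i x : config n -> R1 * eps n < enorm (x - zz i n) -> part n i x = 0.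
Proof.
move=> [c1 c2 _] h; have en := ps_e H n; have [u1|u1] := ltP (u n x) 1.
  by rewrite /part f0 ?mul0r // ltW.
have [j hj] := c1 x u1; have [ij|ij] := eqVneq i j; first by move: h; rewrite ij ltNge hj.
apply: part_far; have := c2 i j ij; have := enormBD (zz i n) x (zz j n); rewrite (enormB (zz i n) x); lra.
Qed.

Lemma sum_part n x : config n -> \sum_(i < k) part n i x = f (u n x).
Proof.
move=> cn; have [c1 c2 _] := cn; have en := ps_e H n; have [u1|u1] := ltP (u n x) 1.
  by rewrite big1 ?f0 ?(ltW u1) // => i _; rewrite /part f0 ?mul0r // ltW.
have [j hj] := c1 x u1; rewrite (bigD1 j) //= part_near ?big1 ?addr0 //; last by lra.
move=> i ij; apply: part_far; have := c2 i j ij; have := enormBD (zz i n) x (zz j n); rewrite (enormB (zz i n) x); lra.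
Qed.

(** Between R1 eps and r eps around the spike u < 1, so the sharp restriction to the ball coincides
    with the continuous cutoff. *)
Lemma part_ball n i (r : R) : config n -> R1 < r -> (forall j, i != j -> (r + R1) * eps n < enorm (zz i n - zz j n)) ->
  (forall x, eball (zz i n) (eps n * r) x -> Om x) -> patch (fun=> 0) (eball (zz i n) (eps n * r)) (fun y => f (v n y)) = part n i.
Proof.
move=> cn r1 sep inO; have [c1 c2 _] := cn; have en := ps_e H n; apply/funext => x; rewrite patchE.
have [xb|xb] := pselect (eball (zz i n) (eps n * r) x); last first.
  rewrite memNset // part_off //; move: xb; rewrite /eball /= => /negP; rewrite -leNgt.
  by apply: lt_le_trans; rewrite mulrC ltr_pM2l.
rewrite mem_set // -uv; last exact: inO.
have [h|h] := leP (enorm (x - zz i n)) (R1 * eps n); first by rewrite part_near //; lra.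
rewrite part_off //; apply: f0; rewrite leNgt; apply/negP => u1.
have [j hj] := c1 x (ltW u1); have [ij|ij] := eqVneq i j; first by move: h; rewrite ij ltNge hj.
have := sep j ij; have := enormBD (zz i n) x (zz j n); rewrite (enormB (zz i n) x).
move: xb; rewrite /eball /=; lra.
Qed.

Lemma part_mass i e : 0 < e -> U [set n | `|(eps n)^-1 ^+ N * intRN (part n i) - M0| <= e].
Proof.
have R10' := R10; have R01' := R01.
move=> e0; have [M M1 hM] := sup_bound H; have := Uoo hM => {}hM.
pose M' := Num.max M (w0 0).
have [L L0 hL] := lip2 M' (ps_gf H).
pose T (y : V) := Num.max (R1 + 3 - enorm (y - 0)) 0.
have cT : cc T by exact: cc_tent.
have iT : 0 <= intRN T by apply: int_ge0 => y; rewrite le_max lexx orbT.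
have d0 : 0 < e / (L * (intRN T + 1)) by rewrite divr_gt0 // mulr_gt0 //; lra.
apply: (uI UU hM (hC i (R1 + 2) d0)) => n uM hc; have en := ps_e H n.
have cG : cc (fun y => part n i (eps n *: y + zz i n)) by exact: cc_aff (cc_part n i).
have cut_w y : f (w0 y) = f (w0 y) * cutoff R1 0 1 y.
  have [h|h] := leP (enorm (y - 0)) ((R1 + 1) * 1); first by rewrite cutoff1 ?mulr1 ?ltr01 //; move: h; rewrite mulr1.
  rewrite (f0 (t := w0 y)) ?mul0r // leNgt; apply/negP => /hR0; move: h; rewrite subr0; lra.
have cW : cc (fun y => f (w0 y)).
  rewrite (_ : (fun y => f (w0 y)) = (fun y => f (w0 y) * cutoff R1 0 1 y)); last by apply/funext => y; exact: cut_w.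
  apply: ccM; last exact: cc_cutoff.
  by move=> y; have [_ _ _ fc] := ps_gf H; exact: ct_comp (@cw y) (fc _).
rewrite /=.
have -> : (eps n)^-1 ^+ N * intRN (part n i) = intRN (fun y => part n i (eps n *: y + zz i n)).
  by rewrite (int_aff _ en (cc_part n i)) exprVn.
rewrite -[M0]mul1r -mulNr addrC -int_lin //.
apply: le_trans (int_abs (e := e / (intRN T + 1)) (g := T) _ _ _) _.
- by apply: ccD => //; exact: ccZ.
- exact: cT.
- move=> y; rewrite mulN1r addrC cut_w /part cutoff_dil // -mulrBl normrM.
  have /andP [k0 k1] := cutoff_itv R1 0 y (@ltr01 R); rewrite [`|cutoff _ _ _ _|]ger0_norm //.
  have [h|h] := leP (enorm y) (R1 + 2); last first.
    rewrite cutoff0 ?mulr0 ?subr0 //; last by (move: (h); glra).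
    by rewrite mulr_ge0 ?divr_ge0 ?(ltW e0) // ?le_max ?lexx ?orbT //; move: (iT); glra.
  have T1 : 1 <= T y by rewrite /T subr0 le_max; apply/orP; left; move: (h); glra.
  have a1 : `|f (u n (eps n *: y + zz i n)) - f (w0 y)| <= e / (intRN T + 1).
    apply: le_trans (hL _ _ _ _) _; rewrite ?le_max ?uM ?wm ?orbT //.
    apply: le_trans (ler_wpM2l (ltW L0) (hc y h)) _.
    rewrite le_eqVlt; apply/orP; left; apply/eqP; field; apply/andP; split; rewrite gt_eqF //; move: (iT); glra.
  apply: le_trans (ler_wpM2l (normr_ge0 _) k1) _; rewrite mulr1; apply: le_trans a1 _.
  by rewrite ler_peMr // divr_ge0 ?(ltW e0) //; move: (iT); glra.
- rewrite mulrAC ler_pdivrMr; last by lra.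
  by rewrite ler_pM2l //; glra.
Qed.

(** On the support of each part, phi is nearly its value at the limit point; the masses converge to
    M0. The function phi is only continuous on the closure, but its product with a part, supported
    in a compact subset of Om, is continuous everywhere. *)
Lemma mass_phi (phi : V -> R) (lim : 'I_k -> V) e : {within closure Om, continuous phi} -> (forall i, closure Om (lim i)) -> 0 < e ->
  exists2 d : R, 0 < d & forall n, config n -> (forall i, enorm (zz i n - lim i) <= d) -> eps n <= d ->
   (forall i, `|(eps n)^-1 ^+ N * intRN (part n i) - M0| <= d) ->
   `|intRN_on Om (fun y => (eps n)^-1 ^+ N * f (v n y) * phi y) - M0 * \sum_(i < k) phi (lim i)| <= e.
Proof.
move=> cphi clim e0; have R10' := R10.
have M00 : 0 <= M0 by apply: int_ge0 => y; exact: (f_ge0 H).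
pose P := \sum_(i < k) `|phi (lim i)|; have P0 : 0 <= P by apply: sumr_ge0.
pose e1 := e / (k%:R * (M0 + 1) + 1); have k0 : 0 <= k%:R :> R by rewrite ler0n.
have D0 : 0 < k%:R * (M0 + 1) + 1 by rewrite ltr_wpDl // mulr_ge0 //; lra.
have e10 : 0 < e1 by rewrite divr_gt0.
have e2e : e1 / 2 < e1 by lra.
have [d1 d10 hd1] : exists2 d : R, 0 < d & forall i y, closure Om y -> enorm (y - lim i) < d -> `|phi y - phi (lim i)| <= e1 / 2.
  have [||d d0 hd] := @fin_r R k (fun i r => forall y, closure Om y -> enorm (y - lim i) < r -> `|phi y - phi (lim i)| <= e1 / 2).
  - by move=> i r r' /andP [_ rr] h y Oy yr; apply: h => //; exact: lt_le_trans yr rr.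
  - move=> i; have [d d0 hd] := within_ct cphi (clim i) (divr_gt0 e10 (ltr0n _ 2)).
    by exists d => // y Oy yd; apply: ltW; exact: hd.
  - by exists d.
have Q0 : 0 < 2 * (P + 1) * (k%:R * (M0 + 1) + 1) by rewrite mulr_gt0 //; move: (P0); glra.
pose d := Num.min (Num.min 1 (d1 / (R1 + 4))) (e / (2 * (P + 1))).
have R4 : 0 < R1 + 4 by (move: (R10'); glra).
have [[da db] dc] : (d <= 1 /\ d <= d1 / (R1 + 4)) /\ d <= e / (2 * (P + 1)) by split; [split|]; rewrite /d !ge_min lexx ?orbT.
have d0 : 0 < d by rewrite !lt_min ltr01 !divr_gt0 //; move: (P0); glra.
have dd1 : (R1 + 4) * d <= d1 by rewrite mulrC -ler_pdivlMr.
have Pd : P * d <= e / 2.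
  by move: dc; rewrite ler_pdivlMr ?mulr_gt0 //; [|move: (P0); glra]; move: (d0); glra.
clearbody d; exists d => // n cn hz hn hm; have en := ps_e H n.
have [c1 c2 c3] := cn.
pose Fi i x := part n i x * patch (fun=> 0) Om phi x.
have inO i x : enorm (x - zz i n) <= (R1 + 2) * eps n -> Om x.
  move=> h; rewrite (_ : x = eps n *: ((eps n)^-1 *: (x - zz i n)) + zz i n); last by rewrite scalerA divff ?gt_eqF // scale1r subrK.
  by apply: c3; rewrite enormZ gtr0_norm ?invr_gt0 // mulrC ler_pdivrMr.
have cF i : cc (Fi i).
  split; last first.
    have [_ [B hB]] := cc_part n i; exists B => x /hB h; by rewrite /Fi h mul0r.
  apply: (@ct_mul_patch _ _ Om (cball (zz i n) ((R1 + 2) * eps n))) => //; first exact: ps_open H.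
  - exact: closed_cball.
  - by move=> x; exact: inO.
  - by case: (cc_part n i).
  - by move=> x /negP; rewrite -ltNge => /ltW; exact: part_far.
have E : intRN_on Om (fun y => (eps n)^-1 ^+ N * f (v n y) * phi y) = \sum_(i < k) (eps n)^-1 ^+ N * intRN (Fi i).
  rewrite /intRN_on (_ : patch _ _ _ = (fun x => \sum_(i < k) (eps n)^-1 ^+ N * Fi i x)); last first.
    apply/funext => x; rewrite -mulr_sumr /Fi -mulr_suml sum_part // !patchE.
    have [Ox|Ox] := pselect (Om x); first by rewrite mem_set // -uv // mulrA.
    by rewrite memNset // !mulr0.
  have [_ ->] := @int_sum _ _ _ (index_enum 'I_k) (fun i x => (eps n)^-1 ^+ N * Fi i x) (fun i => ccZ _ (cF i)).
  by apply: eq_bigr => i _; rewrite int_Z.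
rewrite E mulr_sumr -sumrB; apply: le_trans (ler_norm_sum _ _ _) _.
have E0 : 0 <= (eps n)^-1 ^+ N by rewrite exprn_ge0 // invr_ge0 ltW.
have each i : `|(eps n)^-1 ^+ N * intRN (Fi i) - M0 * phi (lim i)| <= e1 / 2 * (M0 + 1) + `|phi (lim i)| * d.
  have m1 := hm i; have m2 : (eps n)^-1 ^+ N * intRN (part n i) <= M0 + 1 by move: m1; rewrite ler_norml; move: (da); glra.
  have b1 : `|intRN (Fi i) - phi (lim i) * intRN (part n i)| <= e1 / 2 * intRN (part n i).
    rewrite addrC -mulNr -int_lin //; last exact: cc_part.
    apply: int_abs; [by apply: ccD; [apply: ccZ; exact: cc_part|exact: cF]|exact: cc_part|move=> x].
    rewrite /Fi patchE mulNr [phi (lim i) * _]mulrC.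
    have [h|h] := leP (enorm (x - zz i n)) ((R1 + 2) * eps n); last first.
      by rewrite part_far ?(ltW h) // !mul0r oppr0 addr0 normr0 mulr0.
    rewrite mem_set; last exact: inO h.
    rewrite addrC -mulrBr normrM (ger0_norm (part_ge0 n i x)) [X in X <= _]mulrC; apply: ler_wpM2r; first exact: part_ge0.
    apply: hd1; first by apply: subset_closure; exact: inO h.
    have := enormBD x (zz i n) (lim i); have := hz i; have : (R1 + 2) * eps n <= (R1 + 2) * d by rewrite ler_pM2l //; move: (R10'); glra.
    move: (dd1) (hn) (en) (h); glra.
  rewrite (_ : _ - _ = (eps n)^-1 ^+ N * (intRN (Fi i) - phi (lim i) * intRN (part n i)) + phi (lim i) * ((eps n)^-1 ^+ N * intRN (part n i) - M0)); last by ring.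
  apply: le_trans (ler_normD _ _) _; rewrite !normrM; apply: lerD; last by apply: ler_wpM2l.
  rewrite ger0_norm //; apply: le_trans (ler_wpM2l E0 b1) _; rewrite mulrCA; apply: ler_wpM2l; move: (e2e) (m2); glra.
apply: le_trans (ler_sum _ (fun i _ => each i)) _.
rewrite big_split /= sumr_const card_ord -mulr_suml -/P -mulr_natl.
have : e1 * (k%:R * (M0 + 1) + 1) = e by rewrite /e1 divfK ?gt_eqF.
move: (e2e) (Pd); glra.
Qed.
End Mass.

(** * From the hypotheses of the theorem to [pde_seq] *)

Section FromStatement.
Context {R : realType} {N : nat}.
Notation V := 'rV[R]_N.
Implicit Types (x y z : V) (A Om : set V) (g : V -> R).

Lemma patch_in A g x : A x -> patch (fun=> 0) A g x = g x.
Proof. by move=> Ax; rewrite /patch mem_set. Qed.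

Lemma patch_out A g x : ~ A x -> patch (fun=> 0) A g x = 0.
Proof. by move=> Ax; rewrite /patch memNset. Qed.

Lemma holder_ct A (beta : R) g x : open A -> 0 < beta -> holder_bdd A beta g -> A x -> {for x, continuous g}.
Proof.
move=> oA b0 [C hC] Ax; apply/contP => e e0; have [r r0 hr] := (openP A).1 oA x Ax.
have C1 : 0 < `|C| + 1 by rewrite ltr_wpDl.
have [d d0 hd] := pp_small b0 (divr_gt0 (divr_gt0 e0 (ltr0n _ 2)) C1).
exists (Num.min r d); first by rewrite lt_min r0.
move=> y; rewrite lt_min => /andP [yr yd]; have [_ h] := hC y x (hr y yr) Ax.
apply: le_lt_trans h _; have := hd _ (ltW yd); rewrite pp_pos ?enorm_ge0 // ler_pdivlMr // => h.
have h0 : 0 <= powR (enorm (y - x)) beta by exact: powR_ge0.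
have : C * powR (enorm (y - x)) beta <= powR (enorm (y - x)) beta * (`|C| + 1).
  by rewrite mulrC; apply: ler_wpM2l => //; have := ler_norm C; glra.
move: (e0) (h); glra.
Qed.

Lemma C2beta_C2at Om (beta : R) g x : open Om -> 0 < beta -> C2beta Om beta g -> Om x -> C2at g x.
Proof.
move=> oO b0 [_ [d1 [d2 hb]]] Ox; have [r r0 hr] := (openP Om).1 oO x Ox; exists r => //; split.
  move=> y yr; have Oy := hr y yr; split; first by move=> i; exact: d1.
  split; last by move=> i j; exact: d2.
  by move=> i; apply: (holder_ct oO b0 (hb [:: i] isT)).
by move=> i j; apply: (holder_ct oO b0 (hb [:: j; i] isT)).
Qed.

Lemma ct_patch0 Om g : open Om -> {within closure Om, continuous g} -> (forall x, bdry Om x -> g x = 0) ->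
  continuous (patch (fun=> 0) Om g).
Proof.
move=> oO cg g0 x; apply/contP => e e0; have [Ox|nOx] := pselect (Om x).
  have [r r0 hr] := (openP Om).1 oO x Ox; have [d d0 hd] := within_ct cg (subset_closure Ox) e0.
  exists (Num.min r d); first by rewrite lt_min r0.
  move=> y; rewrite lt_min => /andP [yr yd]; have Oy := hr y yr.
  by rewrite !patch_in //; apply: hd => //; exact: subset_closure.
rewrite (patch_out _ nOx).
have [cx|ncx] := pselect (closure Om x); last first.
  have [r r0 hr] := (openP _).1 (closed_openC (@closed_closure _ Om)) x ncx.
  exists r => // y yr; rewrite patch_out ?subrr ?normr0 //.
  by move=> /subset_closure; exact: hr.
have gx : g x = 0 by apply: g0; split=> // /interior_subset.
have [d d0 hd] := within_ct cg cx e0; exists d => // y yd.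
have [Oy|nOy] := pselect (Om y); last by rewrite patch_out // subrr normr0.
by rewrite patch_in //; have := hd y (subset_closure Oy) yd; rewrite gx.
Qed.

Lemma compact_inset (K Om : set V) : open Om -> compact K -> K `<=` Om ->
  exists2 r : R, 0 < r & forall x y, K x -> enorm (y - x) < r -> Om y.
Proof.
move=> oO cK KO; have inv0 (r : R) : 0 < r -> exists k, forall n, (k <= n)%N -> n.+1%:R^-1 < r.
  move=> r0; have [k _ hk] := near_infty_natSinv_lt (PosNum r0); by exists k => n kn; exact: hk.
have [//|k _ hk] := @compact_near R N K nat \oo (fun n y => forall z, enorm (z - y) < n.+1%:R^-1 -> Om z) _ cK.
  move=> x Kx; have [r r0 hr] := (openP Om).1 oO x (KO x Kx); exists (r / 2); first by rewrite divr_gt0.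
  have [k hk] := inv0 (r / 2) (divr_gt0 r0 (ltr0n _ 2)).
  exists k => // n kn y yx z zy; apply: hr; have h3 := lt_trans zy (hk n kn); have := enormBD z y x; lra.
exists k.+1%:R^-1; first by rewrite invr_gt0.
by move=> x y Kx; exact: hk (leqnn k) _ Kx _.
Qed.

(** The Hoelder bound on the second derivatives makes the remainder uniform in x, as [capacity]
    integrates the equation at a fixed step. *)
Lemma sd_C2beta (Om K : set V) (beta eta : R) g : (0 < N)%N -> open Om -> compact K -> K `<=` Om -> 0 < beta -> C2beta Om beta g -> 0 < eta ->
  exists2 h0 : R, 0 < h0 & forall x h, K x -> 0 < h < h0 -> `|\sum_(i < N) sd g x (h *: ev i) - h ^+ 2 * lap g x| <= eta * h ^+ 2.
Proof.
move=> N0 oO cK KO b0 [_ [d1 [d2 hb]]] eta0.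
have [r r0 hr] := compact_inset oO cK KO.
have NR : 0 < N%:R :> R by rewrite ltr0n.
have e20 : 0 < eta / N%:R / 2 by rewrite !divr_gt0.
have [||h0 h00 hh] := @fin_r R N (fun i h0 => forall x h, K x -> 0 < h < h0 -> `|sd g x (h *: ev i) - h ^+ 2 * pd i (pd i g) x| <= eta / N%:R * h ^+ 2).
- move=> i s s' /andP [_ ss] h x t Kx /andP [t0 ts]; apply: h => //; rewrite t0 /=; exact: lt_le_trans ts ss.
- move=> i; have [C hC] := hb [:: i; i] isT; have C1 : 0 < `|C| + 1 by rewrite ltr_wpDl.
  have [d d0 hd_] := pp_small b0 (divr_gt0 e20 C1).
  exists (Num.min r d); first by rewrite lt_min r0.
  move=> x h Kx /andP [h0]; rewrite lt_min => /andP [h1 h2].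
  rewrite (_ : eta / N%:R = 2 * (eta / N%:R / 2)); last by field; rewrite gt_eqF.
  apply: (@sd_unif R N g (pd i g) (pd i (pd i g)) x (ev i) h (eta / N%:R / 2) h0) => t th.
  have ev1 : enorm (ev i : V) = 1 by rewrite enormE sqn_ev sqrtr1.
  have en : enorm (x + t *: ev i - x) = `|t| by rewrite xhx enormZ ev1 mulr1.
  have Ot : Om (x + t *: ev i) by apply: (hr x _ Kx); rewrite en; move: (h1) (th); glra.
  split; first by apply: hd_base; apply: der_hd; exact: d1.
  split; first by apply: hd_base; apply: der_hd; exact: d2.
  have [_ hc] := hC (x + t *: ev i) x Ot (KO x Kx); rewrite en in hc.
  apply: le_trans hc _; have := hd_ `|t| (le_trans th (ltW h2)); rewrite pp_pos ?normr_ge0 // ler_pdivlMr // => hp.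
  have p0 : 0 <= powR `|t| beta by exact: powR_ge0.
  have : C * powR `|t| beta <= powR `|t| beta * (`|C| + 1).
    by rewrite mulrC; apply: ler_wpM2l => //; have := ler_norm C; glra.
  move: (hp); glra.
exists h0 => // x h Kx hx; rewrite /lap mulr_sumr -sumrB; apply: le_trans (ler_norm_sum _ _ _) _.
apply: le_trans (ler_sum _ (fun i _ => hh i x h Kx hx)) _.
by rewrite sumr_const card_ord -mulr_natr le_eqVlt; apply/orP; left; apply/eqP; field; rewrite gt_eqF.
Qed.

Lemma epsn_inv2 (mu : nat -> R) n : 0 < mu n -> (epsn mu n)^-1 ^+ 2 = mu n.
Proof. by move=> m0; rewrite /epsn invrK sqr_sqrtr // ltW. Qed.

Lemma seq_pde Om (p C0 : R) (mu : nat -> R) (v : nat -> V -> R) : (3 <= N)%N -> smooth_bounded_domain Om ->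
  1 < p -> p < N%:R / (N%:R - 2) -> (forall n, exists beta : R, 0 < beta < 1 /\ C2beta Om beta (v n)) ->
  (forall n, 0 < mu n) -> (forall n x, Om x -> - lap (v n) x = mu n * pp p (v n x - 1)) ->
  (forall n x, bdry Om x -> v n x = 0) -> (mu @ \oo --> +oo) ->
  (forall n, muN2 N mu n * intRN_on Om (fun x => pp p (v n x - 1)) <= C0) ->
  pde_seq Om p (fun n => patch (fun=> 0) Om (v n)) (epsn mu) C0.
Proof.
move=> N3 sm p1 pN c2 mu0 eqv bv mui mass; have [oO [bO _]] := sm.
have N0 : (0 < N)%N by exact: leq_trans N3.
have eN : 0 < N%:R - 2 :> R by rewrite subr_gt0 ltr_nat.
have e0 n : 0 < epsn mu n by rewrite /epsn invr_gt0 sqrtr_gt0.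
split => //.
- by move: pN; rewrite ltr_pdivlMr.
- exact: flat_smooth.
- by move=> n; have [beta [_ [cv _]]] := c2 n; apply: ct_patch0 => // x; exact: bv.
- by move=> n x; exact: patch_out.
- move=> n x Ox; have [beta [/andP [b0 _] cb]] := c2 n; have [r r0 hr] := (openP Om).1 oO x Ox.
  have E : lap (v n) x = - ((epsn mu n)^-1 ^+ 2 * fp p (patch (fun=> 0) Om (v n) x)).
    by rewrite epsn_inv2 // patch_in // /fp -eqv // opprK.
  apply: (@hlap_loc _ _ (v n)); first by exists r => // y yr; rewrite patch_in //; exact: hr.
  by rewrite -E; apply: C2_hlap; exact: C2beta_C2at cb Ox.
- move=> n K eta cK KO eta0; have [beta [/andP [b0 _] cb]] := c2 n.
  have [h0 h00 hh] := sd_C2beta N0 oO cK KO b0 cb eta0; have [r r0 hr] := compact_inset oO cK KO.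
  exists (Num.min h0 r); first by rewrite lt_min h00.
  move=> x h Kx; rewrite lt_min => /andP [h1 /andP [h2 h3]].
  have inO (i : 'I_N) (t : R) : `|t| = h -> Om (x + t *: ev i).
    by move=> th; apply: (hr x _ Kx); rewrite xhx enormZ enormE sqn_ev sqrtr1 mulr1 th.
  have -> : \sum_(i < N) sd (patch (fun=> 0) Om (v n)) x (h *: ev i) = \sum_(i < N) sd (v n) x (h *: ev i).
    apply: eq_bigr => i _; rewrite /sd !patch_in //; [exact: KO| |]; last by apply: inO; rewrite gtr0_norm.
    by rewrite -scaleNr; apply: inO; rewrite normrN gtr0_norm.
  have -> : (epsn mu n)^-1 ^+ 2 * fp p (patch (fun=> 0) Om (v n) x) = - lap (v n) x.
    by rewrite epsn_inv2 // patch_in ?eqv //; exact: KO.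
  by rewrite mulrN; apply: hh; rewrite // h1 h2.
- move=> d d0; have : \forall n \near \oo, (d ^+ 2)^-1 < mu n by have /cvgryPgt := mui; exact.
  apply: filterS => n h; rewrite /epsn invf_plt ?posrE ?sqrtr_gt0 //.
  by rewrite -(ger0_norm (ltW d0)) -normfV -sqrtr_sqr ltr_sqrt // exprVn.
- move=> n; rewrite /epsn invrK; have := mass n; rewrite /muN2 /intRN_on.
  congr (_ * intRN _ <= _); apply/funext => x.
  have [Ox|Ox] := pselect (Om x); first by rewrite !patch_in.
  by rewrite !patch_out // /fp pp_neg ?gt_eqF //; lra.
Qed.

End FromStatement.

(** * The subsequence and the properties of a spike sequence *)

Section Stages.
Context {R : realType} {N : nat} (Om : set 'rV[R]_N) (p : R) (u v : nat -> 'rV[R]_N -> R) (eps : nat -> R) (C0 : R).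
Hypothesis H : pde_seq Om p u eps C0.
Notation V := 'rV[R]_N.
Implicit Types (x y : V) (n : nat) (e : R).
Hypothesis uv : forall n x, Om x -> u n x = v n x.
Variables (w0 : V -> R) (R0 : R) (k : nat) (zz : 'I_k -> nat -> V) (lim : 'I_k -> V) (R1 r1 g : R) (k0 : nat).

(* [n] qualifies as the [j]-th term of the subsequence, with [Rn = j + k0]. *)
Record stage (j n : nat) : Prop := Stage {
  st_in : forall i y, enorm y <= 4 * (j + k0)%:R -> Om (eps n *: y + zz i n);
  st_sep : forall i i', i != i' -> 5 * (j + k0)%:R * eps n < enorm (zz i n - zz i' n);
  st_top : forall x, 1 <= u n x -> exists2 i, enorm (x - zz i n) <= R1 * eps n & u n x <= u n (zz i n);
  st_C2 : forall i, let d := fun y : V => v n (eps n *: y + zz i n) - w0 y in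
    forall y, enorm y < 2 * (j + k0)%:R -> `|d y| <= j.+1%:R^-1 /\ (forall a, `|pd a d y| <= j.+1%:R^-1) /\ (forall a b, `|pd b (pd a d) y| <= j.+1%:R^-1);
  st_w0 : forall i y, enorm y <= R1 -> `|u n (eps n *: y + zz i n) - w0 y| <= g;
  st_up : forall x, (forall i, r1 * eps n <= enorm (x - zz i n)) -> u n x <= 2 * ((R0 * eps n) ^+ (N - 2) * snwt predT (zz ^~ n) x);
  st_lim : forall i, enorm (zz i n - lim i) < j.+1%:R^-1;
  st_eps : eps n * (j + k0)%:R <= j.+1%:R^-1;
  st_mass : forall i, `|(eps n)^-1 ^+ N * intRN (part p u eps zz R1 n i) - intRN (fun y => fp p (w0 y))| <= j.+1%:R^-1 }.

Section Exist.
Variables (U : set_system nat).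
Hypotheses (UU : UltraFilter U) (Uoo : forall A : set nat, nbhs \oo A -> U A)
  (dv1 : forall n i x, Om x -> derivable (v n) x (ev i))
  (dv2 : forall n i j x, Om x -> derivable (pd i (v n)) x (ev j))
  (cw : continuous w0) (ww : wsol setT w0 (fp p \o w0)) (wp : forall x, 0 < w0 x)
  (wm : forall x, w0 x <= w0 0) (w1 : 1 < w0 0) (hR0 : forall x, 1 < w0 x <-> enorm x < R0) (dw1 : forall i x, derivable w0 x (ev i))
  (dw2 : forall i j x, derivable (pd i w0) x (ev j)) (cw1 : forall i, continuous (pd i w0)).
Hypotheses (g0 : 0 < g) (R10 : 0 <= R1) (R01 : R0 <= R1)
  (hC : forall i (r e : R), 0 < e -> U [set n | forall y, enorm y <= r -> `|u n (eps n *: y + zz i n) - w0 y| <= e])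
  (hS : forall i j, i != j -> forall K : R, U [set n | K * eps n < enorm (zz i n - zz j n)])
  (hB : forall i (K : R), U [set n | forall xb, bdry Om xb -> K * eps n < enorm (zz i n - xb)])
  (hT : U [set n | forall x, 1 <= u n x -> exists2 i, enorm (x - zz i n) <= R1 * eps n & u n x <= u n (zz i n)])
  (hUp : U [set n | forall x, (forall i, r1 * eps n <= enorm (x - zz i n)) -> u n x <= (1 + 1) * (amp (N := N) eps R0 n * snwt predT (zz ^~ n) x)])
  (hL : forall i e, 0 < e -> U [set n | enorm (zz i n - lim i) < e]).

Lemma stage_U j : U [set n | stage j n].
Proof.
have e0 : 0 < j.+1%:R^-1 :> R by rewrite invr_gt0.
have I (A B : set nat) : U A -> U B -> U [set n | A n /\ B n] by move=> a b; exact: (uI UU a b (fun n c d => conj c d)).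
have h1 := u_all UU (fun i => spike_in H UU wp w1 (hC i) (hB i) (4 * (j + k0)%:R)).
have h2 : U [set n | forall i i', i != i' -> 5 * (j + k0)%:R * eps n < enorm (zz i n - zz i' n)].
  apply: (u_all UU (A := fun i => [set n | forall i', i != i' -> 5 * (j + k0)%:R * eps n < enorm (zz i n - zz i' n)])) => i.
  apply: (u_all UU (A := fun i' => [set n | i != i' -> 5 * (j + k0)%:R * eps n < enorm (zz i n - zz i' n)])) => i'.
  have [ii|ii] := eqVneq i i'; first by apply: (uS UU hT) => n _; rewrite /= ii.
  by apply: (uS UU (hS ii (5 * (j + k0)%:R))) => n h _.
have h4 := u_all UU (fun i => C2_conv H uv dv1 dv2 UU Uoo cw ww wp wm w1 dw1 dw2 cw1 (hC i) (hB i) (2 * (j + k0)%:R) e0).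
have h5 := u_all UU (fun i => hC i R1 g0).
have h7 := u_all UU (fun i => hL i e0).
have h9 := u_all UU (fun i => part_mass H UU Uoo cw wm hR0 R10 R01 hC i e0).
have d0 : 0 < j.+1%:R^-1 / ((j + k0)%:R + 1) :> R by rewrite divr_gt0 // ltr_wpDl.
have h8 := Uoo (ps_e0 H d0).
apply: (uS UU (I _ _ (I _ _ (I _ _ h1 h2) (I _ _ hT h4)) (I _ _ (I _ _ h5 hUp) (I _ _ h7 (I _ _ h9 h8))))) => n [[[a1 a2] [a3 a4]] [[a5 a6] [a7 [a9 a8]]]].
split => //.
have h := ltW a8; have q : 0 < (j + k0)%:R + 1 :> R by rewrite ltr_wpDl.
by move: h; rewrite ler_pdivlMr //; apply: le_trans; rewrite ler_pM2l ?(ps_e H) // lerDl.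
Qed.

(** The set of indices qualifying for stage j belongs to U and therefore meets every tail, so the
    terms can be chosen increasing, one stage after the other. *)
Lemma stages : exists phi : nat -> nat, (forall j, (phi j < phi j.+1)%N) /\ forall j, stage j (phi j).
Proof.
have h j m : exists n, (m < n)%N /\ stage j n.
  have hm : U [set n | (m < n)%N] by apply: Uoo; exists m.+1.
  by have [n [a b]] := uE UU (uI UU hm (stage_U j) (fun n c d => conj c d)); exists n.
pose F j m := sval (cid (h j m)); have hF j m : (m < F j m)%N /\ stage j (F j m) by exact: svalP (cid (h j m)).
pose phi := fix phi j := if j is i.+1 then F i.+1 (phi i) else F 0%N 0%N.
exists phi; split => [j|[|j]]; [by have [] := hF j.+1 (phi j)|by have [] := hF 0%N 0%N|by have [] := hF j.+1 (phi j)].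
Qed.
End Exist.

Section Final.
Variable phi : nat -> nat.
Hypotheses (hphi : forall j, stage j (phi j)) (kpos : (0 < k)%N) (R10 : 0 <= R1) (R00 : 0 < R0) (R01 : R0 <= R1)
  (wp : forall x, 0 < w0 x) (w1 : 1 < w0 0) (hw : forall x, R0 <= enorm x -> w0 x = R0 ^+ (N - 2) * nwt x)
  (g4 : g <= 4^-1) (gw : g <= (w0 0 - 1) / 2) (k0R : R1 + 2 <= k0%:R) (k0r : r1 <= k0%:R)
  (clim : forall i, closure Om (lim i)) (vb : forall n x, bdry Om x -> v n x = 0).
Local Notation E j := (eps (phi j)).
Local Notation Rn j := ((j + k0)%:R : R).
Local Notation f := (fp p).

Let Rnk j : k0%:R <= Rn j.
Proof. by rewrite ler_nat leq_addl. Qed.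

Let en j : 0 < E j.
Proof. exact: ps_e H (phi j). Qed.

Lemma inv_small e : 0 < e -> \forall j \near \oo, j.+1%:R^-1 < e.
Proof. by move=> e0; have [m _ hm] := near_infty_natSinv_lt (PosNum e0); exists m => // j mj; exact: hm. Qed.

Lemma Rn_ge1 j : 1 <= Rn j.
Proof. have a := k0R; have b := R10; have := Rnk j; lra. Qed.

Lemma E_small j : E j <= j.+1%:R^-1.
Proof. by apply: le_trans (st_eps (hphi j)); rewrite ler_peMr ?(ltW (en j)) //; exact: Rn_ge1. Qed.

Lemma z_in i j : Om (zz i (phi j)).
Proof.
have h := st_in (hphi j) i (y := 0); move: h; rewrite enorm0 scaler0 add0r; apply.
by have := Rn_ge1 j; lra.
Qed.

Lemma z_top i j : 1 + (w0 0 - 1) / 2 <= u (phi j) (zz i (phi j)).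
Proof.
have := st_w0 (hphi j) i (y := 0); rewrite enorm0 scaler0 add0r => /(_ R10); rewrite ler_norml => /andP [h _].
have := gw; lra.
Qed.

Lemma v_u n x : closure Om x -> v n x = u n x.
Proof.
move=> cx; have [Ox|Ox] := pselect (Om x); first by rewrite uv.
rewrite (ps_out H n x Ox) vb //; split => // /interior_subset; exact: Ox.
Qed.

Lemma stage_config j : config Om u eps zz R1 (phi j).
Proof.
have a := k0R; have b := R10; have c := Rnk j; have [h1 h2 h3 _ _ _ _ _ _] := hphi j; split.
- by move=> x /h3 [i hi _]; exists i.
- move=> i i' ii; apply: ltW; apply: le_lt_trans (h2 i i' ii); rewrite ler_pM2r //; lra.
- by move=> i y yr; apply: h1; lra.
Qed.

Lemma z_ball i j : closure (eball 0 (4 * Rn j)) `<=` [set y : V | Om (E j *: y + zz i (phi j))].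
Proof.
move=> y; rewrite closureE => /(_ (cball 0 (4 * Rn j))) hy; apply: (st_in (hphi j)).
have : cball (0 : V) (4 * Rn j) y.
  by apply: hy; split; [exact: closed_cball|move=> z; rewrite /eball /cball /=; exact: ltW].
by rewrite /cball /= subr0.
Qed.

Lemma z_disj i i' j : i != i' ->
  eball (zz i (phi j)) (2 * E j * Rn j) `&` eball (zz i' (phi j)) (2 * E j * Rn j) = set0.
Proof.
move=> ii; apply/seteqP; split => // x [].
rewrite /eball /= => h1 h2; have h3 := st_sep (hphi j) ii.
have h4 := enormBD (zz i (phi j)) x (zz i' (phi j)); rewrite (enormB (zz i (phi j)) x) in h4.
have q : 0 < E j * Rn j by rewrite mulr_gt0 //; exact: lt_le_trans ltr01 (Rn_ge1 j).
have E1 : 2 * E j * Rn j = 2 * (E j * Rn j) by rewrite mulrA.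
have E2 : 5 * Rn j * E j = 5 * (E j * Rn j) by rewrite -mulrA [Rn j * _]mulrC.
rewrite E1 in h1 h2; rewrite E2 in h3; move: (h4) (q) (h1) (h2) (h3); glra.
Qed.

(** A point with u >= 1 is dominated by the maximum of its own spike and lies within R1 eps of it,
    so outside the other balls only the spike i matters; elsewhere u < 1. *)
Lemma z_max i j : let S := closure Om `\` \bigcup_(i' in [set i' | i' != i]) eball (zz i' (phi j)) (2 * E j * Rn j) in
  S (zz i (phi j)) /\ (forall x, S x -> v (phi j) x <= v (phi j) (zz i (phi j))) /\ 1 + (w0 0 - 1) / 2 <= v (phi j) (zz i (phi j)).
Proof.
have cz := subset_closure (z_in i j).
have q : 0 < E j * Rn j by rewrite mulr_gt0 //; exact: lt_le_trans ltr01 (Rn_ge1 j).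
have E1 : 2 * E j * Rn j = 2 * (E j * Rn j) by rewrite mulrA.
split; last split; last by rewrite v_u //; exact: z_top.
  split => // -[i' /= ii hb].
  have : (eball (zz i' (phi j)) (2 * E j * Rn j) `&` eball (zz i (phi j)) (2 * E j * Rn j)) (zz i (phi j)).
    by split => //; rewrite /eball /= subrr enorm0 E1; lra.
  by rewrite z_disj.
move=> x [cx nx]; rewrite !v_u //; have [u1|u1] := ltP (u (phi j) x) 1.
  by apply: le_trans (ltW u1) (le_trans _ (z_top i j)); have a := w1; lra.
have [i' h1 h2] := st_top (hphi j) u1; have [<- //|ii] := eqVneq i' i.
exfalso; apply: nx; exists i' => //; rewrite /eball /= E1; apply: le_lt_trans h1 _.
rewrite mulrC mulrCA ltr_pM2l //; have a := k0R; have b := R10; have := Rnk j; lra.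
Qed.

Lemma top_in j : closure [set x | Om x /\ 1 < v (phi j) x] `<=` \bigcup_(i in [set: 'I_k]) eball (zz i (phi j)) (2 * E j * R0).
Proof.
move=> x; rewrite closureE => /(_ [set x | 1 <= u (phi j) x]) hx.
have u1 : 1 <= u (phi j) x.
  apply: hx; split; last by move=> y [Oy]; rewrite /= uv // => /ltW.
  by apply: (@closed_comp _ _ (u (phi j)) [set t | 1 <= t]) => [y _|]; [exact: (ps_cont H (phi j) y)|exact: closed_ge].
have [i h1 _] := st_top (hphi j) u1; exists i => //; rewrite /eball /= ltNge; apply/negP => big.
pose y := (E j)^-1 *: (x - zz i (phi j)).
have yE : E j *: y + zz i (phi j) = x by rewrite /y scalerA divff ?gt_eqF // scale1r subrK.
have yn : enorm y = enorm (x - zz i (phi j)) / E j by rewrite /y enormZ gtr0_norm ?invr_gt0 // mulrC.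
have y1 : enorm y <= R1 by rewrite yn ler_pdivrMr.
have y2 : 2 * R0 <= enorm y by rewrite yn ler_pdivlMr // mulrAC.
have := st_w0 (hphi j) i y1; rewrite yE hw; last by have a := R00; lra.
have R20 : 0 < 2 * R0 by rewrite mulr_gt0.
have hn := nwt_le R20 y2.
(* Beyond 2 R0 the profile is at most 2^(2-N) <= 1/2; with the error g <= 1/4 this contradicts u >=
   1. *)
have : R0 ^+ (N - 2) * nwt y <= 2^-1.
  apply: le_trans (ler_wpM2l (exprn_ge0 _ (ltW R00)) hn) _.
  rewrite exprMn invfM mulrCA divff ?mulr1; last by rewrite expf_neq0 // gt_eqF.
  have N1 : (0 < N - 2)%N by rewrite subn_gt0; exact: ps_N H.
  rewrite lef_pV2 ?posrE ?exprn_gt0 // -[X in X <= _]expr1 ler_eXn2l // ltr1n //.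
rewrite ler_norml => a /andP [_ b]; have c := g4; move: (u1) (c) (a) (b); glra.
Qed.

Lemma v_far j x : closure Om x -> (forall i, ~ eball (zz i (phi j)) (2 * E j * Rn j) x) ->
  0 <= v (phi j) x <= (2 * (k%:R * R0 ^+ (N - 2))) * (Rn j ^+ (N - 2))^-1.
Proof.
move=> cx far; rewrite v_u // (ps_ge0 H) /=.
have R1' := Rn_ge1 j; have ERn : 0 < E j * Rn j by rewrite mulr_gt0 //; exact: lt_le_trans ltr01 R1'.
have far' i : 2 * (E j * Rn j) <= enorm (x - zz i (phi j)).
  by have := far i; rewrite /eball /= mulrA => /negP; rewrite -leNgt.
have a0 : 0 <= (R0 * E j) ^+ (N - 2) by rewrite exprn_ge0 // mulr_ge0 // ltW.
apply: le_trans (st_up (hphi j) (x := x) _) _.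
  move=> i; apply: le_trans (far' i); apply: (@le_trans _ _ (Rn j * E j)).
    by rewrite ler_pM2r //; exact: le_trans k0r (Rnk j).
  by rewrite mulrC; lra.
have hs : snwt predT (zz ^~ (phi j)) x <= k%:R * ((E j * Rn j) ^+ (N - 2))^-1.
  apply: snwt_le; first by rewrite invr_ge0 exprn_ge0 // ltW.
  by move=> i _; apply: nwt_le => //; apply: le_trans (far' i); lra.
rewrite -mulrA ler_pM2l //; apply: le_trans (ler_wpM2l a0 hs) _.
rewrite !exprMn invfM le_eqVlt; apply/orP; left; apply/eqP; field.
by rewrite !expf_neq0 // gt_eqF //; exact: lt_le_trans ltr01 R1'.
Qed.

Lemma v_off (r : R) : 0 < r -> exists Cr : R, 0 < Cr /\ forall j x, closure Om x ->
  (forall i, ~ eball (lim i) r x) -> 0 <= v (phi j) x <= Cr * E j ^+ (N - 2).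
Proof.
move=> r0.
have r20 : 0 < r / 2 by rewrite divr_gt0.
have m0 : 0 < Num.min (r / 2) (r / 2 / (`|r1| + 1)) by rewrite lt_min r20 divr_gt0 // ltr_wpDl.
have [j0 _ hj0] := inv_small m0.
have E0 j : 0 < E j ^+ (N - 2) by rewrite exprn_gt0.
(* The finitely many early terms, whose spikes may still be far from their limits, are covered by
   their maxima, so the estimate holds from the first index on. *)
have [C1 C10 hC1] : exists2 C : R, 0 < C & forall j, (j < j0)%N -> forall x, u (phi j) x <= C * E j ^+ (N - 2).
  elim: j0 {hj0} => [|j [C C00 hC]]; first by exists 1.
  have [m hm] := ps_max H (phi j); exists (Num.max C (u (phi j) m / E j ^+ (N - 2))); first by rewrite lt_max C00.
  move=> i; rewrite ltnS leq_eqVlt => /orP [/eqP ->|ij] x.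
    by apply: le_trans (hm x) _; rewrite -ler_pdivrMr // le_max lexx orbT.
  by apply: le_trans (hC i ij x) _; rewrite ler_pM2r // le_max lexx.
pose C2 := 2 * (R0 ^+ (N - 2) * (k%:R * ((r / 2) ^+ (N - 2))^-1)).
have C20 : 0 <= C2 by rewrite !mulr_ge0 ?invr_ge0 ?exprn_ge0 ?ler0n // ltW.
exists (C1 + C2); split; first by rewrite ltr_pwDl.
move=> j x cx far; rewrite v_u // (ps_ge0 H) /=; have [jj|jj] := ltnP j j0.
  by apply: le_trans (hC1 j jj x) _; rewrite ler_pM2r // lerDl.
have := hj0 j jj; rewrite /= lt_min => /andP [h1 h2].
have far' i : r / 2 <= enorm (x - zz i (phi j)).
  have := far i; rewrite /eball /= => /negP; rewrite -leNgt => h3.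
  have := lt_trans (st_lim (hphi j) i) h1; have := enormBD x (zz i (phi j)) (lim i); move: (h3); glra.
apply: le_trans (st_up (hphi j) (x := x) _) _.
  move=> i; apply: le_trans (far' i); apply: (@le_trans _ _ (E j * (`|r1| + 1))).
    by rewrite mulrC ler_pM2l //; have := ler_norm r1; glra.
  by rewrite -ler_pdivlMr ?ltr_wpDl //; apply: le_trans (E_small j) (ltW h2).
have hs : snwt predT (zz ^~ (phi j)) x <= k%:R * ((r / 2) ^+ (N - 2))^-1.
  apply: snwt_le; first by rewrite invr_ge0 exprn_ge0 // ltW.
  by move=> i _; exact: nwt_le.
apply: (@le_trans _ _ (C2 * E j ^+ (N - 2))); last by rewrite ler_pM2r // lerDr ltW.
have -> : C2 * E j ^+ (N - 2) = 2 * ((R0 * E j) ^+ (N - 2) * (k%:R * ((r / 2) ^+ (N - 2))^-1)) by rewrite /C2 [(R0 * E j) ^+ _]exprMn; ring.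
rewrite ler_pM2l //; apply: (ler_wpM2l _ hs).
by rewrite exprn_ge0 // mulr_ge0 // ltW.
Qed.

Lemma z_lim i : zz i (phi j) @[j --> \oo] --> lim i.
Proof.
apply/cvgrPdist_lt => e e0; apply: filterS (inv_small e0) => j hj; rewrite distrC.
by apply: le_lt_trans (norm_le_enorm _) (lt_trans (st_lim (hphi j) i) hj).
Qed.

Lemma Rn_oo : Rn j @[j --> \oo] --> +oo.
Proof.
apply/cvgryPge => A; have [m hm] : exists m : nat, A <= m%:R.
  by exists (Num.Def.archi_bound `|A|); apply: le_trans (ler_norm A) (ltW (archi_boundP (normr_ge0 A))).
by exists m => // j mj; apply: le_trans hm _; rewrite ler_nat; exact: leq_trans mj (leq_addr _ _).
Qed.

Lemma ERn_0 : E j * Rn j @[j --> \oo] --> (0 : R).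
Proof.
apply/cvgrPdist_lt => e e0; apply: filterS (inv_small e0) => j hj; rewrite sub0r normrN ger0_norm.
  exact: le_lt_trans (st_eps (hphi j)) hj.
by rewrite mulr_ge0 // ltW.
Qed.

Lemma mass_spike i : (E j)^-1 ^+ N * intRN_on (eball (zz i (phi j)) (E j * Rn j)) (fun y => f (v (phi j) y)) @[j --> \oo] --> intRN (fun y => f (w0 y)).
Proof.
apply/cvgrPdist_lt => e e0; apply: filterS (inv_small e0) => j hj; rewrite distrC.
rewrite /intRN_on (part_ball H uv (stage_config j)).
- exact: le_lt_trans (st_mass (hphi j) i) hj.
- by have a := k0R; have b := R10; have := Rnk j; lra.
- move=> i' ii; apply: le_lt_trans (st_sep (hphi j) ii); rewrite ler_pM2r //.
  by have a := k0R; have b := R10; have := Rnk j; lra.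
- move=> x hx; rewrite (_ : x = E j *: ((E j)^-1 *: (x - zz i (phi j))) + zz i (phi j)); last first.
    by rewrite scalerA divff ?gt_eqF // scale1r subrK.
  apply: (st_in (hphi j)); rewrite enormZ gtr0_norm ?invr_gt0 // mulrC ler_pdivrMr //.
  move: hx; rewrite /eball /= => hx; have := Rn_ge1 j => h; apply: ltW; apply: lt_le_trans hx _.
  by rewrite mulrC ler_pM2r //; lra.
Qed.

Lemma mass_test (psi : V -> R) : {within closure Om, continuous psi} ->
  intRN_on Om (fun y => (E j)^-1 ^+ N * f (v (phi j) y) * psi y) @[j --> \oo] --> intRN (fun y => f (w0 y)) * \sum_(i < k) psi (lim i).
Proof.
move=> cpsi; apply/cvgrPdist_le => e e0.
have [d d0 hd] := mass_phi H uv w0 zz R10 cpsi clim e0.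
apply: filterS (inv_small d0) => j hj; rewrite distrC; apply: hd; first exact: stage_config.
- by move=> i; apply: ltW; exact: lt_trans (st_lim (hphi j) i) hj.
- by apply: le_trans (E_small j) (ltW hj).
- by move=> i; apply: le_trans (st_mass (hphi j) i) (ltW hj).
Qed.

(** [edist] is an infimum, to be bounded below over a nonempty set. Without a boundary, Om would
    contain arbitrarily large balls. *)
Lemma bdry_neq0 : exists xb, bdry Om xb.
Proof.
apply: contrapT => no; have [B B0 hB] := ps_Rbd H.
pose i0 : 'I_k := Ordinal kpos; pose c0 : 'I_N := Ordinal (ps_N0 H); have Oz := z_in i0 0.
have := @ball_in R N Om _ (2 * B + 1) (ps_open H) Oz (fun xb hxb => False_ind _ (no (ex_intro _ xb hxb))).
move=> /(_ (zz i0 (phi 0%N) + (2 * B + 1) *: ev c0)); rewrite /cball /= xhx.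
have en1 : enorm ((2 * B + 1) *: ev c0 : V) = 2 * B + 1 by rewrite enormZ enormE sqn_ev sqrtr1 mulr1 ger0_norm //; lra.
rewrite en1 lexx => /(_ isT) O2; have := hB _ Oz; have := hB _ O2.
have := enormD (zz i0 (phi 0%N) + (2 * B + 1) *: ev c0) (- zz i0 (phi 0%N)); rewrite xhx en1 enormN; lra.
Qed.

(** A sequence with v >= 1 + sigma stays within R1 eps of some spike, so its limit is one of the
    limits of the spikes; conversely the spikes themselves are admissible sequences. *)
Lemma spike_subset (mu : nat -> R) : (forall n, eps n = epsn mu n) -> (forall n, 0 < mu n) ->
  spike_set Om p (mu \o phi) (v \o phi) = range lim.
Proof.
move=> eE mu0; apply/seteqP; split => [z [cz [x [xz [cx [sg [Mz [sg0 [_ [top _]]]]]]]]]|z [i _ <-]].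
  apply: contrapT => nz.
  have [||d d0 hd] := @fin_r R k (fun i r => r <= enorm (z - lim i)).
  - by move=> i r r' /andP [_ rr]; exact: le_trans.
  - move=> i; exists (enorm (z - lim i)) => //; apply: enorm_gt0; rewrite subr_eq0; apply/eqP => zi.
    by apply: nz; exists i.
  have dR : 0 < d / 2 / (R1 + 2) by rewrite !divr_gt0 //; have a := R10; lra.
  have N1 : 0 < N%:R + 1 :> R by rewrite ltr_wpDl.
  have : \forall j \near \oo, `|z - x j| < d / 2 / (N%:R + 1).
    by apply: (cvgrPdist_lt _ _).1; rewrite ?divr_gt0.
  move=> h1; have : \forall j \near \oo, False.
    apply: nearI2 h1 (inv_small dR) _ => j hz hj.
    have u1 : 1 <= u (phi j) (x j) by rewrite -v_u //; apply: le_trans (top j); move: (sg0); glra.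
    have [i hi _] := st_top (hphi j) u1.
    have zx : enorm (z - x j) < d / 2.
      apply: le_lt_trans (enorm_le_norm _) _; move: hz; rewrite ltr_pdivlMr // => hz.
      have := normr_ge0 (z - x j); move: (hz); glra.
    have := hd i; have := enormBD z (x j) (lim i); have := enormBD (x j) (zz i (phi j)) (lim i).
    have := st_lim (hphi j) i; have := E_small j; move: hj; rewrite ltr_pdivlMr ?mulrDr; last by have a := R10; move: (a); glra.
    have : R1 * E j <= R1 * j.+1%:R^-1 by apply: ler_wpM2l; [exact: R10|exact: E_small].
    have : 0 < j.+1%:R^-1 :> R by rewrite invr_gt0.
    by move: (j.+1%:R^-1 : R) hi zx => q; rewrite [R1 * q]mulrC; glra.
  by case=> m _ /(_ m (leqnn m)).
split; first exact: clim.
exists (zz i \o phi); split; first exact: z_lim.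
split; first by move=> j; apply: subset_closure; exact: z_in.
exists ((w0 0 - 1) / 2), (`|C0| + 1); split; first by rewrite divr_gt0 // subr_gt0.
split; first by rewrite ltr_wpDl.
split; first by move=> j; rewrite /= v_u; [exact: z_top|apply: subset_closure; exact: z_in].
split.
  move=> e e0; have /cvgryPge /(_ e^-1) h := Rn_oo; apply: filterS h => j hj.
  rewrite (_ : epsn _ j = E j); last by rewrite eE.
  have ge : E j * Rn j <= Defs.edist ((zz i \o phi) j) (bdry Om).
    have [xb hxb] := bdry_neq0.
    apply: lb_le_inf; first by exists (enorm (zz i (phi j) - xb)), xb.
    move=> _ [y hy <-] /=; rewrite leNgt; apply/negP => hlt.
    have [_] := bdry_open (ps_open H) hy; apply.
    rewrite (_ : y = E j *: ((E j)^-1 *: (y - zz i (phi j))) + zz i (phi j)); last first.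
      by rewrite scalerA divff ?gt_eqF // scale1r subrK.
    apply: (st_in (hphi j)); rewrite enormZ gtr0_norm ?invr_gt0 // mulrC ler_pdivrMr // enormB.
    by apply: ltW; apply: lt_le_trans hlt _; rewrite mulrC ler_pM2r //; have := Rn_ge1 j; lra.
  apply: le_trans (ler_wpM2l (ltW e0) ge).
  rewrite mulrCA ler_peMr ?(ltW (en j)) //.
  by have : e * e^-1 <= e * Rn j; [rewrite ler_pM2l|rewrite divff // gt_eqF].
move=> r r0 j; apply: le_trans (_ : C0 <= _); last by apply: le_trans (ler_norm _) _; rewrite lerDl.
apply: le_trans (ps_mass H (phi j)).
have -> : muN2 N (mu \o phi) j = (E j)^-1 ^+ N by rewrite /muN2 eE /epsn invrK.
apply: ler_wpM2l; first by rewrite exprn_ge0 // invr_ge0 ltW.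
(* The integrand restricted to a ball is discontinuous, so the monotonicity that asks regularity of
   the larger function only is used. *)
apply: int_le_nm; first exact: (ps_cc H).
move=> x; have [[hx Ox]|hx] := pselect ((eball (lim i) r `&` Om) x).
  by rewrite patch_in //= -uv // lexx (f_ge0 H).
by rewrite patch_out // lexx (f_ge0 H).
Qed.
End Final.
End Stages.

(** * Spike points and their multiplicities *)

Section Fibers.
Context {R : realType} {N : nat}.
Notation V := 'rV[R]_N.

(** The distinct limits are enumerated by removing duplicates from the list of values; [c] sends a
    spike to the position of its limit. *)
Lemma distinct_values k (lim : 'I_k -> V) : exists (l : nat) (z : 'I_l -> V) (c : 'I_k -> 'I_l),
  [/\ injective z, forall i, z (c i) = lim i & forall j, exists i, c i = j].
Proof.
pose s := undup (codom lim); have us : uniq s by exact: undup_uniq.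
have ins i : lim i \in s by rewrite mem_undup codom_f.
have lt i : (index (lim i) s < size s)%N by rewrite index_mem.
exists (size s), (fun j => nth 0 s j), (fun i => Ordinal (lt i)); split.
- by move=> i j /eqP; rewrite nth_uniq // => /eqP /val_inj.
- by move=> i /=; rewrite nth_index.
- move=> j; have : nth 0 s j \in s by rewrite mem_nth.
  rewrite mem_undup => /codomP [i hi]; exists i; apply: val_inj => /=.
  by rewrite -hi index_uniq.
Qed.

Lemma card_fiber k l (c : 'I_k -> 'I_l) j : #|[set i | c i == j]| = (\sum_(i < k | c i == j) 1)%N.
Proof. by rewrite -sum1_card; apply: eq_bigl => i; apply/idP/idP; rewrite in_setE. Qed.

Lemma sum_fiber k l (c : 'I_k -> 'I_l) : (\sum_(j < l) #|[set i | c i == j]| = k)%N.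
Proof.
rewrite (eq_bigr (fun j => (\sum_(i < k | c i == j) 1)%N)) => [|j _]; last exact: card_fiber.
transitivity (\sum_(i < k) 1)%N; last by rewrite sum1_card card_ord.
by rewrite (partition_big c predT).
Qed.

Lemma sum_fiber_fun k l (c : 'I_k -> 'I_l) (a : 'I_l -> R) : \sum_(j < l) #|[set i | c i == j]|%:R * a j = \sum_(i < k) a (c i).
Proof.
rewrite (partition_big c predT) //=; apply: eq_bigr => j _.
rewrite card_fiber natr_sum mulr_suml; apply: eq_bigr => i /eqP ->; exact: mul1r.
Qed.
End Fibers.

Theorem theorem1p1 (R : realType) (N : nat) (Om : set 'rV[R]_N) (p : R)
  (alpha lambda : nat -> R) (v : nat -> 'rV[R]_N -> R)
  (w0 : 'rV[R]_N -> R) (R0 : R) :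
  (3 <= N)%N ->
  smooth_bounded_domain Om ->
  1 < p -> p < N%:R / (N%:R - 2) ->
  (* w0: the limit profile, unique solution of -Lap w = [w-1]_+^p in R^N, w > 0,
     w -> 0 at infinity, w(0) = max w > 1, int [w-1]_+^p < oo *)
  C2RN w0 ->
  (forall x, - lap w0 x = pp p (w0 x - 1)) ->
  (forall x, 0 < w0 x) ->
  (forall e : R, 0 < e -> exists r : R, forall x, r < enorm x -> `|w0 x| < e) ->
  (forall x, w0 x <= w0 0) -> 1 < w0 0 ->
  (eintRN (fun x => pp p (w0 x - 1)) < +oo)%E ->
  (* R0: {w0 > 1} = B_{R0}(0) *)
  (forall x, 1 < w0 x <-> enorm x < R0) ->
  (* the sequence *)
  (forall n, 0 < lambda n) ->
  (forall n, exists beta : R, 0 < beta < 1 /\ C2beta Om beta (v n)) ->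
  let mu := fun n => lambda n * powR `|alpha n| (p - 1) in
  (forall n x, Om x -> - lap (v n) x = mu n * pp p (v n x - 1)) ->
  (forall n x, bdry Om x -> v n x = 0) ->
  (mu @ \oo --> +oo) ->
  (forall n, intRN_on Om (fun x => powR `|alpha n| p * pp p (v n x - 1)) = 1) ->
  (exists C0 : R, 0 < C0 /\
     forall n, muN2 N mu n * intRN_on Om (fun x => pp p (v n x - 1)) <= C0) ->
  (convex_domain Om \/
   exists C1 : R, 0 < C1 /\
     forall n, muN2 N mu n * intRN_on Om (fun x => pp (p + 1) (v n x - 1)) <= C1) ->
  exists phi : nat -> nat, (forall n, (phi n < phi n.+1)%N) /\
    exists (l : nat) (z : 'I_l -> 'rV[R]_N) (m : 'I_l -> nat),
      spike_sequence_data Om p (mu \o phi) (v \o phi) w0 R0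
        (intRN (fun x => pp p (w0 x - 1))) z m /\
      (forall j, Om (z j) -> m j = 1%N).
Proof.
move=> N3 sm p1 pN C2w eqw wp dw wm w1 _ hR0 lam0 c2 mu eqv bv mui int1 [C0 [_ mass]] _.
have N2 : (2 < N)%N by []; have oO : open Om by case: sm.
have p0 : p != 0 by rewrite gt_eqF //; lra.
(* If alpha_n were 0, the normalised integral would be 0 and not 1, since p is nonzero. *)
have mu0 n : 0 < mu n.
  rewrite /mu mulr_gt0 // powR_gt0 // normr_gt0; apply/eqP => a0.
  have := int1 n; rewrite a0 normr0 powR0 // /intRN_on (_ : patch _ _ _ = fun=> 0); last first.
    by apply/funext => x; rewrite /patch; case: ifP => // _; rewrite mul0r.
  by rewrite int0 => /eqP; rewrite eq_sym oner_eq0.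
pose u n := patch (fun=> 0) Om (v n).
have H : pde_seq Om p u (epsn mu) C0 by exact: seq_pde.
have uv n x : Om x -> u n x = v n x by exact: patch_in.
(* Otherwise the integrand of the normalisation would vanish identically; this guarantees at least
   one spike. *)
have big n : exists x, 1 <= u n x.
  apply: contrapT => no; have := int1 n; rewrite /intRN_on (_ : patch _ _ _ = fun=> 0); last first.
    apply/funext => x; have [Ox|Ox] := pselect (Om x); last exact: patch_out.
    rewrite patch_in // -uv // pp_neg ?mulr0 // subr_le0 leNgt; apply/negP => /ltW u1.
    by apply: no; exists x.
  by rewrite int0 => /eqP; rewrite eq_sym oner_eq0.
have [dw1 [dw2 cwl]] := C2w.
have cw : continuous w0 by exact: cwl [::] isT.
have cw1 i : continuous (pd i w0) by exact: cwl [:: i] isT.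
have ww : wsol setT w0 (fp p \o w0).
  apply: wsol_hlap => y _; split; first exact: cw.
  have -> : - (fp p \o w0) y = lap w0 y by rewrite /= /fp -eqw opprK.
  apply: C2_hlap; exists 1 => //; split; last by move=> i j; exact: (cwl [:: j; i] isT y).
  by move=> z _; split; [move=> i; exact: dw1|split; [move=> i; exact: cw1|move=> i j; exact: dw2]].
have dw0 : dec0 w0.
  by move=> e e0; have [r hr] := dw e e0; exists r => y yr; exact: le_lt_trans (ler_norm _) (hr y yr).
(* An ultrafilter containing all tails, fixed once and for all; every limit up to [stages] is taken
   along it. *)
have [U [UU Uoo]] := ultraFilterLemma (@eventually_filter).
have dv1 n i x : Om x -> derivable (v n) x (ev i) by have [b [_ [_ [d _]]]] := c2 n; exact: d.
have dv2 n i j x : Om x -> derivable (pd i (v n)) x (ev j) by have [b [_ [_ [_ [d _]]]]] := c2 n; exact: d.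
have [k [zz [R1' [[kpos R10'] hC hS hB hT']]]] := spikes H UU Uoo cw ww wp dw0 wm w1 (uS UU (Uoo setT filterT) (fun n _ => big n)).
have R00 := R0_gt0 w1 hR0.
pose R1 := Num.max R1' R0.
have R01 : R0 <= R1 by rewrite le_max lexx orbT.
have R10 : 0 <= R1 by rewrite le_max R10'.
have hT : U [set n | forall x, 1 <= u n x -> exists2 i, enorm (x - zz i n) <= R1 * epsn mu n & u n x <= u n (zz i n)].
  apply: (uS UU hT') => n h x u1; have [i h1 h2] := h x u1; exists i => //; apply: le_trans h1 _.
  by rewrite ler_pM2r ?(ps_e H) // le_max lexx.
have [r1 _ hUp] := upper H UU cw ww wp dw0 w1 hR0 hC hT ltr01.
have cO : compact (closure Om).
  apply: closed_bounded_compact; first exact: closed_closure.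
  by have [B _ hB'] := ps_Rbd H; exists B; exact: closure_bd.
have /choice [lim hlim] i : exists c, closure Om c /\ forall e, 0 < e -> U [set n | enorm (zz i n - c) < e].
  have hz : U [set n | closure Om (zz i n)].
    apply: (uS UU (spike_in H UU wp w1 (hC i) (hB i) 0)) => n /(_ 0); rewrite enorm0 lexx scaler0 add0r => /(_ isT).
    exact: subset_closure.
  by have [c cc hc] := ulim_pt UU cO hz; exists c.
have clim i : closure Om (lim i) by have [] := hlim i.
have hL i : forall e, 0 < e -> U [set n | enorm (zz i n - lim i) < e] by have [] := hlim i.
(* The radii Rn = n + k0 exceed R1 + 2 and r1 from the first term on, so that the threshold nbar can
   be 0. *)
pose k0 := Num.Def.archi_bound (R1 + 2 + `|r1|).
have k0b : R1 + 2 + `|r1| <= k0%:R by apply: ltW; apply: archi_boundP; rewrite addr_ge0 //; move: (R10); glra.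
have k0R : R1 + 2 <= k0%:R by have := normr_ge0 r1; move: (k0b); glra.
have k0r : r1 <= k0%:R by have := ler_norm r1; move: (R10) (k0b); glra.
pose g := Num.min 4^-1 ((w0 0 - 1) / 2).
have g0 : 0 < g by rewrite lt_min invr_gt0 ltr0n divr_gt0 // subr_gt0.
have [g4 gw] : g <= 4^-1 /\ g <= (w0 0 - 1) / 2 by split; rewrite ge_min lexx ?orbT.
have [phi [phiS hphi]] := stages H uv k0 UU Uoo dv1 dv2 cw ww wp wm w1 hR0 dw1 dw2 cw1 g0 R10 R01 hC hS hB hT hUp hL.
have hw x := w0_out N2 p1 cw ww wp dw0 w1 hR0 (x := x).
have [l [z [c [zinj zc csurj]]]] := distinct_values lim.
(* Multiplicities are the sizes of the fibres of [c]. Simplicity comes first: two spikes over the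
   same interior point are equal by [simple], so the fibre is a singleton. *)
exists phi; split => //; exists l, z, (fun j => #|[set i | c i == j]|); split; last first.
  move=> j Oj; have [i ij] := csurj j; rewrite card_fiber (bigD1 i) ?ij //= big1 // => i' /andP [/eqP ci' ii'].
  have E : lim i = lim i' by rewrite -!zc ij ci'.
  have Oi : Om (lim i) by rewrite -zc ij.
  by have e := simple H UU Uoo cw ww wp dw0 w1 hR0 R10 hC hS hT hL Oi E; rewrite e eqxx in ii'.
have rz : range z = range lim.
  apply/seteqP; split => [x [j _ <-]|x [i _ <-]]; last by exists (c i).
  by have [i <-] := csurj j; exists i => //; rewrite zc.
split; first by have := ltn_ord (c (Ordinal kpos)); exact: leq_ltn_trans.
split; first exact: zinj.
split; first by rewrite rz; exact: (spike_subset H uv hphi).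
split; first by move=> j; have [i ij] := csurj j; rewrite card_fiber (bigD1 i) ?ij.
cbv zeta; rewrite sum_fiber.
exists (fun i n => zz i (phi n)), c.
split; first by move=> i; rewrite zc; exact: (z_lim hphi).
split; first by [].
exists (fun n => (n + k0)%:R), 0%N, (2 * (k%:R * R0 ^+ (N - 2))), ((w0 0 - 1) / 2).
split; first exact: Rn_oo.
split; first by rewrite !mulr_gt0 ?exprn_gt0 ?ltr0n.
split; first by rewrite divr_gt0 // subr_gt0.
split; first exact: (ERn_0 H hphi).
split; first by move=> n i y; exact: (z_ball hphi).
split.
  move=> _; split; first by move=> n i j; exact: (z_disj H hphi R10 k0R).
  by move=> n i; exact: (z_max H uv hphi).
split.
  move=> i e e0; apply: filterS (inv_small e0) => n hn y yr.
  have yr' : enorm y < 2 * (n + k0)%:R by move: yr; rewrite /eball /= subr0.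
  have [a1 [a2 a3]] := st_C2 (hphi n) i yr'; have h := ltW hn.
  by split; [exact: le_trans a1 h|split => [a|a b]; [exact: le_trans (a2 a) h|exact: le_trans (a3 a b) h]].
split; first by move=> n _; exact: (top_in H uv hphi).
split.
  move=> r r0; have [Cr [Cr0 hCr]] := v_off H uv hphi R10 R00 k0R bv r0.
  exists Cr; split => // n _ x cx far; apply: hCr => // i; rewrite -zc; exact: far.
split; first by move=> n _ x cx far; exact: (v_far H uv hphi).
have muE n : muN2 N (mu \o phi) n = (epsn mu (phi n))^-1 ^+ N by rewrite /muN2 /epsn invrK.
split.
  move=> i; have h := mass_spike H uv hphi R10 k0R i.
  by under eq_fun do rewrite muE.
move=> psi cpsi; have h := mass_test H uv hphi R10 k0R clim cpsi.
rewrite sum_fiber_fun (eq_bigr (fun i => psi (lim i))) => [|i _]; last by rewrite zc.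
by under eq_fun do rewrite muE.
Qed.
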